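(* Let $n\ge1$, let $a_{1,1},\dots,a_{1,n},a_0\in\mathcal G(\mathbb R^{n+1})$ be Colombeau generalised functions of $(t,x)\in\mathbb R\times\mathbb R^n$, and let $u_0\in\mathcal G_c(\mathbb R^n)$. Consider the Cauchy problem $$D_tu=\sum_{j=1}^na_{1,j}(t,x)D_ju+a_0(t,x)u,\qquad u(0,\cdot)=u_0.\quad( * )$$ (i) Assume that the $a_{1,j}$ are real valued, compactly supported with respect to $x$, with $\partial_{x_k}a_{1,j}$ of logarithmic type for $k,j=1,\dots,n$, and that $a_0$ is compactly supported in $x$ and of logarithmic type. Then the solution $u\in\mathcal G(\mathbb R^{n+1})$ of $( * )$ can be written as $$u(t,x)=F_\phi(b)(u_0)(t,x):=\int_{\mathbb R^n}e^{i\phi(t,x,\eta)}\,b(t,x)\,\widehat{u_0}(\eta)\,\frac{d\eta}{(2\pi)^n},\quad( ** )$$ where $\phi(t,x,\eta)=\sum_{h=1}^n\gamma_h(x,t,0)\eta_h$ with $\gamma=(\gamma_1,\dots,\gamma_n)$ the characteristic curve, and $b\in\mathcal G(\mathbb R^{n+1})$ is the unique solution of $$D_tb=\sum_{j=1}^na_{1,j}(t,x)D_jb+a_0(t,x)b,\qquad b(0,\cdot)=1.$$ (ii) If the $a_{1,j}$ are real valued, slow scale regular, compactly supported with respect to $x$, with $\partial_{x_k}a_{1,j}$ of slow scale logarithmic type for $k,j=1,\dots,n$, and $a_0$ is slow scale regular, compactly supported in $x$ and of slow scale logarithmic type, then formula $( ** )$ holds with $\phi$ and $b$ slow scale regular.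
   Context: $D_t=-i\partial_t$, $D_j=-i\partial_{x_j}$, $\widehat v(\eta)=\int e^{-iy\eta}v(y)\,dy$. Nets are indexed by $\varepsilon\in(0,1]$ and $O(\cdot)$ refers to $\varepsilon\to0$. $\mathcal G(\mathbb R^d)=\mathcal E_M(\mathbb R^d)/\mathcal N(\mathbb R^d)$ is the Colombeau algebra: $\mathcal E_M$ consists of nets $(u_\varepsilon)_\varepsilon$ in $C^\infty(\mathbb R^d)$ such that for all compact $K$ and all $\alpha$ there is $N\in\mathbb N$ with $\sup_K|\partial^\alpha u_\varepsilon|=O(\varepsilon^{-N})$; $\mathcal N$ consists of those nets with $\sup_K|\partial^\alpha u_\varepsilon|=O(\varepsilon^q)$ for all compact $K$, all $\alpha$, all $q\in\mathbb N$. $\mathcal G_c(\mathbb R^n)$ is the subalgebra of compactly supported elements. Operations (products, derivatives, Fourier transform, integrals, compositions) are performed on representatives, and equations are equalities in $\mathcal G$. A slow scale net is a net $(\mu_\varepsilon)_\varepsilon$ in $\mathbb C$ with $|\mu_\varepsilon|^q=O(\varepsilon^{-1})$ for all $q\ge0$. An element $u\in\mathcal G(\mathbb R^d)$ is: real valued if it has a representative of real valued functions; of logarithmic type if it has a representative with $\sup_K|u_\varepsilon|=O(\log(\varepsilon^{-1}))$ for all compact $K$; of slow scale logarithmic type if it has a representative such that for every compact $K$ there is a slow scale net $(\mu_\varepsilon)$ with $\sup_K|u_\varepsilon|=O(\log\mu_\varepsilon)$; slow scale regular if it has a representative such that for every compact $K$ and every $\alpha$ there is a slow scale net $(\mu_\varepsilon)$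 with $\sup_K|\partial^\alpha u_\varepsilon|=O(\mu_\varepsilon)$. A generalised function of $(t,x)$ is compactly supported in $x$ if its support is contained in $\mathbb R\times K$ for some compact $K\subset\mathbb R^n$. The characteristic curve $\gamma_h=\gamma_h(x,t,s)\in\mathcal G(\mathbb R^{n+2})$ is the unique solution of $\frac{d}{ds}\gamma_h(x,t,s)=-a_{1,h}(s,\gamma_1(x,t,s),\dots,\gamma_n(x,t,s))$, $\gamma_h(x,t,t)=x_h$, $h=1,\dots,n$. Under the hypotheses of (i) it is known that $( * )$ has a unique solution $u\in\mathcal G(\mathbb R^{n+1})$. *)

(* Defs.v *)
From HB Require Import structures.
From mathcomp Require Import all_boot all_order all_algebra.
From mathcomp Require Import all_classical all_reals all_analysis.
From mathcomp Require Export complex.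
Set Implicit Arguments.
Unset Strict Implicit.
Unset Printing Implicit Defensive.
Import Order.TTheory GRing.Theory Num.Theory.
Import numFieldNormedType.Exports.
Local Open Scope classical_set_scope.
Local Open Scope ring_scope.
Local Open Scope complex_scope.

Section Smooth.
Variables (R : realType) (d : nat).
Implicit Types (f : 'rV[R]_d -> R[i]).

Definition cabs (z : R[i]) : R := complex.Re `|z|.

Definition re_fun f : 'rV[R]_d -> R := fun x => complex.Re (f x).
Definition im_fun f : 'rV[R]_d -> R := fun x => complex.Im (f x).

Definition pder (i : 'I_d) f : 'rV[R]_d -> R[i] := fun x =>
  'D_(delta_mx 0 i) (re_fun f) x +i* 'D_(delta_mx 0 i) (im_fun f) x.

(* An iterated partial derivative is given by the list of its directions; on
   smooth functions these are exactly the derivatives indexed by multi-indices,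
   by symmetry of the mixed partial derivatives. *)
Definition pders (al : seq 'I_d) f : 'rV[R]_d -> R[i] := foldr pder f al.

Definition smooth f : Prop := forall al : seq 'I_d,
  [/\ continuous (re_fun (pders al f)), continuous (im_fun (pders al f)) &
      forall i x, derivable (re_fun (pders al f)) x (delta_mx 0 i) /\
                  derivable (im_fun (pders al f)) x (delta_mx 0 i)].

End Smooth.

Section Colombeau.
Variables (R : realType) (d : nat).

(* Only the values at eps in ]0, 1] are ever used. *)
Definition net : Type := R -> 'rV[R]_d -> R[i].
Implicit Types (u v : net) (K : set 'rV[R]_d).

(* sup_K |f_eps| = O(g_eps) as eps -> 0.  As C > 0, a negative g_eps is not
   an admissible bound. *)
Definition supO K u (g : R -> R) : Prop :=
  exists2 C : R, 0 < C &
    \forall e \near 0^'+, forall x, K x -> cabs (u e x) <= C * g e.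

Definition smooth_net u : Prop := forall e, 0 < e <= 1 -> smooth (u e).

Definition pders_net (al : seq 'I_d) u : net := fun e => pders al (u e).

Definition moderate u : Prop := smooth_net u /\
  forall K, compact K -> forall al, exists N : nat,
    supO K (pders_net al u) (fun e => e ^- N).

Definition null_on (V : set 'rV[R]_d) u : Prop :=
  forall K, compact K -> K `<=` V -> forall al (q : nat),
    supO K (pders_net al u) (fun e => e ^+ q).

Definition negligible u : Prop := smooth_net u /\ null_on setT u.

Definition eqG u v : Prop := negligible (fun e x => u e x - v e x).

(* The quotient E_M / N: an element is a coset u + N with u in E_M, coerced to
   the predicate of being one of its representatives. *)
Record colombeau : Type := Colombeau {
  reps :> net -> Prop;
  repsP : exists2 u, moderate u & reps = (fun v => eqG v u) }.

Definition colombeau_of u (hu : moderate u) : colombeau :=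
  Colombeau (ex_intro2 _ _ u hu erefl).

Implicit Types (a : colombeau).

Definition supp a : set 'rV[R]_d :=
  [set x | forall V, open V -> V x -> ~ exists2 v, a v & null_on V v].

Definition compactly_supported a : Prop :=
  exists2 K, compact K & supp a `<=` K.

Definition real_rep a (g : R -> 'rV[R]_d -> R) : Prop :=
  a (fun e x => (g e x)%:C).

Definition real_valued a : Prop := exists2 v, a v &
  forall e, 0 < e <= 1 -> forall x, complex.Im (v e x) = 0.

Definition slow_scale (mu : R -> R[i]) : Prop := forall q : R, 0 <= q ->
  exists2 C : R, 0 < C & \forall e \near 0^'+, cabs (mu e) `^ q <= C * e^-1.

Definition log_type a : Prop := exists2 v, a v &
  forall K, compact K -> supO K v (fun e => ln e^-1).

(* For a complex mu_eps, O(log mu_eps) is read as O(log |mu_eps|). *)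
Definition slow_scale_log_type a : Prop := exists2 v, a v &
  forall K, compact K -> exists2 mu, slow_scale mu &
    supO K v (fun e => ln (cabs (mu e))).

Definition slow_scale_regular a : Prop := exists2 v, a v &
  forall K, compact K -> forall al, exists2 mu, slow_scale mu &
    supO K (pders_net al v) (fun e => cabs (mu e)).

Lemma pder_cst (i : 'I_d) (c : R[i]) : pder i (fun=> c) = fun=> 0.
Proof.
by apply/funext => x; rewrite /pder /re_fun /im_fun !derive_cst.
Qed.

Lemma pders_cst (al : seq 'I_d) (c : R[i]) :
  exists c', pders al (fun=> c) = fun=> c'.
Proof.
elim: al => [|i al [c' ih]]; first by exists c.
by exists 0; rewrite /= -/(pders al _) ih pder_cst.
Qed.

Lemma moderate_cst (c : R[i]) : moderate (fun _ _ => c).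
Proof.
split=> [e _ al|K cK al].
  have [c' ->] := pders_cst al c.
  split; try exact: cst_continuous.
  by move=> i x; split; exact: derivable_cst.
exists 0%N; rewrite /pders_net; have [c' ->] := pders_cst al c.
have c0 : 0 <= cabs c' by rewrite /cabs; case: c' => x y /=; exact: sqrtr_ge0.
exists (1 + cabs c'); first by rewrite ltr_pwDl.
near=> e => x _.
by rewrite expr0 invr1 mulr1 lerDr ler01.
Unshelve. all: by end_near. Qed.

Definition cstG (c : R[i]) : colombeau := colombeau_of (moderate_cst c).

Definition pder_net (i : 'I_d) u : net := fun e => pder i (u e).

Lemma moderate_pder (i : 'I_d) u : moderate u -> moderate (pder_net i u).
Proof.
have E al e : pders al (pder_net i u e) = pders (rcons al i) (u e).
  by rewrite /pders foldr_rcons.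
move=> [su mu]; split=> [e e01 al|K cK al]; first by rewrite E; exact: su.
have [N HN] := mu K cK (rcons al i).
by exists N; rewrite /pders_net; under eq_fun do rewrite E.
Qed.

Definition a_rep a : net := s2val (cid2 (repsP a)).

Lemma moderate_a_rep a : moderate (a_rep a).
Proof. exact: s2valP. Qed.

Definition pderG (i : 'I_d) a : colombeau :=
  colombeau_of (moderate_pder i (moderate_a_rep a)).

End Colombeau.

Arguments net : clear implicits.
Arguments colombeau : clear implicits.
Arguments cstG {R d} c.

Section Cauchy.
Variables (R : realType) (n : nat).

Definition tx (t : R) (x : 'rV[R]_n) : 'rV[R]_(1 + n) := row_mx t%:M x.

Definition idx_t : 'I_(1 + n) := lshift n ord0.
Definition idx_x (j : 'I_n) : 'I_(1 + n) := rshift 1 j.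

Definition compactly_supported_x (a : colombeau R (1 + n)) : Prop :=
  exists2 K : set 'rV[R]_n, compact K & supp a `<=` [set y | K (rsubmx y)].

Definition Dnet d (i : 'I_d) (u : net R d) : net R d :=
  fun e x => - 'i%C * pder i (u e) x.

Definition cauchy_problem (a1 : 'I_n -> colombeau R (1 + n)) (a0 : colombeau R (1 + n))
    (g : colombeau R n) (u : colombeau R (1 + n)) : Prop :=
  forall (al : 'I_n -> net R (1 + n)) (al0 v : net R (1 + n)) (w : net R n),
    (forall j, a1 j (al j)) -> a0 al0 -> u v -> g w ->
    eqG (Dnet idx_t v)
        (fun e y => \sum_(j < n) al j e y * Dnet (idx_x j) v e y
                    + al0 e y * v e y) /\
    eqG (fun e x => v e (tx 0 x)) w.

Definition xts (x : 'rV[R]_n) (t s : R) : 'rV[R]_(n + (1 + 1)) :=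
  row_mx x (row_mx t%:M s%:M).

Definition idx_s : 'I_(n + (1 + 1)) := rshift n (rshift 1 ord0).

Definition real_net d : Type := R -> 'rV[R]_d -> R.

Definition c_bounded d (g : 'I_n -> real_net d) : Prop :=
  forall K : set 'rV[R]_d, compact K ->
  exists2 L : set 'rV[R]_n, compact L &
    \forall e \near 0^'+, forall z, K z -> L (\row_h g h e z).

(* The composition a_{1,h}(s, gamma) is defined in the Colombeau algebra for
   real valued c-bounded gamma, and then does not depend on the choice of
   representatives. *)
Definition characteristic_curve (a1 : 'I_n -> colombeau R (1 + n))
    (ga : 'I_n -> colombeau R (n + (1 + 1))) : Prop :=
  (exists2 g, (forall h, real_rep (ga h) (g h)) & c_bounded g) /\
  forall (g : 'I_n -> real_net (n + (1 + 1))) (al : 'I_n -> net R (1 + n)),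
    (forall h, real_rep (ga h) (g h)) -> (forall h, a1 h (al h)) ->
    forall h,
      eqG (pder_net idx_s (fun e z => (g h e z)%:C))
          (fun e z => - al h e (tx (z 0 idx_s) (\row_k g k e z))) /\
      eqG (fun e (y : 'rV[R]_(1 + n)) =>
             (g h e (xts (rsubmx y) (y 0 idx_t) (y 0 idx_t)))%:C)
          (fun _ y => (y 0 (idx_x h))%:C).

(* phi(t, x, eta) = sum_h gamma_h(x, t, 0) eta_h *)
Definition phase (g : 'I_n -> real_net (n + (1 + 1))) : real_net (1 + n + n) :=
  fun e z => \sum_(h < n)
    g h e (xts (rsubmx (lsubmx z)) (z 0 (lshift n idx_t)) 0)
    * z 0 (rshift (1 + n) h).

End Cauchy.

Section Fourier.
Variable R : realType.

(* Integral over R^n as an iterated Lebesgue integral; by Fubini it is the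
   n-dimensional Lebesgue integral on the integrable functions, and below it is
   applied to smooth compactly supported and to rapidly decreasing functions. *)
Fixpoint intRn (n : nat) : ('rV[R]_n -> R) -> R :=
  match n with
  | 0 => fun f => f 0
  | m.+1 => fun f =>
      \int[@lebesgue_measure R]_(x in setT)
        intRn (fun y : 'rV[R]_m => f (row_mx (x%:M : 'rV[R]_1) y))
  end.

Definition intCn (n : nat) (f : 'rV[R]_n -> R[i]) : R[i] :=
  intRn (re_fun f) +i* intRn (im_fun f).

Definition expi (th : R) : R[i] := cos th +i* sin th.

Definition fourier (n : nat) (w : 'rV[R]_n -> R[i]) (eta : 'rV[R]_n) : R[i] :=
  intCn (fun y => expi (- \sum_(k < n) y 0 k * eta 0 k) * w y).

Definition fio (n : nat) (phi : real_net R (1 + n + n)) (b : net R (1 + n))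
    (w : net R n) : net R (1 + n) :=
  fun e y => intCn (fun eta : 'rV[R]_n =>
    expi (phi e (row_mx y eta)) * b e y * fourier (w e) eta
    * ((2 * pi) ^- n)%:C).

Definition compact_rep (n : nat) (u0 : colombeau R n) (w : net R n) : Prop :=
  u0 w /\ exists2 K : set 'rV[R]_n, compact K &
    forall e, 0 < e <= 1 -> forall x, ~ K x -> w e x = 0.

(* u = F_phi(b)(u0), phi being the phase of the curve ga.  The Fourier transform
   is taken on representatives of u0 supported in a common compact set, and phi
   is real valued. *)
Definition is_fio (n : nat) (ga : 'I_n -> colombeau R (n + (1 + 1)))
    (b : colombeau R (1 + n)) (u0 : colombeau R n) (u : colombeau R (1 + n)) :
    Prop :=
  (exists w, compact_rep u0 w) /\
  forall (g : 'I_n -> real_net R (n + (1 + 1))) (be : net R (1 + n))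
         (w : net R n),
    (forall h, real_rep (ga h) (g h)) -> b be -> compact_rep u0 w ->
    u (fio (phase g) be w).

Definition is_phase (n : nat) (ga : 'I_n -> colombeau R (n + (1 + 1)))
    (phi : colombeau R (1 + n + n)) : Prop :=
  forall g : 'I_n -> real_net R (n + (1 + 1)),
    (forall h, real_rep (ga h) (g h)) -> real_rep phi (phase g).

End Fourier.

(* Main.v *)
(* Along the characteristic flow gamma the equation becomes an ordinary
   differential equation, so the solution with data w is b(t, x) w(gamma(x, t, 0)),
   where b is the exponential of i times the integral of a_0 along the flow. That
   this net solves the problem, and that solutions are unique, follows from
   Gronwall's inequality: the logarithmic bounds on d_x a_1 and a_0 turn its
   exponential into a power of 1/eps (into a slow scale net in part (ii)). No
   existence theorem for ordinary differential equations is needed, since gamma is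
   given. As the phase is linear in eta and the amplitude does not depend on eta,
   for each eps the oscillatory integral is the inverse Fourier transform of the Fourier
   transform of u_0, evaluated at gamma(x, t, 0) and multiplied by b; Fourier
   inversion for smooth compactly supported functions thus yields the same net. *)

Require Import Defs.
From HB Require Import structures.
From mathcomp Require Import all_boot all_order all_algebra.
From mathcomp Require Import all_classical all_reals all_analysis.
From mathcomp Require Import measurable_realfun ring lra.
Set Implicit Arguments.
Unset Strict Implicit.
Unset Printing Implicit Defensive.
Import Order.TTheory GRing.Theory Num.Theory.
Import numFieldNormedType.Exports.
Local Open Scope classical_set_scope.
Local Open Scope ring_scope.

(** * Smooth functions and iterated partial derivatives *)

(** In the algebra, gamma satisfies its equation and its initial condition only up to negligible
    nets, and no group property is at hand. What replaces it is that the transport operator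
    annihilates each gamma_h modulo null nets ([nul_Z]), itself a Gronwall estimate: this quantity
    solves a linear equation in s whose coefficients are the d_x a_1 along the flow. Both the
    transported data and the integral in the exponent of b rest on it. Negligibility concerns all
    derivatives, but for moderate nets an interpolation argument reduces it to smallness of the
    values, so that Gronwall is applied to values only. In part (i) gamma is moderate by assumption;
    in part (ii) slow scale bounds for all its derivatives must be proved, by induction on the order
    in x, then through the transport equation for t and the characteristic equation for s.
    Uniqueness identifies arbitrary u and b with the explicit nets. The Fourier integrand is not
    compactly supported in eta, so constants are moved onto w, which has compact support, before
    linearity of the integral is used. *)

Section RealSmooth.
Variable R : realType.

Definition dpart d (i : 'I_d) (f : 'rV[R]_d -> R) : 'rV[R]_d -> R :=
  fun x => 'D_(delta_mx 0 i) f x.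

Definition dparts d (al : seq 'I_d) f := foldr (@dpart d) f al.

Definition rsmooth d (f : 'rV[R]_d -> R) : Prop := forall al,
  continuous (dparts al f) /\
  forall i x, derivable (dparts al f) x (delta_mx 0 i).

(** Finite order makes the product and chain rules provable by induction on [k]: the recursion peels
    off the innermost derivative, and the rules express it through functions of order [k]. [rsmooth]
    is the intersection over all orders. *)
Fixpoint Ck (k : nat) d (f : 'rV[R]_d -> R) : Prop :=
  match k with
  | 0 => continuous f
  | k.+1 => continuous f /\ forall i : 'I_d,
      (forall x, derivable f x (delta_mx 0 i)) /\ Ck k (dpart i f)
  end.

Lemma Ck_continuous k d (f : 'rV[R]_d -> R) : Ck k f -> continuous f.
Proof. by case: k => // k []. Qed.

Lemma dparts_rcons d (al : seq 'I_d) i (f : 'rV[R]_d -> R) :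
  dparts (rcons al i) f = dparts al (dpart i f).
Proof. by rewrite /dparts foldr_rcons. Qed.

Lemma dparts_cat d (al be : seq 'I_d) (f : 'rV[R]_d -> R) :
  dparts (al ++ be) f = dparts al (dparts be f).
Proof. by rewrite /dparts foldr_cat. Qed.

Lemma rsmoothP d (f : 'rV[R]_d -> R) : rsmooth f <-> forall k, Ck k f.
Proof.
split=> [sf k|Cf].
  elim: k f sf => [|k ih] f sf; first exact: (sf [::]).1.
  split; first exact: (sf [::]).1.
  move=> i; split; first by move=> x; exact: (sf [::]).2.
  by apply: ih => al; rewrite -dparts_rcons.
move=> al; elim/last_ind: al f Cf => [|al i ih] f Cf.
  split; first exact: (Cf 0%N).
  by move=> i x; have [_ /(_ i)[]] := Cf 1%N.
by rewrite dparts_rcons; apply: ih => k; have [_ /(_ i)[]] := Cf k.+1.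
Qed.

Lemma rsmooth_dpart d i (f : 'rV[R]_d -> R) : rsmooth f -> rsmooth (dpart i f).
Proof. by move=> sf al; rewrite -dparts_rcons. Qed.

Lemma rsmooth_dparts d al (f : 'rV[R]_d -> R) : rsmooth f -> rsmooth (dparts al f).
Proof. by move=> sf be; rewrite -dparts_cat. Qed.

Lemma rsmooth_continuous d (f : 'rV[R]_d -> R) : rsmooth f -> continuous f.
Proof. by move=> sf; exact: (sf [::]).1. Qed.

Lemma rsmooth_derivable d (f : 'rV[R]_d -> R) : rsmooth f ->
  forall x i, derivable f x (delta_mx 0 i).
Proof. by move=> sf x i; exact: (sf [::]).2. Qed.

Lemma is_derive_line (V : normedModType R) (f : V -> R) (x v : V) (s : R) :
  derivable f (x + s *: v) v ->
  is_derive s 1 (fun r : R => f (x + r *: v)) ('D_v f (x + s *: v)).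
Proof.
move=> df.
have E : (fun h : R => h^-1 *: (f (x + (h *: (1:R) + s) *: v) - f (x + s *: v)))
       = (fun h : R => h^-1 *: (f (h *: v + (x + s *: v)) - f (x + s *: v))).
  apply/funext => h; congr (_ *: (f _ - _)).
  by rewrite scalerDl scaler1 addrCA.
by split; [rewrite /derivable E | rewrite /derive E].
Qed.

Lemma MVT_line (V : normedModType R) (f : V -> R) (v : V) :
  (forall x, derivable f x v) -> forall x (h : R),
  exists2 th : R, 0 <= th <= 1 & f (x + h *: v) - f x = h * 'D_v f (x + (th * h) *: v).
Proof.
move=> df x h.
(* Rescaling to [0, 1] avoids a case distinction on the sign of h. *)
pose g (r : R) := f (x + r *: (h *: v)).
have dg (r : R) : is_derive r 1 g (h * 'D_v f (x + (r * h) *: v)).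
  have := is_derive_line (df (x + (r * h) *: v)).
  have /= H := @is_derive_line _ f x v (r * h) (df _).
  have Eg : g = (fun r => f (x + r *: v)) \o (fun r => r * h).
    by apply/funext => r'; rewrite /g /= scalerA.
  rewrite Eg => _.
  have H2 : is_derive r 1 (fun r : R => r * h) h.
    by apply: is_derive_eq; rewrite scaler0 add0r [_ *: _]mulr1.
  have := @is_derive1_comp R (fun r => f (x + r *: v)) (fun r => r * h) r _ _ H H2.
  by rewrite mulrC.
have := @MVT_segment R g (fun r => h * 'D_v f (x + (r * h) *: v)) 0 1 ler01
  (fun r _ => dg r).
case.
  apply: derivable_within_continuous => r _; exact: (@ex_derive _ _ _ _ _ _ _ (dg r)).
move=> c; rewrite in_itv /= => c01; rewrite /g scale1r scale0r addr0 subr0 mulr1 => ->.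
by exists c.
Qed.

End RealSmooth.

(** * Product and chain rules from continuous partial derivatives *)

Section RealSmooth2.
Variable R : realType.

Lemma near_ord_forall d (T : Type) (F : set_system T) (FF : Filter F)
    (P : 'I_d -> T -> Prop) :
  (forall i, \forall x \near F, P i x) -> \forall x \near F, forall i, P i x.
Proof. by move=> H; exact: filter_forall. Qed.

Lemma rV_normP d (x : 'rV[R]_d) (e : R) : 0 <= e ->
  (`|x| <= e) <-> (forall i, `|x 0 i| <= e).
Proof.
move=> e0; rewrite /Num.Def.normr /= mx_normrE; split=> [H i|H].
  apply: le_trans H; exact: (le_bigmax _ (fun ij => `|x ij.1 ij.2|) (0, i)).
apply: bigmax_le => //; case=> i j _ /=; rewrite (ord1 i); exact: H.
Qed.

Lemma rV_coord_le d (x : 'rV[R]_d) i : `|x 0 i| <= `|x|.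
Proof. by have /rV_normP := lexx `|x|; apply. Qed.

(** Consecutive truncations differ in a single coordinate, so an increment of a function telescopes
    into increments along the axes, to which the mean value theorem applies. *)
Definition trunc d (j : nat) (h : 'rV[R]_d) : 'rV[R]_d :=
  \row_k (if (k < j)%N then h 0 k else 0).

Lemma truncS d (j : 'I_d) (h : 'rV[R]_d) :
  trunc j.+1 h = trunc j h + h 0 j *: delta_mx 0 j.
Proof.
apply/rowP => k; rewrite !mxE /= ltnS leq_eqVlt -val_eqE /=.
by case: eqP => [/ord_inj ->|_] /=; rewrite ?ltnn ?mulr1 ?add0r// mulr0 addr0.
Qed.

Lemma trunc0 d (h : 'rV[R]_d) : trunc 0 h = 0.
Proof. by apply/rowP => k; rewrite !mxE. Qed.

Lemma trunc_full d (h : 'rV[R]_d) : trunc d h = h.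
Proof. by apply/rowP => k; rewrite !mxE ltn_ord. Qed.

Lemma telescope_trunc d (f : 'rV[R]_d -> R) x h :
  f (x + h) - f x = \sum_(j < d) (f (x + trunc j.+1 h) - f (x + trunc j h)).
Proof.
rewrite -[in LHS](trunc_full h).
transitivity (\sum_(0 <= j < d) (f (x + trunc j.+1 h) - f (x + trunc j h))).
  by rewrite (telescope_sumr (fun j => f (x + trunc j h))) // trunc0 addr0.
by rewrite big_mkord.
Qed.

(** Total differentiability from continuity of the partial derivatives: each axis increment is a
    partial derivative at a point close to x. *)
Lemma C1_increment d (f : 'rV[R]_d -> R) (x : 'rV[R]_d) : Ck 1 f ->
  forall e : R, 0 < e -> \forall h \near (0 : 'rV[R]_d),
    `|f (x + h) - f x - \sum_(j < d) h 0 j * dpart j f x| <= e * `|h|.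
Proof.
move=> [cf Cf] e e0.
(* Dividing by d + 1 instead of d covers d = 0; the surplus summand is dropped after
   [big_ord_recr]. *)
have e'0 : 0 < e / d.+1%:R by rewrite divr_gt0.
have H : \forall y \near x, forall j : 'I_d, `|dpart j f x - dpart j f y| <= e / d.+1%:R.
  have H (j : 'I_d) : \forall y \near x, `|dpart j f x - dpart j f y| <= e / d.+1%:R.
    by have /cvgrPdist_le /(_ _ e'0) := (Cf j).2 x.
  exact: near_ord_forall H.
have /nbhs_ballP[r /= r0 Hr] := H.
near=> h.
have hr : `|h| < r.
  near: h; apply/nbhs_ballP; exists r => //= y; rewrite -ball_normE /= sub0r normrN //.
rewrite telescope_trunc -sumrB.
apply: (le_trans (ler_norm_sum _ _ _)).
have -> : e * `|h| = \sum_(j < d.+1) e / d.+1%:R * `|h|.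
  rewrite sumr_const card_ord -[RHS]mulr_natl mulrA; congr (_ * _).
  by rewrite mulrCA mulfV ?mulr1 // pnatr_eq0.
rewrite big_ord_recr /=; apply: ler_wpDr.
  by rewrite mulr_ge0 // ltW.
apply: ler_sum => j _.
rewrite truncS addrA.
have [th th01 ->] := MVT_line (Cf j).1 (x + trunc j h) (h 0 j).
rewrite -/(dpart j f _) -mulrBr normrM mulrC.
apply: ler_pM => //; last exact: rV_coord_le.
rewrite distrC; apply: Hr.
rewrite -ball_normE /= -addrA opprD addNKr normrN.
(* Every coordinate of the intermediate point differs from that of x by at most the corresponding
   coordinate of h. *)
apply: le_lt_trans hr.
apply/rV_normP => // k; rewrite !mxE eqxx /=.
have [/ltn_eqF|ltjk] := ltnP k j.
  move=> E; have -> : (k == j) = false by rewrite -val_eqE /= E.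
  by rewrite mulr0 addr0 rV_coord_le.
rewrite add0r; case: (k == j); rewrite ?mulr0 ?normr0 ?mulr1 //.
rewrite normrM; move: th01 => /andP[th0 th1].
rewrite ger0_norm //; apply: (le_trans _ (rV_coord_le h j)).
by rewrite ler_piMl.
Unshelve. all: by end_near. Qed.

Lemma continuous_lincomb d (c : 'I_d -> R) :
  continuous (fun h : 'rV[R]_d => \sum_(j < d) h 0 j * c j).
Proof.
move=> y; rewrite [X in continuous_at _ X](_ : _ = \sum_(j < d) (fun h : 'rV[R]_d => h 0 j * c j)); last first.
  by apply/funext => h; rewrite fct_sumE.
have H : forall j : 'I_d, {for y, continuous (fun h : 'rV[R]_d => h 0 j * c j)}.
  move=> j; apply: continuousM; [exact: (@coord_continuous R 1 d 0 j)|exact: cst_continuous].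
elim/big_ind : _ => //; first exact: cst_continuous.
  by move=> f g cf cg; exact: continuousD.
by move=> j _; exact: H.
Qed.

(** Only directional derivability of the inner functions is assumed. Their difference quotient [q]
    converges, hence is bounded, and the outer function is replaced by its linear part [S] with an
    error small relative to the increment. *)
Lemma is_derive_comp d (V : normedModType R) (F : 'rV[R]_d -> R)
    (G : 'I_d -> V -> R) (x v : V) : Ck 1 F ->
  (forall k, derivable (G k) x v) ->
  is_derive x v (fun y => F (\row_k G k y))
    (\sum_(k < d) 'D_v (G k) x * dpart k F (\row_k G k x)).
Proof.
move=> CF dG.
pose Ga (y : V) : 'rV[R]_d := \row_k G k y.
have dGa : derivable Ga x v.
  apply/derivable_mxP => i j; rewrite (_ : (fun y => _) = G j) //.
  by apply/funext => y; rewrite mxE.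
have /cvg_ex[/= l Hl] := dGa.
have El : l = \row_k 'D_v (G k) x.
  have : 'D_v Ga x = l by exact/cvg_lim.
  rewrite derive_mx // => <-; apply/rowP => k; rewrite !mxE; congr ('D_v _ x).
  by apply/funext => y; rewrite mxE.
pose q (h : R) := h^-1 *: (Ga (h *: v + x) - Ga x).
pose S (w : 'rV[R]_d) := \sum_(k < d) w 0 k * dpart k F (Ga x).
have cS : S (q h) @[h --> 0^'] --> S l.
  by apply: continuous_cvg => //; exact: continuous_lincomb.
have ql : \forall h \near 0^', `|q h| <= `|l| + 1.
  have /cvgrPdist_le /(_ _ ltr01) := Hl; apply: filterS => h /= Hh.
  have -> : q h = l - (l - q h) by rewrite subKr.
  by apply: (le_trans (ler_normB _ _)); rewrite lerD2l.
have d0 : Ga (h *: v + x) - Ga x @[h --> 0^'] --> (0 : 'rV[R]_d).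
  apply/cvgr0Pnorm_le => e e0.
  have e1 : 0 < e / (`|l| + 1) by rewrite divr_gt0 // ltr_wpDl.
  near=> h.
  have h0 : h != 0 by near: h; exact: nbhs_dnbhs_neq.
  have -> : Ga (h *: v + x) - Ga x = h *: q h by rewrite scalerA mulfV // scale1r.
  rewrite normrZ; apply: (@le_trans _ _ (e / (`|l| + 1) * (`|l| + 1))).
    apply: ler_pM => //; last by near: h.
    by near: h; exact: dnbhs0_le.
  by rewrite divfK // gt_eqF // ltr_wpDl.
suff H : (fun h : R => h^-1 *: (F (Ga (h *: v + x)) - F (Ga x))) @ 0^' --> S l.
  have ES : S l = \sum_(k < d) 'D_v (G k) x * dpart k F (Ga x).
    by rewrite /S El; apply: eq_bigr => k _; rewrite mxE.
  rewrite -ES; split; first by apply/cvg_ex; exists (S l).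
  exact/cvg_lim.
apply/cvgrPdist_le => e e0.
(* Near 0 the quotient [q] is bounded by |l| + 1, so the error of the linear approximation
   contributes at most e / 2. *)
pose e' := e / 2 / (`|l| + 1).
have e'0 : 0 < e' by rewrite !divr_gt0 // ltr_wpDl.
have Hi := d0 _ (C1_increment (Ga x) CF e'0).
have e20 : 0 < e / 2 by rewrite divr_gt0.
near=> h.
have h0 : h != 0 by near: h; exact: nbhs_dnbhs_neq.
pose D := Ga (h *: v + x) - Ga x.
have ED : Ga (h *: v + x) = Ga x + D by rewrite /D [RHS]addrC subrK.
have inc : `|F (Ga x + D) - F (Ga x) - S D| <= e' * `|D| by rewrite /D; near: h; exact: Hi.
have Sq : S (q h) = h^-1 * S D.
  by rewrite /S mulr_sumr; apply: eq_bigr => k _; rewrite mulrA; congr (_ * _); rewrite mxE.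
rewrite ED.
have -> : S l - h^-1 *: (F (Ga x + D) - F (Ga x)) =
   (S l - S (q h)) - h^-1 * (F (Ga x + D) - F (Ga x) - S D).
  by rewrite Sq /GRing.scale /=; ring.
apply: (le_trans (ler_normB _ _)); rewrite (splitr e); apply: lerD.
  by near: h; move/cvgrPdist_le : cS; apply.
rewrite normrM; apply: (@le_trans _ _ (`|h^-1| * (e' * `|D|))).
  by rewrite ler_wpM2l.
rewrite mulrCA -normrZ -/(q h).
apply: (@le_trans _ _ (e' * (`|l| + 1))).
  by apply: ler_wpM2l; [exact: ltW|near: h].
by rewrite /e' divfK // gt_eqF // ltr_wpDl.
Unshelve. all: by end_near. Qed.

Lemma continuous_rowP d (V : topologicalType) (G : 'I_d -> V -> R) :
  (forall k, continuous (G k)) -> continuous (fun y => \row_k G k y : 'rV[R]_d).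
Proof.
move=> cG y; apply/cvgrPdist_le => /= e e0.
have : \forall z \near y, forall k, `|G k y - G k z| <= e.
  have H k : \forall z \near y, `|G k y - G k z| <= e.
    by have /cvgrPdist_le /(_ _ e0) := cG k y.
  exact: near_ord_forall H.
apply: filterS => z Hz; apply/rV_normP; first exact: ltW.
by move=> i; rewrite !mxE.
Qed.

Lemma CkD k d (f g : 'rV[R]_d -> R) : Ck k f -> Ck k g -> Ck k (fun x => f x + g x).
Proof.
elim: k f g => [|k ih] f g; first by move=> /= cf cg x; exact: (continuousD (cf x) (cg x)).
move=> [cf Cf] [cg Cg]; split; first by move=> x; exact: (continuousD (cf x) (cg x)).
move=> i; have [df Cf'] := Cf i; have [dg Cg'] := Cg i.
split; first by move=> x; exact: derivableD.
rewrite (_ : dpart i _ = fun x => dpart i f x + dpart i g x); first exact: ih.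
by apply/funext => x; rewrite /dpart deriveD.
Qed.

Lemma CkS k d (f : 'rV[R]_d -> R) : Ck k.+1 f -> Ck k f.
Proof.
elim: k f => [|k ih] f; first by case.
move=> [cf Cf]; split => // i; have [df Cf'] := Cf i; split => //; exact: ih.
Qed.

Lemma Ck_cst k d (c : R) : Ck k (fun _ : 'rV[R]_d => c).
Proof.
elim: k c => [|k ih] c; first exact: cst_continuous.
split; first exact: cst_continuous.
move=> i; split=> [x|]; first exact: derivable_cst.
rewrite (_ : dpart i _ = fun=> 0) //; apply/funext => x; exact: derive_cst.
Qed.

Lemma Ck_sum k d m (f : 'I_m -> 'rV[R]_d -> R) : (forall j, Ck k (f j)) ->
  Ck k (fun x => \sum_(j < m) f j x).
Proof.
elim: m f => [|m ih] f Cf.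
  rewrite (_ : (fun x => _) = fun=> 0); first exact: Ck_cst.
  by apply/funext => x; rewrite big_ord0.
rewrite (_ : (fun x => _) = fun x => \sum_(j < m) f (widen_ord (leqnSn m) j) x + f ord_max x).
  by apply: CkD => //; apply: ih.
by apply/funext => x; rewrite big_ord_recr.
Qed.

Lemma dpartM d i (f g : 'rV[R]_d -> R) x :
  derivable f x (delta_mx 0 i) -> derivable g x (delta_mx 0 i) ->
  dpart i (fun x => f x * g x) x = dpart i f x * g x + f x * dpart i g x.
Proof.
move=> df dg; rewrite /dpart; have -> := deriveM df dg.
by rewrite addrC; congr (_ + _); exact: mulrC.
Qed.

Lemma CkM k d (f g : 'rV[R]_d -> R) : Ck k f -> Ck k g -> Ck k (fun x => f x * g x).
Proof.
elim: k f g => [|k ih] f g; first by move=> /= cf cg x; exact: (continuousM (cf x) (cg x)).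
move=> [cf Cf] [cg Cg]; split; first by move=> x; exact: (continuousM (cf x) (cg x)).
move=> i; have [df Cf'] := Cf i; have [dg Cg'] := Cg i.
split; first by move=> x; exact: derivableM.
rewrite (_ : dpart i _ = fun x => dpart i f x * g x + f x * dpart i g x).
  by apply: CkD; apply: ih => //; apply: CkS; split.
by apply/funext => x; rewrite dpartM.
Qed.

Lemma Ck_comp k d m (F : 'rV[R]_m -> R) (G : 'I_m -> 'rV[R]_d -> R) :
  Ck k F -> (forall j, Ck k (G j)) -> Ck k (fun x => F (\row_j G j x)).
Proof.
elim: k F G => [|k ih] F G.
  move=> cF cG x; apply: (@continuous_comp _ _ _ (fun x => \row_j G j x) F).
    exact: continuous_rowP.
  exact: cF.
move=> CF CG; split.
  move=> x; apply: (@continuous_comp _ _ _ (fun x => \row_j G j x) F).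
    by apply: continuous_rowP => j; have [] := CG j.
  by have [cF _] := CF; exact: cF.
have CF1 : Ck 1 F.
  by case: CF => cF CF; split=> // i; have [dF CF'] := CF i; split=> //; exact: Ck_continuous CF'.
have D i x := @is_derive_comp m _ F G x (delta_mx 0 i) CF1 (fun j => ((CG j).2 i).1 x).
move=> i; split=> [x|]; first by have [] := D i x.
rewrite (_ : dpart i _ = fun x => \sum_(j < m) dpart i (G j) x * dpart j F (\row_j G j x)).
  apply: Ck_sum => j; apply: CkM; first exact: ((CG j).2 i).2.
  apply: ih; first by have [_ /(_ j)[]] := CF.
  by move=> l; apply: CkS.
by apply/funext => x; have [_] := D i x.
Qed.

Lemma rsmooth_comp d m (F : 'rV[R]_m -> R) (G : 'I_m -> 'rV[R]_d -> R) :
  rsmooth F -> (forall j, rsmooth (G j)) -> rsmooth (fun x => F (\row_j G j x)).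
Proof.
move=> /rsmoothP sF sG; apply/rsmoothP => k; apply: Ck_comp => // j.
by move: k; apply/rsmoothP.
Qed.

Lemma dpart_comp d m (F : 'rV[R]_m -> R) (G : 'I_m -> 'rV[R]_d -> R) i x :
  rsmooth F -> (forall j, rsmooth (G j)) ->
  dpart i (fun x => F (\row_j G j x)) x =
  \sum_(j < m) dpart i (G j) x * dpart j F (\row_j G j x).
Proof.
move=> sF sG.
have [_ E] := @is_derive_comp m _ F G x (delta_mx 0 i) ((rsmoothP _).1 sF 1%N) (fun j => @rsmooth_derivable R d (G j) (sG j) x i).
exact: E.
Qed.

Lemma rsmoothM d (f g : 'rV[R]_d -> R) : rsmooth f -> rsmooth g -> rsmooth (fun x => f x * g x).
Proof. by move=> /rsmoothP sf /rsmoothP sg; apply/rsmoothP => k; exact: CkM. Qed.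

Lemma rsmoothD d (f g : 'rV[R]_d -> R) : rsmooth f -> rsmooth g -> rsmooth (fun x => f x + g x).
Proof. by move=> /rsmoothP sf /rsmoothP sg; apply/rsmoothP => k; exact: CkD. Qed.

Lemma rsmooth_cst d (c : R) : rsmooth (fun _ : 'rV[R]_d => c).
Proof. by apply/rsmoothP => k; exact: Ck_cst. Qed.

Lemma rsmoothN d (f : 'rV[R]_d -> R) : rsmooth f -> rsmooth (fun x => - f x).
Proof.
move=> sf; rewrite (_ : (fun x => - f x) = fun x => -1 * f x).
  exact: (rsmoothM (rsmooth_cst (-1)) sf).
by apply/funext => x; rewrite mulN1r.
Qed.

Lemma rsmoothB d (f g : 'rV[R]_d -> R) : rsmooth f -> rsmooth g -> rsmooth (fun x => f x - g x).
Proof. by move=> sf sg; exact: (rsmoothD sf (rsmoothN sg)). Qed.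

Lemma rsmooth_sum d m (f : 'I_m -> 'rV[R]_d -> R) : (forall j, rsmooth (f j)) ->
  rsmooth (fun x => \sum_(j < m) f j x).
Proof.
move=> sf; apply/rsmoothP => k; apply: Ck_sum => j; move: k; exact/rsmoothP.
Qed.

Lemma dpart_cst d i (c : R) : dpart i (fun _ : 'rV[R]_d => c) = fun=> 0.
Proof. by apply/funext => x; exact: derive_cst. Qed.

Lemma is_derive_coord d (j : 'I_d) (x v : 'rV[R]_d) :
  is_derive x v (fun y : 'rV[R]_d => y 0 j) (v 0 j).
Proof.
have E : (fun h : R => h^-1 *: ((h *: v + x) 0 j - x 0 j)) @ 0^' --> v 0 j.
  apply: cvg_near_cst; near=> h.
  have h0 : h != 0 by near: h; exact: nbhs_dnbhs_neq.
  by rewrite !mxE addrK /GRing.scale /= mulrA mulVf // mul1r.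
by split; [apply/cvg_ex; exists (v 0 j)|apply/cvg_lim].
Unshelve. all: by end_near. Qed.

Lemma dpart_coord d i (j : 'I_d) :
  dpart i (fun y : 'rV[R]_d => y 0 j) = fun=> (j == i)%:R.
Proof.
apply/funext => x; have [_] := is_derive_coord j x (delta_mx 0 i).
by rewrite /dpart => ->; rewrite mxE eqxx.
Qed.

Lemma rsmooth_coord d (j : 'I_d) : rsmooth (fun y : 'rV[R]_d => y 0 j).
Proof.
apply/rsmoothP; case=> [|k]; first exact: coord_continuous.
split; first exact: coord_continuous.
move=> i; split=> [x|]; first by have [] := is_derive_coord j x (delta_mx 0 i).
rewrite dpart_coord; exact: Ck_cst.
Qed.

End RealSmooth2.

(** * Mixed derivatives, changes of variable, smooth functions of one variable, boxes *)

Section Calculus.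
Variable R : realType.

Arguments rsmooth_derivable {R d f} _ x i : rename.
Arguments MVT_line {R V f v} _ x h : rename.
Local Notation dd i := (delta_mx 0 i).

Lemma derive_translate d (f : 'rV[R]_d -> R) (c v x : 'rV[R]_d) :
  derivable f (x + c) v ->
  is_derive x v (fun z => f (z + c)) ('D_v f (x + c)).
Proof.
have E : (fun h : R => h^-1 *: (f (h *: v + x + c) - f (x + c)))
       = (fun h : R => h^-1 *: (f (h *: v + (x + c)) - f (x + c))).
  by apply/funext => h; rewrite addrA.
by move=> df; split; [rewrite /derivable E | rewrite /derive E].
Qed.

Lemma norm_delta_le1 d (i : 'I_d) : `|delta_mx 0 i : 'rV[R]_d| <= 1.
Proof.
apply/rV_normP => // j; rewrite mxE eqxx /=; case: (j == i); by rewrite ?normr1 ?normr0.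
Qed.

(** Mean value theorem in direction i for the increment [phi] in direction j, then in direction j
    for the partial derivative. The second difference does not change when i and j are exchanged,
    which gives [dpartC]. *)
Lemma second_difference d (f : 'rV[R]_d -> R) (i j : 'I_d) (x : 'rV[R]_d) (h : R) : rsmooth f ->
  exists2 p : 'rV[R]_d, `|p - x| <= 2 * `|h| &
    f (x + h *: delta_mx 0 i + h *: delta_mx 0 j) - f (x + h *: delta_mx 0 i)
    - (f (x + h *: delta_mx 0 j) - f x) = h * (h * dpart j (dpart i f) p).
Proof.
move=> sf.
set ei : 'rV[R]_d := delta_mx 0 i; set ej : 'rV[R]_d := delta_mx 0 j.
pose phi (z : 'rV[R]_d) := f (z + h *: ej) - f z.
have dphi z : is_derive z ei phi (dpart i f (z + h *: ej) - dpart i f z).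
  have := derive_translate (rsmooth_derivable sf (z + h *: ej) i).
  by move=> H; apply: (is_deriveB H); apply: derivableP; exact: rsmooth_derivable.
have [th th01 E] := MVT_line (fun z => @ex_derive _ _ _ _ _ _ _ (dphi z)) x h.
have [_ Ed] := dphi (x + (th * h) *: ei).
rewrite Ed in E.
have [th' th'01 E'] := MVT_line (fun z => rsmooth_derivable (rsmooth_dpart i sf) z j) (x + (th * h) *: ei) h.
rewrite E' in E.
exists (x + (th * h) *: ei + (th' * h) *: ej); last first.
  by rewrite -E.
have -> (u v : 'rV[R]_d) : x + u + v - x = u + v by rewrite addrAC [x + u]addrC addrK.
rewrite mulr_natl mulr2n.
have H (t : R) k : 0 <= t <= 1 -> `|(t * h) *: (delta_mx 0 k : 'rV[R]_d)| <= `|h|.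
  move=> /andP[t0 t1]; rewrite normrZ normrM (ger0_norm t0) -[leRHS]mulr1.
  apply: ler_pM => //; last exact: norm_delta_le1.
    by rewrite mulr_ge0.
  by rewrite ler_piMl.
by apply: (le_trans (ler_normD _ _)); apply: lerD; exact: H.
Qed.

Lemma dpartC d (f : 'rV[R]_d -> R) (i j : 'I_d) : rsmooth f ->
  dpart i (dpart j f) = dpart j (dpart i f).
Proof.
move=> sf; apply/funext => x; apply/eqP; rewrite -subr_eq0 -normr_le0.
suff H (e : R) : 0 < e -> `|dpart i (dpart j f) x - dpart j (dpart i f) x| <= e.
  by apply/ler_addgt0Pl => e e0; rewrite addr0; exact: H.
move=> e0.
have e20 : 0 < e / 2 by rewrite divr_gt0.
have c1 : continuous (dpart i (dpart j f)).
  by apply: rsmooth_continuous; do 2 apply: rsmooth_dpart.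
have c2 : continuous (dpart j (dpart i f)).
  by apply: rsmooth_continuous; do 2 apply: rsmooth_dpart.
have /cvgrPdist_le /(_ _ e20) /nbhs_ballP[r1 /= r10 H1] := c1 x.
have /cvgrPdist_le /(_ _ e20) /nbhs_ballP[r2 /= r20 H2] := c2 x.
(* The points supplied by [second_difference] are within 2h of x, hence inside both balls of
   continuity. *)
pose h : R := Num.min r1 r2 / 4.
have m0 : 0 < Num.min r1 r2 by rewrite lt_min r10 r20.
have h0 : 0 < h by apply: divr_gt0 m0 _; exact: ltr0n.
have lt2 : 2 * `|h| < Num.min r1 r2.
  by rewrite (gtr0_norm h0) /h; move: m0; clear; set m := Num.min r1 r2; lra.
have [p Hp Ep] := second_difference i j x h sf.
have [p' Hp' Ep'] := second_difference j i x h sf.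
have EE : dpart i (dpart j f) p' = dpart j (dpart i f) p.
  have hn : h != 0 by rewrite gt_eqF.
  apply: (mulfI hn); apply: (mulfI hn).
  transitivity (f (x + h *: delta_mx 0 j + h *: delta_mx 0 i) - f (x + h *: delta_mx 0 j) -
    (f (x + h *: delta_mx 0 i) - f x)); first exact: esym.
  rewrite [x + h *: delta_mx 0 j + _]addrAC.
  transitivity (f (x + h *: delta_mx 0 i + h *: delta_mx 0 j) - f (x + h *: delta_mx 0 i) -
    (f (x + h *: delta_mx 0 j) - f x)); last exact: Ep.
  by rewrite !opprB; ring.
have B1 : `|dpart i (dpart j f) x - dpart i (dpart j f) p'| <= e / 2.
  apply: H1; rewrite -ball_normE /= distrC; apply: (le_lt_trans Hp').
  by apply: (lt_le_trans lt2); rewrite ge_min lexx.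
have B2 : `|dpart j (dpart i f) x - dpart j (dpart i f) p| <= e / 2.
  apply: H2; rewrite -ball_normE /= distrC; apply: (le_lt_trans Hp).
  by apply: (lt_le_trans lt2); rewrite ge_min lexx orbT.
rewrite EE in B1; rewrite distrC in B2.
rewrite (splitr e); apply: le_trans (lerD B1 B2).
by apply: le_trans (ler_normD _ _); rewrite addrA subrK.
Qed.

Lemma dparts_perm d (f : 'rV[R]_d -> R) (al be : seq 'I_d) : rsmooth f ->
  perm_eq al be -> dparts al f = dparts be f.
Proof.
move=> sf.
have swap (a b : 'I_d) s : dparts (a :: b :: s) f = dparts (b :: a :: s) f.
  exact: (dpartC a b (rsmooth_dparts s sf)).
have mv a s1 s2 : dparts (s1 ++ a :: s2) f = dparts (a :: s1 ++ s2) f.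
  elim: s1 => //= b s1 ih; rewrite ih.
  exact: swap.
elim: al be => [|a al ih] be; first by move/perm_size/esym/size0nil => ->.
move=> pe; have abe : a \in be by rewrite -(perm_mem pe) mem_head.
case/splitPr: abe pe => s1 s2 pe.
rewrite mv /= (ih (s1 ++ s2)) //.
by move: pe; rewrite perm_sym perm_catC /= perm_cons perm_catC perm_sym.
Qed.

Lemma is_derive_precomp d m (f : 'rV[R]_m -> R) (io : 'rV[R]_d -> 'rV[R]_m) v w x :
  (forall h : R, io (h *: v + x) = h *: w + io x) ->
  derivable f (io x) w -> is_derive x v (f \o io) ('D_w f (io x)).
Proof.
move=> H.
have E : (fun h : R => h^-1 *: ((f \o io) (h *: v + x) - (f \o io) x))
       = (fun h : R => h^-1 *: (f (h *: w + io x) - f (io x))).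
  by apply/funext => h /=; rewrite H.
by move=> df; split; [rewrite /derivable E | rewrite /derive E].
Qed.

(** When [io] moves along one coordinate axis for each direction, iterated derivatives are merely
    renamed and no sums of the chain rule appear. The condition is restricted to directions in [al]
    because the diagonal embedding satisfies it only for the x directions. *)
Lemma dparts_precomp d m (f : 'rV[R]_m -> R) (io : 'rV[R]_d -> 'rV[R]_m)
    (si : 'I_d -> 'I_m) (al : seq 'I_d) : rsmooth f ->
  (forall i, i \in al -> forall x (h : R),
     io (h *: delta_mx 0 i + x) = h *: delta_mx 0 (si i) + io x) ->
  dparts al (f \o io) = dparts (map si al) f \o io.
Proof.
move=> sf; elim: al => //= i al ih H.
rewrite ih; last by move=> k kal; apply: H; rewrite inE kal orbT.
apply/funext => x.
have Hi := H i (mem_head _ _) x.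
have [] := @is_derive_precomp _ _ (dparts (map si al) f) io _ _ x Hi _ => //.
exact: rsmooth_derivable (rsmooth_dparts _ sf) _ _.
Qed.

Lemma rsmooth_precomp d m (f : 'rV[R]_m -> R) (io : 'rV[R]_d -> 'rV[R]_m) :
  rsmooth f -> (forall k, rsmooth (fun x => io x 0 k)) -> rsmooth (f \o io).
Proof.
move=> sf si; have := rsmooth_comp sf si; congr rsmooth.
by apply/funext => x /=; congr f; apply/rowP => k; rewrite mxE.
Qed.

(** The witness is the sequence of successive derivatives, the form in which [Ck_comp1] runs its
    induction. *)
Definition smooth1 (f : R -> R) := exists F : nat -> R -> R,
  F 0%N = f /\ forall k (x : R), is_derive x 1 (F k) (F k.+1 x).

Lemma is_derive_lineE (V : normedModType R) (g : V -> R) (x v : V) (l : R) :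
  is_derive x v g l <-> is_derive (0 : R) 1 (fun h : R => g (h *: v + x)) l.
Proof.
have E : (fun h : R => h^-1 *: (g ((h *: (1 : R) + 0) *: v + x) - g ((0 : R) *: v + x)))
       = (fun h : R => h^-1 *: (g (h *: v + x) - g x)).
  by apply/funext => h; rewrite scale0r add0r addr0 [h *: 1]mulr1.
have E' : derivable g x v = derivable (fun h : R => g (h *: v + x)) 0 1.
  by rewrite /derivable -E.
have E'' : 'D_v g x = 'D_1 (fun h : R => g (h *: v + x)) 0.
  by rewrite /derive -E.
by split=> -[H1 H2]; split; [rewrite -E'|rewrite -E''|rewrite E'|rewrite E''].
Qed.

Lemma is_derive_comp1 (V : normedModType R) (f : R -> R) (u : V -> R) (x v : V) (df du : R) :
  is_derive (u x) 1 f df -> is_derive x v u du ->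
  is_derive x v (fun z => f (u z)) (df * du).
Proof.
move=> Hf /is_derive_lineE Hu; apply/is_derive_lineE.
apply: (@is_derive1_comp R f (fun h : R => u (h *: v + x)) 0 df du) => //.
by rewrite scale0r add0r.
Qed.

Lemma Ck_comp1 d k (F : nat -> R -> R) (u : 'rV[R]_d -> R) :
  (forall j (x : R), is_derive x 1 (F j) (F j.+1 x)) -> rsmooth u ->
  forall j, Ck k (fun x => F j (u x)).
Proof.
move=> HF su; have C0 j : continuous (fun x => F j (u x)).
  move=> x; apply: continuous_comp; first exact: rsmooth_continuous.
  by apply: differentiable_continuous; apply/derivable1_diffP; have [] := HF j (u x).
have D j i x : is_derive x (dd i) (fun z => F j (u z)) (F j.+1 (u x) * dpart i u x).
  by apply: is_derive_comp1 => //; apply: derivableP; exact: rsmooth_derivable.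
elim: k => [|k ih] j; first exact: C0.
split=> // i; split=> [x|]; first by have [] := D j i x.
rewrite (_ : dpart i _ = fun x => F j.+1 (u x) * dpart i u x); last first.
  by apply/funext => x; have [] := D j i x.
by apply: CkM => //; move: k {ih}; apply/rsmoothP; exact: rsmooth_dpart.
Qed.

Lemma rsmooth_comp1 d (f : R -> R) (u : 'rV[R]_d -> R) :
  smooth1 f -> rsmooth u -> rsmooth (fun x => f (u x)).
Proof.
by move=> [F [<- HF]] su; apply/rsmoothP => k; exact: Ck_comp1.
Qed.

Lemma dpart_comp1 d (f df : R -> R) (u : 'rV[R]_d -> R) i x :
  (forall x : R, is_derive x 1 f (df x)) -> rsmooth u ->
  dpart i (fun x => f (u x)) x = df (u x) * dpart i u x.
Proof.
move=> Hf su.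
have Hu : is_derive x (dd i) u (dpart i u x).
  by apply: derivableP; exact: rsmooth_derivable.
by have [] := is_derive_comp1 (Hf (u x)) Hu.
Qed.

Lemma smooth1_expR : smooth1 (@expR R).
Proof. by exists (fun=> expR); split=> // k x; exact: is_derive_expR. Qed.

(* [trig k] is the k-th derivative of cos, so that [trig 0] is cos and [trig 3] is sin. *)
Definition trig (k : nat) (x : R) : R := match (k %% 4)%N with
  | 0 => cos x | 1 => - sin x | 2 => - cos x | _ => sin x end.

Lemma is_derive_trig k (x : R) : is_derive x (1 : R) (trig k) (trig k.+1 x).
Proof.
have E : (k.+1 %% 4 = (k %% 4).+1 %% 4)%N by rewrite -[in RHS]addn1 modnDml addn1.
rewrite /trig E; have : (k %% 4 < 4)%N by rewrite ltn_mod.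
case: (k %% 4)%N => [|[|[|[|//]]]] _ /=.
- exact: is_derive_cos.
- exact: is_deriveN.
- by have := is_deriveN (is_derive_cos x); rewrite opprK.
- exact: is_derive_sin.
Qed.

Lemma trig_le1 k (x : R) : `|trig k x| <= 1.
Proof.
have s1 : `|sin x| <= 1 by rewrite ler_norml sin_geN1 sin_le1.
have c1 : `|cos x| <= 1 by rewrite ler_norml cos_geN1 cos_le1.
by rewrite /trig; case: (k %% 4)%N => [|[|[|m]]] //; rewrite normrN.
Qed.

(** Boxes are cofinal among the compact sets, so every local estimate is indexed by one real number.
    They are also convex coordinate by coordinate, which keeps paths along the axes inside. *)
Definition box d (M : R) : set 'rV[R]_d := [set x | forall i, `|x 0 i| <= M].

Arguments box d M : clear implicits.

Lemma box_compact d M : compact (box d M).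
Proof.
have := @rV_compact R d (fun=> `[-M, M]%classic) (fun i => @segment_compact R _ _).
congr compact; apply/seteqP; split=> x /= H i; have := H i; rewrite in_itv /= ler_norml //.
Qed.

Lemma compact_sub_box d (K : set 'rV[R]_d) : compact K ->
  exists2 M : R, 0 <= M & K `<=` box d M.
Proof.
move=> /compact_bounded; rewrite /bounded_set => -[M [Mr HM]].
exists (`|M| + 1); first by rewrite addr_ge0.
move=> x Kx i; apply: le_trans (rV_coord_le x i) _.
apply: HM => //; rewrite (le_lt_trans (ler_norm M)) // ltrDl //.
Qed.

Lemma box_le d M M' : M <= M' -> box d M `<=` box d M'.
Proof. by move=> MM x H i; exact: le_trans (H i) MM. Qed.

Lemma continuous_box_bounded d (f : 'rV[R]_d -> R) M : continuous f ->
  exists2 C : R, 0 <= C & forall x, box d M x -> `|f x| <= C.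
Proof.
move=> cf.
have := @continuous_compact _ _ f (box d M) (continuous_subspaceT cf) (box_compact (M := M)).
move=> /compact_bounded; rewrite /bounded_set => -[C [Cr HC]].
exists (`|C| + 1); first by rewrite addr_ge0.
move=> x Kx; apply: HC; last by exists x.
by rewrite (le_lt_trans (ler_norm C)) // ltrDl.
Qed.

(** The path from x to y along the axes stays in the box: each coordinate of an intermediate point
    is a convex combination of those of x and y. *)
Lemma box_lipschitz d (f : 'rV[R]_d -> R) (M C : R) : rsmooth f ->
  (forall j z, box d M z -> `|dpart j f z| <= C) ->
  forall x y, box d M x -> box d M y -> `|f y - f x| <= d%:R * C * `|y - x|.
Proof.
move=> sf HC x y Bx By.
have -> : f y = f (x + (y - x)) by rewrite addrC subrK.
rewrite telescope_trunc; set h := y - x.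
apply: (le_trans (ler_norm_sum _ _ _)).
have -> : d%:R * C * `|h| = \sum_(j < d) (C * `|h|).
  by rewrite sumr_const card_ord -[RHS]mulr_natl mulrA.
apply: ler_sum => j _; rewrite truncS addrA.
have [th /andP[th0 th1] ->] := MVT_line (fun z => rsmooth_derivable sf z j) (x + trunc j h) (h 0 j).
rewrite normrM mulrC; apply: ler_pM => //; last exact: rV_coord_le.
apply: HC => k; rewrite !mxE eqxx /=.
have xk := Bx k; have yk := By k.
have conv (t : R) : 0 <= t -> t <= 1 -> `|x 0 k + t * (y 0 k - x 0 k)| <= M.
  move=> t0 t1; have -> : x 0 k + t * (y 0 k - x 0 k) = (1 - t) * x 0 k + t * y 0 k by ring.
  apply: (le_trans (ler_normD _ _)); rewrite !normrM (ger0_norm t0) ger0_norm ?subr_ge0 //.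
  have -> : M = (1 - t) * M + t * M by ring.
  by apply: lerD; apply: ler_wpM2l => //; rewrite subr_ge0.
have [kj|jk] := ltnP k j.
  have -> : (k == j) = false by rewrite -val_eqE; apply/negbTE; rewrite ltn_eqF.
  by rewrite mulr0 addr0; have := conv 1 ler01 (lexx _); rewrite mul1r.
case: eqP => [kj|_]; last by rewrite mulr0 !addr0.
by rewrite -kj addr0 mulr1; exact: conv.
Qed.

End Calculus.

Arguments box {R} d M.
Arguments rsmooth_derivable {R d f} _ x i : rename.
Arguments MVT_line {R V f v} _ x h : rename.

(** * Integrals depending on a parameter *)

Section ParamIntegral.
Variable R : realType.
Local Notation mu := (@lebesgue_measure R).

Definition jn d (z : 'rV[R]_d) (th : R) : 'rV[R]_(d + 1) := row_mx z th%:M.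

Lemma continuous_integrable (f : R -> R) a b : continuous f ->
  mu.-integrable `[a, b] (EFin \o f).
Proof.
move=> cf; apply: continuous_compact_integrable; first exact: segment_compact.
exact: continuous_subspaceT.
Qed.

Lemma Rintegral_segment_bound (f : R -> R) (a b C : R) : a <= b -> continuous f ->
  (forall x, a <= x <= b -> `|f x| <= C) ->
  `|\int[mu]_(x in `[a, b]) f x| <= C * (b - a).
Proof.
move=> ab cf HC.
have If := continuous_integrable a b cf.
apply: (le_trans (le_normr_Rintegral _ If)); first exact: measurable_itv.
have -> : C * (b - a) = \int[mu]_(x in `[a, b]) C.
  rewrite Rintegral_cst; last exact: measurable_itv.
  rewrite /= lebesgue_measure_itv /= lte_fin; move: ab; rewrite le_eqVlt => /predU1P[->|->]; rewrite ?ltxx ?subrr ?mulr0 //.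
apply: le_Rintegral => //.
- by apply: continuous_integrable => x; apply: cvg_norm; exact: cf.
- by apply: continuous_integrable; exact: cst_continuous.
Qed.

Lemma jn_continuous d (z : 'rV[R]_d) : continuous (jn z).
Proof.
have -> : jn z = fun th => \row_k jn z th 0 k.
  by apply/funext => th; apply/rowP => k; rewrite mxE.
apply: continuous_rowP => k th.
have -> : (fun th => jn z th 0 k) = fun th => match @fintype.split d 1 k with inl j => z 0 j | inr j => th end.
  apply/funext => t; rewrite mxE; case: fintype.split => // j.
  by rewrite mxE (ord1 j) eqxx mulr1n.
by case: fintype.split => j; [exact: cst_continuous|exact: cvg_id].
Qed.

Lemma jn_shift d (z : 'rV[R]_d) (h th : R) i :
  jn (h *: delta_mx 0 i + z) th = h *: delta_mx 0 (lshift 1 i) + jn z th.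
Proof.
apply/rowP => k; rewrite !mxE; case: splitP => j Ej; rewrite !mxE !eqxx /=.
  have -> : k = lshift 1 j by apply/val_inj.
  by rewrite (inj_eq (@lshift_inj d 1)).
have -> : k = rshift d j by apply/val_inj.
by rewrite eq_rlshift mulr0 add0r.
Qed.

Lemma box_jn d M (z : 'rV[R]_d) (th : R) : box d M z -> `|th| <= M -> box (d + 1) M (jn z th).
Proof.
move=> Bz Bt k; rewrite mxE; case: fintype.split => j; first exact: Bz.
by rewrite mxE (ord1 j) eqxx mulr1n.
Qed.

Lemma rV_continuous d (f : 'rV[R]_d -> R) :
  (forall (z : 'rV[R]_d) (e : R), 0 < e -> \forall w \near z, `|f z - f w| <= e) ->
  continuous f.
Proof.
move=> H z; have FF : Filter (nbhs z) by exact: nbhs_filter.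
apply: (proj2 (@cvgrPdist_le _ _ _ (nbhs z) FF f (f z))) => e e0; exact: H.
Qed.

Definition pint d (F : 'rV[R]_(d + 1) -> R) (a b : R) (z : 'rV[R]_d) : R :=
  \int[mu]_(th in `[a, b]) F (jn z th).

Lemma box_shift d M (z : 'rV[R]_d) (h : R) i : box d M z -> `|h| <= 1 ->
  box d (M + 1) (h *: delta_mx 0 i + z).
Proof.
move=> Bz h1 k; rewrite !mxE eqxx /= addrC; apply: (le_trans (ler_normD _ _)); apply: lerD.
  exact: Bz.
by case: (k == i); rewrite ?mulr1 ?mulr0 ?normr0.
Qed.

Lemma box_norm d (z : 'rV[R]_d) : box d `|z| z.
Proof. by move=> i; exact: rV_coord_le. Qed.

Lemma continuous_jnF d (F : 'rV[R]_(d + 1) -> R) z : continuous F ->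
  continuous (fun th => F (jn z th)).
Proof. by move=> cF th; apply: continuous_comp; [exact: jn_continuous|exact: cF]. Qed.

Lemma segment_norm (a b x : R) : a <= x <= b -> `|x| <= `|a| + `|b|.
Proof.
move=> /andP[ax xb]; rewrite ler_norml; apply/andP; split.
  have := ler_norm (- a); have := normr_ge0 b; rewrite normrN; lra.
have := ler_norm b; have := normr_ge0 a; lra.
Qed.

(** Differentiation under the integral sign; on a segment the derivative of the integrand is
    dominated by a constant. *)
Lemma is_derive_pint d (F : 'rV[R]_(d + 1) -> R) (a b : R) z i : rsmooth F ->
  is_derive z (delta_mx 0 i) (pint F a b) (pint (dpart (lshift 1 i) F) a b z).
Proof.
move=> sF; apply/is_derive_lineE.
pose f (h th : R) := F (jn (h *: delta_mx 0 i + z) th).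
have df (h th : R) : is_derive h 1 (f ^~ th) (dpart (lshift 1 i) F (jn (h *: delta_mx 0 i + z) th)).
  have -> : f ^~ th = fun h => F (jn z th + h *: delta_mx 0 (lshift 1 i)).
    by apply/funext => k; rewrite /f jn_shift addrC.
  have := @is_derive_line R _ F (jn z th) (delta_mx 0 (lshift 1 i)) h (rsmooth_derivable sF _ _).
  by rewrite jn_shift [_ + jn z th]addrC.
(* A box containing all points with z displaced by at most 1 and the integration variable in
   [a, b]. *)
pose M := `|z| + 1 + (`|a| + `|b|).
have [C C0 HC] := continuous_box_bounded M (rsmooth_continuous (rsmooth_dpart (lshift 1 i) sF)).
have I0 : (`]-1, 1[%classic : set R) 0 by rewrite /= in_itv /= ltr01 ltrN10.
have intf x : (`]-1, 1[%classic : set R) x -> mu.-integrable `[a, b] (EFin \o f x).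
  by move=> _; apply: continuous_integrable; apply: continuous_jnF; exact: rsmooth_continuous.
have d1 x y : (`]-1, 1[%classic : set R) x -> (`[a, b]%classic : set R) y -> derivable (f ^~ y) x 1.
  by move=> _ _; have [] := df x y.
have GC x y : (`]-1, 1[%classic : set R) x -> (`[a, b]%classic : set R) y -> `|partial1of2 f x y| <= C.
  rewrite /= !in_itv /= => /andP[x1 x2] y12.
  rewrite partial1of2E; have [_ ->] := df x y.
  apply: HC; apply: box_jn.
    apply: box_le (box_shift _ (@box_norm _ z) _); first by rewrite lerDl addr_ge0.
    by rewrite ler_norml !ltW.
  by apply: (le_trans (segment_norm y12)); rewrite lerDr addr_ge0.
have H := @cvg_differentiation_under_integral R _ _ mu f `[a, b] (measurable_itv _) 0 (-1) 1 I0 intf d1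
  (fun=> C) (fun=> C0) (@continuous_integrable (fun=> C) a b (@cst_continuous _ _ _)) GC.
have E : (fun h : R => h^-1 *: (pint F a b ((h *: (1 : R) + 0) *: delta_mx 0 i + z) - pint F a b ((0 : R) *: delta_mx 0 i + z)))
  @ 0^' --> pint (dpart (lshift 1 i) F) a b z.
  have -> : pint (dpart (lshift 1 i) F) a b z = \int[mu]_(y in `[a, b]) partial1of2 f 0 y.
    apply: eq_Rintegral => th _; rewrite partial1of2E; have [_ ->] := df 0 th.
    by rewrite scale0r add0r.
  apply: cvg_trans H; apply: near_eq_cvg; apply: nearW => h.
  by rewrite [h *: 1]mulr1.
by split; [apply/cvg_ex; eexists; exact: E|exact/cvg_lim].
Qed.

(** The integrand is Lipschitz on a box around z with one constant for the whole segment, so the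
    integral is locally Lipschitz. *)
Lemma continuous_pint d (F : 'rV[R]_(d + 1) -> R) (a b : R) : a <= b -> rsmooth F ->
  continuous (pint F a b).
Proof.
move=> ab sF.
apply: rV_continuous => z e e0.
pose M := `|z| + 1 + (`|a| + `|b|).
have HC (j : 'I_(d + 1)) : exists C : R, forall w, box (d + 1) M w -> `|dpart j F w| <= C.
  by have [C _ HC] := continuous_box_bounded M (rsmooth_continuous (rsmooth_dpart j sF)); exists C.
have {HC}[c Hc] := choice HC.
pose C : R := \sum_j `|c j|.
have HC j w : box (d + 1) M w -> `|dpart j F w| <= C.
  move=> Bw; apply: le_trans (Hc j w Bw) _; apply: le_trans (ler_norm _) _.
  by rewrite /C (bigD1 j) //= lerDl sumr_ge0.
have C0 : 0 <= C by rewrite sumr_ge0.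
pose L := (d + 1)%:R * C * (b - a).
have L0 : 0 <= L by rewrite !mulr_ge0 // subr_ge0.
(* L may be 0, for instance when a = b, hence L + 1. *)
have e' : 0 < e / (L + 1) by rewrite divr_gt0 // ltr_wpDl.
have zM : box d M z by apply: box_le (@box_norm _ z); rewrite /M -addrA lerDl !addr_ge0.
near=> w.
have wz : `|z - w| <= e / (L + 1).
  near: w; apply/nbhs_ballP; exists (e / (L + 1)) => //= y.
  by rewrite -ball_normE /= => /ltW.
have w1 : `|z - w| <= 1.
  near: w; apply/nbhs_ballP; exists 1 => //= y.
  by rewrite -ball_normE /= => /ltW.
have wM : box d M w.
  apply: (@box_le _ _ `|w|); last exact: box_norm.
  have -> : w = z - (z - w) by rewrite subKr.
  apply: (le_trans (ler_normB _ _)); rewrite /M; have := normr_ge0 a; have := normr_ge0 b; lra.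
rewrite /pint -RintegralB //; try by apply: continuous_integrable; apply: continuous_jnF; exact: rsmooth_continuous.
apply: (@le_trans _ _ ((d + 1)%:R * C * `|z - w| * (b - a))).
  apply: Rintegral_segment_bound => //.
    move=> th; apply: continuousB; exact: (continuous_jnF (rsmooth_continuous sF)).
  move=> th thab.
  have Bt : `|th| <= M by apply: (le_trans (segment_norm thab)); rewrite lerDr addr_ge0.
  apply: (le_trans (box_lipschitz sF HC (box_jn wM Bt) (box_jn zM Bt))).
  apply: ler_wpM2l; first by rewrite mulr_ge0.
  apply/rV_normP => // k; rewrite !mxE; case: fintype.split => j.
    by have := rV_coord_le (z - w) j; rewrite !mxE.
  by rewrite subrr normr0.
rewrite mulrAC -/L; apply: (@le_trans _ _ (L * (e / (L + 1)))); first exact: ler_wpM2l.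
rewrite mulrA ler_pdivrMr ?ltr_wpDl // [L * e]mulrC; apply: ler_wpM2l; first exact: ltW.
by rewrite lerDl.
Unshelve. all: by end_near. Qed.

Lemma dparts_pint d (F : 'rV[R]_(d + 1) -> R) (a b : R) al : rsmooth F ->
  dparts al (pint F a b) = pint (dparts (map (lshift 1) al) F) a b.
Proof.
move=> sF; elim: al => //= i al ->; apply/funext => z.
by have [_] := @is_derive_pint _ (dparts (map (lshift 1) al) F) a b z i (rsmooth_dparts _ sF).
Qed.

Lemma rsmooth_pint d (F : 'rV[R]_(d + 1) -> R) (a b : R) : a <= b -> rsmooth F ->
  rsmooth (pint F a b).
Proof.
move=> ab sF al; rewrite dparts_pint //; split.
  exact: (continuous_pint ab (rsmooth_dparts _ sF)).
move=> i z.
by have [] := @is_derive_pint _ (dparts (map (lshift 1) al) F) a b z i (rsmooth_dparts _ sF).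
Qed.

End ParamIntegral.

(** * Nets and growth scales *)

Section Nets.
Variable R : realType.

Definition snet d (u : real_net R d) := forall e : R, 0 < e <= 1 -> rsmooth (u e).
Definition dnet d (al : seq 'I_d) (u : real_net R d) : real_net R d := fun e => dparts al (u e).

(* A scale is a class of admissible growth rates in eps. It is instantiated by
   the moderate rates and by the slow scale ones, so that each estimate is proved
   once for parts (i) and (ii). *)
Record scale := Scale {
  bound :> (R -> R) -> Prop;
  bound_cst : forall c, bound (fun=> c);
  bound_le : forall g h, bound g -> (\forall e \near 0^'+, `|h e| <= `|g e|) -> bound h;
  boundD : forall g h, bound g -> bound h -> bound (fun e => g e + h e);
  boundM : forall g h, bound g -> bound h -> bound (fun e => g e * h e) }.

Lemma near01 : \forall e \near (0 : R)^'+, 0 < e <= 1.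
Proof.
near=> e; apply/andP; split; first by near: e; exact: nbhs_right_gt.
by near: e; apply: nbhs_right_le; exact: ltr01.
Unshelve. all: by end_near. Qed.

Section ScaleClosure.
Variable P : scale.

Lemma bound_norm g : P g -> P (fun e => `|g e|).
Proof. by move=> Pg; apply: (bound_le Pg); apply: nearW => e; rewrite normr_id. Qed.

Definition Obd d (u : real_net R d) := forall M : R, exists2 g, P g &
  \forall e \near 0^'+, forall x, box d M x -> `|u e x| <= g e.

Lemma Obd_le d (u v : real_net R d) : Obd v ->
  (forall M, \forall e \near 0^'+, forall x, box d M x -> `|u e x| <= `|v e x|) -> Obd u.
Proof.
move=> Ov uv M; have [g Pg Hg] := Ov M; exists g => //.
near=> e => x Bx; apply: le_trans (near Hg e _ x Bx) => //.
by move: x Bx; near: e; exact: uv.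
Unshelve. all: by end_near. Qed.

Lemma Obd_ext d (u v : real_net R d) : (forall e, 0 < e <= 1 -> u e = v e) -> Obd v -> Obd u.
Proof.
move=> uv Ov; apply: (Obd_le Ov) => M; apply: filterS near01 => e e01 x _.
by rewrite uv.
Qed.

Lemma Obd_cst d (c : R) : Obd (fun _ (_ : 'rV[R]_d) => c).
Proof. by move=> M; exists (fun=> `|c|); [exact: bound_cst|exact: nearW]. Qed.

Lemma ObdD d (u v : real_net R d) : Obd u -> Obd v -> Obd (fun e x => u e x + v e x).
Proof.
move=> Ou Ov M; have [g Pg Hg] := Ou M; have [h Ph Hh] := Ov M.
exists (fun e => g e + h e); first exact: boundD.
near=> e => x Bx; apply: (le_trans (ler_normD _ _)); apply: lerD.
  by move: x Bx; near: e.
by move: x Bx; near: e.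
Unshelve. all: by end_near. Qed.

Lemma ObdM d (u v : real_net R d) : Obd u -> Obd v -> Obd (fun e x => u e x * v e x).
Proof.
move=> Ou Ov M; have [g Pg Hg] := Ou M; have [h Ph Hh] := Ov M.
exists (fun e => g e * h e); first exact: boundM.
near=> e => x Bx; rewrite normrM; apply: ler_pM => //.
  by move: x Bx; near: e.
by move: x Bx; near: e.
Unshelve. all: by end_near. Qed.

Lemma ObdN d (u : real_net R d) : Obd u -> Obd (fun e x => - u e x).
Proof. by move=> Ou; apply: (Obd_le Ou) => M; apply: nearW => e x _; rewrite normrN. Qed.

(* Bounds are indexed by the sublists of [al] because exactly these derivatives
   occur in the Leibniz and chain rules for the derivative [al]. *)
Definition Sb d (al : seq 'I_d) (u : real_net R d) :=
  forall be, subseq be al -> Obd (dnet be u).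

Lemma subseq_rcons_inv (T : eqType) (be al : seq T) i : subseq be (rcons al i) ->
  subseq be al \/ exists2 be', be = rcons be' i & subseq be' al.
Proof.
elim/last_ind: be => [|be j _]; first by left; exact: sub0seq.
rewrite -subseq_rev !rev_rcons /=; case: eqP => [->|_] H.
  by right; exists be => //; rewrite -subseq_rev.
by left; rewrite -subseq_rev rev_rcons.
Qed.

(** A sublist of [rcons al i] is a sublist of [al], possibly followed by i, and the last entry is
    the innermost derivative. The closure properties of [Sb] are inductions along this
    equivalence. *)
Lemma Sb_rcons d (al : seq 'I_d) i u : Sb (rcons al i) u <-> Sb al u /\ Sb al (dnet [:: i] u).
Proof.
have E be : dnet (rcons be i) u = dnet be (dnet [:: i] u).
  by apply/funext => e; rewrite /dnet dparts_rcons.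
split=> [H|[H1 H2] be /subseq_rcons_inv[|[be' ->]] sb].
- split=> be sb; first by apply: H; exact: subseq_trans sb (subseq_rcons _ _).
  by rewrite -E; apply: H; rewrite -!cats1; apply: cat_subseq.
- exact: H1.
- by rewrite E; exact: H2.
Qed.

Lemma Sb_nil d (u : real_net R d) : Sb [::] u <-> Obd u.
Proof.
split=> [H|H be]; first exact: (H [::]).
by rewrite subseq0 => /eqP ->.
Qed.

Lemma Sb_ext d al (u v : real_net R d) : (forall e, 0 < e <= 1 -> u e = v e) ->
  Sb al v -> Sb al u.
Proof.
move=> uv Sv be sb; apply: Obd_ext (Sv be sb) => e e01.
by rewrite /dnet uv.
Qed.

Lemma Sb_cst d al (c : R) : Sb al (fun _ (_ : 'rV[R]_d) => c).
Proof.
elim/last_ind: al c => [|al i ih] c; first by apply/Sb_nil; exact: Obd_cst.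
apply/Sb_rcons; split=> //; rewrite /dnet /=.
by rewrite dpart_cst.
Qed.

Lemma snet_dnet d al (u : real_net R d) : snet u -> snet (dnet al u).
Proof. by move=> su e e01; apply: rsmooth_dparts; exact: su. Qed.

Lemma SbD d al (u v : real_net R d) : snet u -> snet v -> Sb al u -> Sb al v ->
  Sb al (fun e x => u e x + v e x).
Proof.
elim/last_ind: al u v => [|al i ih] u v su sv.
  by move=> /Sb_nil Ou /Sb_nil Ov; apply/Sb_nil; exact: ObdD.
move=> /Sb_rcons[Ou Ou'] /Sb_rcons[Ov Ov']; apply/Sb_rcons; split; first exact: ih.
apply: (@Sb_ext _ _ _ (fun e x => dnet [:: i] u e x + dnet [:: i] v e x)); last first.
  exact: ih (snet_dnet _ su) (snet_dnet _ sv) Ou' Ov'.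
move=> e e01; apply/funext => x; rewrite /dnet /= /dpart deriveD //.
  by apply: rsmooth_derivable; exact: su.
by apply: rsmooth_derivable; exact: sv.
Qed.

Lemma SbM d al (u v : real_net R d) : snet u -> snet v -> Sb al u -> Sb al v ->
  Sb al (fun e x => u e x * v e x).
Proof.
elim/last_ind: al u v => [|al i ih] u v su sv.
  by move=> /Sb_nil Ou /Sb_nil Ov; apply/Sb_nil; exact: ObdM.
move=> /Sb_rcons[Ou Ou'] /Sb_rcons[Ov Ov']; apply/Sb_rcons; split; first exact: ih.
apply: (@Sb_ext _ _ _ (fun e x => dnet [:: i] u e x * v e x + u e x * dnet [:: i] v e x)).
  move=> e e01; apply/funext => x; rewrite /dnet /= dpartM //.
    by apply: rsmooth_derivable; exact: su.
  by apply: rsmooth_derivable; exact: sv.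
have su' := snet_dnet [:: i] su; have sv' := snet_dnet [:: i] sv.
apply: SbD; [| |exact: ih..].
  by move=> e e01; apply: rsmoothM; [exact: su'|exact: sv].
by move=> e e01; apply: rsmoothM; [exact: su|exact: sv'].
Qed.

Lemma SbN d al (u : real_net R d) : snet u -> Sb al u -> Sb al (fun e x => - u e x).
Proof.
move=> su Su; apply: (@Sb_ext _ _ _ (fun e x => -1 * u e x)).
  by move=> e _; apply/funext => x; rewrite mulN1r.
by apply: (SbM _ su _ Su); [move=> e _; exact: rsmooth_cst|exact: Sb_cst].
Qed.

Lemma Sb_sum d al m (u : 'I_m -> real_net R d) : (forall j, snet (u j)) ->
  (forall j, Sb al (u j)) -> Sb al (fun e x => \sum_(j < m) u j e x).
Proof.
elim: m u => [|m ih] u su Su.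
  apply: (@Sb_ext _ _ _ (fun _ _ => 0)); last exact: Sb_cst.
  by move=> e _; apply/funext => x; rewrite big_ord0.
apply: (@Sb_ext _ _ _ (fun e x => \sum_(j < m) u (widen_ord (leqnSn m) j) e x + u ord_max e x)).
  by move=> e _; apply/funext => x; rewrite big_ord_recr.
apply: SbD => //; last by apply: ih.
by move=> e e01; apply: rsmooth_sum => j; exact: su.
Qed.

(** c-boundedness: [M'] does not depend on eps, so an outer net is evaluated on one fixed box, where
    its own bounds apply. *)
Definition cbd d m (G : 'I_m -> real_net R d) := forall M : R, exists M' : R,
  \forall e \near 0^'+, forall x, box d M x -> forall k, `|G k e x| <= M'.

Lemma Obd_comp d m (f : real_net R m) (G : 'I_m -> real_net R d) : cbd G ->
  Obd f -> Obd (fun e x => f e (\row_k G k e x)).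
Proof.
move=> cG Of M; have [M' HM'] := cG M; have [g Pg Hg] := Of M'; exists g => //.
near=> e => x Bx.
suff : box m M' (\row_k G k e x) by move: (\row_k _); near: e.
by move=> k; rewrite mxE; move: x Bx k; near: e.
Unshelve. all: by end_near. Qed.

Lemma snet_comp d m (f : real_net R m) (G : 'I_m -> real_net R d) :
  snet f -> (forall k, snet (G k)) -> snet (fun e x => f e (\row_k G k e x)).
Proof. by move=> sf sG e e01; apply: rsmooth_comp => [|k]; [exact: sf|exact: sG]. Qed.

(** The inner functions are controlled only along sublists of [al]. This lets the lemma serve in an
    induction on the order, where the higher derivatives of the flow are still unknown. *)
Lemma Sb_comp d m al (f : real_net R m) (G : 'I_m -> real_net R d) : cbd G ->
  snet f -> (forall k, snet (G k)) ->
  (forall be, Obd (dnet be f)) -> (forall k, Sb al (G k)) ->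
  Sb al (fun e x => f e (\row_k G k e x)).
Proof.
move=> cG; elim/last_ind: al f => [|al i ih] f sf sG Of SG.
  by apply/Sb_nil; apply: Obd_comp => //; exact: (Of [::]).
apply/Sb_rcons; split.
  by apply: ih => // k; have /Sb_rcons[] := SG k.
apply: (@Sb_ext _ _ _ (fun e x => \sum_(k < m) dnet [:: i] (G k) e x * dnet [:: k] f e (\row_k G k e x))).
  move=> e e01; apply/funext => x; rewrite /dnet /= dpart_comp //; first exact: sf.
  by move=> j; exact: sG.
apply: Sb_sum => k.
  move=> e e01; apply: rsmoothM; first exact: (snet_dnet _ (sG k)).
  exact: (snet_comp (snet_dnet [:: k] sf) sG e01).
apply: SbM.
- exact: snet_dnet.
- exact: (snet_comp (snet_dnet [:: k] sf) sG).
- by have /Sb_rcons[] := SG k.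
- apply: ih => //; first exact: snet_dnet.
    move=> be; have := Of (rcons be k); rewrite (_ : dnet _ _ = dnet be (dnet [:: k] f)) //.
    by apply/funext => e; rewrite /dnet dparts_rcons.
  by move=> l; have /Sb_rcons[] := SG l.
Qed.

(** The bounds on [F j (u e x)] are a hypothesis because a scale is not stable under functions such
    as exp; for exp they come from logarithmic bounds, for cos and sin from boundedness. *)
Lemma Sb_comp1 d al (F : nat -> R -> R) (u : real_net R d) :
  (forall j (x : R), is_derive x 1 (F j) (F j.+1 x)) -> snet u ->
  (forall j, Obd (fun e x => F j (u e x))) -> Sb al u ->
  forall j, Sb al (fun e x => F j (u e x)).
Proof.
move=> HF su OF; elim/last_ind: al => [|al i ih] Su j; first by apply/Sb_nil.
have /Sb_rcons[S1 S2] := Su.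
apply/Sb_rcons; split; first exact: ih.
apply: (@Sb_ext _ _ _ (fun e x => F j.+1 (u e x) * dnet [:: i] u e x)).
  move=> e e01; apply/funext => x; rewrite /dnet /=.
  by rewrite (@dpart_comp1 R d (F j) (F j.+1)) //; exact: su.
apply: SbM; [|exact: snet_dnet|exact: ih|exact: S2].
  move=> e e01; apply/rsmoothP => k; apply: (Ck_comp1 _ HF); exact: su.
Qed.

End ScaleClosure.

Lemma e_small (c : R) : 0 < c -> \forall e \near (0 : R)^'+, 0 < e <= c.
Proof.
move=> c0; near=> e; apply/andP; split; first by near: e; exact: nbhs_right_gt.
by near: e; apply: nbhs_right_le.
Unshelve. all: by end_near. Qed.

Definition modb (g : R -> R) := exists N : nat, \forall e \near 0^'+, `|g e| <= e ^- N.

Lemma ler_expVn (e : R) (m n : nat) : 0 < e <= 1 -> (m <= n)%N -> e ^- m <= e ^- n.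
Proof.
move=> /andP[e0 e1] mn; rewrite lef_pV2 ?posrE ?exprn_gt0 //.
by apply: ler_wiXn2l => //; exact: ltW.
Qed.

Lemma cst_le_expV (c : R) : \forall e \near (0 : R)^'+, c <= e ^- 1.
Proof.
have c0 : 0 < (`|c| + 1)^-1 by rewrite invr_gt0 ltr_wpDl.
apply: filterS (e_small c0) => e /andP[e0 e1]; rewrite expr1.
apply: (@le_trans _ _ (`|c| + 1)); first by rewrite (le_trans (ler_norm c)) // lerDl.
by rewrite -[leLHS]invrK lef_pV2 ?posrE.
Qed.

Program Definition modscale : scale := @Scale modb _ _ _ _.
Next Obligation. by move=> c; exists 1%N; exact: cst_le_expV. Qed.
Next Obligation.
move=> g h [N HN] gh; exists N; near=> e; apply: (@le_trans _ _ `|g e|).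
  by near: e.
by near: e.
Unshelve. all: by end_near. Qed.
Next Obligation.
(* The additional power of 1/eps absorbs the factor 2 of the sum. *)
move=> g h [N HN] [N' HN']; exists (N + N' + 1)%N; near=> e.
have e01 : 0 < e <= 1 by near: e; exact: near01.
apply: (le_trans (ler_normD _ _)).
apply: (@le_trans _ _ (2 * e ^- (N + N'))).
  rewrite mulr_natl mulr2n; apply: lerD.
    apply: (@le_trans _ _ (e ^- N)); first by near: e.
    by apply: ler_expVn => //; exact: leq_addr.
  apply: (@le_trans _ _ (e ^- N')); first by near: e.
  by apply: ler_expVn => //; exact: leq_addl.
rewrite [in leRHS]exprD invfM mulrC; apply: ler_wpM2l.
  by rewrite invr_ge0 exprn_ge0 //; case/andP: e01 => /ltW.
by near: e; exact: cst_le_expV.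
Unshelve. all: by end_near. Qed.
Next Obligation.
move=> g h [N HN] [N' HN']; exists (N + N')%N; near=> e.
rewrite normrM exprD invfM; apply: ler_pM => //; by near: e.
Unshelve. all: by end_near. Qed.

(* Only the values of u are required to be small: for moderate nets this already
   implies the smallness of all derivatives, see [nul_dpart]. *)
Definition nul d (u : real_net R d) := forall (M : R) (q : nat),
  \forall e \near 0^'+, forall x, box d M x -> `|u e x| <= e ^+ q.

Definition mode d (u : real_net R d) := snet u /\ forall al, Obd modscale (dnet al u).

Lemma nul_le d (u v : real_net R d) : nul v ->
  (forall M, \forall e \near 0^'+, forall x, box d M x -> `|u e x| <= `|v e x|) -> nul u.
Proof.
move=> Ov uv M q; near=> e => x Bx; apply: (@le_trans _ _ `|v e x|).
  by move: x Bx; near: e; exact: uv.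
by move: x Bx; near: e; exact: Ov.
Unshelve. all: by end_near. Qed.

Lemma nul_ext d (u v : real_net R d) : (forall e, 0 < e <= 1 -> u e =1 v e) -> nul v -> nul u.
Proof.
move=> uv Ov; apply: (nul_le Ov) => M; apply: filterS near01 => e e01 x _.
by rewrite uv.
Qed.

Lemma nulN d (u : real_net R d) : nul u -> nul (fun e x => - u e x).
Proof. by move=> Ou; apply: (nul_le Ou) => M; apply: nearW => e x _; rewrite normrN. Qed.

Lemma nul0 d : nul (fun _ (_ : 'rV[R]_d) => 0).
Proof.
move=> M q; apply: filterS near01 => e /andP[e0 _] x _.
by rewrite normr0 exprn_ge0 // ltW.
Qed.

Lemma nulM d (u v : real_net R d) : Obd modscale u -> nul v -> nul (fun e x => u e x * v e x).
Proof.
move=> Ou nv M q; have [g [N HN] Hg] := Ou M.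
near=> e => x Bx.
have e01 : 0 < e <= 1 by near: e; exact: near01.
have e0 : 0 < e by case/andP: e01.
have -> : e ^+ q = e ^- N * e ^+ (N + q) by rewrite exprD mulKf // expf_neq0 // gt_eqF.
rewrite normrM; apply: ler_pM => //.
  apply: (@le_trans _ _ (g e)); first by move: x Bx; near: e.
  by apply: (le_trans (ler_norm _)); near: e.
by move: x Bx; near: e; exact: nv.
Unshelve. all: by end_near. Qed.

Lemma nulD d (u v : real_net R d) : nul u -> nul v -> nul (fun e x => u e x + v e x).
Proof.
move=> nu nv M q; have h0 : (0 : R) < 1 / 2 by lra.
near=> e => x Bx.
have /andP[e0 e1] : 0 < e <= 1 / 2 by near: e; exact: e_small.
apply: (le_trans (ler_normD _ _)).
apply: (@le_trans _ _ (e ^+ q.+1 + e ^+ q.+1)).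
  apply: lerD; first by move: x Bx; near: e; exact: nu.
  by move: x Bx; near: e; exact: nv.
rewrite -mulr2n exprS -mulrnAl -[leRHS]mul1r; apply: ler_wpM2r.
  by rewrite exprn_ge0 // ltW.
by rewrite -mulr_natl; move: e1; lra.
Unshelve. all: by end_near. Qed.

Lemma nul_sum d m (u : 'I_m -> real_net R d) : (forall j, nul (u j)) ->
  nul (fun e x => \sum_(j < m) u j e x).
Proof.
elim: m u => [|m ih] u nu.
  apply: (@nul_ext _ _ (fun _ _ => 0)); last exact: nul0.
  by move=> e _ x; rewrite big_ord0.
apply: (@nul_ext _ _ (fun e x => \sum_(j < m) u (widen_ord (leqnSn m) j) e x + u ord_max e x)).
  by move=> e _ x; rewrite big_ord_recr.
by apply: nulD => //; apply: ih.
Qed.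

Lemma mode_dnet d al (u : real_net R d) : mode u -> mode (dnet al u).
Proof.
move=> [su mu]; split; first exact: snet_dnet.
move=> be; rewrite (_ : dnet be _ = dnet (be ++ al) u) //.
by apply/funext => e; rewrite /dnet dparts_cat.
Qed.

(* Landau's trick: interpolate u' between u and u'' by Taylor's formula with a step
   which is a large power of eps. *)
Lemma nul_dpart d i (u : real_net R d) : mode u -> nul u -> nul (dnet [:: i] u).
Proof.
move=> [su mu] nu M q.
have [g [N HN] Hg] := mu [:: i; i] (M + 1).
have h0 : (0 : R) < 1 / 3 by lra.
near=> e => x Bx.
have e01 : 0 < e <= 1 by near: e; exact: near01.
have /andP[e0 e3] : 0 < e <= 1 / 3 by near: e; exact: e_small.
(* With the second derivative at most eps^-N, this step makes the Taylor remainder at most eps^(q +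
   1); the values are taken so small that their quotient by h is at most 2 eps^(q + 2). *)
pose h := e ^+ (q + 1 + N).
have hp : 0 < h by rewrite exprn_gt0.
have h1 : h <= 1 by apply: exprn_ile1; [exact: ltW|case/andP: e01].
have sue := su e e01.
have BM1 (t : R) : `|t| <= 1 -> box d (M + 1) (x + t *: delta_mx 0 i).
  by move=> t1; rewrite [x + _]addrC; exact: box_shift.
have Hn : forall y, box d (M + 1) y -> `|u e y| <= e ^+ (q + 2 + (q + 1 + N)).
  by near: e; exact: nu.
have H2 : forall y, box d (M + 1) y -> `|dpart i (dpart i (u e)) y| <= e ^- N.
  move=> y By; apply: (@le_trans _ _ (g e)); first by move: y By; near: e.
  by apply: (le_trans (ler_norm _)); near: e.
have [th /andP[th0 th1] E1] := MVT_line (fun z => rsmooth_derivable sue z i) x h.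
have th1' : `|th * h| <= 1.
  by rewrite ger0_norm ?mulr_ge0 ?(ltW hp) // mulr_ile1 // ltW.
have [th' /andP[th'0 th'1] E2] := MVT_line (fun z => rsmooth_derivable (rsmooth_dpart i sue) z i) x (th * h).
have A1 : `|dpart i (u e) (x + (th * h) *: delta_mx 0 i)| <= 2 * e ^+ (q + 2).
  have : `|h * dpart i (u e) (x + (th * h) *: delta_mx 0 i)| <= 2 * e ^+ (q + 2 + (q + 1 + N)).
    rewrite -E1; apply: (le_trans (ler_normB _ _)); rewrite mulr_natl mulr2n; apply: lerD.
      by apply: Hn; apply: BM1; rewrite gtr0_norm.
    by apply: Hn; have := BM1 0; rewrite scale0r addr0 normr0; apply.
  by rewrite normrM (gtr0_norm hp) exprD mulrA -/h [leRHS]mulrC ler_pM2l.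
have A2 : `|dpart i (u e) (x + (th * h) *: delta_mx 0 i) - dpart i (u e) x| <= e ^+ (q + 1).
  rewrite E2 normrM; apply: (@le_trans _ _ (h * e ^- N)).
    apply: ler_pM => //.
      by rewrite ger0_norm ?mulr_ge0 ?(ltW hp) // ler_piMl // ltW.
    apply: H2; apply: BM1; rewrite ger0_norm ?mulr_ge0 ?(ltW hp) //.
    by rewrite mulr_ile1 // ?mulr_ge0 ?(ltW hp) // mulr_ile1 // ltW.
  by rewrite /h exprD mulfK // expf_neq0 // gt_eqF.
rewrite /dnet /=.
have -> : dpart i (u e) x = dpart i (u e) (x + (th * h) *: delta_mx 0 i) -
   (dpart i (u e) (x + (th * h) *: delta_mx 0 i) - dpart i (u e) x) by rewrite subKr.
apply: (le_trans (ler_normB _ _)); apply: (le_trans (lerD A1 A2)).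
rewrite !exprD expr1 mulrCA -mulrDr -[leRHS]mulr1; apply: ler_wpM2l.
  by rewrite exprn_ge0 // ltW.
by rewrite expr2; move: e0 e3; clear; nra.
Unshelve. all: by end_near. Qed.

Lemma nul_dnet d al (u : real_net R d) : mode u -> nul u -> nul (dnet al u).
Proof.
move=> mu nu; elim: al => //= i al ih.
exact: (@nul_dpart _ i (dnet al u) (mode_dnet al mu) ih).
Qed.

Lemma mode_Sb d (u : real_net R d) : mode u <-> snet u /\ forall al, Sb modscale al u.
Proof. by split=> -[su H]; split=> // al; [move=> be _|apply: (H al)]. Qed.

Lemma mode_ext d (u v : real_net R d) : (forall e, 0 < e <= 1 -> u e = v e) -> mode v -> mode u.
Proof.
move=> uv [sv mv]; split; first by move=> e e01; rewrite uv //; exact: sv.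
by move=> al; apply: Obd_ext (mv al) => e e01; rewrite /dnet uv.
Qed.

Lemma modeD d (u v : real_net R d) : mode u -> mode v -> mode (fun e x => u e x + v e x).
Proof.
move=> /mode_Sb[su Su] /mode_Sb[sv Sv]; apply/mode_Sb; split.
  by move=> e e01; apply: rsmoothD; [exact: su|exact: sv].
by move=> al; exact: SbD.
Qed.

Lemma modeM d (u v : real_net R d) : mode u -> mode v -> mode (fun e x => u e x * v e x).
Proof.
move=> /mode_Sb[su Su] /mode_Sb[sv Sv]; apply/mode_Sb; split.
  by move=> e e01; apply: rsmoothM; [exact: su|exact: sv].
by move=> al; exact: SbM.
Qed.

Lemma mode_cst d (c : R) : mode (fun _ (_ : 'rV[R]_d) => c).
Proof. by apply/mode_Sb; split=> [e _|al]; [exact: rsmooth_cst|exact: Sb_cst]. Qed.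

Lemma modeN d (u : real_net R d) : mode u -> mode (fun e x => - u e x).
Proof.
move=> /mode_Sb[su Su]; apply/mode_Sb; split.
  by move=> e e01; apply: rsmoothN; exact: su.
by move=> al; exact: SbN.
Qed.

Lemma modeB d (u v : real_net R d) : mode u -> mode v -> mode (fun e x => u e x - v e x).
Proof. by move=> mu mv; apply: modeD => //; exact: modeN. Qed.

Lemma nulB d (u v : real_net R d) : nul u -> nul v -> nul (fun e x => u e x - v e x).
Proof. by move=> mu mv; apply: nulD => //; exact: nulN. Qed.

Lemma mode_sum d m (u : 'I_m -> real_net R d) : (forall j, mode (u j)) ->
  mode (fun e x => \sum_(j < m) u j e x).
Proof.
move=> mu; apply/mode_Sb; split.
  by move=> e e01; apply: rsmooth_sum => j; have [su _] := mu j; exact: su.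
by move=> al; apply: Sb_sum => j; have /mode_Sb[su Su] := mu j.
Qed.

Lemma mode_comp d m (f : real_net R m) (G : 'I_m -> real_net R d) : cbd G ->
  mode f -> (forall k, mode (G k)) -> mode (fun e x => f e (\row_k G k e x)).
Proof.
move=> cG [sf mf] mG; apply/mode_Sb; split.
  by apply: snet_comp => // k; have [] := mG k.
by move=> al; apply: Sb_comp => // k; have /mode_Sb[] := mG k.
Qed.

Lemma nul_comp d m (f : real_net R m) (G : 'I_m -> real_net R d) : cbd G ->
  nul f -> nul (fun e x => f e (\row_k G k e x)).
Proof.
move=> cG nf M q; have [M' HM'] := cG M.
near=> e => x Bx.
suff : box m M' (\row_k G k e x) by move: (\row_k _); near: e; exact: nf.
by move=> k; rewrite mxE; move: x Bx k; near: e.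
Unshelve. all: by end_near. Qed.

(** Both arguments stay in one box, where the outer net is Lipschitz with a moderate constant; a
    null difference of the arguments outweighs it. *)
Lemma nul_compB d m (f : real_net R m) (G H : 'I_m -> real_net R d) : cbd G -> cbd H ->
  mode f -> (forall k, nul (fun e x => G k e x - H k e x)) ->
  nul (fun e x => f e (\row_k G k e x) - f e (\row_k H k e x)).
Proof.
move=> cG cH [sf mf] GH M q.
have [M1 HM1] := cG M; have [M2 HM2] := cH M.
pose M' := Num.max M1 M2.
have Hb (j : 'I_m) : exists N : nat, \forall e \near (0 : R)^'+, forall z, box m M' z -> `|dpart j (f e) z| <= e ^- N.
  have [g [N HN] Hg] := mf [:: j] M'; exists N; near=> e => z Bz.
  apply: (@le_trans _ _ (g e)); first by move: z Bz; near: e.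
  by apply: (le_trans (ler_norm _)); near: e.
have [N HN] := choice Hb.
pose NN := (\max_j N j)%N.
have HNN : \forall e \near (0 : R)^'+, forall j z, box m M' z -> `|dpart j (f e) z| <= e ^- NN.
  have K : \forall e \near (0 : R)^'+, forall j z, box m M' z -> `|dpart j (f e) z| <= e ^- (N j).
    exact: near_ord_forall.
  near=> e => j z Bz; apply: (@le_trans _ _ (e ^- (N j))); first by move: j z Bz; near: e.
  apply: ler_expVn; first by near: e; exact: near01.
  exact: leq_bigmax.
have nd : \forall e \near (0 : R)^'+, forall k x, box d M x -> `|G k e x - H k e x| <= e ^+ (q + 1 + NN).
  by apply: near_ord_forall => k; exact: GH.
near=> e => x Bx.
have e01 : 0 < e <= 1 by near: e; exact: near01.
have e0 : 0 < e by case/andP: e01.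
have B1 : box m M' (\row_k G k e x).
  move=> k; rewrite mxE; apply: (@le_trans _ _ M1); last by rewrite le_max lexx.
  by move: x Bx k; near: e.
have B2 : box m M' (\row_k H k e x).
  move=> k; rewrite mxE; apply: (@le_trans _ _ M2); last by rewrite le_max lexx orbT.
  by clear B1; move: x Bx k; near: e.
have L := @box_lipschitz R m (f e) M' (e ^- NN) (sf e e01) (near HNN e _) _ _ B2 B1.
apply: (le_trans (L _)) => //.
have : `|\row_k G k e x - \row_k H k e x| <= e ^+ (q + 1 + NN).
  apply/rV_normP; first by rewrite exprn_ge0 // ltW.
  by move=> k; rewrite !mxE; clear B1 B2 L; move: k x Bx; near: e.
move=> dn; apply: (@le_trans _ _ (m%:R * e ^- NN * e ^+ (q + 1 + NN))).
  by apply: ler_wpM2l => //; rewrite mulr_ge0 // invr_ge0 exprn_ge0 // ltW.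
rewrite exprD -mulrA [e ^- NN * _]mulrC mulfK ?expf_neq0 ?gt_eqF //.
rewrite exprD expr1 mulrCA -[leRHS]mulr1; apply: ler_wpM2l; first by rewrite exprn_ge0 // ltW.
have : m%:R <= e ^- 1 by near: e; exact: cst_le_expV.
rewrite expr1 => me; rewrite -[leRHS](mulVf (lt0r_neq0 e0)).
by apply: ler_wpM2r me; exact: ltW.
Unshelve. all: by end_near. Qed.

End Nets.

(** * Gronwall estimates *)

Section Gronwall.
Variable R : realType.

Lemma is_derive_congr (V : normedModType R) (f : V -> R) (x v : V) (l l' : R) :
  is_derive x v f l -> l = l' -> is_derive x v f l'.
Proof. by move=> H <-. Qed.

(** The product of exp (- c (x - a)) and E + rho is nonincreasing: since c is at least 1, rho is at
    most c rho and the inequality becomes homogeneous in E + rho. *)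
Lemma gronwall_right (E dE : R -> R) (c rho a b : R) : 1 <= c -> 0 <= rho -> a <= b ->
  (forall x : R, is_derive x 1 E (dE x)) ->
  (forall x, a <= x <= b -> dE x <= c * E x + rho) ->
  E b <= expR (c * (b - a)) * (E a + rho).
Proof.
move=> c1 r0 ab HE Hd.
pose F (x : R) := expR (- c * (x - a)) * (E x + rho).
pose dF (x : R) := expR (- c * (x - a)) * (dE x - c * (E x + rho)).
have HF x : is_derive x (1 : R) F (dF x).
  have H1 : is_derive x (1 : R) (fun x => - c * (x - a)) (- c).
    by apply: is_derive_eq; rewrite ?scaler0 ?add0r ?addr0 subr0 [_ *: _]mulr1.
  have H2 := @is_derive_comp1 R R expR (fun x => - c * (x - a)) x 1 _ _ (is_derive_expR _) H1.
  have H3 : is_derive x (1 : R) (fun x => E x + rho) (dE x + 0) by apply: is_deriveD.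
  apply: (is_derive_congr (is_deriveM H2 H3)).
  by rewrite /dF addr0 /GRing.scale /=; ring.
have cF : {within `[a, b], continuous F}.
  by apply: derivable_within_continuous => x _; have [] := HF x.
have [x xab Ex] := MVT_segment ab (fun x _ => HF x) cF.
have : F b <= F a.
  rewrite -subr_le0 Ex; apply: mulr_le0_ge0; last by rewrite subr_ge0.
  apply: mulr_ge0_le0; first exact: expR_ge0.
  rewrite subr_le0; move: xab; rewrite in_itv /= => xab.
  apply: le_trans (Hd x xab) _; rewrite mulrDr lerD2l.
  by rewrite ler_peMl.
rewrite /F subrr mulr0 expR0 mul1r => H.
have e0 := expR_gt0 (c * (b - a)).
rewrite -(ler_pM2l e0) mulrA -expRD in H.
have E0 : c * (b - a) + - c * (b - a) = 0 by ring.
rewrite E0 expR0 mul1r in H.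
by apply: le_trans H; rewrite lerDl.
Qed.

Lemma gronwall (E dE : R -> R) (c rho a b : R) : 1 <= c -> 0 <= rho ->
  (forall x : R, is_derive x 1 E (dE x)) ->
  (forall x, Num.min a b <= x <= Num.max a b -> `|dE x| <= c * E x + rho) ->
  E b <= expR (c * `|b - a|) * (E a + rho).
Proof.
move=> c1 r0 HE Hd; have [ab|ba] := leP a b.
  rewrite ger0_norm ?subr_ge0 //; apply: (gronwall_right (dE := dE)) => // x xab.
  apply: le_trans (ler_norm _) _; apply: Hd.
  by rewrite (min_idPl ab) (max_idPr ab).
have ba' := ltW ba.
(* Reversal of time: the bound on the absolute value of the derivative is symmetric. *)
pose E' x := E (- x).
have HE' (x : R) : is_derive x (1 : R) E' (- dE (- x)).
  have H1 : is_derive x (1 : R) (fun x : R => - x) (- 1).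
    by apply: is_deriveN.
  have := @is_derive_comp1 R R E (fun x : R => - x) x 1 _ _ (HE (- x)) H1.
  by rewrite mulrN1.
have := @gronwall_right E' (fun x => - dE (- x)) c rho (- a) (- b) c1 r0.
rewrite /E' !opprK lerN2 => /(_ ba' HE').
rewrite ler0_norm ?subr_le0 // opprB [- b + a]addrC; apply => x xab.
apply: le_trans (ler_norm _) _; rewrite normrN; apply: Hd.
rewrite (min_idPr ba') (max_idPl ba').
by move: xab => /andP[]; rewrite lerNl => -> ; rewrite lerNr => ->.
Qed.

(** The sum of squares [E] is differentiable where the sum of absolute values S is not. From 2 S^2
    <= 2 N E and 2 u r <= u^2 + r^2 come the constants 2 l N + 1 and N r^2, and the summand 1 is
    what makes the scalar lemma applicable. *)
Lemma gronwall_vec N (y dy : 'I_N -> R -> R) (l r a b : R) : 0 <= l -> 0 <= r ->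
  (forall k (x : R), is_derive x 1 (y k) (dy k x)) ->
  (forall x, Num.min a b <= x <= Num.max a b ->
     forall k, `|dy k x| <= l * (\sum_j `|y j x|) + r) ->
  forall k, (y k b) ^+ 2 <=
    expR ((2 * l * N%:R + 1) * `|b - a|) * (\sum_j (y j a) ^+ 2 + N%:R * r ^+ 2).
Proof.
move=> l0 r0 Hy Hd k.
pose E x := \sum_j (y j x) ^+ 2.
pose dE x := \sum_j (2 * y j x * dy j x).
have HE (x : R) : is_derive x (1 : R) E (dE x).
  have -> : E = \sum_j (fun x => y j x ^+ 2) by apply/funext => z; rewrite fct_sumE.
  apply: is_derive_sum => j.
  have H2 := is_deriveM (Hy j x) (Hy j x).
  have <- : (y j * y j)%R = (fun x => y j x ^+ 2) by apply/funext => z; rewrite expr2.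
  by apply: (is_derive_congr H2); rewrite /GRing.scale /=; ring.
apply: (@le_trans _ _ (E b)).
  by rewrite /E (bigD1 k) //= lerDl sumr_ge0 // => j _; exact: sqr_ge0.
have N0 : (0 : R) <= N%:R by [].
apply: (gronwall (dE := dE)) => //.
- by rewrite lerDr !mulr_ge0.
- by rewrite mulr_ge0 // sqr_ge0.
move=> x xab; set S := \sum_j `|y j x|.
have HdE : `|dE x| <= \sum_j (2 * `|y j x| * (l * S + r)).
  apply: (le_trans (ler_norm_sum _ _ _)); apply: ler_sum => j _.
  rewrite !normrM (ger0_norm (ler0n _ 2)); apply: ler_wpM2l; first by rewrite mulr_ge0.
  exact: Hd.
apply: (le_trans HdE).
have -> : \sum_j (2 * `|y j x| * (l * S + r)) = l * (2 * S * S) + \sum_j (2 * `|y j x| * r).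
  under eq_bigr do rewrite mulrDr.
  rewrite big_split /= -mulr_suml -mulr_sumr -/S; congr (_ + _); ring.
have H1 : 2 * S * S <= 2 * N%:R * E x.
  have -> : 2 * S * S = \sum_i \sum_j (2 * `|y i x| * `|y j x|).
    rewrite -mulrA {1}/S mulr_suml mulr_sumr; apply: eq_bigr => i _.
    by rewrite mulr_sumr mulr_sumr; apply: eq_bigr => j _; rewrite mulrA.
  have -> : 2 * N%:R * E x = \sum_(i < N) \sum_(j < N) (y i x ^+ 2 + y j x ^+ 2).
    under eq_bigr do rewrite big_split /= sumr_const card_ord.
    rewrite big_split /= sumr_const card_ord -sumrMnl.
    under eq_bigr do rewrite -mulr_natl.
    by rewrite -mulr_sumr -/(E x) -mulr_natl; ring.
  apply: ler_sum => i _; apply: ler_sum => j _.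
  rewrite -[y i x ^+ 2]real_normK ?num_real // -[y j x ^+ 2]real_normK ?num_real //.
  by move: `|y i x| `|y j x| => u v; have := sqr_ge0 (u - v); clear; nra.
have H2 : \sum_j (2 * `|y j x| * r) <= E x + N%:R * r ^+ 2.
  have -> : N%:R * r ^+ 2 = \sum_(j < N) r ^+ 2 by rewrite sumr_const card_ord mulr_natl.
  rewrite /E -big_split /=; apply: ler_sum => j _.
  rewrite -[y j x ^+ 2]real_normK ?num_real //.
  by move: `|y j x| => u; have := sqr_ge0 (u - r); clear; nra.
apply: (le_trans (lerD (ler_wpM2l l0 H1) H2)).
have -> : l * (2 * N%:R * E x) + (E x + N%:R * r ^+ 2) = (2 * l * N%:R + 1) * E x + N%:R * r ^+ 2 by ring.
exact: lexx.
Qed.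

(** Replacing the s coordinate is written as a displacement along the s axis, so that the curve is a
    straight line and its derivative is a directional one. *)
Definition sets n (z : 'rV[R]_(n + (1 + 1))) (s : R) : 'rV[R]_(n + (1 + 1)) :=
  z + (s - z 0 (idx_s n)) *: delta_mx 0 (idx_s n).

Lemma setsE n (z : 'rV[R]_(n + (1 + 1))) s k :
  sets z s 0 k = if k == idx_s n then s else z 0 k.
Proof.
rewrite !mxE eqxx /=; case: eqP => [->|_]; last by rewrite mulr0 addr0.
by rewrite mulr1 addrC subrK.
Qed.

Lemma sets_id n (z : 'rV[R]_(n + (1 + 1))) : sets z (z 0 (idx_s n)) = z.
Proof. by rewrite /sets subrr scale0r addr0. Qed.

Lemma box_sets n M (z : 'rV[R]_(n + (1 + 1))) s : box _ M z -> `|s| <= M -> box _ M (sets z s).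
Proof. by move=> Bz Bs k; rewrite setsE; case: eqP. Qed.

Lemma gronwall_box n N (Y : 'I_N -> 'rV[R]_(n + (1 + 1)) -> R) (M l r : R) :
  (forall k, rsmooth (Y k)) -> 0 <= l -> 0 <= r ->
  (forall z, box _ M z -> forall k, `|dpart (idx_s n) (Y k) z| <= l * (\sum_j `|Y j z|) + r) ->
  forall z s, box _ M z -> `|s| <= M -> forall k, (Y k z) ^+ 2 <=
    expR ((2 * l * N%:R + 1) * (2 * M)) * (\sum_j (Y j (sets z s)) ^+ 2 + N%:R * r ^+ 2).
Proof.
move=> sY l0 r0 Hd z s Bz Bs k.
pose y j (u : R) := Y j (sets z u).
have Hy j (u : R) : is_derive u (1 : R) (y j) (dpart (idx_s n) (Y j) (sets z u)).
  pose z0 := z - z 0 (idx_s n) *: delta_mx 0 (idx_s n).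
  have E v : sets z v = z0 + v *: delta_mx 0 (idx_s n).
    by rewrite /sets /z0 scalerBl addrCA addrC.
  have -> : y j = fun v => Y j (z0 + v *: delta_mx 0 (idx_s n)).
    by apply/funext => v; rewrite /y E.
  by rewrite E; apply: is_derive_line; exact: rsmooth_derivable.
have Bzs := Bz (idx_s n).
have := @gronwall_vec N y _ l r s (z 0 (idx_s n)) l0 r0 Hy _ k.
rewrite /y sets_id => H; apply: le_trans (H _) _.
  move=> u /andP[u1 u2] j; apply: Hd; apply: box_sets => //.
  move: Bs Bzs; rewrite !ler_norml => /andP[a1 a2] /andP[b1 b2].
  apply/andP; split; first by apply: le_trans u1; rewrite le_min a1.
  by apply: (le_trans u2); rewrite ge_max a2.
apply: ler_wpM2r.
  by rewrite addr_ge0 ?mulr_ge0 ?sqr_ge0 // sumr_ge0 // => j _; exact: sqr_ge0.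
(* Both endpoints lie in [-M, M], so the length of the interval is at most 2 M. *)
rewrite ler_expR; apply: ler_wpM2l; first by rewrite addr_ge0 // !mulr_ge0.
apply: (le_trans (ler_normB _ _)); rewrite mulr_natl mulr2n; exact: lerD.
Qed.

(* This is what Gronwall's inequality requires of its linear coefficient. *)
Definition logb (P : scale R) (l : R -> R) :=
  (forall e, 0 <= l e) /\ forall c, 0 <= c -> P (fun e => expR (c * l e)).

Lemma bound_sum (P : scale R) m (g : 'I_m -> R -> R) : (forall j, P (g j)) ->
  P (fun e => \sum_(j < m) g j e).
Proof.
elim: m g => [|m ih] g Pg.
  by apply: (bound_le (bound_cst P 0)); apply: nearW => e; rewrite big_ord0.
have := boundD (ih (fun j => g (widen_ord (leqnSn m) j)) (fun j => Pg _)) (Pg ord_max).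
by move=> H; apply: (bound_le H); apply: nearW => e; rewrite big_ord_recr.
Qed.

(** Turns the bounds on squares given by Gronwall into bounds on absolute values without a square
    root. *)
Lemma le_1Dsqr (u : R) : u <= 1 + u ^+ 2.
Proof. by have := sqr_ge0 (u - 1); have := sqr_ge0 u; nra. Qed.

Section GronwallNets.
Variables (n N : nat) (Y : 'I_N -> real_net R (n + (1 + 1))).
(** The value of s at which data are known. It depends on the point: s = t for quantities built from
    gamma, s = 0 for solutions of the Cauchy problem. *)
Variable s1 : 'rV[R]_(n + (1 + 1)) -> R.
Hypothesis sY : forall k, snet (Y k).
Hypothesis Bs1 : forall M z, box _ M z -> `|s1 z| <= M.

Let gexp (l : R -> R) (M : R) (e : R) : R := expR ((2 * l e * N%:R + 1) * (2 * `|M|)).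

Let bound_gexp (P : scale R) l M : logb P l -> P (gexp l M).
Proof.
move=> [l0 Hl].
have H : 0 <= 4 * N%:R * `|M| -> P (fun e => expR (4 * N%:R * `|M| * l e) * expR (2 * `|M|)).
  by move=> c0; apply: (boundM (Hl _ c0) (bound_cst P (expR (2 * `|M|)))).
apply: (bound_le (H _)); first by rewrite !mulr_ge0.
apply: nearW => e; rewrite -expRD /gexp.
by have -> : (2 * l e * N%:R + 1) * (2 * `|M|) = 4 * N%:R * `|M| * l e + 2 * `|M| by ring.
Qed.

Let gronwall_near M (l r D : R -> R) : (forall e, 0 <= l e) ->
  (\forall e \near 0^'+, 0 <= r e /\ forall z, box _ M z ->
     forall k, `|dnet [:: idx_s n] (Y k) e z| <= l e * (\sum_j `|Y j e z|) + r e) ->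
  (\forall e \near 0^'+, forall k z, box _ M z -> `|Y k e (sets z (s1 z))| <= D e) ->
  \forall e \near 0^'+, forall k z, box _ M z ->
    (Y k e z) ^+ 2 <= gexp l M e * (N%:R * D e ^+ 2 + N%:R * r e ^+ 2).
Proof.
move=> l0 HY HD; near=> e => k z Bz.
have e01 : 0 < e <= 1 by near: e; exact: near01.
have [re He] : 0 <= r e /\ forall z, box _ M z ->
     forall k, `|dnet [:: idx_s n] (Y k) e z| <= l e * (\sum_j `|Y j e z|) + r e by near: e.
have De : forall k z, box _ M z -> `|Y k e (sets z (s1 z))| <= D e by near: e.
have M0 : 0 <= M by apply: le_trans (Bz (idx_s n)).
have G := gronwall_box (fun k => sY k e01) (l0 e) re He Bz (Bs1 Bz) k.
rewrite /gexp (ger0_norm M0); apply: (le_trans G).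
apply: ler_wpM2l; first exact: expR_ge0.
rewrite lerD2r; apply: (@le_trans _ _ (\sum_(j < N) D e ^+ 2)).
  apply: ler_sum => j _; rewrite -[leLHS]real_normK ?num_real //.
  have Dj := De j z Bz.
  by rewrite ler_pXn2r ?nnegrE //; apply: le_trans Dj.
by rewrite sumr_const card_ord mulr_natl.
Unshelve. all: by end_near. Qed.

Lemma gronwall_Obd (P : scale R) :
  (forall M, exists l r, [/\ logb P l, P r & \forall e \near 0^'+, 0 <= r e /\ forall z, box _ M z ->
     forall k, `|dnet [:: idx_s n] (Y k) e z| <= l e * (\sum_j `|Y j e z|) + r e]) ->
  (forall M, exists2 D, P D & \forall e \near 0^'+, forall k z, box _ M z ->
     `|Y k e (sets z (s1 z))| <= D e) ->
  forall k, Obd P (Y k).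
Proof.
move=> HY HD k M.
have [l [r [Pl Pr Hlr]]] := HY M.
have [D PD HDM] := HD M.
have G := gronwall_near Pl.1 Hlr HDM.
have sq g : P g -> P (fun e => N%:R * g e ^+ 2).
  move=> Pg; have H := boundM (bound_cst P N%:R) (boundM Pg Pg).
  by apply: (bound_le H); apply: nearW => e; rewrite expr2.
have PB := boundD (bound_cst P 1) (boundM (bound_gexp M Pl) (boundD (sq _ PD) (sq _ Pr))).
exists (fun e => 1 + gexp l M e * (N%:R * D e ^+ 2 + N%:R * r e ^+ 2)) => //.
apply: filterS G => e H x Bx; apply: (@le_trans _ _ (1 + (Y k e x) ^+ 2)).
  rewrite -[_ ^+ 2]real_normK ?num_real //.
  exact: le_1Dsqr.
by rewrite lerD2l; exact: H.
Qed.

Lemma gronwall_nul (rho : 'I_N -> real_net R (n + (1 + 1))) :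
  (forall k, nul (rho k)) ->
  (forall M, exists2 l, logb (modscale R) l & \forall e \near 0^'+, forall z, box _ M z ->
     forall k, `|dnet [:: idx_s n] (Y k) e z| <= l e * (\sum_j `|Y j e z|) + `|rho k e z|) ->
  (forall M q, \forall e \near 0^'+, forall k z, box _ M z ->
     `|Y k e (sets z (s1 z))| <= e ^+ q) ->
  forall k, nul (Y k).
Proof.
move=> nr HY HD k M q.
have [l Pl Hl] := HY M.
have [K HK] := bound_gexp M Pl.
(* The Gronwall factor costs eps^-K and the constant 2 N costs 1/eps; as squares are estimated, data
   of order Q leave eps^(2q) with eps^(K + 1) to spare. *)
pose Q := (q + K + 1)%N.
have G : \forall e \near 0^'+, forall k z, box _ M z ->
    (Y k e z) ^+ 2 <= gexp l M e * (N%:R * (e ^+ Q) ^+ 2 + N%:R * (e ^+ Q) ^+ 2).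
  have nr' : \forall e \near (0 : R)^'+, forall k z, box _ M z -> `|rho k e z| <= e ^+ Q.
    by apply: near_ord_forall => j; exact: nr.
  apply: (gronwall_near (r := fun e => e ^+ Q) (D := fun e => e ^+ Q) Pl.1) => //.
  near=> e; split.
    by have /andP[e0 _] : 0 < e <= 1 by [near: e; exact: near01]; rewrite exprn_ge0 // ltW.
  move=> z Bz j; apply: (@le_trans _ _ (l e * (\sum_j0 `|Y j0 e z|) + `|rho j e z|)).
    by move: z Bz j; near: e.
  by rewrite lerD2l; move: j z Bz; near: e.
near=> e => x Bx.
have e01 : 0 < e <= 1 by near: e; exact: near01.
have e0 : 0 < e by case/andP: e01.
have H : (Y k e x) ^+ 2 <= gexp l M e * (N%:R * (e ^+ Q) ^+ 2 + N%:R * (e ^+ Q) ^+ 2).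
  by move: (k) x Bx; near: e.
have eq0 : 0 <= e ^+ q by rewrite exprn_ge0 // ltW.
rewrite -(@ler_pXn2r _ 2) ?nnegrE // real_normK ?num_real //.
apply: (le_trans H).
have gK : gexp l M e <= e ^- K by apply: (le_trans (ler_norm _)); near: e.
have N2 : 2 * N%:R <= e ^- 1 by near: e; exact: cst_le_expV.
have -> : N%:R * (e ^+ Q) ^+ 2 + N%:R * (e ^+ Q) ^+ 2 = (2 * N%:R) * (e ^+ Q) ^+ 2 by ring.
apply: (@le_trans _ _ (e ^- K * (e ^- 1 * (e ^+ Q) ^+ 2))).
  apply: ler_pM => //.
  - exact: expR_ge0.
  - by rewrite mulr_ge0 ?sqr_ge0 // mulr_ge0.
  - by apply: ler_wpM2r => //; exact: sqr_ge0.
have eK : e ^+ K != 0 by rewrite expf_neq0 // gt_eqF.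
have en : e != 0 by rewrite gt_eqF.
have -> : e ^- K * (e ^- 1 * (e ^+ Q) ^+ 2) = (e ^+ q) ^+ 2 * e ^+ (K + 1).
  rewrite /Q !exprD expr1; field; by rewrite en eK.
rewrite -[leRHS]mulr1; apply: ler_wpM2l; first exact: sqr_ge0.
by apply: exprn_ile1; [exact: ltW|case/andP: e01].
Unshelve. all: by end_near. Qed.

End GronwallNets.

End Gronwall.

(** * The characteristic flow *)

Section Coordinates.
Variable R : realType.
Variable n : nat.

Definition ix (j : 'I_n) : 'I_(n + (1 + 1)) := lshift (1 + 1) j.
Definition it : 'I_(n + (1 + 1)) := rshift n (lshift 1 ord0).
Local Notation iis := (idx_s n).
Local Notation rnet := (real_net R).

Lemma tx_t (t : R) (x : 'rV[R]_n) : tx t x 0 (idx_t n) = t.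
Proof. by rewrite /tx /idx_t row_mxEl mxE eqxx mulr1n. Qed.

Lemma tx_x (t : R) (x : 'rV[R]_n) h : tx t x 0 (idx_x h) = x 0 h.
Proof. by rewrite /tx /idx_x row_mxEr. Qed.

Lemma xts_x (x : 'rV[R]_n) (t s : R) j : xts x t s 0 (ix j) = x 0 j.
Proof. by rewrite /xts /ix row_mxEl. Qed.

Lemma xts_t (x : 'rV[R]_n) (t s : R) : xts x t s 0 it = t.
Proof. by rewrite /xts /it row_mxEr row_mxEl mxE eqxx mulr1n. Qed.

Lemma xts_s (x : 'rV[R]_n) (t s : R) : xts x t s 0 iis = s.
Proof. by rewrite /xts /idx_s row_mxEr row_mxEr mxE eqxx mulr1n. Qed.

Lemma tx_ind (Q : 'I_(1 + n) -> Prop) : Q (idx_t n) -> (forall h, Q (idx_x h)) -> forall k, Q k.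
Proof.
move=> Qt Qx k; case: (fintype.splitP k) => j Ej.
  by have -> : k = idx_t n by apply/val_inj; rewrite /= Ej (ord1 j).
by have -> : k = idx_x j by apply/val_inj.
Qed.

Lemma xts_ind (Q : 'I_(n + (1 + 1)) -> Prop) : (forall j, Q (ix j)) -> Q it -> Q iis ->
  forall k, Q k.
Proof.
move=> Qx Qt Qs k; case: (fintype.splitP k) => j Ej.
  by have -> : k = ix j by apply/val_inj.
case: (@fintype.splitP 1 1 j) => l El.
  by have -> : k = it by apply/val_inj; rewrite /= Ej El (ord1 l).
by have -> : k = iis by apply/val_inj; rewrite /= Ej El (ord1 l).
Qed.

Lemma sum_tx (F : 'I_(1 + n) -> R) : \sum_k F k = F (idx_t n) + \sum_h F (idx_x h).
Proof. by rewrite big_split_ord /= big_ord1. Qed.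

Lemma sum_xts (F : 'I_(n + (1 + 1)) -> R) :
  \sum_k F k = \sum_j F (ix j) + F it + F iis.
Proof. by rewrite big_split_ord /= big_split_ord /= !big_ord1 addrA. Qed.

Lemma eq_ix_ix j k : (ix j == ix k) = (j == k). Proof. exact: (inj_eq (@lshift_inj _ _)). Qed.
Lemma eq_ix_it j : (ix j == it) = false. Proof. exact: eq_lrshift. Qed.
Lemma eq_ix_iis j : (ix j == iis) = false. Proof. exact: eq_lrshift. Qed.
Lemma eq_it_ix j : (it == ix j) = false. Proof. exact: eq_rlshift. Qed.
Lemma eq_iis_ix j : (iis == ix j) = false. Proof. exact: eq_rlshift. Qed.
Lemma eq_it_iis : (it == iis) = false.
Proof. by rewrite /it /idx_s (inj_eq (@rshift_inj _ _)). Qed.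
Lemma eq_iis_it : (iis == it) = false. Proof. by rewrite eq_sym eq_it_iis. Qed.
Lemma eq_xx j k : (idx_x j == idx_x k :> 'I_(1 + n)) = (j == k).
Proof. exact: (inj_eq (@rshift_inj _ _)). Qed.
Lemma eq_xt j : (idx_x j == idx_t n) = false. Proof. exact: eq_rlshift. Qed.
Lemma eq_tx j : (idx_t n == idx_x j) = false. Proof. exact: eq_lrshift. Qed.

Definition eq_idx := (eq_ix_ix, eq_ix_it, eq_ix_iis, eq_it_ix, eq_iis_ix, eq_it_iis, eq_iis_it,
  eq_xx, eq_xt, eq_tx).

Lemma mode_coord d (k : 'I_d) : mode (fun (_ : R) (z : 'rV[R]_d) => z 0 k).
Proof.
split; first by move=> e _; exact: rsmooth_coord.
elim/last_ind => [|al i _]; last first.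
  rewrite (_ : dnet _ _ = dnet al (fun _ _ => (k == i)%:R)); first exact: (mode_cst _ _).2.
  by apply/funext => e; rewrite /dnet dparts_rcons dpart_coord.
by move=> M; exists (fun=> M); [exact: bound_cst|apply: nearW => e x; exact].
Qed.

(** The embedding s = t, where gamma equals x up to a null net; [zero_s] below is the slice s = 0 on
    which solutions are read off. *)
Definition diag (y : 'rV[R]_(1 + n)) : 'rV[R]_(n + (1 + 1)) :=
  xts (rsubmx y) (y 0 (idx_t n)) (y 0 (idx_t n)).
Definition zero_s (y : 'rV[R]_(1 + n)) : 'rV[R]_(n + (1 + 1)) :=
  xts (rsubmx y) (y 0 (idx_t n)) 0.
Definition proj_tx (z : 'rV[R]_(n + (1 + 1))) : 'rV[R]_(1 + n) := tx (z 0 it) (lsubmx z).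

Lemma diag_x y j : diag y 0 (ix j) = y 0 (idx_x j). Proof. by rewrite xts_x mxE. Qed.
Lemma diag_t y : diag y 0 it = y 0 (idx_t n). Proof. exact: xts_t. Qed.
Lemma diag_s y : diag y 0 iis = y 0 (idx_t n). Proof. exact: xts_s. Qed.
Lemma zero_s_x y j : zero_s y 0 (ix j) = y 0 (idx_x j). Proof. by rewrite xts_x mxE. Qed.
Lemma zero_s_t y : zero_s y 0 it = y 0 (idx_t n). Proof. exact: xts_t. Qed.
Lemma zero_s_s y : zero_s y 0 iis = 0. Proof. exact: xts_s. Qed.
Lemma proj_tx_t z : proj_tx z 0 (idx_t n) = z 0 it. Proof. exact: tx_t. Qed.
Lemma proj_tx_x z j : proj_tx z 0 (idx_x j) = z 0 (ix j). Proof. by rewrite tx_x mxE. Qed.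

Lemma box_diag M y : box _ M y -> box _ M (diag y).
Proof. by move=> By; apply: xts_ind => [j||]; rewrite ?xts_x ?xts_t ?xts_s ?mxE; exact: By. Qed.

Lemma box_zero_s M y : box _ M y -> box _ M (zero_s y).
Proof.
move=> By; apply: xts_ind => [j||]; rewrite ?xts_x ?xts_t ?xts_s ?mxE; try exact: By.
by rewrite normr0; apply: le_trans (By (idx_t n)).
Qed.

Lemma box_proj_tx M z : box _ M z -> box _ M (proj_tx z).
Proof. by move=> By; apply: tx_ind => [|j]; rewrite ?tx_x ?tx_t ?mxE; exact: By. Qed.

Lemma sets_t z : sets z (z 0 it) = diag (proj_tx z).
Proof.
apply/rowP; apply: xts_ind => [j||]; rewrite setsE ?diag_x ?diag_t ?diag_s ?proj_tx_t ?proj_tx_x.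
- by rewrite eq_ix_iis.
- by rewrite eq_it_iis.
- by rewrite eqxx.
Qed.

Lemma sets_0 z : sets z 0 = zero_s (proj_tx z).
Proof.
apply/rowP; apply: xts_ind => [j||]; rewrite setsE ?zero_s_x ?zero_s_t ?zero_s_s ?proj_tx_t ?proj_tx_x.
- by rewrite eq_ix_iis.
- by rewrite eq_it_iis.
- by rewrite eqxx.
Qed.

Lemma proj_tx_diag y : proj_tx (diag y) = y.
Proof.
by apply/rowP; apply: tx_ind => [|h]; rewrite ?proj_tx_t ?proj_tx_x ?diag_t ?diag_x.
Qed.

Definition pull d m (io : 'rV[R]_d -> 'rV[R]_m) (f : rnet m) : rnet d := fun e x => f e (io x).

Section Pull.
Variables (d m : nat) (io : 'rV[R]_d -> 'rV[R]_m).
Hypothesis mio : forall k, mode (fun (_ : R) x => io x 0 k).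
Hypothesis Bio : forall M : R, exists M' : R, forall x, box _ M x -> box _ M' (io x).

Let rowio x : \row_k io x 0 k = io x. Proof. by apply/rowP => k; rewrite mxE. Qed.

Let cbd_io : cbd (fun k (_ : R) x => io x 0 k).
Proof.
move=> M; have [M' HM'] := Bio M; exists M'; apply: nearW => e x Bx k; exact: HM'.
Qed.

Lemma pull_mode f : mode f -> mode (pull io f).
Proof.
move=> mf; have := mode_comp cbd_io mf mio; apply: mode_ext => e _.
by apply/funext => x; rewrite /pull rowio.
Qed.

Lemma pull_snet f : snet f -> snet (pull io f).
Proof.
move=> mf; have := snet_comp mf (fun k => (mio k).1); rewrite /snet => H e e01.
by have := H e e01; congr rsmooth; apply/funext => x; rewrite /pull rowio.
Qed.

Lemma pull_nul f : nul f -> nul (pull io f).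
Proof.
move=> mf; have := nul_comp cbd_io mf; apply: nul_ext => e _ x.
by rewrite /pull rowio.
Qed.

Lemma dpart_pull f i e x : 0 < e <= 1 -> snet f ->
  dnet [:: i] (pull io f) e x =
  \sum_k dpart i (fun x => io x 0 k) x * dnet [:: k] f e (io x).
Proof.
move=> e01 sf; rewrite /dnet /= /pull.
rewrite -[in RHS](rowio x) -(dpart_comp i x (sf e e01) (fun k => (mio k).1 e e01)).
by congr (dpart i _ x); apply/funext => y; rewrite rowio.
Qed.

End Pull.

Let mode_eq d (u v : rnet d) : (forall e x, u e x = v e x) -> mode v -> mode u.
Proof. by move=> uv; apply: mode_ext => e _; apply/funext. Qed.

Lemma mode_diag k : mode (fun (_ : R) y => diag y 0 k).
Proof.
move: k; apply: xts_ind => [j||].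
- by apply: mode_eq (mode_coord (idx_x j)) => e x; rewrite diag_x.
- by apply: mode_eq (mode_coord (idx_t n)) => e x; rewrite diag_t.
- by apply: mode_eq (mode_coord (idx_t n)) => e x; rewrite diag_s.
Qed.

Lemma mode_zero_s k : mode (fun (_ : R) y => zero_s y 0 k).
Proof.
move: k; apply: xts_ind => [j||].
- by apply: mode_eq (mode_coord (idx_x j)) => e x; rewrite zero_s_x.
- by apply: mode_eq (mode_coord (idx_t n)) => e x; rewrite zero_s_t.
- by apply: mode_eq (@mode_cst _ _ 0) => e x; rewrite zero_s_s.
Qed.

Lemma mode_proj_tx k : mode (fun (_ : R) z => proj_tx z 0 k).
Proof.
move: k; apply: tx_ind => [|h].
- by apply: mode_eq (mode_coord it) => e x; rewrite proj_tx_t.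
- by apply: mode_eq (mode_coord (ix h)) => e x; rewrite proj_tx_x.
Qed.

Lemma dpart_diag_t (f : rnet (n + (1 + 1))) e y : 0 < e <= 1 -> snet f ->
  dnet [:: idx_t n] (pull diag f) e y = dnet [:: it] f e (diag y) + dnet [:: iis] f e (diag y).
Proof.
move=> e01 sf; rewrite (dpart_pull mode_diag) // sum_xts big1 ?add0r.
  have E1 : (fun x => diag x 0 it) = (fun y => y 0 (idx_t n)) by apply/funext => x; rewrite xts_t.
  have E2 : (fun x => diag x 0 iis) = (fun y => y 0 (idx_t n)) by apply/funext => x; rewrite xts_s.
  by rewrite E1 E2 dpart_coord eqxx !mul1r.
move=> j _; have -> : (fun x => diag x 0 (ix j)) = (fun y => y 0 (idx_x j)).
  by apply/funext => x; rewrite xts_x mxE.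
by rewrite dpart_coord eq_idx mul0r.
Qed.

Lemma dpart_diag_x (f : rnet (n + (1 + 1))) j e y : 0 < e <= 1 -> snet f ->
  dnet [:: idx_x j] (pull diag f) e y = dnet [:: ix j] f e (diag y).
Proof.
move=> e01 sf; rewrite (dpart_pull mode_diag) // sum_xts.
have E1 : (fun x => diag x 0 it) = (fun y => y 0 (idx_t n)) by apply/funext => x; rewrite xts_t.
have E2 : (fun x => diag x 0 iis) = (fun y => y 0 (idx_t n)) by apply/funext => x; rewrite xts_s.
rewrite E1 E2 dpart_coord eq_idx !mul0r !addr0.
have E3 k : (fun x => diag x 0 (ix k)) = (fun y => y 0 (idx_x k)).
  by apply/funext => x; rewrite xts_x mxE.
rewrite (bigD1 j) //= E3 dpart_coord eqxx mul1r big1 ?addr0 // => k kj.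
by rewrite E3 dpart_coord eq_idx (negbTE kj) mul0r.
Qed.

(** The direction in (x, t, s) into which [zero_s] carries the k-th direction of (t, x). For [diag]
    the same renaming is valid in the x directions only, since t moves two coordinates there. *)
Definition si (k : 'I_(1 + n)) : 'I_(n + (1 + 1)) :=
  match fintype.split k with inl _ => it | inr j => ix j end.

Lemma si_t : si (idx_t n) = it.
Proof. by rewrite /si /idx_t (unsplitK (inl _)). Qed.

Lemma si_x j : si (idx_x j) = ix j.
Proof. by rewrite /si /idx_x (unsplitK (inr _)). Qed.

Lemma zero_s_shift k (y : 'rV[R]_(1 + n)) (h : R) :
  zero_s (h *: delta_mx 0 k + y) = h *: delta_mx 0 (si k) + zero_s y.
Proof.
apply/rowP; move: k; apply: tx_ind => [|h0]; apply: xts_ind => [j||];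
  by rewrite ?si_t ?si_x [RHS]mxE [X in _ = X + _]mxE [X in _ = _ * X + _]mxE
    ?xts_x ?xts_t ?xts_s ?[LHS]mxE ?mxE ?eq_idx ?eqxx /= ?mulr0 ?add0r // !mxE ?eq_idx ?eqxx ?mulr0 ?add0r.
Qed.

Lemma dnet_zero_s (f : rnet (n + (1 + 1))) al e : 0 < e <= 1 -> snet f ->
  dnet al (pull zero_s f) e = fun y => dnet (map si al) f e (zero_s y).
Proof.
move=> e01 sf; rewrite /dnet.
rewrite (_ : pull zero_s f e = f e \o zero_s) //.
rewrite (dparts_precomp (si := si)) //; first exact: sf.
by move=> i _ x h; exact: zero_s_shift.
Qed.

Lemma dpart_proj_s (f : rnet (1 + n)) e z : 0 < e <= 1 -> snet f ->
  dnet [:: iis] (pull proj_tx f) e z = 0.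
Proof.
move=> e01 sf; rewrite (dpart_pull mode_proj_tx) // big1 //; apply: tx_ind => [|j] _.
  have -> : (fun x => proj_tx x 0 (idx_t n)) = (fun z => z 0 it) by apply/funext => x; rewrite tx_t.
  by rewrite dpart_coord eq_idx mul0r.
have -> : (fun x => proj_tx x 0 (idx_x j)) = (fun z => z 0 (ix j)) by apply/funext => x; rewrite tx_x mxE.
by rewrite dpart_coord eq_idx mul0r.
Qed.

Section AlongFlow.
Variable g : 'I_n -> rnet (n + (1 + 1)).
Hypothesis mg : forall h, mode (g h).
Hypothesis cg : cbd g.

(** The point (s, gamma) at which the coefficients are evaluated, split into coordinates so that the
    composition lemmas apply. *)
Definition flow : 'I_(1 + n) -> rnet (n + (1 + 1)) :=
  fun k e z => tx (z 0 iis) (\row_h g h e z) 0 k.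

Lemma flow_t : flow (idx_t n) = fun _ z => z 0 iis.
Proof. by apply/funext => e; apply/funext => z; rewrite /flow tx_t. Qed.

Lemma flow_x h : flow (idx_x h) = g h.
Proof. by apply/funext => e; apply/funext => z; rewrite /flow tx_x mxE. Qed.

Lemma mode_flow k : mode (flow k).
Proof.
by move: k; apply: tx_ind => [|h]; rewrite ?flow_t ?flow_x //; exact: mode_coord.
Qed.

Lemma cbd_flow : cbd flow.
Proof.
move=> M; have [M' HM'] := cg M; exists (Num.max M M'); apply: filterS HM' => e H x Bx.
apply: tx_ind => [|h]; rewrite ?flow_t ?flow_x le_max.
  by rewrite Bx.
by rewrite H ?orbT.
Qed.

Definition along (f : rnet (1 + n)) : rnet (n + (1 + 1)) :=
  fun e z => f e (tx (z 0 iis) (\row_h g h e z)).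

Lemma alongE f e z : along f e z = f e (\row_k flow k e z).
Proof. by congr (f e _); apply/rowP => k; rewrite [RHS]mxE. Qed.

Lemma along_mode f : mode f -> mode (along f).
Proof.
move=> mf; have := mode_comp cbd_flow mf mode_flow; apply: mode_ext => e _.
by apply/funext => x; rewrite alongE.
Qed.

Lemma along_snet f : snet f -> snet (along f).
Proof.
move=> sf e e01; have := snet_comp sf (fun k => (mode_flow k).1) e01.
by congr rsmooth; apply/funext => x; rewrite alongE.
Qed.

Lemma along_nul f : nul f -> nul (along f).
Proof.
move=> mf; have := nul_comp cbd_flow mf; apply: nul_ext => e _ x.
by rewrite alongE.
Qed.

(** The time coordinate of the flow is s, hence the time derivative of f occurs only when
    differentiating in s. *)
Lemma dpart_along f i e z : 0 < e <= 1 -> snet f ->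
  dnet [:: i] (along f) e z =
  (iis == i)%:R * along (dnet [:: idx_t n] f) e z +
  \sum_h dnet [:: i] (g h) e z * along (dnet [:: idx_x h] f) e z.
Proof.
move=> e01 sf; rewrite {1}/dnet /=.
have -> : along f e = fun z => f e (\row_k flow k e z) by apply/funext => x; rewrite alongE.
rewrite (dpart_comp i z (sf e e01) (fun k => (mode_flow k).1 e e01)).
rewrite sum_tx flow_t dpart_coord !alongE; congr (_ + _).
by apply: eq_bigr => h _; rewrite flow_x alongE.
Qed.

End AlongFlow.

End Coordinates.

Section Derivations.
Variable R : realType.

Lemma dpartD d (f g : 'rV[R]_d -> R) i x : rsmooth f -> rsmooth g ->
  dpart i (fun x => f x + g x) x = dpart i f x + dpart i g x.
Proof. by move=> sf sg; rewrite /dpart deriveD //; exact: rsmooth_derivable. Qed.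

Lemma dpartN d (f : 'rV[R]_d -> R) i x : rsmooth f ->
  dpart i (fun x => - f x) x = - dpart i f x.
Proof. by move=> sf; rewrite /dpart deriveN //; exact: rsmooth_derivable. Qed.

Lemma dpartB d (f g : 'rV[R]_d -> R) i x : rsmooth f -> rsmooth g ->
  dpart i (fun x => f x - g x) x = dpart i f x - dpart i g x.
Proof. by move=> sf sg; rewrite (dpartD i x sf (rsmoothN sg)) dpartN. Qed.

Lemma dpart_sum d m (f : 'I_m -> 'rV[R]_d -> R) i x : (forall j, rsmooth (f j)) ->
  dpart i (fun x => \sum_(j < m) f j x) x = \sum_(j < m) dpart i (f j) x.
Proof.
elim: m f => [|m ih] f sf.
  rewrite big_ord0 (_ : (fun x => _) = fun=> 0) ?dpart_cst //.
  by apply/funext => y; rewrite big_ord0.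
rewrite big_ord_recr /= -ih // -dpartD //; last by apply: rsmooth_sum.
by congr (dpart i _ x); apply/funext => y; rewrite big_ord_recr.
Qed.

Lemma dpart_mul d (f g : 'rV[R]_d -> R) i x : rsmooth f -> rsmooth g ->
  dpart i (fun x => f x * g x) x = dpart i f x * g x + f x * dpart i g x.
Proof. by move=> sf sg; rewrite dpartM //; exact: rsmooth_derivable. Qed.

End Derivations.

(** * Transport operator, linearised characteristic equation and uniqueness *)

Section Flow.
Variable R : realType.
Variable n : nat.
Local Notation iis := (idx_s n).
Local Notation iit := (it n).
Local Notation rnet := (real_net R).
Variable A : 'I_n -> rnet (1 + n).
Variable g : 'I_n -> rnet (n + (1 + 1)).
Hypothesis mA : forall j, mode (A j).
Hypothesis mg : forall h, mode (g h).
Hypothesis cg : cbd g.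

(** Defect of the characteristic equation on representatives; it is null, not zero, and has to be
    carried through every computation. *)
Let rho h : rnet (n + (1 + 1)) := fun e z => dnet [:: iis] (g h) e z + along g (A h) e z.

Hypothesis F1 : forall h, nul (rho h).
Hypothesis F2 : forall h, nul (fun e y => pull (@diag R n) (g h) e y - y 0 (idx_x h)).

Definition logbound (P : scale R) m (f : rnet m) := forall M, exists2 l, logb P l &
  \forall e \near 0^'+, forall y, box _ M y -> `|f e y| <= l e.

Hypothesis HL : forall j k, logbound (modscale R) (dnet [:: idx_x k] (A j)).

(* The transport operator d_t - sum_j A_j d_j, acting on functions of (x, t, s) and,
   as [Xop], on functions of (t, x). *)
Definition Xs (f : rnet (n + (1 + 1))) : rnet (n + (1 + 1)) := fun e z =>
  dnet [:: iit] f e z - \sum_j pull (@proj_tx R n) (A j) e z * dnet [:: ix j] f e z.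

Definition Xop (f : rnet (1 + n)) : rnet (1 + n) := fun e y =>
  dnet [:: idx_t n] f e y - \sum_j A j e y * dnet [:: idx_x j] f e y.

Let Z h := Xs (g h).

Let Bproj (M : R) : exists M' : R, forall x, box _ M x -> box _ M' (@proj_tx R n x).
Proof. by exists M => x; exact: box_proj_tx. Qed.
Let Bdiag (M : R) : exists M' : R, forall x, box _ M x -> box _ M' (@diag R n x).
Proof. by exists M => x; exact: box_diag. Qed.
Let Bzero (M : R) : exists M' : R, forall x, box _ M x -> box _ M' (@zero_s R n x).
Proof. by exists M => x; exact: box_zero_s. Qed.

Let mpA j : mode (pull (@proj_tx R n) (A j)).
Proof. exact: (pull_mode (@mode_proj_tx R n) Bproj). Qed.

Lemma Xs_mode f : mode f -> mode (Xs f).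
Proof.
move=> mf; apply: modeB; first exact: mode_dnet.
by apply: mode_sum => j; apply: modeM => //; exact: mode_dnet.
Qed.

Lemma Xs_nul f : mode f -> nul f -> nul (Xs f).
Proof.
move=> mf nf; apply: nulB; first exact: nul_dnet.
apply: nul_sum => j; apply: nulM; last exact: nul_dnet.
exact: (mpA j).2 [::].
Qed.

Let mrho h : mode (rho h).
Proof. by apply: modeD; [exact: mode_dnet|exact: along_mode]. Qed.

(** [Xs] differentiates in t and x, while the time coordinate of the flow is s, so only the images
    of the gamma_k survive in the chain rule. *)
Lemma Xs_along f e z : 0 < e <= 1 -> snet f ->
  Xs (along g f) e z = \sum_k along g (dnet [:: idx_x k] f) e z * Z k e z.
Proof.
move=> e01 sf; rewrite /Xs dpart_along // eq_iis_it mul0r add0r.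
under [X in _ - X]eq_bigr => j _ do rewrite dpart_along // eq_iis_ix mul0r add0r mulr_sumr.
rewrite exchange_big /= -sumrB; apply: eq_bigr => k _.
rewrite /Z /Xs mulrBr mulr_sumr mulrC; congr (_ - _).
by apply: eq_bigr => j _; rewrite /dnet /=; ring.
Qed.

(** The coefficients of [Xs] do not depend on s, so [Xs] commutes with the derivative in s; then the
    characteristic equation is inserted and [Xs_along] makes the result linear in [Z]. *)
Let dZ h e z : 0 < e <= 1 ->
  dnet [:: iis] (Z h) e z =
  Xs (rho h) e z - \sum_k along g (dnet [:: idx_x k] (A h)) e z * Z k e z.
Proof.
move=> e01.
have sg k : rsmooth (g k e) by exact: (mg k).1.
have sr : rsmooth (rho h e) by exact: (mrho h).1.
have sal : rsmooth (along g (A h) e) by exact: (along_mode mg cg (mA h)).1.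
have spA j : rsmooth (pull (@proj_tx R n) (A j) e) by exact: (mpA j).1.
rewrite -Xs_along //; last exact: (mA h).1.
have Egs : dpart iis (g h e) = fun z => rho h e z - along g (A h) e z.
  by apply/funext => y; rewrite /rho /dnet /= addrK.
have sw i : dpart iis (dpart i (g h e)) z = dpart i (rho h e) z - dpart i (along g (A h) e) z.
  by rewrite (dpartC _ _ (sg h)) Egs (dpartB i z sr sal).
have sM j : rsmooth (fun z => pull (@proj_tx R n) (A j) e z * dpart (ix j) (g h e) z).
  exact: rsmoothM (spA j) (rsmooth_dpart (ix j) (sg h)).
rewrite {1}/dnet /= {1}/Z {1}/Xs /dnet /=.
rewrite (dpartB iis z (rsmooth_dpart iit (sg h)) (rsmooth_sum sM)) (dpart_sum iis z sM).
rewrite sw /Xs /dnet /=.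
under eq_bigr => j _.
  rewrite (dpart_mul iis z (spA j) (rsmooth_dpart (ix j) (sg h))).
  have := @dpart_proj_s R n (A j) e z e01 (mA j).1; rewrite /dnet /= => ->.
  rewrite mul0r add0r sw mulrBr; over.
by rewrite sumrB; ring.
Qed.

(** At s = t the flow point is (t, x) up to a null net, and a moderate net does not see the
    difference. *)
Lemma pull_along_diag f : mode f -> nul (fun e y => pull (@diag R n) (along g f) e y - f e y).
Proof.
move=> mf.
pose G k : rnet (1 + n) := pull (@diag R n) (flow g k).
pose H k : rnet (1 + n) := fun _ y => y 0 k.
have cG : cbd G.
  move=> M; have [M' HM'] := cbd_flow cg M; exists M'; apply: filterS HM' => e HH x Bx k.
  by apply: HH; exact: box_diag.
have cH : cbd H by move=> M; exists M; apply: nearW => e x Bx k; exact: Bx.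
have GH k : nul (fun e x => G k e x - H k e x).
  move: k; apply: tx_ind => [|h]; rewrite /G ?flow_t ?flow_x; last exact: F2.
  apply: (@nul_ext _ _ _ (fun _ _ => 0)); last exact: nul0.
  by move=> e _ y; rewrite /pull /H diag_s subrr.
apply: nul_ext (nul_compB cG cH mf GH) => e _ y.
rewrite /pull alongE; congr (f e _ - f e _); apply/rowP => k; by rewrite !mxE.
Qed.

(** Differentiate the null net gamma_h(x, t, t) - x_h. In t this gives the sum of the t and s
    derivatives of gamma_h, the latter being -A_h up to null nets; in x_j it subtracts a Kronecker
    delta, and the deltas weighted by A_j restore exactly A_h. *)
Let nulZ_diag h : nul (pull (@diag R n) (Z h)).
Proof.
pose D : rnet (1 + n) := fun e y => pull (@diag R n) (g h) e y - y 0 (idx_x h).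
have mD : mode D.
  by apply: modeB; [exact: (pull_mode (@mode_diag R n) Bdiag)|exact: mode_coord].
have nD i : nul (dnet [:: i] D) by apply: nul_dnet => //; exact: F2.
have nr : nul (pull (@diag R n) (rho h)) by exact: (pull_nul Bdiag).
have na := pull_along_diag (mA h).
have ns : nul (fun e y => \sum_j A j e y * dnet [:: idx_x j] D e y).
  by apply: nul_sum => j; apply: nulM => //; exact: (mA j).2 [::].
have N := nulB (nulD (nulB (nD (idx_t n)) nr) na) ns.
apply: nul_ext N => e e01 y.
have sg : snet (g h) by exact: (mg h).1.
have sp : rsmooth (pull (@diag R n) (g h) e) by exact: (pull_mode (@mode_diag R n) Bdiag (mg h)).1.
have dD i : dnet [:: i] D e y = dnet [:: i] (pull (@diag R n) (g h)) e y - (idx_x h == i)%:R.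
  rewrite /dnet /= /D (dpartB i y sp (rsmooth_coord R _)).
  by rewrite dpart_coord.
have t1 := dpart_diag_t y e01 sg.
have Er : pull (@diag R n) (rho h) e y = dnet [:: iis] (g h) e (diag y) + pull (@diag R n) (along g (A h)) e y.
  by [].
rewrite dD eq_xt subr0 t1 Er.
under eq_bigr => j _.
  rewrite dD dpart_diag_x // mulrBr; over.
rewrite sumrB.
have -> : \sum_j A j e y * (idx_x h == idx_x j :> 'I_(1 + n))%:R = A h e y.
  rewrite (bigD1 h) //= eqxx mulr1 big1 ?addr0 // => j jh.
  by rewrite eq_xx eq_sym (negbTE jh) mulr0.
rewrite {1}/pull /Z /Xs.
have -> : \sum_j pull (@proj_tx R n) (A j) e (diag y) * dnet [:: ix j] (g h) e (diag y) =
   \sum_j A j e y * dnet [:: ix j] (g h) e (diag y).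
  by apply: eq_bigr => j _; rewrite /pull proj_tx_diag.
ring.
Qed.

Lemma along_logbound (P : scale R) f : logbound P f -> logbound P (along g f).
Proof.
move=> Hf M; have [M' HM'] := cbd_flow cg M; have [l Pl Hl] := Hf M'; exists l => //.
near=> e => x Bx; rewrite alongE.
suff : box _ M' (\row_k flow g k e x) by move: (\row_k _); near: e.
by move=> k; rewrite mxE; move: x Bx k; near: e.
Unshelve. all: by end_near. Qed.

Lemma logb_sum (P : scale R) m (l : 'I_m -> R -> R) : (forall j, logb P (l j)) ->
  logb P (fun e => \sum_(j < m) l j e).
Proof.
elim: m l => [|m ih] l Hl.
  split=> [e|c c0]; first by rewrite big_ord0.
  by apply: (bound_le (bound_cst P 1)); apply: nearW => e; rewrite big_ord0 mulr0 expR0.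
have [p1 p2] := ih (fun j => l (widen_ord (leqnSn m) j)) (fun j => Hl _).
have [q1 q2] := Hl ord_max.
split=> [e|c c0]; first by rewrite big_ord_recr addr_ge0 //=; exact: p1.
apply: (bound_le (boundM (p2 c c0) (q2 c c0))); apply: nearW => e.
by rewrite big_ord_recr /= mulrDr expRD.
Qed.

Lemma logbound_all (P : scale R) m m' (f : 'I_m' -> rnet m) : (forall j, logbound P (f j)) ->
  forall M, exists2 l, logb P l &
    \forall e \near 0^'+, forall j y, box _ M y -> `|f j e y| <= l e.
Proof.
move=> Hf M.
have /choice[l Hl] : forall j, exists l, logb P l /\ \forall e \near 0^'+, forall y, box _ M y -> `|f j e y| <= l e.
  by move=> j; have [l Pl H] := Hf j M; exists l.
exists (fun e => \sum_j l j e); first by apply: logb_sum => j; exact: (Hl j).1.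
have H : \forall e \near 0^'+, forall j y, box _ M y -> `|f j e y| <= l j e.
  by apply: near_ord_forall => j; exact: (Hl j).2.
apply: filterS H => e H j y By; apply: (le_trans (H j y By)).
by rewrite (bigD1 j) //= lerDl sumr_ge0 // => k _; exact: (Hl k).1.1.
Qed.

(* The flow is transported: Z_h solves the linearised characteristic equation along
   the flow and vanishes on s = t, as one sees by differentiating
   gamma_h(x, t, t) = x_h. *)
Lemma nul_Z h : nul (Z h).
Proof.
move: h; apply: (@gronwall_nul R n n Z (fun z => z 0 iit) _ _ (fun h => Xs (rho h))).
- by move=> h; exact: (Xs_mode (mg h)).1.
- by move=> M z; exact.
- by move=> h; exact: Xs_nul.
- move=> M.
  have H h : exists2 l, logb (modscale R) l & \forall e \near 0^'+, forall k y, box _ M y ->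
      `|along g (dnet [:: idx_x k] (A h)) e y| <= l e.
    by apply: logbound_all => k; exact: along_logbound.
  have /choice[l Hl] : forall h, exists l, logb (modscale R) l /\ \forall e \near 0^'+, forall k y, box _ M y ->
      `|along g (dnet [:: idx_x k] (A h)) e y| <= l e.
    by move=> h; have [l Pl HH] := H h; exists l.
  exists (fun e => \sum_h l h e); first by apply: logb_sum => h; exact: (Hl h).1.
  have K : \forall e \near 0^'+, forall h k y, box _ M y ->
      `|along g (dnet [:: idx_x k] (A h)) e y| <= l h e.
    by apply: near_ord_forall => h; exact: (Hl h).2.
  near=> e => z Bz h.
  have e01 : 0 < e <= 1 by near: e; exact: near01.
  rewrite dZ //; apply: (le_trans (ler_normB _ _)); rewrite addrC lerD2r.
  apply: (le_trans (ler_norm_sum _ _ _)); rewrite mulr_sumr; apply: ler_sum => k _.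
  rewrite normrM; apply: ler_wpM2r => //.
  apply: (@le_trans _ _ (l h e)); first by move: h k z Bz; near: e.
  by rewrite (bigD1 h) //= lerDl sumr_ge0 // => j _; exact: (Hl j).1.1.
- move=> M q; apply: near_ord_forall => h.
  apply: filterS (nulZ_diag h M q) => e H z Bz.
  by rewrite sets_t; apply: (H (proj_tx z)); exact: box_proj_tx.
Unshelve. all: by end_near. Qed.

(* Along a characteristic the transport system becomes a linear system of ordinary
   differential equations in s, with zero data at s = 0. *)
Lemma transport_unique N (v : 'I_N -> rnet (1 + n)) (C : 'I_N -> 'I_N -> rnet (1 + n)) :
  (forall i, mode (v i)) ->
  (forall i j, logbound (modscale R) (C i j)) ->
  (forall i, nul (fun e y => Xop (v i) e y - \sum_j C i j e y * v j e y)) ->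
  (forall i, nul (fun e (x : 'rV[R]_n) => v i e (tx 0 x))) ->
  forall i, nul (v i).
Proof.
move=> mv HC Hv v0.
pose W i := along g (v i).
have mW i : mode (W i) by exact: along_mode.
pose nu i : rnet (1 + n) := fun e y => Xop (v i) e y - \sum_j C i j e y * v j e y.
(* The error in the equation for [W]: the null residual of the transport system along the flow, and
   the defect of gamma times the gradient of [v i]. *)
pose res i : rnet (n + (1 + 1)) := fun e z => along g (nu i) e z +
  \sum_h rho h e z * along g (dnet [:: idx_x h] (v i)) e z.
have nres i : nul (res i).
  apply: nulD; first by apply: along_nul => //; exact: Hv.
  apply: nul_sum => h; apply: (@nul_ext _ _ _ (fun e z => along g (dnet [:: idx_x h] (v i)) e z * rho h e z)).
    by move=> e _ z; rewrite mulrC.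
  by apply: nulM => //; exact: (along_mode mg cg (mode_dnet [:: idx_x h] (mv i))).2 [::].
have dW i e z : 0 < e <= 1 ->
    dnet [:: iis] (W i) e z = \sum_j along g (C i j) e z * W j e z + res i e z.
  move=> e01; rewrite /W dpart_along //; last exact: (mv i).1.
  rewrite eqxx mul1r /res.
  have -> : along g (nu i) e z = along g (dnet [:: idx_t n] (v i)) e z
     - \sum_j along g (A j) e z * along g (dnet [:: idx_x j] (v i)) e z
     - \sum_j along g (C i j) e z * along g (v j) e z by [].
  under [X in _ = _ + (_ + X)]eq_bigr => h _ do rewrite /rho mulrDl.
  rewrite big_split /=; ring.
have nW : forall i, nul (W i).
  apply: (@gronwall_nul R n N W (fun=> 0) _ _ res).
  - by move=> i; exact: (mW i).1.
  - by move=> M z Bz; rewrite normr0; apply: le_trans (Bz iis).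
  - exact: nres.
  - move=> M.
    have H i : exists2 l, logb (modscale R) l & \forall e \near 0^'+, forall j y, box _ M y ->
        `|along g (C i j) e y| <= l e.
      by apply: logbound_all => k; exact: along_logbound.
    have /choice[l Hl] : forall i, exists l, logb (modscale R) l /\ \forall e \near 0^'+, forall k y, box _ M y ->
        `|along g (C i k) e y| <= l e.
      by move=> h; have [l Pl HH] := H h; exists l.
    exists (fun e => \sum_h l h e); first by apply: logb_sum => h; exact: (Hl h).1.
    have K : \forall e \near 0^'+, forall h k y, box _ M y -> `|along g (C h k) e y| <= l h e.
      by apply: near_ord_forall => h; exact: (Hl h).2.
    near=> e => z Bz h.
    have e01 : 0 < e <= 1 by near: e; exact: near01.
    rewrite dW //; apply: (le_trans (ler_normD _ _)); rewrite lerD2r.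
    apply: (le_trans (ler_norm_sum _ _ _)); rewrite mulr_sumr; apply: ler_sum => k _.
    rewrite normrM; apply: ler_wpM2r => //.
    apply: (@le_trans _ _ (l h e)); first by move: h k z Bz; near: e.
    by rewrite (bigD1 h) //= lerDl sumr_ge0 // => j _; exact: (Hl j).1.1.
  - move=> M q; apply: near_ord_forall => i.
    (* At s = 0 the value of [W i] is the initial value of [v i] at gamma(x, t, 0), and
       c-boundedness keeps this point in a fixed box. *)
    have [M' HM'] := cg M.
    near=> e => z Bz; rewrite sets_0 /W /along zero_s_s.
    suff : box n M' (\row_h g h e (zero_s (proj_tx z))).
      by move: (\row_h _); near: e; exact: v0.
    move=> k; rewrite mxE; have B : box _ M (zero_s (proj_tx z)).
      by apply: box_zero_s; exact: box_proj_tx.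
    by move: (zero_s _) B k; near: e.
move=> i.
(* Restricting to s = t recovers [v i] itself from its values along the flow. *)
have N1 := nulB (@pull_nul _ _ _ _ Bdiag _ (nW i)) (pull_along_diag (mv i)).
by apply: nul_ext N1 => e _ y; rewrite /W; ring.
Unshelve. all: by end_near. Qed.

End Flow.

(** * Integration along the flow *)

Section IntegralNets.
Variable R : realType.
Variable d : nat.
Local Notation rnet := (real_net R).
Local Notation mu := (@lebesgue_measure R).

Lemma pint_bound (F : 'rV[R]_(d + 1) -> R) (C : R) z : continuous F ->
  (forall th, 0 <= th <= 1 -> `|F (jn z th)| <= C) -> `|pint F 0 1 z| <= C.
Proof.
move=> cF HC; have := @Rintegral_segment_bound R (fun th => F (jn z th)) 0 1 C ler01 (@continuous_jnF R d F z cF) HC.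
by rewrite subr0 mulr1.
Qed.

Definition pintn (F : rnet (d + 1)) : rnet d := fun e => pint (F e) 0 1.

Lemma snet_pintn F : snet F -> snet (pintn F).
Proof. by move=> sF e e01; apply: rsmooth_pint; [exact: ler01|exact: sF]. Qed.

Lemma dnet_pintn F al e : snet F -> 0 < e <= 1 ->
  dnet al (pintn F) e = pintn (dnet (map (lshift 1) al) F) e.
Proof. by move=> sF e01; rewrite /dnet /pintn dparts_pint //; exact: sF. Qed.

Lemma Obd_pintn P F : snet F -> Obd P F -> Obd P (pintn F).
Proof.
move=> sF OF M; have [g Pg Hg] := OF (Num.max M 1); exists g => //.
near=> e => z Bz; apply: pint_bound.
  by apply: rsmooth_continuous; apply: sF; near: e; exact: near01.
move=> th /andP[th0 th1].
suff : box _ (Num.max M 1) (jn z th) by move: (jn z th); near: e.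
apply: box_jn; first by apply: box_le Bz; rewrite le_max lexx.
by rewrite ger0_norm // le_max th1 orbT.
Unshelve. all: by end_near. Qed.

Lemma nul_pintn F : snet F -> nul F -> nul (pintn F).
Proof.
move=> sF nF M q; have H := nF (Num.max M 1) q.
near=> e => z Bz; apply: pint_bound.
  by apply: rsmooth_continuous; apply: sF; near: e; exact: near01.
move=> th /andP[th0 th1].
suff : box _ (Num.max M 1) (jn z th) by move: (jn z th); near: e.
apply: box_jn; first by apply: box_le Bz; rewrite le_max lexx.
by rewrite ger0_norm // le_max th1 orbT.
Unshelve. all: by end_near. Qed.

Lemma Sb_pintn P al F : snet F -> Sb P (map (lshift 1) al) F -> Sb P al (pintn F).
Proof.
move=> sF SF be sb.
apply: (@Obd_ext _ _ _ _ (pintn (dnet (map (lshift 1) be) F))).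
  by move=> e e01; exact: dnet_pintn.
by apply: Obd_pintn; [exact: snet_dnet|apply: SF; exact: map_subseq].
Qed.

Lemma mode_pintn F : mode F -> mode (pintn F).
Proof.
move=> /mode_Sb[sF SF]; apply/mode_Sb; split; first exact: snet_pintn.
by move=> al; exact: Sb_pintn.
Qed.

Let If (F : 'rV[R]_(d + 1) -> R) z : continuous F ->
  mu.-integrable `[0, 1] (EFin \o (fun th => F (jn z th))).
Proof. by move=> cF; apply: continuous_integrable; exact: continuous_jnF. Qed.

Lemma pintD (F G : 'rV[R]_(d + 1) -> R) z : continuous F -> continuous G ->
  pint (fun w => F w + G w) 0 1 z = pint F 0 1 z + pint G 0 1 z.
Proof.
by move=> cF cG; rewrite /pint RintegralD //; exact: If.
Qed.

Lemma pintB (F G : 'rV[R]_(d + 1) -> R) z : continuous F -> continuous G ->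
  pint (fun w => F w - G w) 0 1 z = pint F 0 1 z - pint G 0 1 z.
Proof.
by move=> cF cG; rewrite /pint RintegralB //; exact: If.
Qed.

Lemma pintZ (c : R) (F : 'rV[R]_(d + 1) -> R) z : continuous F ->
  pint (fun w => c * F w) 0 1 z = c * pint F 0 1 z.
Proof. by move=> cF; rewrite /pint RintegralZl //; exact: If. Qed.

Lemma continuous_sumR (T : topologicalType) m (F : 'I_m -> T -> R) : (forall j, continuous (F j)) ->
  continuous (fun w => \sum_(j < m) F j w).
Proof.
elim: m F => [|m ih] F cF.
  rewrite (_ : (fun w => _) = fun=> 0); first exact: cst_continuous.
  by apply/funext => w; rewrite big_ord0.
rewrite (_ : (fun w => _) = fun w => \sum_(j < m) F (widen_ord (leqnSn m) j) w + F ord_max w).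
  by move=> w; apply: continuousD; [apply: ih|exact: cF].
by apply/funext => w; rewrite big_ord_recr.
Qed.

Lemma pint_sum m (F : 'I_m -> 'rV[R]_(d + 1) -> R) z : (forall j, continuous (F j)) ->
  pint (fun w => \sum_(j < m) F j w) 0 1 z = \sum_(j < m) pint (F j) 0 1 z.
Proof.
elim: m F => [|m ih] F cF.
  rewrite big_ord0 (_ : (fun w => _) = fun w => 0 * 0).
    rewrite /pint; under eq_Rintegral do rewrite mul0r.
    by rewrite Rintegral_cst ?mul0r //; exact: measurable_itv.
  by apply/funext => w; rewrite big_ord0 mul0r.
rewrite big_ord_recr /= -ih // -pintD //; last exact: continuous_sumR.
by congr (pint _ 0 1 z); apply/funext => w; rewrite big_ord_recr.
Qed.

Lemma eq_pint (F G : 'rV[R]_(d + 1) -> R) z : (forall th, F (jn z th) = G (jn z th)) ->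
  pint F 0 1 z = pint G 0 1 z.
Proof. by move=> FG; apply: eq_Rintegral => th _; exact: FG. Qed.

Lemma Rintegral_FTC (H dH : R -> R) : (forall x : R, is_derive x 1 H (dH x)) ->
  continuous dH -> \int[mu]_(x in `[0, 1]) dH x = H 1 - H 0.
Proof.
move=> HH cd; rewrite /Rintegral.
have cH : continuous H.
  move=> x; apply: differentiable_continuous; apply/derivable1_diffP.
  by have [] := HH x.
rewrite (@continuous_FTC2 R dH H 0 1) ?ltr01 //.
- exact: continuous_subspaceT.
- split=> [x _||]; first by have [] := HH x.
    by apply: cvg_at_right_filter; exact: cH.
  by apply: cvg_at_left_filter; exact: cH.
- by move=> x _; rewrite derive1E; have [_ ->] := HH x.
Qed.

End IntegralNets.

(** * The integral over s from 0 to t *)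

Section Primitive.
Variable R : realType.
Variable n : nat.
Local Notation iis := (idx_s n).
Local Notation iit := (it n).
Local Notation rnet := (real_net R).

Definition ith : 'I_(1 + n + 1) := rshift (1 + n) ord0.
Definition iy (k : 'I_(1 + n)) : 'I_(1 + n + 1) := lshift 1 k.

(* The substitution s = theta t turns the integral from 0 to t, with a variable
   endpoint, into t times an integral over [0, 1]. *)
Definition homot (w : 'rV[R]_(1 + n + 1)) : 'rV[R]_(n + (1 + 1)) :=
  xts (rsubmx (lsubmx w)) (w 0 (iy (idx_t n))) (w 0 (iy (idx_t n)) * w 0 ith).

Lemma homot_x w j : homot w 0 (ix j) = w 0 (iy (idx_x j)).
Proof. by rewrite xts_x !mxE. Qed.
Lemma homot_t w : homot w 0 iit = w 0 (iy (idx_t n)). Proof. exact: xts_t. Qed.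
Lemma homot_s w : homot w 0 iis = w 0 (iy (idx_t n)) * w 0 ith. Proof. exact: xts_s. Qed.

Lemma jn_y (y : 'rV[R]_(1 + n)) th k : jn y th 0 (iy k) = y 0 k.
Proof. by rewrite /jn row_mxEl. Qed.
Lemma jn_th (y : 'rV[R]_(1 + n)) th : jn y th 0 ith = th.
Proof. by rewrite /jn row_mxEr mxE eqxx mulr1n. Qed.

Lemma mode_homot k : mode (fun (_ : R) w => homot w 0 k).
Proof.
move: k; apply: xts_ind => [j||].
- apply: mode_ext (mode_coord R (iy (idx_x j))) => e _; apply/funext => w; exact: homot_x.
- apply: mode_ext (mode_coord R (iy (idx_t n))) => e _; apply/funext => w; exact: homot_t.
- apply: mode_ext (modeM (mode_coord R (iy (idx_t n))) (mode_coord R ith)) => e _.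
  by apply/funext => w; exact: homot_s.
Qed.

Lemma Bhomot (M : R) : exists M' : R, forall x, box _ M x -> box _ M' (homot x).
Proof.
exists (Num.max M (M * M)) => x Bx; apply: xts_ind => [j||]; rewrite ?homot_x ?homot_t ?homot_s le_max.
- by rewrite Bx.
- by rewrite Bx.
- by rewrite normrM ler_pM ?orbT //; exact: Bx.
Qed.

Lemma homot_jn y th : homot (jn y th) = zero_s y + (y 0 (idx_t n) * th) *: delta_mx 0 iis.
Proof.
apply/rowP; apply: xts_ind => [j||]; rewrite [RHS]mxE [X in _ = _ + X]mxE [X in _ = _ + _ * X]mxE.
- by rewrite homot_x zero_s_x jn_y eq_ix_iis mulr0 addr0.
- by rewrite homot_t zero_s_t jn_y eq_it_iis mulr0 addr0.
- by rewrite homot_s zero_s_s jn_y jn_th !eqxx mulr1 add0r.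
Qed.

Lemma dpart_homot_x (f : rnet (n + (1 + 1))) e w j : 0 < e <= 1 -> snet f ->
  dnet [:: iy (idx_x j)] (pull homot f) e w = dnet [:: ix j] f e (homot w).
Proof.
move=> e01 sf; rewrite (dpart_pull mode_homot) // sum_xts.
have E1 : (fun x => homot x 0 iit) = (fun w => w 0 (iy (idx_t n))) by apply/funext => x; exact: homot_t.
have E2 : (fun x => homot x 0 iis) = (fun w => w 0 (iy (idx_t n)) * w 0 ith) by apply/funext => x; exact: homot_s.
have E3 k : (fun x => homot x 0 (ix k)) = (fun w => w 0 (iy (idx_x k))) by apply/funext => x; exact: homot_x.
have eqiy a b : (iy a == iy b) = (a == b) by exact: (inj_eq (@lshift_inj _ _)).
rewrite E1 E2 (dpart_mul _ _ (rsmooth_coord _ _) (rsmooth_coord _ _)) !dpart_coord eqiy eq_tx.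
rewrite (_ : (ith == _) = false); last exact: eq_rlshift.
rewrite !(mul0r, mulr0, addr0) (bigD1 j) //= E3 dpart_coord eqxx mul1r big1 ?addr0 // => k kj.
by rewrite E3 dpart_coord eqiy eq_xx (negbTE kj) mul0r.
Qed.

Lemma dpart_homot_t (f : rnet (n + (1 + 1))) e w : 0 < e <= 1 -> snet f ->
  dnet [:: iy (idx_t n)] (pull homot f) e w =
  dnet [:: iit] f e (homot w) + w 0 ith * dnet [:: iis] f e (homot w).
Proof.
move=> e01 sf; rewrite (dpart_pull mode_homot) // sum_xts.
have E1 : (fun x => homot x 0 iit) = (fun w => w 0 (iy (idx_t n))) by apply/funext => x; exact: homot_t.
have E2 : (fun x => homot x 0 iis) = (fun w => w 0 (iy (idx_t n)) * w 0 ith) by apply/funext => x; exact: homot_s.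
have E3 k : (fun x => homot x 0 (ix k)) = (fun w => w 0 (iy (idx_x k))) by apply/funext => x; exact: homot_x.
have eqiy a b : (iy a == iy b) = (a == b) by exact: (inj_eq (@lshift_inj _ _)).
rewrite E1 E2 (dpart_mul _ _ (rsmooth_coord _ _) (rsmooth_coord _ _)) !dpart_coord eqxx.
rewrite (_ : (ith == _) = false); last exact: eq_rlshift.
rewrite mulr0 addr0 !mul1r big1 ?add0r // => k _.
by rewrite E3 dpart_coord eqiy eq_xt mul0r.
Qed.

(** The integral of f(x, t, s) over s from 0 to t, for either sign of t. *)
Definition prim (f : rnet (n + (1 + 1))) : rnet (1 + n) :=
  fun e y => y 0 (idx_t n) * pintn (pull homot f) e y.

Lemma mode_prim f : mode f -> mode (prim f).
Proof.
move=> mf; apply: modeM; first exact: mode_coord.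
by apply: mode_pintn; apply: (pull_mode mode_homot Bhomot).
Qed.

(** The factor t is bounded on a box and goes into the constant c of [logb], which is arbitrary for
    this reason. *)
Lemma logbound_prim (P : scale R) f : snet f -> logbound P f -> logbound P (prim f).
Proof.
move=> sf Hf M; pose M1 := Num.max M 1.
have [M2 HM2] := Bhomot M1; have [l Pl Hl] := Hf M2.
exists (fun e => `|M| * l e).
  split=> [e|c c0]; first by rewrite mulr_ge0 //; exact: Pl.1.
  have := Pl.2 (c * `|M|); rewrite mulr_ge0 // => /(_ isT) H.
  by apply: (bound_le H); apply: nearW => e; rewrite mulrA.
near=> e => y By; rewrite /prim normrM; apply: ler_pM => //.
  by apply: le_trans (By _) _; exact: ler_norm.
apply: pint_bound.
  apply: rsmooth_continuous; apply: (pull_snet mode_homot) => //.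
  by near: e; exact: near01.
move=> th /andP[th0 th1]; rewrite /pull.
suff : box _ M2 (homot (jn y th)) by move: (homot _); near: e.
apply: HM2; apply: box_jn; first by apply: box_le By; rewrite le_max lexx.
by rewrite ger0_norm // le_max th1 orbT.
Unshelve. all: by end_near. Qed.

Variable A : 'I_n -> rnet (1 + n).
Hypothesis mA : forall j, mode (A j).

(** Leibniz rule for an integral with moving endpoint: a boundary term at s = t plus the integral of
    [Xs A f], since the coefficients of the operator do not depend on s. *)
Lemma X_prim f e y : 0 < e <= 1 -> mode f ->
  Xop A (prim f) e y = pull (@diag R n) f e y +
    y 0 (idx_t n) * pintn (pull homot (Xs A f)) e y.
Proof.
move=> e01 mf; have sf := mf.1.
have shf : snet (pull homot f) by exact: (pull_snet mode_homot).
have sI : rsmooth (pintn (pull homot f) e) by exact: snet_pintn.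
have st : rsmooth (fun y : 'rV[R]_(1 + n) => y 0 (idx_t n)) by exact: rsmooth_coord.
have cont al : continuous (dnet al (pull homot f) e).
  by apply: rsmooth_continuous; exact: (snet_dnet al shf).
have contf al : continuous (pull homot (dnet al f) e).
  exact: (rsmooth_continuous (pull_snet mode_homot (snet_dnet al sf) e01)).
have D i : dnet [:: i] (prim f) e y = (idx_t n == i)%:R * pintn (pull homot f) e y +
    y 0 (idx_t n) * pintn (dnet [:: iy i] (pull homot f)) e y.
  rewrite /dnet /= /prim (dpart_mul i y st sI) dpart_coord; congr (_ + _ * _).
  by have := dnet_pintn [:: i] shf e01; rewrite /dnet /= => ->.
set t := y 0 (idx_t n).
pose F1 (w : 'rV[R]_(1 + n + 1)) := pull homot (dnet [:: iit] f) e w.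
pose F2 (w : 'rV[R]_(1 + n + 1)) := w 0 ith * pull homot (dnet [:: iis] f) e w.
have cF2 : continuous F2.
  by move=> w; apply: continuousM; [exact: coord_continuous|exact: contf].
pose J j : R := pint (pull homot (dnet [:: ix j] f) e) 0 1 y.
have Dt : dnet [:: idx_t n] (prim f) e y = pintn (pull homot f) e y + t * (pint F1 0 1 y + pint F2 0 1 y).
  rewrite D eqxx mul1r; congr (_ + _ * _); rewrite -pintD //; last exact: contf.
  by apply: eq_pint => th; exact: dpart_homot_t.
have Dx j : dnet [:: idx_x j] (prim f) e y = t * J j.
  have z0 : (idx_t n == idx_x j)%:R = 0 :> R by rewrite eq_tx.
  rewrite D z0 [X in X + _]mul0r add0r; apply: (congr1 (fun v => y 0 (idx_t n) * v)).
  by apply: eq_pint => th; exact: dpart_homot_x.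
have XE : Xop A (prim f) e y = pintn (pull homot f) e y + t * (pint F1 0 1 y + pint F2 0 1 y) -
    \sum_j A j e y * (t * J j).
  by rewrite /Xop Dt; congr (_ - _); apply: eq_bigr => j _; rewrite Dx.
rewrite {}XE {Dt Dx D}.
have EX : pintn (pull homot (Xs A f)) e y = pint F1 0 1 y -
    \sum_j A j e y * J j.
  have -> : \sum_j A j e y * J j =
      pint (fun w => \sum_j A j e y * pull homot (dnet [:: ix j] f) e w) 0 1 y.
    rewrite pint_sum; first by apply: eq_bigr => j _; rewrite pintZ.
    by move=> j w; apply: continuousM; [exact: cst_continuous|exact: contf].
  pose S (w : 'rV[R]_(1 + n + 1)) : R := \sum_j A j e y * pull homot (dnet [:: ix j] f) e w.
  have cS : continuous S.
    by apply: continuous_sumR => j w; apply: continuousM; [exact: cst_continuous|exact: contf].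
  rewrite -/S -pintB //; last exact: contf.
  apply: eq_pint => th; rewrite /F1 /S /pull /Xs; congr (_ - _).
  apply: eq_bigr => j _; congr (_ * _).
  rewrite /pull; congr (A j e _); apply/rowP; apply: tx_ind => [|k].
    by rewrite proj_tx_t homot_t jn_y.
  by rewrite proj_tx_x homot_x jn_y.
(* The terms from differentiating the factor t and the argument s = theta t add up to the integral
   of the theta derivative of theta f, which is f at theta = 1. *)
have FT : pintn (pull homot f) e y + t * pint F2 0 1 y = pull (@diag R n) f e y.
  rewrite -pintZ // -pintD; [|exact: (cont [::])|]; last first.
    by move=> w; apply: continuousM; [exact: cst_continuous|exact: cF2].
  pose H (th : R) := th * f e (homot (jn y th)).
  pose u (th : R) : R := f e (homot (jn y th)).
  pose v (th : R) : R := dnet [:: iis] f e (homot (jn y th)).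
  pose dH (th : R) : R := u th + t * (th * v th).
  have HH (th : R) : is_derive th (1 : R) H (dH th).
    have L := @is_derive_line R _ (f e) (zero_s y) (delta_mx 0 iis) (t * th) (rsmooth_derivable (sf e e01) _ _).
    have L2 : is_derive th (1 : R) (fun th : R => t * th) t.
      have := is_deriveM (is_derive_cst t th (1 : R)) (is_derive_id th (1 : R)).
      by move=> /is_derive_congr; apply; rewrite scaler0 addr0 [_ *: _]mulr1.
    have L3 := @is_derive_comp1 R R _ (fun th => t * th) th 1 _ _ L L2.
    have := is_deriveM (is_derive_id th (1 : R)) L3.
    have -> : (id * (fun z : R => f e (zero_s y + (t * z) *: delta_mx 0 iis)))%R = H.
      by apply/funext => z; rewrite /H homot_jn.
    move=> /is_derive_congr; apply.
    by rewrite /dH /u /v homot_jn /dnet /= /dpart /GRing.scale /=; ring.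
  have cd : continuous dH.
    have c1 : continuous u by exact: (@continuous_jnF R _ _ y (cont [::])).
    have c2 : continuous v by exact: (@continuous_jnF R _ _ y (contf [:: iis])).
    rewrite /dH => th; apply: continuousD; first exact: c1.
    apply: continuousM; first exact: cst_continuous.
    by apply: continuousM; [exact: cvg_id|exact: c2].
  have FT := Rintegral_FTC HH cd.
  rewrite /H mul1r mul0r subr0 in FT.
  rewrite /pull; have -> : diag y = homot (jn y 1).
    apply/rowP; apply: xts_ind => [j||]; rewrite ?diag_x ?diag_t ?diag_s ?homot_x ?homot_t ?homot_s ?jn_y ?jn_th ?mulr1 //.
  rewrite -FT; apply: eq_Rintegral => th _.
  by rewrite /dH /u /v /F2 jn_th.
rewrite EX -FT mulrDr mulrBr mulr_sumr.
under [X in _ - X]eq_bigr => j _ do rewrite mulrCA.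
ring.
Qed.

End Primitive.

(** * Explicit solution and uniqueness *)

Section Solution.
Variable R : realType.
Variable n : nat.
Local Notation iis := (idx_s n).
Local Notation iit := (it n).
Local Notation rnet := (real_net R).

Record flow_ok (A : 'I_n -> rnet (1 + n)) (g : 'I_n -> rnet (n + (1 + 1))) : Prop := FlowOk {
  flow_mA : forall j, mode (A j);
  flow_mg : forall h, mode (g h);
  flow_cg : cbd g;
  flow_ode : forall h, nul (fun e z => dnet [:: iis] (g h) e z + along g (A h) e z);
  flow_init : forall h, nul (fun e y => pull (@diag R n) (g h) e y - y 0 (idx_x h));
  flow_log : forall j k, logbound (modscale R) (dnet [:: idx_x k] (A j)) }.

Variables (A : 'I_n -> rnet (1 + n)) (g : 'I_n -> rnet (n + (1 + 1))).
Hypothesis ok : flow_ok A g.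
Let mA := flow_mA ok.
Let mg := flow_mg ok.
Let cg := flow_cg ok.
Local Notation X := (Xop A).

Lemma XM u v e y : 0 < e <= 1 -> snet u -> snet v ->
  X (fun e y => u e y * v e y) e y = X u e y * v e y + u e y * X v e y.
Proof.
move=> e01 su sv; rewrite /Xop /dnet /=.
rewrite (dpart_mul _ _ (su e e01) (sv e e01)).
under eq_bigr => j _ do rewrite (dpart_mul _ _ (su e e01) (sv e e01)) mulrDr.
rewrite big_split /= mulrBl mulrBr mulr_suml mulr_sumr.
have -> : \sum_j A j e y * (dpart (idx_x j) (u e) y * v e y) = \sum_j A j e y * dpart (idx_x j) (u e) y * v e y.
  by apply: eq_bigr => j _; rewrite mulrA.
have -> : \sum_j A j e y * (u e y * dpart (idx_x j) (v e) y) = \sum_j u e y * (A j e y * dpart (idx_x j) (v e) y).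
  by apply: eq_bigr => j _; rewrite mulrCA.
ring.
Qed.

Lemma XD u v e y : 0 < e <= 1 -> snet u -> snet v ->
  X (fun e y => u e y + v e y) e y = X u e y + X v e y.
Proof.
move=> e01 su sv; rewrite /Xop /dnet /=.
rewrite (dpartD _ _ (su e e01) (sv e e01)).
under eq_bigr => j _ do rewrite (dpartD _ _ (su e e01) (sv e e01)) mulrDr.
rewrite big_split /=; ring.
Qed.

Lemma XB u v e y : 0 < e <= 1 -> snet u -> snet v ->
  X (fun e y => u e y - v e y) e y = X u e y - X v e y.
Proof.
move=> e01 su sv; rewrite /Xop /dnet /=.
rewrite (dpartB _ _ (su e e01) (sv e e01)).
under eq_bigr => j _ do rewrite (dpartB _ _ (su e e01) (sv e e01)) mulrBr.
rewrite sumrB; ring.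
Qed.

Lemma Xcomp1 (f df : R -> R) u e y : (forall x : R, is_derive x 1 f (df x)) ->
  0 < e <= 1 -> snet u ->
  X (fun e y => f (u e y)) e y = df (u e y) * X u e y.
Proof.
move=> Hf e01 su; rewrite /Xop /dnet /=.
rewrite (dpart_comp1 _ _ Hf (su e e01)).
under eq_bigr => j _ do rewrite (dpart_comp1 _ _ Hf (su e e01)).
rewrite mulrBr mulr_sumr; congr (_ - _).
by apply: eq_bigr => j _; rewrite mulrCA.
Qed.

(** [Xs] contains no derivative in s, so it commutes with restriction to s = 0. *)
Lemma X_zero_s f e y : 0 < e <= 1 -> snet f ->
  X (pull (@zero_s R n) f) e y = pull (@zero_s R n) (Xs A f) e y.
Proof.
move=> e01 sf.
have E i : dnet [:: i] (pull (@zero_s R n) f) e y = dnet [:: si i] f e (zero_s y) by rewrite dnet_zero_s.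
rewrite /Xop E si_t {2}/pull /Xs; congr (_ - _).
apply: eq_bigr => j _; rewrite E si_x /pull; congr (A j e _ * _).
by apply/rowP; apply: tx_ind => [|h]; rewrite ?proj_tx_t ?proj_tx_x ?zero_s_t ?zero_s_x.
Qed.

Let Bzero (M : R) : exists M' : R, forall x, box _ M x -> box _ M' (@zero_s R n x).
Proof. by exists M => x; exact: box_zero_s. Qed.

Let nulZ := nul_Z mA mg cg (flow_ode ok) (flow_init ok) (flow_log ok).

(** In [X_prim] the boundary term is p up to a null net, and the integrand [Xs] of p along the flow
    is null by [nul_Z]. *)
Lemma nul_X_prim p : mode p -> nul (fun e y => X (prim (along g p)) e y - p e y).
Proof.
move=> mp; have ma := along_mode mg cg mp.
have N : nul (Xs A (along g p)).
  apply: (@nul_ext _ _ _ (fun e z => \sum_k along g (dnet [:: idx_x k] p) e z * Xs A (g k) e z)).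
    by move=> e e01 z; rewrite Xs_along //; exact: mp.1.
  apply: nul_sum => k; apply: nulM; last exact: nulZ.
  exact: (along_mode mg cg (mode_dnet [:: idx_x k] mp)).2 [::].
have N1 : nul (fun e (y : 'rV[R]_(1 + n)) => y 0 (idx_t n) * pintn (pull (@homot R n) (Xs A (along g p))) e y).
  apply: nulM; first exact: (mode_coord R (idx_t n)).2 [::].
  apply: nul_pintn; first by apply: (pull_snet (@mode_homot R n)); exact: (Xs_mode mA ma).1.
  exact: (pull_nul (@Bhomot R n)).
apply: nul_ext (nulD (pull_along_diag cg (flow_init ok) mp) N1) => e e01 y.
by rewrite X_prim //; ring.
Qed.

Section Amplitude.
Variables p q : rnet (1 + n).
Hypothesis (mp : mode p) (mq : mode q).
Hypothesis (lp : logbound (modscale R) p) (lq : logbound (modscale R) q).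

(* b = exp (i int_0^t a_0(s, gamma(x, t, s)) ds) with a_0 = p + i q. *)
Definition amp_exp : rnet (1 + n) := fun e y => expR (- prim (along g q) e y).
Definition amp_arg : rnet (1 + n) := prim (along g p).
Definition amp1 : rnet (1 + n) := fun e y => amp_exp e y * cos (amp_arg e y).
Definition amp2 : rnet (1 + n) := fun e y => amp_exp e y * sin (amp_arg e y).

Let mQ : mode (prim (along g q)). Proof. by apply: mode_prim; exact: along_mode. Qed.
Let mP : mode amp_arg. Proof. by apply: mode_prim; exact: along_mode. Qed.

(** The modulus of b is such an exponential; the logarithmic type of a_0 keeps it within the
    scale. *)
Lemma Obd_exp (P : scale R) m (f : rnet m) : logbound P f -> Obd P (fun e y => expR (- f e y)).
Proof.
move=> Hf M; have [l Pl Hl] := Hf M; exists (fun e => expR (1 * l e)); first exact: Pl.2.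
apply: filterS Hl => e H y By; rewrite ger0_norm ?expR_ge0 // ler_expR mul1r.
by apply: le_trans (H y By); rewrite -normrN; exact: ler_norm.
Qed.

Lemma Sb_expN (P : scale R) m al (f : rnet m) : snet f -> logbound P f -> Sb P al f ->
  Sb P al (fun e y => expR (- f e y)).
Proof.
move=> sf lf Sf.
have := @Sb_comp1 R P m al (fun=> expR) (fun e y => - f e y) (fun _ x => is_derive_expR x) _ (fun=> Obd_exp lf) _ 0%N.
apply; first by move=> e e01; apply: rsmoothN; exact: sf.
exact: SbN.
Qed.

Lemma Sb_trig (P : scale R) m al k (f : rnet m) : snet f -> Sb P al f ->
  Sb P al (fun e y => trig k (f e y)).
Proof.
move=> sf Sf; apply: (Sb_comp1 (@is_derive_trig R) sf) => // j.
apply: (Obd_le (Obd_cst P m 1)) => M; apply: nearW => e x _.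
by rewrite normr1 trig_le1.
Qed.

Lemma snet_comp1 m (F : nat -> R -> R) k (u : rnet m) :
  (forall j (x : R), is_derive x 1 (F j) (F j.+1 x)) -> snet u -> snet (fun e y => F k (u e y)).
Proof.
move=> HF su e e01; apply/rsmoothP => l; apply: Ck_comp1 => //; exact: su.
Qed.

Lemma snet_exp : snet amp_exp.
Proof.
have sN : snet (fun e y => - prim (along g q) e y) by move=> e e01; apply: rsmoothN; exact: mQ.1.
exact: (@snet_comp1 _ (fun=> expR) 0%N _ (fun _ x => is_derive_expR x) sN).
Qed.

Lemma snet_trig k : snet (fun e y => trig k (amp_arg e y)).
Proof.
exact: (@snet_comp1 _ (@trig R) k _ (@is_derive_trig R) mP.1).
Qed.

Lemma Sb_amp (P : scale R) al : logbound P q ->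
  Sb P al (prim (along g p)) -> Sb P al (prim (along g q)) -> Sb P al amp1 /\ Sb P al amp2.
Proof.
move=> lq' Sp Sq.
have lQ : logbound P (prim (along g q)).
  apply: logbound_prim; first by apply: along_snet => //; exact: mq.1.
  exact: along_logbound.
have SE := Sb_expN mQ.1 lQ Sq.
split; first exact: (SbM snet_exp (snet_trig 0) SE (Sb_trig 0 mP.1 Sp)).
exact: (SbM snet_exp (snet_trig 3) SE (Sb_trig 3 mP.1 Sp)).
Qed.

Lemma mode_amp : mode amp1 /\ mode amp2.
Proof.
have S al := @Sb_amp (modscale R) al lq (((mode_Sb _).1 mP).2 al) (((mode_Sb _).1 mQ).2 al).
split; apply/mode_Sb; split=> [e e01|al].
- by apply: rsmoothM; [exact: snet_exp|exact: (snet_trig 0)].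
- exact: (S al).1.
- by apply: rsmoothM; [exact: snet_exp|exact: (snet_trig 3)].
- exact: (S al).2.
Qed.

Let m1 := mode_amp.1.
Let m2 := mode_amp.2.

(** Real and imaginary parts of X b = i (p + i q) b, which is the equation for b after
    multiplication by i. *)
Lemma amp_eq : nul (fun e y => X amp1 e y + q e y * amp1 e y + p e y * amp2 e y) /\
  nul (fun e y => X amp2 e y - p e y * amp1 e y + q e y * amp2 e y).
Proof.
have NP := nul_X_prim mp; have NQ := nul_X_prim mq.
have sQ := mQ.1; have sP := mP.1.
have sQN : snet (fun e y => - prim (along g q) e y) by move=> e e01; apply: rsmoothN; exact: sQ.
have XE e y : 0 < e <= 1 -> X amp_exp e y = - amp_exp e y * X (prim (along g q)) e y.
  move=> e01.
  rewrite (@Xcomp1 expR expR (fun e y => - prim (along g q) e y) e y (@is_derive_expR R) e01 sQN).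
  have D (x : R) : is_derive x (1 : R) (fun x : R => - x) (- 1) by apply: is_deriveN.
  by rewrite (@Xcomp1 (fun x => - x) (fun=> - 1) (prim (along g q)) e y D e01 sQ) mulN1r mulrN mulNr.
have XC e y : 0 < e <= 1 -> X (fun e y => cos (amp_arg e y)) e y = - sin (amp_arg e y) * X amp_arg e y.
  by move=> e01; rewrite (@Xcomp1 cos (fun x => - sin x) amp_arg e y (@is_derive_cos R)).
have XS e y : 0 < e <= 1 -> X (fun e y => sin (amp_arg e y)) e y = cos (amp_arg e y) * X amp_arg e y.
  by move=> e01; rewrite (@Xcomp1 sin cos amp_arg e y (@is_derive_sin R)).
have O1 := m1.2 [::]; have O2 := m2.2 [::].
have sc : snet (fun e y => cos (amp_arg e y)) := snet_trig 0.
have ss : snet (fun e y => sin (amp_arg e y)) := snet_trig 3.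
split.
- have N := nulD (nulM O1 NQ) (nulM O2 NP).
  apply: nul_ext (nulN N) => e e01 y; rewrite /dnet /=.
  rewrite {1}/amp1 (XM _ e01 snet_exp sc) (XE _ _ e01) (XC _ _ e01) /amp1 /amp2 /amp_arg.
  by set P1 := Xop _ _ _ _; set Q1 := Xop _ _ _ _; set c := cos _; set s := sin _; set E := amp_exp _ _; ring.
- have N := nulB (nulM O1 NP) (nulM O2 NQ).
  apply: nul_ext N => e e01 y; rewrite /dnet /=.
  rewrite {1}/amp2 (XM _ e01 snet_exp ss) (XE _ _ e01) (XS _ _ e01) /amp1 /amp2 /amp_arg.
  by set P1 := Xop _ _ _ _; set Q1 := Xop _ _ _ _; set c := cos _; set s := sin _; set E := amp_exp _ _; ring.
Qed.

Lemma amp_init e x : amp1 e (tx 0 x) = 1 /\ amp2 e (tx 0 x) = 0.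
Proof.
rewrite /amp1 /amp2 /amp_exp /amp_arg /prim tx_t !mul0r oppr0 expR0 cos0 sin0.
by rewrite mul1r mulr0.
Qed.

Section Data.
Variables w1 w2 : rnet n.
Hypothesis (mw1 : mode w1) (mw2 : mode w2).

Definition transported (w : rnet n) : rnet (1 + n) :=
  pull (@zero_s R n) (fun e z => w e (\row_h g h e z)).

Lemma mode_transported w : mode w -> mode (transported w).
Proof.
by move=> mw; apply: (pull_mode (@mode_zero_s R n) Bzero); exact: mode_comp.
Qed.

(** By the chain rule the result is a combination of the [Xs A (g k)] with moderate coefficients,
    and these are null. *)
Lemma nul_X_transported w : mode w -> nul (X (transported w)).
Proof.
move=> mw.
have mc : mode (fun e z => w e (\row_h g h e z)) by exact: mode_comp.
pose N e z := \sum_k (fun e z => dnet [:: k] w e (\row_h g h e z)) e z * Xs A (g k) e z.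
have nN : nul N.
  apply: nul_sum => k; apply: nulM; last exact: nulZ.
  exact: (mode_comp cg (mode_dnet [:: k] mw) mg).2 [::].
apply: nul_ext (pull_nul Bzero nN) => e e01 y.
rewrite X_zero_s //; last exact: mc.1.
rewrite /pull; set z := zero_s y.
have D i : dnet [:: i] (fun e z => w e (\row_h g h e z)) e z = \sum_k dnet [:: i] (g k) e z * dnet [:: k] w e (\row_h g h e z).
  by rewrite /dnet /= (dpart_comp i z (mw.1 e e01) (fun k => (mg k).1 e e01)).
rewrite /N {1}/Xs D.
under [X in _ - X]eq_bigr => j _ do rewrite D mulr_sumr.
rewrite exchange_big /= -sumrB; apply: eq_bigr => k _.
rewrite /Xs mulrBr mulr_sumr mulrC; congr (_ - _).
by apply: eq_bigr => j _; rewrite /dnet /=; ring.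
Qed.

(** At t = 0 the slice s = 0 meets the diagonal s = t, where gamma is x up to a null net. *)
Lemma nul_transported_init w : mode w -> nul (fun e x => transported w e (tx 0 x) - w e x).
Proof.
move=> mw.
pose G h : rnet n := fun e x => g h e (zero_s (tx 0 x)).
pose H h : rnet n := fun _ x => x 0 h.
have B M (x : 'rV[R]_n) : 0 <= M -> box _ M x -> box _ M (tx 0 x).
  by move=> M0 Bx; apply: tx_ind => [|h]; rewrite ?tx_t ?tx_x ?normr0.
have cG : cbd G.
  move=> M; have [M' HM'] := cg (Num.max M 0); exists M'; apply: filterS HM' => e HH x Bx k.
  apply: HH; apply: box_zero_s; apply: B; first by rewrite le_max lexx orbT.
  by apply: box_le Bx; rewrite le_max lexx.
have cH : cbd H by move=> M; exists M; apply: nearW => e x Bx k; exact: Bx.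
have GH h : nul (fun e x => G h e x - H h e x).
  move=> M k; have F := flow_init ok h (Num.max M 0) k.
  apply: filterS F => e F x Bx.
  have := F (tx 0 x); rewrite /pull tx_x /G /H.
  have -> : diag (tx 0 x) = zero_s (tx 0 x) by rewrite /diag /zero_s tx_t.
  apply; apply: B; first by rewrite le_max lexx orbT.
  by apply: box_le Bx; rewrite le_max lexx.
apply: nul_ext (nul_compB cG cH mw GH) => e _ x.
by rewrite /transported /pull; congr (_ - w e _); apply/rowP => k; rewrite [in RHS]mxE.
Qed.

Definition sol1 : rnet (1 + n) := fun e y => amp1 e y * transported w1 e y - amp2 e y * transported w2 e y.
Definition sol2 : rnet (1 + n) := fun e y => amp1 e y * transported w2 e y + amp2 e y * transported w1 e y.

Let mt1 := mode_transported mw1.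
Let mt2 := mode_transported mw2.

Lemma mode_sol : mode sol1 /\ mode sol2.
Proof. by split; [apply: modeB|apply: modeD]; apply: modeM. Qed.

Lemma sol_eq : nul (fun e y => X sol1 e y + q e y * sol1 e y + p e y * sol2 e y) /\
  nul (fun e y => X sol2 e y - p e y * sol1 e y + q e y * sol2 e y).
Proof.
have [N1 N2] := amp_eq.
have T1 := nul_X_transported mw1; have T2 := nul_X_transported mw2.
have O1 := m1.2 [::]; have O2 := m2.2 [::].
have Q1 := mt1.2 [::]; have Q2 := mt2.2 [::].
have s1 := m1.1; have s2 := m2.1; have st1 := mt1.1; have st2 := mt2.1.
have sM u v : snet u -> snet v -> snet (fun e (y : 'rV[R]_(1 + n)) => u e y * v e y).
  by move=> su sv e e01; apply: rsmoothM; [exact: su|exact: sv].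
split.
- have N := nulB (nulD (nulM Q1 N1) (nulM O1 T1)) (nulD (nulM Q2 N2) (nulM O2 T2)).
  apply: nul_ext N => e e01 y; rewrite /dnet /= /sol1.
  rewrite (XB y e01 (sM _ _ s1 st1) (sM _ _ s2 st2)) (XM y e01 s1 st1) (XM y e01 s2 st2) /sol2.
  ring.
- have N := nulD (nulD (nulM Q2 N1) (nulM O1 T2)) (nulD (nulM Q1 N2) (nulM O2 T1)).
  apply: nul_ext N => e e01 y; rewrite /dnet /= /sol2.
  rewrite (XD y e01 (sM _ _ s1 st2) (sM _ _ s2 st1)) (XM y e01 s1 st2) (XM y e01 s2 st1) /sol1.
  ring.
Qed.

Lemma sol_init : nul (fun e x => sol1 e (tx 0 x) - w1 e x) /\ nul (fun e x => sol2 e (tx 0 x) - w2 e x).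
Proof.
have I1 := nul_transported_init mw1; have I2 := nul_transported_init mw2.
split.
- apply: nul_ext I1 => e _ x; rewrite /sol1; have [-> ->] := amp_init e x; by rewrite mul1r mul0r subr0.
- apply: nul_ext I2 => e _ x; rewrite /sol2; have [-> ->] := amp_init e x; by rewrite mul1r mul0r addr0.
Qed.

End Data.

(** The complex equation is a real 2 by 2 system with rows (-q, -p) and (p, -q), an instance of
    [transport_unique]. *)
Lemma system_unique v1 v2 : mode v1 -> mode v2 ->
  nul (fun e y => X v1 e y + q e y * v1 e y + p e y * v2 e y) ->
  nul (fun e y => X v2 e y - p e y * v1 e y + q e y * v2 e y) ->
  nul (fun e (x : 'rV[R]_n) => v1 e (tx 0 x)) -> nul (fun e (x : 'rV[R]_n) => v2 e (tx 0 x)) ->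
  nul v1 /\ nul v2.
Proof.
move=> mv1 mv2 N1 N2 I1 I2.
pose v (i : 'I_2) := if i == ord0 then v1 else v2.
pose C (i j : 'I_2) : rnet (1 + n) := if i == j then fun e y => - q e y else
  if i == ord0 then fun e y => - p e y else p.
have lN f : logbound (modscale R) f -> logbound (modscale R) (fun e (y : 'rV[R]_(1 + n)) => - f e y).
  by move=> H M; have [l Pl Hl] := H M; exists l => //; apply: filterS Hl => e Hl y By; rewrite normrN Hl.
have H := transport_unique mg cg (flow_ode ok) (flow_init ok) (v := v) (C := C).
have K : forall i, nul (v i).
  apply: H.
  - by move=> i; rewrite /v; case: ifP.
  - by move=> i j; rewrite /C; case: ifP => _; [exact: lN|case: ifP => // _; exact: lN].
  - move=> i; case: (unliftP ord0 i) => [j ->|->].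
      apply: nul_ext N2 => e _ y; rewrite big_ord_recl big_ord1 (ord1 j) /v /C /=; ring.
    by apply: nul_ext N1 => e _ y; rewrite big_ord_recl big_ord1 /v /C /=; ring.
  - by move=> i; rewrite /v; case: ifP.
by split; [exact: (K ord0)|exact: (K (lift ord0 ord0))].
Qed.

End Amplitude.

End Solution.

(** * Fourier inversion *)

Section Iterated.
Variable R : realType.
Local Notation mu := (@lebesgue_measure R).

Lemma Rintegral_FTC_seg (H dH : R -> R) a b : a <= b -> (forall x : R, is_derive x 1 H (dH x)) ->
  continuous dH -> \int[mu]_(x in `[a, b]) dH x = H b - H a.
Proof.
rewrite le_eqVlt => /predU1P[->|ab] HH cd.
  by rewrite set_itv1 Rintegral_set1 subrr.
rewrite /Rintegral.
have cH : continuous H.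
  move=> x; apply: differentiable_continuous; apply/derivable1_diffP.
  by have [] := HH x.
rewrite (@continuous_FTC2 R dH H a b) //.
- exact: continuous_subspaceT.
- split=> [x _||]; first by have [] := HH x.
    by apply: cvg_at_right_filter; exact: cH.
  by apply: cvg_at_left_filter; exact: cH.
- by move=> x _; rewrite derive1E; have [_ ->] := HH x.
Qed.

Lemma continuous_line d (F : 'rV[R]_d -> R) z i : rsmooth F ->
  continuous (fun x : R => F (z + x *: delta_mx 0 i)).
Proof.
move=> sF x; apply: differentiable_continuous; apply/derivable1_diffP.
by have [] := @is_derive_line R _ F z (delta_mx 0 i) x (rsmooth_derivable sF _ _).
Qed.

Lemma rsmooth_eq d (f h : 'rV[R]_d -> R) : f =1 h -> rsmooth h -> rsmooth f.
Proof. by move=> /funext ->. Qed.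

(* U(z) = z_i int_0^1 F(z with z_i replaced by theta z_i) dtheta. *)
Lemma antiderivative d (F : 'rV[R]_d -> R) i : rsmooth F ->
  exists2 U, rsmooth U & dpart i U = F.
Proof.
move=> sF.
pose th : 'I_(d + 1) := rshift d ord0.
pose c k (w : 'rV[R]_(d + 1)) : R := if k == i then w 0 (lshift 1 i) * w 0 th else w 0 (lshift 1 k).
have sc k : rsmooth (c k).
  by rewrite /c; case: (k == i); [apply: rsmoothM|]; exact: rsmooth_coord.
pose G (w : 'rV[R]_(d + 1)) := F (\row_k c k w).
have sG : rsmooth G by exact: rsmooth_comp.
have sP : rsmooth (pint G 0 1) by apply: rsmooth_pint => //; exact: ler01.
have si : rsmooth (fun z : 'rV[R]_d => z 0 i) by exact: rsmooth_coord.
exists (fun z : 'rV[R]_d => z 0 i * pint G 0 1 z); first exact: rsmoothM.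
apply/funext => z; rewrite (dpart_mul i z si sP) dpart_coord eqxx mul1r.
have EcJ (t : R) : \row_k c k (jn z t) = (z - z 0 i *: delta_mx 0 i) + (z 0 i * t) *: delta_mx 0 i.
  apply/rowP => k; rewrite !mxE eqxx /= /c; case: eqP => [->|_].
    by rewrite /jn row_mxEl row_mxEr mxE eqxx !mulr1 mulr1n subrr add0r.
  by rewrite /jn row_mxEl !mulr0 subr0 addr0.
have DG w : dpart (lshift 1 i) G w = w 0 th * dpart i F (\row_k c k w).
  rewrite /G dpart_comp // (bigD1 i) //= big1 ?addr0 => [|k ki].
    have -> : c i = fun w => w 0 (lshift 1 i) * w 0 th by apply/funext => x; rewrite /c eqxx.
    rewrite (dpart_mul _ _ (rsmooth_coord _ _) (rsmooth_coord _ _)) !dpart_coord eqxx mul1r.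
    by rewrite eq_rlshift mulr0 addr0.
  have -> : c k = fun w => w 0 (lshift 1 k) by apply/funext => x; rewrite /c (negbTE ki).
  by rewrite dpart_coord (inj_eq (@lshift_inj _ _)) (negbTE ki) mul0r.
have DP : dpart i (pint G 0 1) z = pint (dpart (lshift 1 i) G) 0 1 z.
  by have [_] := is_derive_pint 0 1 z i sG.
rewrite DP.
have cG : continuous G by exact: rsmooth_continuous.
have cD : continuous (dpart (lshift 1 i) G) by apply: rsmooth_continuous; exact: rsmooth_dpart.
rewrite -pintZ // -pintD //; last by move=> w; apply: continuousM; [exact: cst_continuous|exact: cD].
pose z0 := z - z 0 i *: delta_mx 0 i.
pose u (t : R) : R := F (z0 + (z 0 i * t) *: delta_mx 0 i).
pose v (t : R) : R := dpart i F (z0 + (z 0 i * t) *: delta_mx 0 i).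
have HH (t : R) : is_derive t (1 : R) (fun t => t * u t) (u t + z 0 i * (t * v t)).
  have L := @is_derive_line R _ F z0 (delta_mx 0 i) (z 0 i * t) (rsmooth_derivable sF _ _).
  have L2 : is_derive t (1 : R) (fun t : R => z 0 i * t) (z 0 i).
    have := is_deriveM (is_derive_cst (z 0 i) t (1 : R)) (is_derive_id t (1 : R)).
    by move=> /is_derive_congr; apply; rewrite scaler0 addr0 [_ *: _]mulr1.
  have L3 := @is_derive_comp1 R R _ (fun t => z 0 i * t) t 1 _ _ L L2.
  have := is_deriveM (is_derive_id t (1 : R)) L3.
  by move=> /is_derive_congr; apply; rewrite /u /v /dpart /GRing.scale /=; ring.
have cu : continuous u.
  have -> : u = fun t => G (jn z t) by apply/funext => t; rewrite /G EcJ.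
  exact: continuous_jnF.
have cv : continuous v.
  have -> : v = fun t => dpart i F (\row_k c k (jn z t)) by apply/funext => t; rewrite EcJ.
  apply: (@continuous_jnF R _ (fun w => dpart i F (\row_k c k w)) z).
  exact: rsmooth_continuous (rsmooth_comp (rsmooth_dpart i sF) sc).
have cd : continuous (fun t => u t + z 0 i * (t * v t)).
  move=> t; apply: continuousD; first exact: cu.
  apply: continuousM; first exact: cst_continuous.
  by apply: continuousM; [exact: cvg_id|exact: cv].
have u1 : u 1 = F z by rewrite /u mulr1 subrK.
have := Rintegral_FTC_seg ler01 HH cd.
rewrite [1 * _]mul1r [0 * _]mul0r subr0 u1 => <-.
apply: eq_Rintegral => t _; rewrite DG /G EcJ -/z0 /jn row_mxEr mxE eqxx mulr1n //.
Qed.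

Lemma jn_line (x y : R) : jn (x%:M : 'rV[R]_1) y = jn 0 y + x *: delta_mx 0 (lshift 1 ord0).
Proof.
have -> : x%:M = x *: delta_mx 0 ord0 + 0 :> 'rV[R]_1.
  by apply/rowP => k; rewrite !mxE (ord1 k) eqxx mulr1n mulr1 addr0.
by rewrite jn_shift addrC.
Qed.

(** With [U] an antiderivative of [G] in the first variable, both sides equal the integral over
    [c, d] of the increment of [U]: one by integrating inside, the other because differentiating the
    integral of [U] under the integral sign gives that of [G]. *)
Lemma fubini_segment (G : 'rV[R]_(1 + 1) -> R) (a b c d : R) : a <= b -> c <= d -> rsmooth G ->
  \int[mu]_(x in `[a, b]) \int[mu]_(y in `[c, d]) G (jn (x%:M : 'rV[R]_1) y) =
  \int[mu]_(y in `[c, d]) \int[mu]_(x in `[a, b]) G (jn (x%:M : 'rV[R]_1) y).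
Proof.
move=> ab cd sG.
have [U sU EU] := antiderivative (lshift 1 ord0) sG.
have cU : continuous U by exact: rsmooth_continuous.
have inner y : \int[mu]_(x in `[a, b]) G (jn (x%:M : 'rV[R]_1) y) =
    U (jn (b%:M : 'rV[R]_1) y) - U (jn (a%:M : 'rV[R]_1) y).
  pose H (x : R) := U (jn 0 y + x *: delta_mx 0 (lshift 1 ord0)).
  pose dH (x : R) := G (jn 0 y + x *: delta_mx 0 (lshift 1 ord0)).
  have HH x : is_derive x (1 : R) H (dH x).
    have := @is_derive_line R _ U (jn 0 y) (delta_mx 0 (lshift 1 ord0)) x (rsmooth_derivable sU _ _).
    by rewrite -/(dpart _ U _) EU.
  have cdH : continuous dH.
    exact: continuous_line.
  have := Rintegral_FTC_seg ab HH cdH; rewrite /H -!jn_line => <-.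
  by apply: eq_Rintegral => x _; rewrite jn_line.
have -> : \int[mu]_(y in `[c, d]) \int[mu]_(x in `[a, b]) G (jn (x%:M : 'rV[R]_1) y) =
  \int[mu]_(y in `[c, d]) (U (jn (b%:M : 'rV[R]_1) y) - U (jn (a%:M : 'rV[R]_1) y)).
  by apply: eq_Rintegral => y _; exact: inner.
have IU x : mu.-integrable `[c, d] (EFin \o (fun y => U (jn (x%:M : 'rV[R]_1) y))).
  by apply: continuous_integrable; exact: continuous_jnF.
rewrite RintegralB //; try exact: IU.
have Ex (x : R) : x%:M = 0 + x *: delta_mx 0 ord0 :> 'rV[R]_1.
  by apply/rowP => k; rewrite !mxE (ord1 k) eqxx mulr1n mulr1 add0r.
pose V (x : R) := pint U c d (0 + x *: delta_mx 0 ord0).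
pose dV (x : R) := pint G c d (0 + x *: delta_mx 0 ord0).
have HV x : is_derive x (1 : R) V (dV x).
  have [D1 D2] := is_derive_pint c d (0 + x *: delta_mx 0 ord0 : 'rV[R]_1) ord0 sU.
  have := @is_derive_line R _ (pint U c d) 0 (delta_mx 0 ord0) x D1.
  by rewrite D2 EU.
have cdV : continuous dV.
  by apply: continuous_line; exact: rsmooth_pint.
have := Rintegral_FTC_seg ab HV cdV.
rewrite /V -!Ex => <-; apply: eq_Rintegral => x _.
by rewrite /dV -Ex.
Qed.

Definition supported d (M : R) (F : 'rV[R]_d -> R) := forall z, ~ box d M z -> F z = 0.

Lemma Rintegral_supp (f : R -> R) M : (forall x, M < `|x| -> f x = 0) ->
  \int[mu]_(x in setT) f x = \int[mu]_(x in `[- M, M]) f x.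
Proof.
move=> Hf; rewrite [RHS]Rintegral_mkcond; apply: eq_Rintegral => x _.
rewrite patchE; case: ifPn => // /negP H; apply: Hf.
rewrite ltNge; apply/negP => xM; apply: H; rewrite inE /= in_itv /=.
by rewrite -ler_norml.
Qed.

(** [intRn] peels off the first variable of integration, which an induction turns into an additional
    parameter; the two index types are equal but not convertible. *)
Definition assoc_rV k m (w : 'rV[R]_((k + 1) + m)) : 'rV[R]_(k + (1 + m)) :=
  row_mx (lsubmx (lsubmx w)) (row_mx (rsubmx (lsubmx w)) (rsubmx w)).

Lemma assoc_row k m (z : 'rV[R]_k) (x : 'rV[R]_1) (y : 'rV[R]_m) :
  assoc_rV (row_mx (row_mx z x) y) = row_mx z (row_mx x y).
Proof. by rewrite /assoc_rV !(row_mxKl, row_mxKr). Qed.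

Lemma rsmooth_assoc k m (G : 'rV[R]_(k + (1 + m)) -> R) : rsmooth G ->
  rsmooth (fun w => G (assoc_rV w)).
Proof.
move=> sG; apply: (rsmooth_precomp (io := @assoc_rV k m)) => // l.
case: (fintype.splitP l) => j Ej.
  have -> : l = lshift (1 + m) j by apply/val_inj.
  by apply: rsmooth_eq (rsmooth_coord _ (lshift m (lshift 1 j))) => w; rewrite /assoc_rV row_mxEl !mxE.
have -> : l = rshift k j by apply/val_inj.
case: (@fintype.splitP 1 m j) => h Eh.
  have -> : j = lshift m h by apply/val_inj.
  by apply: rsmooth_eq (rsmooth_coord _ (lshift m (rshift k h))) => w; rewrite /assoc_rV row_mxEr row_mxEl !mxE.
have -> : j = rshift 1 h by apply/val_inj.
by apply: rsmooth_eq (rsmooth_coord _ (rshift (k + 1) h)) => w; rewrite /assoc_rV !row_mxEr !mxE.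
Qed.

Lemma box_row_mx k m M (z : 'rV[R]_k) (y : 'rV[R]_m) :
  box (k + m) M (row_mx z y) <-> box k M z /\ box m M y.
Proof.
split=> [H|[Hz Hy] l].
  split=> j; first by have := H (lshift m j); rewrite row_mxEl.
  by have := H (rshift k j); rewrite row_mxEr.
by case: (fintype.splitP l) => j Ej;
  [have -> : l = lshift m j by apply/val_inj|have -> : l = rshift k j by apply/val_inj];
  rewrite ?row_mxEl ?row_mxEr.
Qed.

Lemma box_scalar M (x : R) : box 1 M (x%:M) <-> `|x| <= M.
Proof.
split=> [/(_ ord0)|H k]; first by rewrite mxE eqxx mulr1n.
by rewrite mxE (ord1 k) eqxx mulr1n.
Qed.

Lemma supported_assoc k m M (G : 'rV[R]_(k + (1 + m)) -> R) : supported M G ->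
  supported M (fun w => G (assoc_rV w)).
Proof.
move=> sG w Bw; apply: sG => /box_row_mx[B1 /box_row_mx[B2 B3]]; apply: Bw.
rewrite -[w]hsubmxK; apply/box_row_mx; split=> //.
by rewrite -[lsubmx w]hsubmxK; apply/box_row_mx.
Qed.

(** The support confines each one-dimensional integral to [-M, M], where [rsmooth_pint] applies. The
    number k of parameters is general because each step of the induction adds one. *)
Lemma intRn_smooth k m M (G : 'rV[R]_(k + m) -> R) : 0 <= M -> rsmooth G -> supported M G ->
  rsmooth (fun z => intRn (fun y : 'rV[R]_m => G (row_mx z y))) /\
  supported M (fun z => intRn (fun y : 'rV[R]_m => G (row_mx z y))).
Proof.
move=> M0; elim: m k G => [|m ih] k G sG suG.
  split=> /=.
    apply: (rsmooth_precomp (io := fun z => row_mx z 0)) => // l.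
    case: (fintype.splitP l) => j Ej; last by case: j {Ej}.
    have -> : l = lshift 0 j by apply/val_inj.
    by apply: rsmooth_eq (rsmooth_coord _ j) => w; rewrite row_mxEl.
  by move=> z Bz; apply: suG => /box_row_mx[].
have [sK suK] := ih (k + 1)%N _ (rsmooth_assoc sG) (supported_assoc suG).
set K := (fun z : 'rV[R]_(k + 1) => _) in sK suK.
have E z : intRn (fun y : 'rV[R]_m.+1 => G (row_mx z y)) = pint K (- M) M z.
  rewrite /= (@Rintegral_supp _ M).
    apply: eq_Rintegral => x _; rewrite /K; congr intRn; apply/funext => y.
    by rewrite /jn assoc_row.
  move=> x Mx; have := suK (jn z x); rewrite /K.
  have -> : (fun y : 'rV[R]_m => G (assoc_rV (row_mx (jn z x) y))) = fun y => G (row_mx z (row_mx x%:M y)).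
    by apply/funext => y; rewrite /jn assoc_row.
  by apply; move=> /box_row_mx[_ /box_scalar]; rewrite leNgt Mx.
split.
  by apply: rsmooth_eq E _; apply: rsmooth_pint => //; rewrite ge0_cp.
move=> z Bz; rewrite E /pint.
have -> : \int[mu]_(th in `[(- M), M]) K (jn z th) = \int[mu]_(th in `[(- M), M]) 0.
  by apply: eq_Rintegral => th _; apply: suK => /box_row_mx[].
by rewrite Rintegral_cst ?mul0r //; exact: measurable_itv.
Qed.

Lemma rsmooth_row_cst k m (z : 'rV[R]_k) (G : 'rV[R]_(k + m) -> R) : rsmooth G ->
  rsmooth (fun y : 'rV[R]_m => G (row_mx z y)).
Proof.
move=> sG; apply: (rsmooth_precomp (io := fun y => row_mx z y)) => // l.
case: (fintype.splitP l) => j Ej.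
  have -> : l = lshift m j by apply/val_inj.
  by apply: rsmooth_eq (rsmooth_cst (z 0 j)) => w; rewrite row_mxEl.
have -> : l = rshift k j by apply/val_inj.
by apply: rsmooth_eq (rsmooth_coord _ j) => w; rewrite row_mxEr.
Qed.

(** The outer variable is exchanged with the next one on a square, and with the remaining ones by
    induction while that one is frozen. *)
Lemma intRn_swap m M (G : 'rV[R]_(1 + m) -> R) : 0 <= M -> rsmooth G -> supported M G ->
  \int[mu]_(x in setT) intRn (fun y : 'rV[R]_m => G (row_mx x%:M y)) =
  intRn (fun y : 'rV[R]_m => \int[mu]_(x in setT) G (row_mx x%:M y)).
Proof.
move=> M0; elim: m G => [|m ih] G sG suG //=.
have [sK suK] := @intRn_smooth (1 + 1) m M _ M0 (rsmooth_assoc (G := G) sG) (supported_assoc suG).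
set K := (fun z : 'rV[R]_(1 + 1) => _) in sK suK.
have EK (x y1 : R) : intRn (fun y : 'rV[R]_m => G (row_mx x%:M (row_mx y1%:M y))) = K (jn (x%:M : 'rV[R]_1) y1).
  by rewrite /K; congr intRn; apply/funext => y; rewrite /jn assoc_row.
have K0 (x y1 : R) : M < `|x| \/ M < `|y1| -> K (jn (x%:M : 'rV[R]_1) y1) = 0.
  move=> H; apply: suK => /box_row_mx[/box_scalar H1 /box_scalar H2].
  by case: H; rewrite ltNge ?H1 ?H2.
have Z0 (f : R -> R) : (forall x, f x = 0) -> \int[mu]_(x in setT) f x = 0.
  move=> Hf; rewrite (@Rintegral_supp _ 0) // oppr0 set_itv1 Rintegral_set1 //.
have inner x : \int[mu]_(y1 in setT) K (jn (x%:M : 'rV[R]_1) y1) = \int[mu]_(y1 in `[- M, M]) K (jn (x%:M : 'rV[R]_1) y1).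
  by apply: Rintegral_supp => y1 H; apply: K0; right.
have inner2 y1 : \int[mu]_(x in setT) K (jn (x%:M : 'rV[R]_1) y1) = \int[mu]_(x in `[- M, M]) K (jn (x%:M : 'rV[R]_1) y1).
  by apply: Rintegral_supp => x H; apply: K0; left.
have MM : - M <= M by lra.
transitivity (\int[mu]_(x in setT) \int[mu]_(y1 in setT) K (jn (x%:M : 'rV[R]_1) y1)).
  by apply: eq_Rintegral => x _; apply: eq_Rintegral => y1 _; rewrite EK.
transitivity (\int[mu]_(x in `[- M, M]) \int[mu]_(y1 in `[- M, M]) K (jn (x%:M : 'rV[R]_1) y1)).
  rewrite (@Rintegral_supp _ M); first by apply: eq_Rintegral => x _; exact: inner.
  by move=> x Mx; apply: Z0 => y1; apply: K0; left.
rewrite fubini_segment //.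
transitivity (\int[mu]_(y1 in setT) \int[mu]_(x in setT) K (jn (x%:M : 'rV[R]_1) y1)).
  rewrite [RHS](@Rintegral_supp _ M); first by apply: eq_Rintegral => y1 _; rewrite inner2.
  by move=> y1 My1; apply: Z0 => x; apply: K0; right.
apply: eq_Rintegral => y1 _.
pose swp (w : 'rV[R]_(1 + m)) : 'rV[R]_(1 + (1 + m)) := row_mx (lsubmx w) (row_mx y1%:M (rsubmx w)).
have ss : rsmooth (fun w => G (swp w)).
  apply: (rsmooth_precomp (io := swp)) => // l.
  case: (fintype.splitP l) => j Ej.
    have -> : l = lshift (1 + m) j by apply/val_inj.
    by apply: rsmooth_eq (rsmooth_coord _ (lshift m j)) => w; rewrite /swp row_mxEl mxE.
  have -> : l = rshift 1 j by apply/val_inj.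
  case: (@fintype.splitP 1 m j) => h Eh.
    have -> : j = lshift m h by apply/val_inj.
    by apply: rsmooth_eq (rsmooth_cst ((y1%:M : 'rV[R]_1) 0 h)) => w; rewrite /swp row_mxEr row_mxEl.
  have -> : j = rshift 1 h by apply/val_inj.
  by apply: rsmooth_eq (rsmooth_coord _ (rshift 1 h)) => w; rewrite /swp !row_mxEr mxE.
have su : supported M (fun w => G (swp w)).
  move=> w Bw; apply: suG => /(@box_row_mx 1 (1 + m)) [B1 /(@box_row_mx 1 m) [_ B3]]; apply: Bw.
  by rewrite -[w]hsubmxK; apply/box_row_mx.
have := ih _ ss su.
have E (x : R) (y : 'rV[R]_m) : swp (row_mx x%:M y) = row_mx x%:M (row_mx y1%:M y).
  by rewrite /swp row_mxKl row_mxKr.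
under eq_Rintegral => x _.
  under [fun y => _]eq_fun do rewrite E.
  rewrite EK; over.
move=> ->; congr intRn; apply/funext => y; apply: eq_Rintegral => x _; by rewrite E.
Qed.

End Iterated.

(** * Dominated convergence on the line and on segments *)

Section RealLineLimits.
Variable R : realType.
Local Notation mu := (@lebesgue_measure R).

Lemma integrable_oneDsqrV (K : R) : mu.-integrable setT (EFin \o (fun x : R => K * (1 + x ^+ 2)^-1)).
Proof.
suff H : mu.-integrable setT (EFin \o (fun x : R => (oneDsqr x)^-1)).
  exact: (integrableZl _ K H).
apply/integrableP; split.
  apply/measurable_EFinP; apply: continuous_measurable_fun; exact: continuous_oneDsqrV.
have -> : (\int[mu]_x `|(EFin \o (fun x : R => (oneDsqr x)^-1)%R) x| = \int[mu]_x ((oneDsqr x)^-1)%:E)%E.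
  apply: eq_integral => x _ /=; rewrite ger0_norm // invr_ge0 /oneDsqr addr_ge0 // sqr_ge0.
rewrite ge0_symfun_integralT.
- rewrite -set_itvcy integral0y_oneDsqr -EFinM; exact: ltry.
- by move=> x; rewrite invr_ge0 /oneDsqr addr_ge0 // sqr_ge0.
- exact: continuous_oneDsqrV.
- by move=> x /=; rewrite /oneDsqr sqrrN.
Qed.

Lemma decay_integrable (f : R -> R) K : continuous f ->
  (forall x, (1 + x ^+ 2) * `|f x| <= K) -> mu.-integrable setT (EFin \o f).
Proof.
move=> cf Hf.
apply: (le_integrable measurableT _ _ (integrable_oneDsqrV K)).
  by apply/measurable_EFinP; exact: continuous_measurable_fun.
move=> x _; rewrite /= lee_fin.
have p0 : 0 < 1 + x ^+ 2 by rewrite ltr_pwDl // sqr_ge0.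
rewrite [leRHS]ger0_norm; first by rewrite ler_pdivlMr // mulrC.
by rewrite divr_ge0 ?(ltW p0) //; apply: le_trans (Hf x); rewrite mulr_ge0 // ltW.
Qed.

(** The absolute value of f is itself the dominating function: the factors [h m] are at most 1 and
    the windows only remove mass. *)
Lemma truncated_cvg (f : R -> R) (h : nat -> R -> R) (N : nat -> R) K : continuous f ->
  (forall x, (1 + x ^+ 2) * `|f x| <= K) ->
  (forall m, continuous (h m)) -> (forall m x, `|h m x| <= 1) ->
  (forall x, h m x @[m --> \oo] --> (1 : R)) ->
  N m @[m --> \oo] --> +oo%R ->
  \int[mu]_(x in `[- N m, N m]) (h m x * f x) @[m --> \oo] --> \int[mu]_(x in setT) f x.
Proof.
move=> cf Hf ch h1 hl Noo.
pose F m (x : R) : R := h m x * f x * \1_(`[- N m, N m]%classic) x.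
have If := decay_integrable cf Hf.
have mF m : measurable_fun setT (EFin \o F m).
  apply/measurable_EFinP; apply: measurable_funM; last exact: measurable_indic.
  apply: measurable_funM; apply: continuous_measurable_fun; [exact: ch|exact: cf].
have mf : measurable_fun setT (EFin \o f).
  by apply/measurable_EFinP; exact: continuous_measurable_fun.
have FF : {ae mu, forall x, setT x -> (fun m => (EFin \o F m) x) @ \oo --> (EFin \o f) x}.
  apply: aeW => x _; apply: cvg_EFin; first exact: nearW.
  have : (fun m => h m x * f x) @ \oo --> f x.
    by rewrite -[X in _ --> X]mul1r; apply: cvgM; [exact: hl|exact: cvg_cst].
  apply: cvg_trans; apply: near_eq_cvg.
  have : \forall m \near \oo, `|x| <= N m by move/cvgryPge : Noo; apply.
  apply: filterS => m Hm; rewrite /= /F indicE mem_set ?mulr1 //= in_itv /=.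
  by rewrite -ler_norml.
have FG : {ae mu, forall x m, setT x -> (`|(EFin \o F m) x| <= (EFin \o (fun x => `|f x|)%R) x)%E}.
  apply: aeW => x m _; rewrite /= lee_fin /F indicE; case: (x \in _); last by rewrite mulr0 normr0.
  by rewrite mulr1 normrM ler_piMl.
have [_ _ H] := @dominated_convergence _ _ R mu setT measurableT (fun m => EFin \o F m) (EFin \o f)
  (EFin \o (fun x => `|f x|)%R) mF mf FF (integrable_norm If) FG.
have E m : (\int[mu]_(x in setT) (EFin \o F m) x = (\int[mu]_(x in `[(- N m)%R, N m]) (h m x * f x)%:E))%E.
  rewrite [RHS]integral_mkcond; apply: eq_integral => x _.
  by rewrite /= /F patchE indicE; case: ifP; rewrite ?mulr1 ?mulr0.
rewrite /Rintegral; apply: fine_cvg.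
rewrite fineK; last first.
  exact: integrable_fin_num.
by move: H; under eq_fun do rewrite E.
Qed.

Lemma bounded_cvg0 (f : nat -> R -> R) a b C : (forall m, continuous (f m)) ->
  (forall m x, a <= x <= b -> `|f m x| <= C) -> (forall x, f m x @[m --> \oo] --> (0 : R)) ->
  \int[mu]_(x in `[a, b]) f m x @[m --> \oo] --> (0 : R).
Proof.
move=> cf fC f0.
have mI : measurable `[a, b]%classic by exact: measurable_itv.
have mF m : measurable_fun `[a, b]%classic (EFin \o f m).
  by apply/measurable_EFinP; apply: measurable_funTS; exact: continuous_measurable_fun.
have FF : {ae mu, forall x, `[a, b]%classic x -> (fun m => (EFin \o f m) x) @ \oo --> (cst 0%E) x}.
  by apply: aeW => x _; apply: cvg_EFin; [exact: nearW|exact: f0].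
have FG : {ae mu, forall x m, `[a, b]%classic x -> (`|(EFin \o f m) x| <= (EFin \o (fun=> C)) x)%E}.
  by apply: aeW => x m /=; rewrite in_itv /= lee_fin => xab; exact: fC.
have IC : mu.-integrable `[a, b]%classic (EFin \o (fun=> C)).
  by apply: continuous_integrable; exact: cst_continuous.
have [_ _ H] := @dominated_convergence _ _ R mu `[a, b]%classic mI (fun m => EFin \o f m) (cst 0%E)
  (EFin \o (fun=> C)) mF (measurable_cst (0%E : \bar R)) FF IC FG.
rewrite integral0 in H.
have : fine (\int[mu]_(x in `[a, b]) (EFin \o f m) x)%E @[m --> \oo] --> fine 0%:E by apply: fine_cvg.
by [].
Qed.

End RealLineLimits.

(** * Damped cosine integrals over a finite interval *)

Section ExpCos.
Variable R : realType.
Local Notation mu := (@lebesgue_measure R).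

Lemma int_exp_cos (a dl N : R) : 0 < dl -> 0 <= N ->
  \int[mu]_(t in `[0, N]) (expR (- dl * t) * cos (a * t)) =
  (dl + expR (- dl * N) * (a * sin (a * N) - dl * cos (a * N))) / (dl ^+ 2 + a ^+ 2).
Proof.
move=> dl0 N0.
have p0 : dl ^+ 2 + a ^+ 2 != 0 by rewrite gt_eqF // ltr_pwDl ?exprn_gt0 // sqr_ge0.
pose dH (t : R) : R := expR (- dl * t) * cos (a * t).
pose H (t : R) : R := expR (- dl * t) * (a * sin (a * t) - dl * cos (a * t)) * (dl ^+ 2 + a ^+ 2)^-1.
have lin (c t : R) : is_derive t (1 : R) (fun t => c * t) c.
  have := is_deriveM (is_derive_cst c t (1 : R)) (is_derive_id t (1 : R)).
  by move=> /is_derive_congr; apply; rewrite scaler0 addr0 /GRing.scale /= mulr1.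
have de (t : R) : is_derive t (1 : R) (fun t => expR (- dl * t)) (expR (- dl * t) * - dl).
  exact: (@is_derive_comp1 R R expR _ t 1 _ _ (is_derive_expR _) (lin _ t)).
have dc (t : R) : is_derive t (1 : R) (fun t => cos (a * t)) (- sin (a * t) * a).
  exact: (@is_derive_comp1 R R cos _ t 1 _ _ (is_derive_cos _) (lin _ t)).
have ds (t : R) : is_derive t (1 : R) (fun t => sin (a * t)) (cos (a * t) * a).
  exact: (@is_derive_comp1 R R sin _ t 1 _ _ (is_derive_sin _) (lin _ t)).
have HH (t : R) : is_derive t (1 : R) H (dH t).
  have h1 := is_deriveM (is_derive_cst a t (1 : R)) (ds t).
  have h2 := is_deriveM (is_derive_cst dl t (1 : R)) (dc t).
  have h3 := is_deriveM (de t) (is_deriveB h1 h2).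
  have := is_deriveM h3 (is_derive_cst (dl ^+ 2 + a ^+ 2)^-1 t (1 : R)).
  by move/is_derive_congr; apply; rewrite !fctE /dH /GRing.scale /=; field.
have ce : continuous (fun t => expR (- dl * t)).
  move=> t; apply: differentiable_continuous; apply/derivable1_diffP; by have [] := de t.
have cc : continuous (fun t => cos (a * t)).
  move=> t; apply: differentiable_continuous; apply/derivable1_diffP; by have [] := dc t.
have cdH : continuous dH.
  by move=> t; apply: (@continuousM _ _ (fun t => expR (- dl * t)) (fun t => cos (a * t)) t); [exact: ce|exact: cc].
rewrite (Rintegral_FTC_seg N0 HH cdH) /H !mulr0 sin0 cos0 expR0.
by field.
Qed.

(** Damping 1/k up to length k^3 leaves the factor exp (- k^2) <= k^-2 at the endpoint. This beats
    the denominator, which is only k^-2 at a = 0, and makes the bound uniform in a. *)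
Lemma exp_cos_error (a k : R) : 1 <= k ->
  `|expR (- k^-1 * k ^+ 3) * (a * sin (a * k ^+ 3) - k^-1 * cos (a * k ^+ 3)) / (k^-1 ^+ 2 + a ^+ 2)| <= 2 / k.
Proof.
move=> k1; have k0 : 0 < k by apply: lt_le_trans k1.
have kn0 : k != 0 by rewrite gt_eqF.
have d0 : 0 < k^-1 by rewrite invr_gt0.
have p0 : 0 < k^-1 ^+ 2 + a ^+ 2 by rewrite ltr_pwDl ?exprn_gt0 // sqr_ge0.
have -> : - k^-1 * k ^+ 3 = - k ^+ 2 by field.
have He : expR (- k ^+ 2) <= (k ^+ 2)^-1.
  rewrite expRN lef_pV2 ?posrE ?expR_gt0 ?exprn_gt0 //.
  by apply: le_trans (expR_ge1Dx _); rewrite lerDr.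
have Hn : `|a * sin (a * k ^+ 3) - k^-1 * cos (a * k ^+ 3)| <= `|a| + k^-1.
  apply: le_trans (ler_normB _ _) _; rewrite !normrM (gtr0_norm d0).
  apply: lerD; first by rewrite -[leRHS]mulr1 ler_wpM2l // (@trig_le1 R 3).
  by rewrite -[leRHS]mulr1 ler_wpM2l ?(ltW d0) // (@trig_le1 R 0).
have Hq : `|a| + k^-1 <= 2 * k * (k^-1 ^+ 2 + a ^+ 2).
  rewrite -(real_normK (num_real a)); set b := `|a|.
  have -> : 2 * k * (k^-1 ^+ 2 + b ^+ 2) = 2 * k^-1 + 2 * k * b ^+ 2 by field.
  (* Completing the square in k b. *)
  rewrite -subr_ge0; have -> : 2 * k^-1 + 2 * k * b ^+ 2 - (b + k^-1) = k^-1 * ((k * b - 2^-1) ^+ 2 + (k * b) ^+ 2 + 3 / 4) by field.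
  by rewrite mulr_ge0 // ?(ltW d0) // !addr_ge0 // ?sqr_ge0 // divr_ge0.
rewrite normrM (gtr0_norm (_ : 0 < (k^-1 ^+ 2 + a ^+ 2)^-1)) ?invr_gt0 //.
rewrite ler_pdivrMr // normrM (gtr0_norm (expR_gt0 _)).
have -> : 2 / k * (k^-1 ^+ 2 + a ^+ 2) = (k ^+ 2)^-1 * (2 * k * (k^-1 ^+ 2 + a ^+ 2)) by field.
by apply: ler_pM => //; exact: le_trans Hn Hq.
Qed.

End ExpCos.

(** * Fourier inversion on the line for a real function of compact support *)

Section FourierLine.
Variable R : realType.
Local Notation mu := (@lebesgue_measure R).
Variables (w : R -> R) (M x : R).
Hypothesis M0 : 0 <= M.
Hypothesis sw : rsmooth (fun z : 'rV[R]_1 => w (z 0 ord0)).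
Hypothesis suw : forall y, M < `|y| -> w y = 0.

Let W (z : 'rV[R]_1) := w (z 0 ord0).
Let w1 (y : R) := dpart ord0 W (0 + y *: delta_mx 0 ord0).
Let w2 (y : R) := dpart ord0 (dpart ord0 W) (0 + y *: delta_mx 0 ord0).

Let lineE (y : R) : (0 + y *: delta_mx 0 ord0 : 'rV[R]_1) 0 ord0 = y.
Proof. by rewrite !mxE eqxx mulr1 add0r. Qed.

Let dw (y : R) : is_derive y (1 : R) w (w1 y).
Proof.
have := @is_derive_line R _ W 0 (delta_mx 0 ord0) y (rsmooth_derivable sw _ _).
by congr is_derive; apply/funext => z; rewrite /W lineE.
Qed.

Let dw1 (y : R) : is_derive y (1 : R) w1 (w2 y).
Proof.
exact: (@is_derive_line R _ (dpart ord0 W) 0 (delta_mx 0 ord0) y (rsmooth_derivable (rsmooth_dpart _ sw) _ _)).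
Qed.

Let cdiff (f df : R -> R) : (forall y : R, is_derive y 1 f (df y)) -> continuous f.
Proof.
move=> H y; apply: differentiable_continuous; apply/derivable1_diffP; by have [] := H y.
Qed.

Let cw : continuous w. Proof. exact: cdiff dw. Qed.
Let cw1 : continuous w1. Proof. exact: cdiff dw1. Qed.
Let cw2 : continuous w2.
Proof. by apply: continuous_line; do 2 apply: rsmooth_dpart. Qed.

Let supp_derive (f df : R -> R) : (forall y, M < `|y| -> f y = 0) ->
  (forall y : R, is_derive y 1 f (df y)) -> forall y, M < `|y| -> df y = 0.
Proof.
move=> Hf Hd y My; have [_ <-] := Hd y.
rewrite (_ : 0 = 'D_1 (fun=> 0 : R) y); last by rewrite derive_cst.
apply: near_eq_derive.
have : \forall z \near y, M < `|z|.
  by have /cvgr_gt := @norm_continuous R R^o y; apply.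
by apply: filterS => z; exact: Hf.
Qed.

(** The interval of radius [B] around x contains the support of w in its interior, so boundary terms
    vanish, and it is symmetric about the peak of the Poisson kernel. *)
Let B := M + `|x| + 1.
Let B0 : 0 < B. Proof. by rewrite ltr_wpDl // addr_ge0. Qed.
Let xB : x - B <= x + B. Proof. by have := B0; lra. Qed.

Let out y : ~~ (x - B < y < x + B) -> M < `|y|.
Proof.
move=> H; have : B <= `|y - x|.
  rewrite leNgt; apply: contra H; rewrite ltr_norml => /andP[H1 H2].
  by apply/andP; split; [move: H1|move: H2]; lra.
move=> H2; have := ler_normB y x; rewrite /B in H2; lra.
Qed.

Let wl : w (x - B) = 0. Proof. by apply: suw; apply: out; rewrite ltxx. Qed.
Let wr : w (x + B) = 0. Proof. by apply: suw; apply: out; rewrite ltxx andbF. Qed.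
Let suw1 := supp_derive suw dw.
Let w1l : w1 (x - B) = 0. Proof. by apply: suw1; apply: out; rewrite ltxx. Qed.
Let w1r : w1 (x + B) = 0. Proof. by apply: suw1; apply: out; rewrite ltxx andbF. Qed.

Let tk k (eta y : R) := trig k ((x - y) * eta).

Let dtk k eta (y : R) : is_derive y (1 : R) (tk k eta) (tk k.+1 eta y * - eta).
Proof.
have H : is_derive y (1 : R) (fun y => (x - y) * eta) (- eta).
  have H1 := is_deriveB (is_derive_cst x y (1 : R)) (is_derive_id y (1 : R)).
  have := is_deriveM H1 (is_derive_cst eta y (1 : R)).
  by move=> /is_derive_congr; apply; rewrite scaler0 add0r sub0r /GRing.scale /= mulrN1.
exact: (@is_derive_comp1 R R (trig k) _ y 1 _ _ (is_derive_trig k _) H).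
Qed.

Let ctk k eta : continuous (tk k eta). Proof. exact: cdiff (dtk k eta). Qed.

(** For k = 0 and k = 3, the real and imaginary parts of exp (i x eta) times the Fourier transform
    of w; the index k treats both together and shifts under differentiation. *)
Definition ft_shift k (eta : R) := \int[mu]_(y in setT) (trig k ((x - y) * eta) * w y).

Let Rint_supp (f : R -> R) : (forall y, M < `|y| -> f y = 0) ->
  \int[mu]_(y in setT) f y = \int[mu]_(y in `[x - B, x + B]) f y.
Proof.
move=> Hf; rewrite [RHS]Rintegral_mkcond; apply: eq_Rintegral => y _.
rewrite patchE; case: ifPn => // /negP H; apply: Hf; apply: out.
apply/negP => /andP[y1 y2]; apply: H; rewrite inE /= in_itv /=.
by rewrite !ltW.
Qed.

Let ftE k eta : ft_shift k eta = \int[mu]_(y in `[x - B, x + B]) (tk k eta y * w y).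
Proof. by apply: Rint_supp => y /suw ->; rewrite mulr0. Qed.

Let trig2 k (a : R) : trig k.+2 a = - trig k a.
Proof.
rewrite /trig; have -> : (k.+2 %% 4 = (k %% 4).+2 %% 4)%N by rewrite -[in RHS]addn2 modnDml addn2.
have : (k %% 4 < 4)%N by rewrite ltn_mod.
by case: (k %% 4)%N => [|[|[|[|//]]]] _ /=; rewrite ?opprK.
Qed.

Let cprod k eta (f : R -> R) : continuous f -> continuous (fun y => tk k eta y * f y).
Proof. by move=> cf y; apply: continuousM; [exact: ctk|exact: cf]. Qed.

(** Two integrations by parts at once: [H] is an antiderivative of the sum of the two integrands,
    and it vanishes at both ends. *)
Let parts k eta : eta ^+ 2 * ft_shift k eta = - \int[mu]_(y in `[x - B, x + B]) (tk k eta y * w2 y).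
Proof.
pose u (y : R) : R := tk k eta y * w2 y.
pose v (y : R) : R := tk k eta y * w y.
pose H (y : R) : R := tk k eta y * w1 y + eta * (tk k.+1 eta y * w y).
pose dH (y : R) : R := u y + eta ^+ 2 * v y.
have HH (y : R) : is_derive y (1 : R) H (dH y).
  have H1 := is_deriveM (dtk k eta y) (dw1 y).
  have H2 := is_deriveM (dtk k.+1 eta y) (dw y).
  have H3 := is_deriveM (is_derive_cst eta y (1 : R)) H2.
  have := is_deriveD H1 H3; move/is_derive_congr; apply.
  by rewrite /dH /u /v /tk trig2 /GRing.scale /=; ring.
have c1 : continuous u by move=> y; apply: continuousM; [exact: ctk|exact: cw2].
have c2 : continuous v by move=> y; apply: continuousM; [exact: ctk|exact: cw].
pose v2 (y : R) : R := eta ^+ 2 * v y.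
have c3 : continuous v2.
  by move=> y; apply: (@continuousM _ _ (fun=> eta ^+ 2) v y); [exact: cst_continuous|exact: c2].
have cdH : continuous dH.
  rewrite /dH => y; apply: continuousD; first exact: c1.
  exact: c3.
have := Rintegral_FTC_seg xB HH cdH.
rewrite /H wl wr w1l w1r !mulr0 !addr0 subr0 => Z.
apply/eqP; rewrite -addr_eq0 addrC; apply/eqP; rewrite -Z ftE.
rewrite -RintegralZl //; last by apply: continuous_integrable; exact: cprod.
rewrite -RintegralD //; first by apply: continuous_integrable; exact: cprod.
exact: (continuous_integrable _ _ c3).
Qed.

Let seg_bounded (f : R -> R) : continuous f -> exists2 K : R, 0 <= K & forall y, x - B <= y <= x + B -> `|f y| <= K.
Proof.
move=> cf.
have [c _ Hc] := @EVT_max R (fun y => `|f y|) (x - B) (x + B) xB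
  (continuous_subspaceT (fun y => cvg_norm (cf y))).
exists `|f c| => // y yab; apply: Hc; by rewrite in_itv.
Qed.

Let tk_int_bound k eta (f : R -> R) K : continuous f -> (forall y, x - B <= y <= x + B -> `|f y| <= K) ->
  `|\int[mu]_(y in `[x - B, x + B]) (tk k eta y * f y)| <= K * (2 * B).
Proof.
move=> cf HK; have -> : 2 * B = (x + B) - (x - B) by lra.
apply: Rintegral_segment_bound => //; first exact: cprod.
by move=> y yab; rewrite normrM -[leRHS]mul1r; apply: ler_pM => //; [exact: trig_le1|exact: HK].
Qed.

Lemma ft_decay k : exists K : R, forall eta, (1 + eta ^+ 2) * `|ft_shift k eta| <= K.
Proof.
have [K0 _ H0] := seg_bounded cw; have [K2 _ H2] := seg_bounded cw2.
exists (K0 * (2 * B) + K2 * (2 * B)) => eta.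
rewrite mulrDl mul1r; apply: lerD; first by rewrite ftE; exact: tk_int_bound.
rewrite -{1}[eta ^+ 2]ger0_norm ?sqr_ge0 // -normrM parts normrN.
exact: tk_int_bound.
Qed.

Let two_var (F : R -> R -> R) := rsmooth (fun z : 'rV[R]_(1 + 1) => F (z 0 (lshift 1 ord0)) (z 0 (rshift 1 ord0))).

Let pt_l (eta y : R) : jn (eta%:M : 'rV[R]_1) y 0 (lshift 1 ord0) = eta.
Proof. by rewrite /jn row_mxEl mxE eqxx mulr1n. Qed.
Let pt_r (eta y : R) : jn (eta%:M : 'rV[R]_1) y 0 (rshift 1 ord0) = y.
Proof. by rewrite /jn row_mxEr mxE eqxx mulr1n. Qed.

Let smooth_tk_w k : two_var (fun eta y => tk k eta y * w y).
Proof.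
apply: rsmoothM.
  apply/rsmoothP => l; apply: (@Ck_comp1 R _ l (@trig R) (fun z : 'rV[R]_(1 + 1) => (x - z 0 (rshift 1 ord0)) * z 0 (lshift 1 ord0)) (@is_derive_trig R)).
  apply: rsmoothM; last exact: rsmooth_coord.
  by apply: rsmoothB; [exact: rsmooth_cst|exact: rsmooth_coord].
apply: rsmooth_eq (rsmooth_comp (G := fun (j : 'I_1) (z : 'rV[R]_(1 + 1)) => z 0 (rshift 1 ord0)) sw _).
  by move=> z; rewrite mxE.
by move=> j; exact: rsmooth_coord.
Qed.

Lemma ft_continuous k : continuous (ft_shift k).
Proof.
have sG := smooth_tk_w k.
have -> : ft_shift k = fun eta => pint (fun z : 'rV[R]_(1 + 1) => tk k (z 0 (lshift 1 ord0)) (z 0 (rshift 1 ord0)) * w (z 0 (rshift 1 ord0)))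
     (x - B) (x + B) (0 + eta *: delta_mx 0 ord0).
  apply/funext => eta; rewrite ftE; apply: eq_Rintegral => y _.
  have -> : 0 + eta *: delta_mx 0 ord0 = eta%:M :> 'rV[R]_1.
    by apply/rowP => i; rewrite !mxE (ord1 i) eqxx mulr1n mulr1 add0r.
  by rewrite pt_l pt_r.
by apply: continuous_line; apply: rsmooth_pint.
Qed.

Lemma ft_even eta : ft_shift 0%N (- eta) = ft_shift 0%N eta.
Proof. by apply: eq_Rintegral => y _; rewrite /trig /= mulrN cosN. Qed.

Let ft_oddk k eta : (forall a : R, trig k (- a) = - trig k a) -> ft_shift k (- eta) = - ft_shift k eta.
Proof.
move=> Hk; pose v (y : R) : R := tk k eta y * w y.
have cv : continuous v by move=> y; apply: continuousM; [exact: ctk|exact: cw].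
have It := @continuous_integrable R v (x - B) (x + B) cv.
rewrite !ftE -[RHS]mulN1r -RintegralZl //.
by apply: eq_Rintegral => y _; rewrite /tk mulrN Hk mulNr mulN1r.
Qed.

Lemma ft_odd eta : ft_shift 3%N (- eta) = - ft_shift 3%N eta.
Proof. by apply: ft_oddk => a; exact: sinN. Qed.

Lemma Rintegral_opp (f : R -> R) (N : R) : 0 <= N -> continuous f ->
  \int[mu]_(t in `[- N, 0]) f t = \int[mu]_(t in `[0, N]) f (- t).
Proof.
move=> N0 cf; rewrite /Rintegral -[X in `[_, X]]oppr0.
by rewrite integration_by_substitution_oppr //; exact: continuous_subspaceT.
Qed.

Lemma Rintegral_split (f : R -> R) (N : R) : 0 <= N -> continuous f ->
  \int[mu]_(t in `[- N, N]) f t = \int[mu]_(t in `[0, N]) f (- t) + \int[mu]_(t in `[0, N]) f t.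
Proof.
move=> N0 cf; rewrite -Rintegral_opp //.
have It := fun a b : R => @continuous_integrable R f a b cf.
have := @Rintegral_itvB R f (BLeft (- N)) (BRight N) 0 (It _ _).
rewrite !bnd_simp oppr_le0 N0 => /(_ isT isT).
rewrite Rintegral_itv_obnd_cbnd => [<-|]; first by rewrite addrC subrK.
by apply: integrableS (It 0 N) => //; apply: subset_itvr; rewrite bnd_simp.
Qed.

(** The integrand is odd, so its integrals over [-m, m] vanish, and they converge to the integral
    over the line. *)
Lemma sine_inversion : \int[mu]_(eta in setT) ft_shift 3%N eta = 0.
Proof.
have [K HK] := ft_decay 3%N.
have c3 := @ft_continuous 3%N.
have H := @truncated_cvg R (ft_shift 3%N) (fun _ _ => 1) (fun m => m%:R) K c3 HK
  (fun _ => @cst_continuous _ _ _) (fun _ _ => _) (fun _ => cvg_cst _) (@cvgr_idn R).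
have {}H := H _; rewrite normr1 lexx in H; have {}H := H (fun _ _ => isT).
have E (m : nat) : \int[mu]_(eta in `[- (m%:R : R), m%:R]) (1 * ft_shift 3%N eta) = 0.
  under eq_Rintegral do rewrite mul1r.
  rewrite Rintegral_split //.
  have -> : \int[mu]_(t in `[0, m%:R]) ft_shift 3%N (- t) = - \int[mu]_(t in `[0, m%:R]) ft_shift 3%N t.
    rewrite -mulN1r -RintegralZl //; last exact: continuous_integrable.
    by apply: eq_Rintegral => t _; rewrite ft_odd mulN1r.
  by rewrite addNr.
have : (fun m : nat => \int[mu]_(eta in `[- (m%:R : R), m%:R]) (1 * ft_shift 3%N eta)) @ \oo --> (0 : R).
  by rewrite (_ : (fun m => _) = fun=> 0); [exact: cvg_cst|apply/funext].
by move=> H0; apply: (cvg_unique (@Rhausdorff R) (H _) H0).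
Qed.

Let kk (m : nat) : R := m.+1%:R.
Let kk0 m : 0 < kk m. Proof. by rewrite ltr0n. Qed.
Let kk1 m : 1 <= kk m. Proof. by rewrite ler1n. Qed.
Let kkn0 m : kk m != 0. Proof. by rewrite gt_eqF. Qed.
(* The Fourier integral is regularised by exp (- |t| / k) and truncated at k^3; the
   inner integral is then the Poisson kernel [po] up to the error [er]. *)
Let hh m (t : R) := expR (- (kk m)^-1 * `|t|).
Let er m (a : R) := expR (- (kk m)^-1 * (kk m) ^+ 3) *
  (a * sin (a * (kk m) ^+ 3) - (kk m)^-1 * cos (a * (kk m) ^+ 3)) / ((kk m)^-1 ^+ 2 + a ^+ 2).
Let po m (y : R) := (kk m)^-1 / ((kk m)^-1 ^+ 2 + (x - y) ^+ 2).
(** What remains of w(y) times the inner integral after w(x) [po] is split off: it tends to 0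
    pointwise and boundedly, whereas the part split off carries the limit. *)
Let rest m (y : R) := (w y - w x) * po m y + w y * er m (x - y).

Let kkV : (kk m)^-1 @[m --> \oo] --> (0 : R).
Proof. exact: cvg_harmonic. Qed.

Let den m a : 0 < (kk m)^-1 ^+ 2 + a ^+ 2.
Proof. by rewrite ltr_pwDl ?sqr_ge0 // exprn_gt0 // invr_gt0. Qed.

Let wlip : exists2 K : R, 0 <= K & forall y, x - B <= y <= x + B -> `|w y - w x| <= K * `|x - y|.
Proof.
have [K K0 HK] := seg_bounded cw1; exists K => // y /andP[y1 y2].
have [th /andP[th0 th1]] := @MVT_line R R^o w 1 (fun z => ex_derive (is_derive := dw z)) x (y - x).
have scA (r : R) : r *: (1 : R^o) = r by exact: mulr1.
rewrite !scA [x + (y - x)]addrC subrK => ->.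
rewrite normrM mulrC distrC; apply: ler_wpM2r => //.
have [_ ->] := dw (x + th * (y - x)).
apply: HK.
have : `|th * (y - x)| <= B.
  rewrite normrM ger0_norm // -[leRHS]mul1r; apply: ler_pM => //.
  by rewrite ler_norml; apply/andP; split; [move: y1|move: y2]; lra.
by rewrite ler_norml => /andP[h1 h2]; apply/andP; split; [move: h1|move: h2]; lra.
Qed.

Let er_le m a : `|er m a| <= 2 / kk m.
Proof. by apply: exp_cos_error; exact: kk1. Qed.

Let rest0 y : rest m y @[m --> \oo] --> (0 : R).
Proof.
have S (f : nat -> R) C : (forall m, `|f m| <= C * (kk m)^-1) -> f m @[m --> \oo] --> (0 : R).
  move=> Hf; apply/norm_cvg0P.
  apply: (@squeeze_cvgr _ _ _ _ (cst 0) (fun m => C * (kk m)^-1)); last 2 first.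
  - exact: cvg_cst.
  - by rewrite -(mulr0 C); apply: cvgM; [exact: cvg_cst|exact: kkV].
  by apply: nearW => m; rewrite normr_ge0 Hf.
rewrite -[0]addr0; apply: cvgD; last first.
  apply: (S _ (`|w y| * 2)) => m; rewrite normrM -mulrA.
  by apply: ler_wpM2l => //; exact: er_le.
have [<-|yx] := eqVneq x y.
  by rewrite subrr; under eq_fun do rewrite mul0r; exact: cvg_cst.
have q0 : 0 < (x - y) ^+ 2 by rewrite exprn_even_gt0 //= subr_eq0.
apply: (S _ (`|w y - w x| / (x - y) ^+ 2)) => m; rewrite normrM -mulrA.
apply: ler_wpM2l => //; rewrite /po ger0_norm; last first.
  by rewrite divr_ge0 ?invr_ge0 ?(ltW (kk0 m)) // ltW.
rewrite mulrC; apply: ler_wpM2r; first by rewrite invr_ge0 ltW.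
by rewrite lef_pV2 ?posrE // lerDr exprn_ge0 // invr_ge0 ltW.
Qed.

(** Near y = x the Lipschitz bound of w compensates the peak of the kernel, since |x - y| / k is at
    most k^-2 + (x - y)^2. *)
Let rest_bounded : exists C : R, forall m y, x - B <= y <= x + B -> `|rest m y| <= C.
Proof.
have [K K0 HK] := wlip; have [L L0 HL] := seg_bounded cw.
exists (K + L * 2) => m y yB; apply: le_trans (ler_normD _ _) _; apply: lerD; last first.
  rewrite normrM; apply: ler_pM => //; first exact: HL.
  apply: le_trans (er_le _ _) _; rewrite ler_pdivrMr // ler_pMr //; exact: kk1.
rewrite normrM /po [X in _ * X]ger0_norm; last first.
  by rewrite divr_ge0 ?invr_ge0 ?(ltW (kk0 m)) // ltW.
rewrite mulrA ler_pdivrMr //.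
apply: le_trans (_ : K * `|x - y| * (kk m)^-1 <= _).
  by apply: ler_wpM2r; [rewrite invr_ge0 ltW|exact: HK].
rewrite -mulrA; apply: ler_wpM2l => //.
rewrite -(real_normK (num_real (x - y))); set a := `|x - y|; set b := (kk m)^-1.
rewrite -subr_ge0; have -> : b ^+ 2 + a ^+ 2 - a * b = (b - a / 2) ^+ 2 + 3 / 4 * a ^+ 2 by field.
by rewrite addr_ge0 ?sqr_ge0 // mulr_ge0 ?sqr_ge0 // divr_ge0.
Qed.

(** The mass of the Poisson kernel on the interval is therefore 2 atan (k B), which tends to pi. *)
Let dpo m (y : R) : is_derive y (1 : R) (fun y => atan (kk m * (y - x))) (po m y).
Proof.
have h1 := is_deriveB (is_derive_id y (1 : R)) (is_derive_cst x y (1 : R)).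
have h2 := is_deriveM (is_derive_cst (kk m) y (1 : R)) h1.
have := @is_derive_comp1 R R atan _ y 1 _ _ (is_derive1_atan _) h2.
move=> /is_derive_congr; apply.
rewrite /po scaler0 addr0 subr0 /GRing.scale /= mulr1.
have k0 := kkn0 m; have d1 : 1 + (kk m * (y - x)) ^+ 2 != 0 by rewrite gt_eqF // ltr_pwDl // sqr_ge0.
have d2 : (kk m)^-1 ^+ 2 + (x - y) ^+ 2 != 0 by rewrite gt_eqF.
have -> : (kk m)^-1 ^+ 2 + (x - y) ^+ 2 = (1 + (kk m * (y - x)) ^+ 2) / kk m ^+ 2 by field.
have H (k z : R) : k != 0 -> 1 + (k * z) ^+ 2 != 0 ->
    (1 + (k * z) ^+ 2)^-1 * k = k^-1 / ((1 + (k * z) ^+ 2) / k ^+ 2).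
  by move=> k1 k2; field; rewrite k1.
exact: (H (kk m) (y - x) k0 d1).
Qed.

Let cpo m : continuous (po m).
Proof.
pose v (y : R) : R := x - y.
pose u (y : R) : R := (kk m)^-1 ^+ 2 + v y ^+ 2.
have cv : continuous v.
  by move=> y; apply: (@continuousB _ _ _ (fun=> x) id y); [exact: cst_continuous|exact: cvg_id].
have cu : continuous u.
  move=> y; apply: (@continuousD _ _ _ (fun=> (kk m)^-1 ^+ 2) (fun y => v y * v y) y); first exact: cst_continuous.
  by apply: (@continuousM _ _ v v y); exact: cv.
move=> y; apply: (@continuousM _ _ (fun=> (kk m)^-1) (fun y => (u y)^-1) y); first exact: cst_continuous.
by apply: (@continuousV _ _ u y); [rewrite gt_eqF //; exact: den|exact: cu].
Qed.

Let ehm m (t : R) : 0 <= t -> hh m t = expR (- (kk m)^-1 * t).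
Proof. by move=> t0; rewrite /hh ger0_norm. Qed.

Let smooth_exp m : rsmooth (fun z : 'rV[R]_(1 + 1) => expR (- (kk m)^-1 * z 0 (lshift 1 ord0))).
Proof.
apply: (rsmooth_comp1 (smooth1_expR R) (u := fun z : 'rV[R]_(1 + 1) => - (kk m)^-1 * z 0 (lshift 1 ord0))).
by apply: rsmoothM; [exact: rsmooth_cst|exact: rsmooth_coord].
Qed.

Let N3 m : 0 <= kk m ^+ 3. Proof. by rewrite exprn_ge0 // ltW. Qed.

(** After exchanging the integrals the inner one is the explicit [int_exp_cos] with a = x - y. *)
Let half m : \int[mu]_(t in `[0, kk m ^+ 3]) (hh m t * ft_shift 0%N t) =
  \int[mu]_(y in `[x - B, x + B]) (rest m y + w x * po m y).
Proof.
pose G (z : 'rV[R]_(1 + 1)) := expR (- (kk m)^-1 * z 0 (lshift 1 ord0)) *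
  (tk 0%N (z 0 (lshift 1 ord0)) (z 0 (rshift 1 ord0)) * w (z 0 (rshift 1 ord0))).
have sG : rsmooth G by apply: rsmoothM; [exact: smooth_exp|exact: smooth_tk_w].
have Gj t y : G (jn (t%:M : 'rV[R]_1) y) = expR (- (kk m)^-1 * t) * (tk 0%N t y * w y).
  by rewrite /G pt_l pt_r.
transitivity (\int[mu]_(t in `[0, kk m ^+ 3]) \int[mu]_(y in `[x - B, x + B]) G (jn (t%:M : 'rV[R]_1) y)).
  apply: eq_Rintegral => t; rewrite inE /= in_itv /= => /andP[t0 _].
  rewrite ehm // ftE -RintegralZl //; last by apply: continuous_integrable; exact: cprod.
  by apply: eq_Rintegral => y _; rewrite Gj.
rewrite (fubini_segment (N3 m) xB sG); apply: eq_Rintegral => y _.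
pose v (t : R) : R := expR (- (kk m)^-1 * t) * cos ((x - y) * t).
have cv : continuous v.
  have sv : rsmooth (fun z : 'rV[R]_1 => v (z 0 ord0)).
    apply: rsmoothM.
      apply: (rsmooth_comp1 (smooth1_expR R) (u := fun z : 'rV[R]_1 => - (kk m)^-1 * z 0 ord0)).
      by apply: rsmoothM; [exact: rsmooth_cst|exact: rsmooth_coord].
    apply/rsmoothP => l; apply: (@Ck_comp1 R _ l (@trig R) (fun z : 'rV[R]_1 => (x - y) * z 0 ord0) (@is_derive_trig R) _ 0%N).
    by apply: rsmoothM; [exact: rsmooth_cst|exact: rsmooth_coord].
  have := @continuous_line R 1 _ 0 ord0 sv.
  by under eq_fun do rewrite lineE.
transitivity (w y * \int[mu]_(t in `[0, kk m ^+ 3]) v t).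
  rewrite -RintegralZl //; last exact: continuous_integrable.
  by apply: eq_Rintegral => t _; rewrite Gj /v /tk /trig /=; ring.
rewrite int_exp_cos ?invr_gt0 //.
by rewrite /rest /er /po; set e := expR _; set D := (_ + _)^-1; ring.
Qed.

Let atan_limit : atan (kk m * B) @[m --> \oo] --> pi / 2.
Proof.
have H : kk m * B @[m --> \oo] --> +oo.
  apply/cvgryPge => A; near=> m.
  have : A / B <= kk m.
    apply: (@le_trans _ _ m%:R); last by rewrite ler_nat.
    near: m; have /cvgryPge := @cvgr_idn R; exact.
  by rewrite ler_pdivrMr.
exact: (cvg_comp _ _ H (@cvgy_atan R)).
Unshelve. all: by end_near. Qed.

Let er_continuous m : continuous (fun y => er m (x - y)).
Proof.
set c : R := kk m ^+ 3; set dl : R := (kk m)^-1.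
pose v (y : R) : R := x - y.
pose u (y : R) : R := dl ^+ 2 + v y ^+ 2.
pose s (y : R) : R := sin (v y * c).
pose t (y : R) : R := cos (v y * c).
have cv : continuous v.
  by move=> y; apply: (@continuousB _ _ _ (fun=> x) id y); [exact: cst_continuous|exact: cvg_id].
have cvc : continuous (fun y => v y * c).
  by move=> y; apply: (@continuousM _ _ v (fun=> c) y); [exact: cv|exact: cst_continuous].
have cu : continuous u.
  move=> y; apply: (@continuousD _ _ _ (fun=> dl ^+ 2) (fun y => v y * v y) y); first exact: cst_continuous.
  by apply: (@continuousM _ _ v v y); exact: cv.
have cs : continuous s.
  by move=> y; apply: (@continuous_comp _ _ _ (fun y => v y * c) sin y); [exact: cvc|exact: continuous_sin].
have ct : continuous t.
  by move=> y; apply: (@continuous_comp _ _ _ (fun y => v y * c) cos y); [exact: cvc|exact: continuous_cos].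
have cn : continuous (fun y => v y * s y - dl * t y).
  move=> y; apply: (@continuousB _ _ _ (fun y => v y * s y) (fun y => dl * t y) y).
    by apply: (@continuousM _ _ v s y); [exact: cv|exact: cs].
  by apply: (@continuousM _ _ (fun=> dl) t y); [exact: cst_continuous|exact: ct].
move=> y; apply: (@continuousM _ _ (fun y => expR (- dl * c) * (v y * s y - dl * t y)) (fun y => (u y)^-1) y).
  by apply: (@continuousM _ _ (fun=> expR (- dl * c)) (fun y => v y * s y - dl * t y) y); [exact: cst_continuous|exact: cn].
by apply: (@continuousV _ _ u y); [rewrite gt_eqF //; exact: den|exact: cu].
Qed.

Let rest_continuous m : continuous (rest m).
Proof.
move=> y; apply: (@continuousD _ _ _ (fun y => (w y - w x) * po m y) (fun y => w y * er m (x - y)) y).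
  apply: (@continuousM _ _ (fun y => w y - w x) (po m) y); last exact: cpo.
  by apply: (@continuousB _ _ _ w (fun=> w x) y); [exact: cw|exact: cst_continuous].
by apply: (@continuousM _ _ w (fun y => er m (x - y)) y); [exact: cw|exact: er_continuous].
Qed.

Let hh_continuous m : continuous (hh m).
Proof.
move=> t; apply: (@continuous_comp _ _ _ (fun t => - (kk m)^-1 * `|t|) expR t); last exact: continuous_expR.
by apply: (@continuousM _ _ (fun=> - (kk m)^-1) (fun t => `|t|) t); [exact: cst_continuous|exact: norm_continuous].
Qed.

Let hh_limit t : hh m t @[m --> \oo] --> (1 : R).
Proof.
rewrite -expR0.
have H : - (kk m)^-1 * `|t| @[m --> \oo] --> (0 : R).
  have -> : (0 : R) = - 0 * `|t| by rewrite oppr0 mul0r.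
  by apply: cvgM; [apply: cvgN; exact: kkV|exact: cvg_cst].
exact: (cvg_comp _ _ H (@continuous_expR R 0)).
Qed.

Let cube_limit : kk m ^+ 3 @[m --> \oo] --> +oo.
Proof.
apply/cvgryPge => A; near=> m.
apply: (@le_trans _ _ (kk m)); last by rewrite -{1}[kk m]expr1 ler_weXn2l.
apply: (@le_trans _ _ m%:R); last by rewrite ler_nat.
near: m; have /cvgryPge := @cvgr_idn R; exact.
Unshelve. all: by end_near. Qed.

Lemma cosine_inversion : \int[mu]_(eta in setT) ft_shift 0%N eta = 2 * pi * w x.
Proof.
have [K HK] := ft_decay 0%N.
have c0 := @ft_continuous 0%N.
have h1 m t : `|hh m t| <= 1.
  rewrite /hh gtr0_norm ?expR_gt0 // -expR0 ler_expR mulNr oppr_le0.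
  by rewrite mulr_ge0 // invr_ge0 ltW.
have H := truncated_cvg c0 HK hh_continuous h1 hh_limit cube_limit.
(* The outer factor 2 comes from evenness in eta, the inner one from the two halves of the
   kernel. *)
pose S m : R := 2 * (\int[mu]_(y in `[x - B, x + B]) rest m y + w x * (2 * atan (kk m * B))).
have E m : \int[mu]_(eta in `[- kk m ^+ 3, kk m ^+ 3]) (hh m eta * ft_shift 0%N eta) = S m.
  pose u (t : R) : R := hh m t * ft_shift 0%N t.
  have cu : continuous u.
    by move=> t; apply: (@continuousM _ _ (hh m) (ft_shift 0%N) t); [exact: hh_continuous|exact: c0].
  rewrite (@Rintegral_split u _ (N3 m) cu).
  have -> : \int[mu]_(t in `[0, kk m ^+ 3]) u (- t) = \int[mu]_(t in `[0, kk m ^+ 3]) u t.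
    by apply: eq_Rintegral => t _; rewrite /u ft_even /hh normrN.
  rewrite -mulr2n -[LHS]mulr_natl half /S.
  have Ip := @continuous_integrable R _ (x - B) (x + B) (@cpo m).
  pose q (y : R) : R := w x * po m y.
  have cq : continuous q.
    by move=> y; apply: (@continuousM _ _ (fun=> w x) (po m) y); [exact: cst_continuous|exact: cpo].
  have I1 := @continuous_integrable R _ (x - B) (x + B) (@rest_continuous m).
  have I2 := @continuous_integrable R _ (x - B) (x + B) cq.
  rewrite (RintegralD _ I1 I2) //.
  rewrite RintegralZl // (Rintegral_FTC_seg xB (@dpo m) (@cpo m)).
  have -> : kk m * (x + B - x) = kk m * B by ring.
  have -> : kk m * (x - B - x) = - (kk m * B) by ring.
  have E2 (a : R) : atan a - atan (- a) = 2 * atan a by rewrite atanN opprK mulr_natl mulr2n.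
  by rewrite E2.
have L : S m @[m --> \oo] --> (2 * pi * w x).
  have -> : 2 * pi * w x = 2 * (0 + w x * (2 * (pi / 2))) by field.
  have [C HC] := rest_bounded.
  apply: cvgM; first exact: cvg_cst.
  apply: cvgD; first exact: (bounded_cvg0 rest_continuous HC rest0).
  apply: cvgM; first exact: cvg_cst.
  by apply: cvgM; [exact: cvg_cst|exact: atan_limit].
have H' : S m @[m --> \oo] --> \int[mu]_(eta in setT) ft_shift 0%N eta.
  by move: H; rewrite (_ : (fun m : nat => \int[mu]_(_ in _) _) = S) //; apply/funext.
exact: (cvg_unique (@Rhausdorff R) H' L).
Qed.

End FourierLine.

Local Open Scope complex_scope.

Section ComplexParts.
Variable R : realType.
Implicit Types z v : R[i].

Lemma complex_ReM z v : complex.Re (z * v) = complex.Re z * complex.Re v - complex.Im z * complex.Im v.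
Proof. by case: z; case: v. Qed.

Lemma complex_ImM z v : complex.Im (z * v) = complex.Re z * complex.Im v + complex.Im z * complex.Re v.
Proof. by case: z; case: v. Qed.

Lemma complex_ext z v : complex.Re z = complex.Re v -> complex.Im z = complex.Im v -> z = v.
Proof. by case: z; case: v => ? ? ? ? /= -> ->. Qed.

Lemma expiD (a b : R) : expi (a + b) = expi a * expi b.
Proof. by apply: complex_ext; rewrite ?complex_ReM ?complex_ImM /= ?cosD ?sinD //; ring. Qed.

Lemma expi0 : expi (0 : R) = 1.
Proof. by apply: complex_ext; rewrite /= ?cos0 ?sin0. Qed.

End ComplexParts.

(** * Fourier inversion in several variables *)

Section Inversion.
Variable R : realType.
Local Notation mu := (@lebesgue_measure R).

Lemma rsmooth_trig d k (u : 'rV[R]_d -> R) : rsmooth u -> rsmooth (fun z => trig k (u z)).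
Proof.
move=> su; apply/rsmoothP => l; apply: (@Ck_comp1 R _ l (@trig R) u (@is_derive_trig R) _ k).
exact: su.
Qed.

Definition csmooth d (w : 'rV[R]_d -> R[i]) := rsmooth (re_fun w) /\ rsmooth (im_fun w).
Definition csupported d (M : R) (w : 'rV[R]_d -> R[i]) := forall z, ~ box d M z -> w z = 0.

Lemma csmoothM d (a w : 'rV[R]_d -> R[i]) : csmooth a -> csmooth w -> csmooth (fun z => a z * w z).
Proof.
move=> [ar ai] [wr wi]; split.
  apply: rsmooth_eq (rsmoothB (rsmoothM ar wr) (rsmoothM ai wi)) => z; exact: complex_ReM.
apply: rsmooth_eq (rsmoothD (rsmoothM ar wi) (rsmoothM ai wr)) => z; exact: complex_ImM.
Qed.

Lemma csmooth_expi d (u : 'rV[R]_d -> R) : rsmooth u -> csmooth (fun z => expi (u z)).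
Proof.
by move=> su; split; [exact: (rsmooth_trig 0%N su)|exact: (rsmooth_trig 3%N su)].
Qed.

Lemma csmooth_cst d (c : R[i]) : csmooth (fun _ : 'rV[R]_d => c).
Proof. by split; exact: rsmooth_cst. Qed.

Lemma csupportedM d M (a w : 'rV[R]_d -> R[i]) : csupported M w -> csupported M (fun z => a z * w z).
Proof. by move=> sw z /sw ->; rewrite mulr0. Qed.

Lemma supported_re d M (w : 'rV[R]_d -> R[i]) : csupported M w -> supported M (re_fun w).
Proof. by move=> sw z /sw; rewrite /re_fun => ->. Qed.

Lemma supported_im d M (w : 'rV[R]_d -> R[i]) : csupported M w -> supported M (im_fun w).
Proof. by move=> sw z /sw; rewrite /im_fun => ->. Qed.

Lemma Rintegral_zero (f : R -> R) : (forall x, f x = 0) -> \int[mu]_(x in setT) f x = 0.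
Proof. by move=> Hf; rewrite (@Rintegral_supp R f 0) // oppr0 set_itv1 Rintegral_set1. Qed.

Lemma Rint_lin (f g : R -> R) M a b : continuous f -> continuous g ->
  (forall x, M < `|x| -> f x = 0) -> (forall x, M < `|x| -> g x = 0) ->
  \int[mu]_(x in setT) (a * f x + b * g x) = a * \int[mu]_(x in setT) f x + b * \int[mu]_(x in setT) g x.
Proof.
move=> cf cg sf sg; pose u (x : R) : R := a * f x; pose v (x : R) : R := b * g x.
have cu : continuous u by move=> x; apply: (@continuousM _ _ (fun=> a) f x); [exact: cst_continuous|exact: cf].
have cv : continuous v by move=> x; apply: (@continuousM _ _ (fun=> b) g x); [exact: cst_continuous|exact: cg].
rewrite (@Rintegral_supp R (fun x => a * f x + b * g x) M); last first.
  by move=> x Mx; rewrite sf // sg // !mulr0 addr0.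
rewrite (@Rintegral_supp R f M) // (@Rintegral_supp R g M) //.
have If := @continuous_integrable R f (- M) M cf.
have Ig := @continuous_integrable R g (- M) M cg.
have Iu := @continuous_integrable R u (- M) M cu.
have Iv := @continuous_integrable R v (- M) M cv.
rewrite -RintegralZl // -RintegralZl //.
exact: (RintegralD _ Iu Iv).
Qed.

Lemma continuous_scalar (f : 'rV[R]_1 -> R) : rsmooth f -> continuous (fun x : R => f x%:M).
Proof.
move=> sf; have E (x : R) : x%:M = 0 + x *: delta_mx 0 ord0 :> 'rV[R]_1.
  by apply/rowP => k; rewrite !mxE (ord1 k) eqxx mulr1n mulr1 add0r.
rewrite (_ : (fun x : R => f x%:M) = fun x => f (0 + x *: delta_mx 0 ord0)); last first.
  by apply/funext => x; rewrite E.
exact: (@continuous_line R 1 f 0 ord0 sf).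
Qed.

(** Linearity of an iterated integral needs integrability at every level; smoothness and a common
    support provide it through [intRn_smooth]. *)
Lemma intRn_lin m (f g : 'rV[R]_m -> R) M a b : 0 <= M -> rsmooth f -> rsmooth g ->
  supported M f -> supported M g ->
  intRn (fun y => a * f y + b * g y) = a * intRn f + b * intRn g.
Proof.
move=> M0; elim: m f g => [//|m ih] f g sf sg suf sug.
have [kf lf] := @intRn_smooth R 1 m M f M0 sf suf.
have [kg lg] := @intRn_smooth R 1 m M g M0 sg sug.
have row_su (h : 'rV[R]_(1 + m) -> R) (x : R) : supported M h -> supported M (fun y => h (row_mx x%:M y)).
  by move=> Hh y By; apply: Hh => /box_row_mx[].
rewrite /=.
transitivity (\int[mu]_(x in setT) (a * intRn (fun y => f (row_mx x%:M y)) + b * intRn (fun y => g (row_mx x%:M y)))).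
  apply: eq_Rintegral => x _; apply: ih.
  - exact: (@rsmooth_row_cst R 1 m x%:M f sf).
  - exact: (@rsmooth_row_cst R 1 m x%:M g sg).
  - exact: row_su.
  - exact: row_su.
apply: (@Rint_lin (fun x => intRn (fun y => f (row_mx x%:M y))) (fun x => intRn (fun y => g (row_mx x%:M y))) M).
- exact: (continuous_scalar kf).
- exact: (continuous_scalar kg).
- by move=> x Mx; apply: lf => /box_scalar; rewrite leNgt Mx.
- by move=> x Mx; apply: lg => /box_scalar; rewrite leNgt Mx.
Qed.

Definition Cint (F : R -> R[i]) : R[i] :=
  (\int[mu]_(x in setT) complex.Re (F x)) +i* (\int[mu]_(x in setT) complex.Im (F x)).

Lemma Cint_scale (c : R[i]) (F : R -> R[i]) M : continuous (fun x => complex.Re (F x)) ->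
  continuous (fun x => complex.Im (F x)) -> (forall x, M < `|x| -> F x = 0) ->
  Cint (fun x => c * F x) = c * Cint F.
Proof.
move=> cr ci sF.
have s1 x : M < `|x| -> complex.Re (F x) = 0 by move=> /sF ->.
have s2 x : M < `|x| -> complex.Im (F x) = 0 by move=> /sF ->.
apply: complex_ext; rewrite ?complex_ReM ?complex_ImM /=.
  rewrite -mulNr -(Rint_lin _ _ cr ci s1 s2).
  by apply: eq_Rintegral => x _; rewrite complex_ReM mulNr.
rewrite -(Rint_lin _ _ ci cr s2 s1).
by apply: eq_Rintegral => x _; rewrite complex_ImM.
Qed.

Lemma intCn_scale m (c : R[i]) (F : 'rV[R]_m -> R[i]) M : 0 <= M -> csmooth F -> csupported M F ->
  intCn (fun x => c * F x) = c * intCn F.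
Proof.
move=> M0 [sr si] su; have u1 := supported_re su; have u2 := supported_im su.
apply: complex_ext; rewrite ?complex_ReM ?complex_ImM /=.
  rewrite -mulNr -(intRn_lin _ _ M0 sr si u1 u2).
  by congr intRn; apply/funext => x; rewrite /re_fun complex_ReM mulNr.
rewrite -(intRn_lin _ _ M0 si sr u2 u1).
by congr intRn; apply/funext => x; rewrite /im_fun complex_ImM.
Qed.

Definition dot m (x y : 'rV[R]_m) : R := \sum_(k < m) x 0 k * y 0 k.

Lemma dot_row m (a b : R) (x y : 'rV[R]_m) :
  @dot m.+1 (row_mx (a%:M : 'rV[R]_1) x) (row_mx (b%:M : 'rV[R]_1) y) = a * b + dot x y.
Proof.
pose f (i : 'I_(1 + m)) : R := (row_mx (a%:M : 'rV[R]_1) x) 0 i * (row_mx (b%:M : 'rV[R]_1) y) 0 i.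
transitivity (\sum_(i < 1 + m) f i); first by [].
rewrite big_split_ord big_ord1 /f !row_mxEl !mxE !eqxx !mulr1n.
by congr (_ + _); apply: eq_bigr => k _; rewrite !row_mxEr.
Qed.

Lemma rsmooth_dotl m (y : 'rV[R]_m) : rsmooth (fun x => dot x y).
Proof.
by apply: rsmooth_sum => k; apply: rsmoothM; [exact: rsmooth_coord|exact: rsmooth_cst].
Qed.

Lemma fourier_scale m (c : R[i]) (w : 'rV[R]_m -> R[i]) M eta : 0 <= M -> csmooth w -> csupported M w ->
  fourier (fun y => c * w y) eta = c * fourier w eta.
Proof.
move=> M0 sw uw; rewrite /fourier -(intCn_scale c M0).
- by congr intCn; apply/funext => y; rewrite mulrCA.
- exact: (csmoothM (csmooth_expi (rsmoothN (rsmooth_dotl eta))) sw).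
- exact: csupportedM.
Qed.

(** The partial Fourier transform in the first variable. *)
Definition slice m (eta1 : R) (w : 'rV[R]_(1 + m) -> R[i]) : 'rV[R]_m -> R[i] :=
  fun y => Cint (fun y1 => expi (- (y1 * eta1)) * w (row_mx y1%:M y)).

Lemma csmooth_slice m M eta1 (w : 'rV[R]_(1 + m) -> R[i]) : 0 <= M -> csmooth w -> csupported M w ->
  csmooth (slice eta1 w) /\ csupported M (slice eta1 w).
Proof.
move=> M0 sw uw; pose F (z : 'rV[R]_(1 + m)) := expi (- (z 0 (lshift m ord0) * eta1)) * w z.
have [sr si] : csmooth F.
  exact: (csmoothM (csmooth_expi (rsmoothN (rsmoothM (rsmooth_coord R (lshift m ord0)) (rsmooth_cst eta1)))) sw).
have uF : csupported M F by exact: csupportedM.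
have key (f : 'rV[R]_(1 + m) -> R) : rsmooth f -> supported M f ->
    rsmooth (fun y : 'rV[R]_m => \int[mu]_(y1 in setT) f (row_mx (y1%:M : 'rV[R]_1) y)).
  move=> sf uf.
  pose G (z : 'rV[R]_(m + 1)) := f (row_mx (rsubmx z) (lsubmx z)).
  have sG : rsmooth G.
    apply: (rsmooth_precomp (io := fun z : 'rV[R]_(m + 1) => row_mx (rsubmx z) (lsubmx z))) => // l.
    case: (fintype.splitP l) => j Ej.
      have -> : l = lshift m j by apply/val_inj.
      by apply: rsmooth_eq (rsmooth_coord _ (rshift m j)) => z; rewrite row_mxEl mxE.
    have -> : l = rshift 1 j by apply/val_inj.
    by apply: rsmooth_eq (rsmooth_coord _ (lshift 1 j)) => z; rewrite row_mxEr mxE.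
  have E y : \int[mu]_(y1 in setT) f (row_mx (y1%:M : 'rV[R]_1) y) = pint G (- M) M y.
    rewrite (@Rintegral_supp _ _ M).
      by apply: eq_Rintegral => y1 _; rewrite /G /jn row_mxKl row_mxKr.
    by move=> y1 My1; apply: uf => /box_row_mx[/box_scalar]; rewrite leNgt My1.
  by apply: rsmooth_eq E _; apply: rsmooth_pint => //; rewrite ge0_cp.
have EF y1 (y : 'rV[R]_m) : expi (- (y1 * eta1)) * w (row_mx y1%:M y) = F (row_mx (y1%:M : 'rV[R]_1) y).
  by rewrite /F row_mxEl mxE eqxx mulr1n.
split.
  split.
    apply: rsmooth_eq (key _ sr (supported_re uF)) => y.
    by apply: eq_Rintegral => y1 _; rewrite EF.
  apply: rsmooth_eq (key _ si (supported_im uF)) => y.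
  by apply: eq_Rintegral => y1 _; rewrite EF.
move=> y By; rewrite /slice.
have Z0 y1 : expi (- (y1 * eta1)) * w (row_mx y1%:M y) = 0.
  by rewrite uw ?mulr0 // => /box_row_mx[].
by apply: complex_ext; apply: Rintegral_zero => y1; rewrite Z0.
Qed.

Lemma continuous_row1 m (f : 'rV[R]_(1 + m) -> R) (y : 'rV[R]_m) : rsmooth f ->
  continuous (fun x : R => f (row_mx x%:M y)).
Proof.
move=> sf; apply: (@continuous_scalar (fun z => f (row_mx z y))).
apply: (rsmooth_precomp (io := fun z : 'rV[R]_1 => row_mx z y)) => // l.
case: (fintype.splitP l) => j Ej.
  have -> : l = lshift m j by apply/val_inj.
  by apply: rsmooth_eq (rsmooth_coord _ j) => z; rewrite row_mxEl.
have -> : l = rshift 1 j by apply/val_inj.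
by apply: rsmooth_eq (rsmooth_cst (y 0 j)) => z; rewrite row_mxEr.
Qed.

Lemma Cint_slice m M (c : R[i]) eta1 (w : 'rV[R]_(1 + m) -> R[i]) y : csmooth w -> csupported M w ->
  Cint (fun y1 => c * (expi (- (y1 * eta1)) * w (row_mx y1%:M y))) = c * slice eta1 w y.
Proof.
move=> sw uw; pose F (z : 'rV[R]_(1 + m)) := expi (- (z 0 (lshift m ord0) * eta1)) * w z.
have [sr si] : csmooth F.
  exact: (csmoothM (csmooth_expi (rsmoothN (rsmoothM (rsmooth_coord R (lshift m ord0)) (rsmooth_cst eta1)))) sw).
have EF y1 : expi (- (y1 * eta1)) * w (row_mx y1%:M y) = F (row_mx (y1%:M : 'rV[R]_1) y).
  by rewrite /F row_mxEl mxE eqxx mulr1n.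
rewrite /slice (_ : (fun y1 => expi _ * _) = fun y1 => F (row_mx (y1%:M : 'rV[R]_1) y)); last first.
  by apply/funext => y1; rewrite EF.
rewrite (_ : (fun y1 => c * _) = fun y1 => c * F (row_mx (y1%:M : 'rV[R]_1) y)); last first.
  by apply/funext => y1; rewrite EF.
apply: (@Cint_scale c (fun y1 => F (row_mx y1%:M y)) M).
- exact: (@continuous_row1 m (re_fun F) y sr).
- exact: (@continuous_row1 m (im_fun F) y si).
- by move=> y1 My1; rewrite /F uw ?mulr0 // => /box_row_mx[/box_scalar]; rewrite leNgt My1.
Qed.

(** [fourier] integrates the first variable outermost; [intRn_swap] moves it innermost, where it
    forms the partial transform. *)
Lemma fourier_slice m M (w : 'rV[R]_(1 + m) -> R[i]) eta1 (eta : 'rV[R]_m) : 0 <= M ->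
  csmooth w -> csupported M w ->
  @fourier R m.+1 w (row_mx (eta1%:M : 'rV[R]_1) eta) = fourier (slice eta1 w) eta.
Proof.
move=> M0 sw uw.
pose e := row_mx (eta1%:M : 'rV[R]_1) eta.
pose F (y : 'rV[R]_(1 + m)) := expi (- @dot m.+1 y e) * w y.
have [sr si] : csmooth F.
  exact: (csmoothM (csmooth_expi (rsmoothN (@rsmooth_dotl m.+1 e))) sw).
have uF : csupported M F by exact: csupportedM.
transitivity (intCn (fun y : 'rV[R]_m => Cint (fun y1 => F (row_mx y1%:M y)))).
  apply: complex_ext.
    exact: (intRn_swap M0 sr (supported_re uF)).
  exact: (intRn_swap M0 si (supported_im uF)).
congr intCn; apply/funext => y.
rewrite -(Cint_slice _ _ _ sw uw); congr Cint; apply/funext => y1.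
by rewrite /F dot_row opprD addrC expiD mulrA.
Qed.

(** In each of the real and imaginary parts one cosine and one sine transform occur; the cosine
    gives the value and the sine integrates to 0. *)
Lemma inversion1 (W : R -> R[i]) M x : 0 <= M ->
  csmooth (fun z : 'rV[R]_1 => W (z 0 ord0)) -> (forall y, M < `|y| -> W y = 0) ->
  Cint (fun eta => Cint (fun y => expi ((x - y) * eta) * W y)) = (2 * pi)%:C * W x.
Proof.
move=> M0 [sr si] sW.
pose p y := complex.Re (W y); pose q y := complex.Im (W y).
have up y : M < `|y| -> p y = 0 by move=> /sW; rewrite /p => ->.
have uq y : M < `|y| -> q y = 0 by move=> /sW; rewrite /q => ->.
have cts (f : R -> R) k eta : rsmooth (fun z : 'rV[R]_1 => f (z 0 ord0)) ->
    continuous (fun y => trig k ((x - y) * eta) * f y).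
  move=> sf; have sg : rsmooth (fun z : 'rV[R]_1 => (x - z 0 ord0) * eta).
    exact: (rsmoothM (rsmoothB (rsmooth_cst x) (rsmooth_coord R ord0)) (rsmooth_cst eta)).
  have := continuous_scalar (rsmoothM (rsmooth_trig k sg) sf).
  have Es (z : R) : (z%:M : 'rV[R]_1) 0 ord0 = z by rewrite mxE eqxx mulr1n.
  by under eq_fun do rewrite Es.
have sup0 (f : R -> R) k eta : (forall y, M < `|y| -> f y = 0) ->
   forall y, M < `|y| -> trig k ((x - y) * eta) * f y = 0.
  by move=> Hf y /Hf ->; rewrite mulr0.
have inner eta : Cint (fun y => expi ((x - y) * eta) * W y) =
   (1 * ft_shift p x 0%N eta + (-1) * ft_shift q x 3%N eta) +i* (1 * ft_shift q x 0%N eta + 1 * ft_shift p x 3%N eta).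
  apply: complex_ext => /=.
    rewrite -(Rint_lin _ _ (cts p 0%N eta sr) (cts q 3%N eta si) (sup0 p 0%N eta up) (sup0 q 3%N eta uq)).
    by apply: eq_Rintegral => y _; rewrite complex_ReM mul1r mulN1r.
  rewrite -(Rint_lin _ _ (cts q 0%N eta si) (cts p 3%N eta sr) (sup0 q 0%N eta uq) (sup0 p 3%N eta up)).
  by apply: eq_Rintegral => y _; rewrite complex_ImM !mul1r.
have It (f : R -> R) k : rsmooth (fun z : 'rV[R]_1 => f (z 0 ord0)) -> (forall y, M < `|y| -> f y = 0) ->
    mu.-integrable setT (EFin \o ft_shift f x k).
  move=> sf uf; have [K HK] := ft_decay x M0 sf uf k.
  by apply: decay_integrable HK; exact: (@ft_continuous _ _ _ x M0 sf uf k).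
have outer (f g : R -> R) c : rsmooth (fun z : 'rV[R]_1 => f (z 0 ord0)) ->
    rsmooth (fun z : 'rV[R]_1 => g (z 0 ord0)) -> (forall y, M < `|y| -> f y = 0) ->
    (forall y, M < `|y| -> g y = 0) ->
    \int[mu]_(eta in setT) (1 * ft_shift f x 0%N eta + c * ft_shift g x 3%N eta) = 2 * pi * f x.
  move=> sf sg uf ug.
  have I1 := It f 0%N sf uf; have I2 := It g 3%N sg ug.
  have J1 : mu.-integrable setT (EFin \o (fun eta => 1 * ft_shift f x 0%N eta)).
    by move: (integrableZl measurableT 1 I1).
  have J2 : mu.-integrable setT (EFin \o (fun eta => c * ft_shift g x 3%N eta)).
    by move: (integrableZl measurableT c I2).
  rewrite (RintegralD _ J1 J2) // RintegralZl // RintegralZl //.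
  by rewrite (sine_inversion x M0 sg ug) (cosine_inversion x M0 sf uf) mulr0 addr0 mul1r.
rewrite (_ : (fun eta => Cint _) = fun eta => (1 * ft_shift p x 0%N eta + (-1) * ft_shift q x 3%N eta) +i* (1 * ft_shift q x 0%N eta + 1 * ft_shift p x 3%N eta)); last first.
  by apply/funext => eta; exact: inner.
apply: complex_ext; rewrite ?complex_ReM ?complex_ImM /= mul0r.
  by rewrite subr0; exact: (outer p q (-1) sr si up uq).
by rewrite addr0; exact: (outer q p 1 si sr uq up).
Qed.

Lemma csmooth_comp m (w : 'rV[R]_(1 + m) -> R[i]) (y : 'rV[R]_m) : csmooth w ->
  csmooth (fun z : 'rV[R]_1 => w (row_mx ((z 0 ord0)%:M : 'rV[R]_1) y)).
Proof.
have key (f : 'rV[R]_(1 + m) -> R) : rsmooth f -> rsmooth (fun z : 'rV[R]_1 => f (row_mx ((z 0 ord0)%:M : 'rV[R]_1) y)).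
  move=> sf; apply: (rsmooth_precomp (io := fun z : 'rV[R]_1 => row_mx ((z 0 ord0)%:M : 'rV[R]_1) y)) => // l.
  case: (fintype.splitP l) => j Ej.
    have -> : l = lshift m j by apply/val_inj.
    by apply: rsmooth_eq (rsmooth_coord _ j) => z; rewrite row_mxEl (ord1 j) mxE eqxx mulr1n.
  have -> : l = rshift 1 j by apply/val_inj.
  by apply: rsmooth_eq (rsmooth_cst (y 0 j)) => z; rewrite row_mxEr.
by move=> [wr wi]; split; [exact: (key _ wr)|exact: (key _ wi)].
Qed.

(** At fixed eta1 the induction hypothesis inverts the remaining variables of the partial transform,
    which is again smooth with compact support; the outer integral is then one-dimensional
    inversion. *)
Theorem fourier_inversion m (w : 'rV[R]_m -> R[i]) M x : 0 <= M -> csmooth w -> csupported M w ->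
  intCn (fun eta => expi (dot x eta) * fourier w eta) = ((2 * pi) ^+ m)%:C * w x.
Proof.
move=> M0; elim: m w x => [|m ih] w x sw uw.
  rewrite (thinmx0 x) expr0 mul1r.
  have E (y : 'rV[R]_0) : dot y 0 = 0 by rewrite /dot big_ord0.
  have Ef : fourier w 0 = w 0.
    by rewrite /fourier; apply: complex_ext; rewrite /= /re_fun /im_fun -/(dot 0 0) E oppr0 expi0 mul1r.
  by apply: complex_ext; rewrite /= /re_fun /im_fun Ef E expi0 mul1r.
pose x1 := (lsubmx (x : 'rV[R]_(1 + m))) 0 ord0; pose x' := rsubmx (x : 'rV[R]_(1 + m)).
have Ex : x = row_mx (x1%:M : 'rV[R]_1) x'.
  have <- : lsubmx (x : 'rV[R]_(1 + m)) = x1%:M.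
    by apply/rowP => k; rewrite (ord1 k) [RHS]mxE eqxx mulr1n.
  by rewrite hsubmxK.
pose c : R[i] := ((2 * pi) ^+ m)%:C.
pose W y1 := c * w (row_mx (y1%:M : 'rV[R]_1) x').
have sW : csmooth (fun z : 'rV[R]_1 => W (z 0 ord0)).
  exact: (csmoothM (csmooth_cst 1 c) (csmooth_comp x' sw)).
have uW y1 : M < `|y1| -> W y1 = 0.
  by move=> My1; rewrite /W uw ?mulr0 // => /(@box_row_mx _ 1 m) [/box_scalar]; rewrite leNgt My1.
transitivity (Cint (fun eta1 => intCn (fun eta : 'rV[R]_m =>
   expi (@dot m.+1 x (row_mx (eta1%:M : 'rV[R]_1) eta)) * fourier w (row_mx (eta1%:M : 'rV[R]_1) eta)))).
  by [].
transitivity (Cint (fun eta => Cint (fun y => expi ((x1 - y) * eta) * W y))); last first.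
  rewrite (inversion1 _ M0 sW uW) /W Ex mulrA; congr (_ * _).
  by rewrite /c -rmorphM -exprS.
congr Cint; apply/funext => eta1.
have [ss us] := csmooth_slice eta1 M0 sw uw.
(* The factor exp (i x1 eta1) is put inside the transform, since [intCn_scale] asks for compact
   support and the integrand in eta has none. *)
transitivity (intCn (fun eta : 'rV[R]_m => expi (dot x' eta) * fourier (fun y => expi (x1 * eta1) * slice eta1 w y) eta)).
  congr intCn; apply/funext => eta.
  rewrite Ex dot_row expiD (fourier_slice _ _ M0 sw uw) (fourier_scale _ _ M0 ss us).
  by rewrite mulrCA mulrA.
rewrite ih; last 2 first.
- exact: (csmoothM (csmooth_cst m (expi (x1 * eta1))) ss).
- exact: csupportedM.
rewrite -/c mulrA -(Cint_slice _ _ _ sw uw); congr Cint; apply/funext => y.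
by rewrite /W mulrBl expiD; ring.
Qed.

End Inversion.

(** * Pointwise value of the Fourier integral operator *)

Section FioFormula.
Variable R : realType.

(** At a fixed point y the amplitude and the power of 2 pi are constants; they are moved onto w, as
    in the inversion theorem, and the phase is the one of inversion at X. *)
Lemma fio_value n (phi : real_net R (1 + n + n)) (b : net R (1 + n)) (w : net R n)
    (X : 'rV[R]_n) e y M : 0 <= M -> csmooth (w e) -> csupported M (w e) ->
  (forall eta, phi e (row_mx y eta) = dot X eta) ->
  fio phi b w e y = b e y * w e X.
Proof.
move=> M0 sw uw Hphi; rewrite /fio.
set c : R[i] := b e y * ((2 * pi) ^- n)%:C.
transitivity (intCn (fun eta : 'rV[R]_n => expi (dot X eta) * fourier (fun y => c * w e y) eta)).
  congr intCn; apply/funext => eta.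
  by rewrite (fourier_scale c _ M0 sw uw) Hphi /c -!mulrA; do 2 congr (_ * _); exact: mulrC.
rewrite (fourier_inversion X M0 (csmoothM (csmooth_cst n c) sw) (csupportedM (fun=> c) uw)).
rewrite mulrA; congr (_ * _); rewrite /c mulrCA -rmorphM mulfV ?mulr1 //.
by rewrite expf_neq0 // mulf_neq0 // gt_eqF // pi_gt0.
Qed.

End FioFormula.

(** * Real and complex nets *)

Section Translation.
Variable R : realType.

Lemma cabs_ge0 (z : R[i]) : 0 <= cabs z.
Proof. by rewrite /cabs; case: z => x y /=; exact: sqrtr_ge0. Qed.

Lemma cabs_re (z : R[i]) : `|complex.Re z| <= cabs z.
Proof.
by rewrite /cabs; case: z => x y /=; rewrite -sqrtr_sqr ler_wsqrtr // lerDl sqr_ge0.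
Qed.

Lemma cabs_im (z : R[i]) : `|complex.Im z| <= cabs z.
Proof.
by rewrite /cabs; case: z => x y /=; rewrite -sqrtr_sqr ler_wsqrtr // lerDr sqr_ge0.
Qed.

Lemma cabs_le (z : R[i]) : cabs z <= `|complex.Re z| + `|complex.Im z|.
Proof.
rewrite /cabs; case: z => x y /=; rewrite -[leRHS]ger0_norm ?addr_ge0 // -sqrtr_sqr.
rewrite ler_wsqrtr // sqrrD !real_normK ?num_real // [leRHS]addrAC lerDl.
by rewrite mulrn_wge0 // mulr_ge0.
Qed.

Lemma cabsC (x : R) : cabs x%:C = `|x|.
Proof. by rewrite /cabs /= expr0n /= addr0 sqrtr_sqr. Qed.

Variable d : nat.
Implicit Types (u v : net R d).

Definition renet u : real_net R d := fun e => re_fun (u e).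
Definition imnet u : real_net R d := fun e => im_fun (u e).

Lemma re_pders al (f : 'rV[R]_d -> R[i]) : re_fun (pders al f) = dparts al (re_fun f).
Proof. by elim: al => //= i al <-. Qed.

Lemma im_pders al (f : 'rV[R]_d -> R[i]) : im_fun (pders al f) = dparts al (im_fun f).
Proof. by elim: al => //= i al <-. Qed.

Lemma smoothP (f : 'rV[R]_d -> R[i]) : smooth f <-> csmooth f.
Proof.
split=> [sf|[sr si] al].
  split=> al; have [c1 c2 H] := sf al; rewrite -?re_pders -?im_pders; split=> // i x;
  by have [] := H i x.
rewrite re_pders im_pders; have [c1 H1] := sr al; have [c2 H2] := si al.
by split=> // i x; split.
Qed.

Lemma smooth_netP u : smooth_net u <-> snet (renet u) /\ snet (imnet u).
Proof.
split=> [su|[sr si] e e01]; last by apply/smoothP; split; [exact: sr|exact: si].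
by split=> e e01; have [H1 H2] := (smoothP _).1 (su e e01); [exact: H1|exact: H2].
Qed.

Lemma renet_pders al u : renet (pders_net al u) = dnet al (renet u).
Proof. by apply/funext => e; exact: re_pders. Qed.

Lemma imnet_pders al u : imnet (pders_net al u) = dnet al (imnet u).
Proof. by apply/funext => e; exact: im_pders. Qed.

Lemma Obd_supO (P : scale R) u :
  (forall K, compact K -> exists2 g, P g & supO K u g) <->
  Obd P (renet u) /\ Obd P (imnet u).
Proof.
split=> [H|[Hr Hi] K cK].
  split=> M; have [g Pg [C C0 HC]] := H _ (@box_compact R d M);
    (exists (fun e => C * g e); first by apply: boundM => //; exact: bound_cst);
    apply: filterS HC => e He x Bx.
    exact: le_trans (cabs_re _) (He x Bx).
  exact: le_trans (cabs_im _) (He x Bx).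
have [M M0 KM] := compact_sub_box cK.
have [g Pg Hg] := Hr M; have [h Ph Hh] := Hi M.
exists (fun e => g e + h e); first exact: boundD.
exists 1 => //; near=> e => x /KM Bx; rewrite mul1r.
apply: le_trans (cabs_le _) _; apply: lerD.
  by move: x Bx; near: e; exact: Hg.
by move: x Bx; near: e; exact: Hh.
Unshelve. all: by end_near. Qed.

Lemma modb_expV N : modb (fun e : R => e ^- N).
Proof.
exists N; apply: filterS (near01 R) => e /andP[e0 _].
by rewrite ger0_norm // invr_ge0 exprn_ge0 // ltW.
Qed.

Lemma supO_le (K : set 'rV[R]_d) u (g h : R -> R) : supO K u g ->
  (\forall e \near 0^'+, g e <= h e) -> supO K u h.
Proof.
move=> [C C0 HC] gh; exists C => //; near=> e => x Kx.
apply: (@le_trans _ _ (C * g e)).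
  by move: x Kx; near: e.
by rewrite ler_pM2l //; near: e.
Unshelve. all: by end_near. Qed.

Lemma moderateP u : moderate u <-> mode (renet u) /\ mode (imnet u).
Proof.
split=> [[/smooth_netP[sr si] mu]|[[sr mr] [si mi]]].
  have H al : Obd (modscale R) (renet (pders_net al u)) /\ Obd (modscale R) (imnet (pders_net al u)).
    apply/Obd_supO => K cK; have [N HN] := mu K cK al.
    by exists (fun e => e ^- N) => //; exact: modb_expV.
  split; split=> // al; have [] := H al; by rewrite renet_pders imnet_pders.
split; first by apply/smooth_netP.
move=> K cK al.
have : Obd (modscale R) (renet (pders_net al u)) /\ Obd (modscale R) (imnet (pders_net al u)).
  by rewrite renet_pders imnet_pders; split; [exact: mr|exact: mi].
move=> /Obd_supO /(_ K cK)[g [N HN] Hg]; exists N; apply: supO_le Hg _.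
by apply: filterS HN => e; apply: le_trans; exact: ler_norm.
Qed.

Lemma nul_supO u (V : set 'rV[R]_d) : null_on V u -> forall K, compact K -> K `<=` V -> forall q : nat,
  \forall e \near 0^'+, forall x, K x -> cabs (u e x) <= e ^+ q.
Proof.
move=> nu K cK KV q; have [C C0 HC] := nu K cK KV [::] q.+1.
have C1 : 0 < C^-1 by rewrite invr_gt0.
near=> e => x Kx.
have /andP[e0 eC] : 0 < e <= C^-1 by near: e; exact: e_small.
apply: (@le_trans _ _ (C * e ^+ q.+1)).
  by move: x Kx; near: e; exact: HC.
rewrite exprS mulrA ler_piMl ?exprn_ge0 ?(ltW e0) //.
by rewrite -[leRHS](mulfV (lt0r_neq0 C0)) ler_pM2l.
Unshelve. all: by end_near. Qed.

(** On the right only values are required to be small; [nul_dnet] recovers the derivatives. *)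
Lemma negligibleP u : Defs.negligible u <->
  (mode (renet u) /\ nul (renet u)) /\ (mode (imnet u) /\ nul (imnet u)).
Proof.
split=> [[su nu]|[[mr nr] [mi ni]]].
  have /moderateP[mr mi] : moderate u.
    split=> // K cK al; exists 0%N; apply: supO_le (nu K cK _ al 0%N) _ => //.
    by apply: nearW => e; rewrite expr0 invr1.
  split; split=> // M q.
    apply: filterS (nul_supO nu (@box_compact R d M) (fun _ _ => Logic.I) q) => e H x Bx.
    exact: le_trans (cabs_re _) (H x Bx).
  apply: filterS (nul_supO nu (@box_compact R d M) (fun _ _ => Logic.I) q) => e H x Bx.
  exact: le_trans (cabs_im _) (H x Bx).
split; first by apply/smooth_netP; split; [exact: mr.1|exact: mi.1].
move=> K cK _ al q; have [M M0 KM] := compact_sub_box cK.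
have Nr := nul_dnet al mr nr M q; have Ni := nul_dnet al mi ni M q.
exists 2 => //; near=> e => x /KM Bx.
apply: le_trans (cabs_le _) _; rewrite mulr_natl mulr2n; apply: lerD.
  have -> : complex.Re (pders_net al u e x) = dnet al (renet u) e x by rewrite -renet_pders.
  by move: x Bx; near: e; exact: Nr.
have -> : complex.Im (pders_net al u e x) = dnet al (imnet u) e x by rewrite -imnet_pders.
by move: x Bx; near: e; exact: Ni.
Unshelve. all: by end_near. Qed.

Lemma eqGP u v : eqG u v <->
  (mode (fun e x => renet u e x - renet v e x) /\ nul (fun e x => renet u e x - renet v e x)) /\
  (mode (fun e x => imnet u e x - imnet v e x) /\ nul (fun e x => imnet u e x - imnet v e x)).
Proof.
rewrite /eqG negligibleP.
have -> : renet (fun e x => u e x - v e x) = fun e x => renet u e x - renet v e x.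
  apply/funext => e; apply/funext => x; rewrite /renet /re_fun.
  by case: (u e x); case: (v e x).
have -> // : imnet (fun e x => u e x - v e x) = fun e x => imnet u e x - imnet v e x.
apply/funext => e; apply/funext => x; rewrite /imnet /im_fun.
by case: (u e x); case: (v e x).
Qed.

Lemma eqG_moderate u v : moderate u -> moderate v ->
  nul (fun e x => renet u e x - renet v e x) -> nul (fun e x => imnet u e x - imnet v e x) -> eqG u v.
Proof.
move=> /moderateP[? ?] /moderateP[? ?] ? ?.
by apply/eqGP; split; split=> //; exact: modeB.
Qed.

Lemma eqG_refl u : moderate u -> eqG u u.
Proof.
move=> mu; apply: eqG_moderate => //; apply: (@nul_ext _ _ _ (fun _ _ => 0)); try exact: nul0;
by move=> e _ x; rewrite subrr.
Qed.

Lemma eqG_sym u v : eqG u v -> eqG v u.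
Proof.
move=> /eqGP[[m1 n1] [m2 n2]]; apply/eqGP.
by split; split; [apply: mode_ext (modeN m1)|apply: nul_ext (nulN n1)|apply: mode_ext (modeN m2)|apply: nul_ext (nulN n2)];
  move=> e _; [apply/funext|move|apply/funext|move] => x; rewrite opprB.
Qed.

Lemma eqG_trans v u w : eqG u v -> eqG v w -> eqG u w.
Proof.
move=> /eqGP[[m1 n1] [m2 n2]] /eqGP[[m3 n3] [m4 n4]]; apply/eqGP.
by split; split; [apply: mode_ext (modeD m1 m3)|apply: nul_ext (nulD n1 n3)|apply: mode_ext (modeD m2 m4)|apply: nul_ext (nulD n2 n4)];
  move=> e _; [apply/funext|move|apply/funext|move] => x; rewrite addrA subrK.
Qed.

Lemma eqG_mod u v : eqG u v -> moderate v -> moderate u.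
Proof.
move=> /eqGP[[m1 n1] [m2 n2]] /moderateP[m3 m4]; apply/moderateP.
by split; [apply: mode_ext (modeD m1 m3)|apply: mode_ext (modeD m2 m4)];
  move=> e _; apply/funext => x; rewrite subrK.
Qed.

Lemma reps_moderate (a : colombeau R d) u : a u -> moderate u.
Proof. by have [w mw ->] := repsP a => /eqG_mod; exact. Qed.

Lemma reps_eqG (a : colombeau R d) u v : a u -> a v -> eqG u v.
Proof. by have [w mw ->] := repsP a => uw /eqG_sym; exact: eqG_trans. Qed.

Lemma eqG_reps (a : colombeau R d) u v : a u -> eqG v u -> a v.
Proof. by have [w mw ->] := repsP a => uw vu; exact: eqG_trans vu uw. Qed.

Lemma a_rep_in (a : colombeau R d) : a (a_rep a).
Proof. by rewrite /a_rep; case: cid2 => v mv E /=; rewrite [X in X v]E; exact: eqG_refl. Qed.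

Lemma colombeau_eq (a b : colombeau R d) u : a u -> b u -> a = b.
Proof.
move=> au bu; have E : reps a = reps b.
  apply/funext => v; apply/propext; split=> H.
    by apply: eqG_reps bu _; exact: reps_eqG H au.
  by apply: eqG_reps au _; exact: reps_eqG H bu.
case: a b E {au bu} => [ra pa] [rb pb] /= E; subst rb.
by congr Colombeau; exact: Prop_irrelevance.
Qed.

End Translation.

(** * Representatives with compact support *)

Section Cutoff.
Variable R : realType.

(* The family x^-k exp (-1/x) is stable under differentiation up to linear combinations. *)
Definition flat (k : nat) (x : R) : R := if 0 < x then x^-1 ^+ k * expR (- x^-1) else 0.

(** From exp y >= (y / (k + 2))^(k + 2) at y = 1/h. Quadratic decay is what gives the derivative 0
    at the origin. *)
Lemma flat_bound k (h : R) : `|flat k h| <= k.+2%:R ^+ k.+2 * h ^+ 2.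
Proof.
rewrite /flat; case: ifPn => [h0|_]; last by rewrite normr0 mulr_ge0 ?sqr_ge0 // exprn_ge0.
have y0 : 0 < h^-1 by rewrite invr_gt0.
rewrite -[h ^+ 2]invrK -exprVn; set y := h^-1 in y0 *.
rewrite ger0_norm ?mulr_ge0 ?exprn_ge0 ?expR_ge0 ?(ltW y0) // expRN.
have N0 : (0 : R) < k.+2%:R by rewrite ltr0n.
have H : (y / k.+2%:R) ^+ k.+2 <= expR y.
  have -> : expR y = expR (y / k.+2%:R) ^+ k.+2.
    by rewrite -expRM_natl -mulr_natl mulrC mulfVK ?gt_eqF.
  apply: lerXn2r; rewrite ?nnegrE ?expR_ge0 ?divr_ge0 ?(ltW y0) ?(ltW N0) //.
  by apply: le_trans (expR_ge1Dx _); rewrite lerDr.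
rewrite ler_pdivrMr ?expR_gt0 //.
apply: le_trans (ler_wpM2l (_ : 0 <= k.+2%:R ^+ k.+2 * y ^- 2) H); last first.
  by rewrite mulr_ge0 ?exprn_ge0 ?invr_ge0 ?exprn_ge0 ?(ltW y0) ?(ltW N0).
have eqle (p q : R) : p = q -> p <= q by move=> ->.
apply: eqle; rewrite expr_div_n ![_ ^+ k.+2]exprS ![_ ^+ k.+1]exprS.
have a0 : (k.+2%:R : R) != 0 by rewrite gt_eqF.
have b0 : (k.+2%:R : R) ^+ k != 0 by rewrite expf_neq0.
have yn0 : y != 0 by rewrite gt_eqF.
have alg (a b c v : R) : a != 0 -> b != 0 -> v != 0 ->
    c = a * (a * b) / v ^+ 2 * (v * (v * c) / (a * (a * b))).
  by move=> a1 b1 v1; field; rewrite v1 b1 a1.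
exact: alg.
Qed.

Lemma is_derive_quadratic (f : R -> R) C : f 0 = 0 -> (forall h, `|f h| <= C * h ^+ 2) ->
  is_derive (0 : R) (1 : R) f 0.
Proof.
move=> f0 Hf.
have E : (fun h : R => h^-1 *: (f (h *: (1 : R) + 0) - f 0)) @ 0^' --> (0 : R).
  apply/norm_cvg0P; apply: (@squeeze_cvgr _ _ _ _ (cst 0) (fun h => C * `|h|)); last 2 first.
  - exact: cvg_cst.
  - have L (z : R) : z = C * `|0 : R| -> (fun h : R => C * `|h|) @ (0 : R) --> z.
      by move=> ->; apply: cvgM; [exact: cvg_cst|apply: cvg_norm; exact: cvg_id].
    by apply: cvg_within_filter; apply: L; rewrite normr0 mulr0.
  near=> h; rewrite normr_ge0 /= f0 subr0 addr0 [h *: 1]mulr1 normrM normfV.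
  have h0 : 0 < `|h| by rewrite normr_gt0; near: h; exact: nbhs_dnbhs_neq.
  rewrite mulrC ler_pdivrMr // -mulrA; apply: le_trans (Hf h) _.
  by rewrite -expr2 real_normK // num_real.
by apply: DeriveDef; [apply/cvg_ex; exists 0; exact: E|exact: cvg_lim E].
Unshelve. all: by end_near. Qed.

Lemma is_derive_flat k (x : R) : is_derive x (1 : R) (flat k) (- k%:R * flat k.+1 x + flat k.+2 x).
Proof.
have [x0|x0|->] := ltgtP x 0.
- rewrite /flat (le_gtF (ltW x0)) mulr0 addr0.
  apply: (near_eq_is_derive _ (is_derive_cst (0 : R) x (1 : R))).
  have : \forall z \near x, z < 0 by exact: lt_nbhsl.
  by apply: filterS => z z0; rewrite (le_gtF (ltW z0)).
- have xn : x != 0 by rewrite gt_eqF.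
  pose f (x : R) : R := x^-1 ^+ k * expR (- x^-1).
  apply: (@near_eq_is_derive _ _ _ f).
    have : \forall z \near x, 0 < z by exact: lt_nbhsr.
    by apply: filterS => z z0; rewrite /flat z0.
  have dv : is_derive x (1 : R) (fun x => x^-1) (- x ^- 2).
    by have := is_deriveV xn (is_derive_id x (1 : R)); move/is_derive_congr; apply; rewrite /= [_ *: _]mulr1.
  have dvk : is_derive x (1 : R) (fun x => x^-1 ^+ k) (k%:R * x^-1 ^+ k.-1 * - x ^- 2).
    have := @is_deriveX R R (fun x => x^-1) k x 1 _ dv.
    by rewrite exprfctE; move/is_derive_congr; apply.
  have de : is_derive x (1 : R) (fun x => expR (- x^-1)) (expR (- x^-1) * x ^- 2).
    have := @is_derive_comp1 R R expR (fun x => - x^-1) x 1 _ _ (is_derive_expR _) (is_deriveN dv).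
    by rewrite opprK.
  have := is_deriveM dvk de; move/is_derive_congr; apply.
  rewrite /flat x0 /GRing.scale /= -!exprVn; set y := x^-1.
  by clear f; case: k {dvk} => [|k] /=; rewrite ?mul0r ?expr0 ?exprS; ring.
rewrite /flat ltxx mulr0 addr0.
by apply: (is_derive_quadratic _ (flat_bound k)); rewrite /flat ltxx.
Qed.

Lemma rsmooth_flat d k (u : 'rV[R]_d -> R) : rsmooth u -> rsmooth (fun z => flat k (u z)).
Proof.
move=> su; apply/rsmoothP => l; elim: l k => [|l ih] k.
  move=> z; apply: continuous_comp; first exact: rsmooth_continuous.
  by apply: differentiable_continuous; apply/derivable1_diffP; have [] := is_derive_flat k (u z).
have D i z : is_derive z (delta_mx 0 i) (fun z => flat k (u z))
    ((- k%:R * flat k.+1 (u z) + flat k.+2 (u z)) * dpart i u z).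
  apply: is_derive_comp1; first exact: is_derive_flat.
  by apply: derivableP; exact: rsmooth_derivable.
split.
  move=> z; apply: continuous_comp; first exact: rsmooth_continuous.
  by apply: differentiable_continuous; apply/derivable1_diffP; have [] := is_derive_flat k (u z).
move=> i; split=> [z|]; first by have [] := D i z.
have -> : dpart i (fun z => flat k (u z)) = fun z => (- k%:R * flat k.+1 (u z) + flat k.+2 (u z)) * dpart i u z.
  by apply/funext => z; have [_] := D i z.
apply: CkM; last by have /rsmoothP := rsmooth_dpart i su; exact.
by apply: CkD; [apply: CkM; [exact: Ck_cst|exact: ih]|exact: ih].
Qed.

(** Inside the box of size M the sum vanishes and the value is e exp (-1) = 1. Outside the box of
    size M + 1 some x_j^2 - M^2 is at least 1, its summand is at least exp (-1), and the outer
    argument is nonpositive. *)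
Definition cutoff d (M : R) (x : 'rV[R]_d) : R :=
  expR 1 * flat 0 (1 - expR 1 * \sum_(j < d) flat 0 (x 0 j ^+ 2 - M ^+ 2)).

Lemma flat_ge0 k x : 0 <= flat k x.
Proof.
rewrite /flat; case: ifPn => // x0.
by rewrite mulr_ge0 ?expR_ge0 // exprn_ge0 // invr_ge0 ltW.
Qed.

Lemma rsmooth_cutoff d M : rsmooth (@cutoff d M).
Proof.
have s1 (j : 'I_d) : rsmooth (fun x : 'rV[R]_d => x 0 j ^+ 2 - M ^+ 2).
  exact: (rsmoothB (rsmoothM (rsmooth_coord R j) (rsmooth_coord R j)) (rsmooth_cst (M ^+ 2))).
have s2 : rsmooth (fun x : 'rV[R]_d => \sum_(j < d) flat 0 (x 0 j ^+ 2 - M ^+ 2)).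
  by apply: rsmooth_sum => j; exact: rsmooth_flat.
have s3 := rsmoothB (rsmooth_cst 1) (rsmoothM (rsmooth_cst (expR 1)) s2).
exact: (rsmoothM (rsmooth_cst (expR 1)) (rsmooth_flat 0 s3)).
Qed.

Lemma cutoff1 d M (x : 'rV[R]_d) : 0 <= M -> box d M x -> cutoff M x = 1.
Proof.
move=> M0 Bx; rewrite /cutoff big1 => [|j _].
  by rewrite mulr0 subr0 /flat ltr01 expr0 mul1r invr1 -expRD subrr expR0.
rewrite /flat ifF //; apply/negbTE; rewrite -leNgt subr_le0.
by rewrite -(real_normK (num_real (x 0 j))) lerXn2r ?nnegrE.
Qed.

Lemma cutoff0 d M (x : 'rV[R]_d) : 0 <= M -> ~ box d (M + 1) x -> cutoff M x = 0.
Proof.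
move=> M0 Bx; have [j Hj] : exists j, M + 1 < `|x 0 j|.
  apply: contrapT => H; apply: Bx => j; rewrite leNgt; apply/negP => Hj; apply: H; by exists j.
rewrite /cutoff (_ : flat 0 (1 - _) = 0) ?mulr0 //.
rewrite /flat ifF //; apply/negbTE; rewrite -leNgt subr_le0.
have H1 : 1 <= x 0 j ^+ 2 - M ^+ 2.
  rewrite -(real_normK (num_real (x 0 j))) lerBrDr.
  apply: (@le_trans _ _ ((M + 1) ^+ 2)); last by rewrite lerXn2r ?nnegrE ?addr_ge0 // ltW.
  rewrite sqrrD expr1n mulr1 addrC -addrA lerD2l lerDr mulrn_wge0 //.
have H2 : expR (- 1) <= flat 0 (x 0 j ^+ 2 - M ^+ 2).
  have p0 : 0 < x 0 j ^+ 2 - M ^+ 2 by apply: lt_le_trans H1.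
  rewrite /flat p0 expr0 mul1r ler_expR lerN2 -[leRHS]invr1 lef_pV2 ?posrE //.
have E1 : expR 1 * expR (- 1) = 1 :> R by rewrite -expRD subrr expR0.
rewrite -[leLHS]E1 ler_pM2l ?expR_gt0 //; apply: le_trans H2 _.
rewrite (bigD1 j) //= lerDl; apply: sumr_ge0 => k _; exact: flat_ge0.
Qed.

End Cutoff.

(** * Cutting off a representative near the support *)

Section CompactRep.
Variables (R : realType) (n : nat).

Lemma mode_fixed (f : 'rV[R]_n -> R) : rsmooth f -> mode (fun _ : R => f).
Proof.
move=> sf; split; first by move=> e _.
move=> al M; have [C C0 HC] := continuous_box_bounded M (rsmooth_continuous (rsmooth_dparts al sf)).
by exists (fun=> C); [exact: bound_cst|exact: nearW].
Qed.

Lemma closed_ball_compact (x : 'rV[R]_n) (r : R) : compact [set y : 'rV[R]_n | forall i, `|y 0 i - x 0 i| <= r].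
Proof.
have := @rV_compact R n (fun i => `[x 0 i - r, x 0 i + r]%classic) (fun i => @segment_compact R _ _).
congr compact; apply/seteqP; split=> y /= H i; have := H i; rewrite in_itv /= ler_norml.
  by move=> /andP[h1 h2]; apply/andP; split; [move: h1|move: h2]; lra.
by move=> /andP[h1 h2]; apply/andP; split; [move: h1|move: h2]; lra.
Qed.

(** The definition of the support supplies some representative that is null near x; [u] differs from
    it by a negligible net. The radius is halved so that a closed ball, which is compact, fits into
    the open set. *)
Lemma local_null (a : colombeau R n) u x : a u -> ~ supp a x ->
  exists2 r : R, 0 < r & forall q : nat, \forall e \near 0^'+, forall y, `|x - y| < r ->
    `|renet u e y| <= e ^+ q /\ `|imnet u e y| <= e ^+ q.
Proof.
move=> au sx.
have [V [oV Vx [v av nv]]] : exists V, [/\ open V, V x & exists2 v, a v & null_on V v].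
  apply: contrapT => H; apply: sx => V oV Vx Hv; apply: H; by exists V.
have /nbhs_ballP[r /= r0 Hr] : nbhs x V by exact: open_nbhs_nbhs.
have r2 : 0 < r / 2 by rewrite divr_gt0.
exists (r / 2) => // q.
pose L := [set y : 'rV[R]_n | forall i, `|y 0 i - x 0 i| <= r / 2].
have cL : compact L by exact: closed_ball_compact.
have LV : L `<=` V.
  move=> y Ly; apply: Hr; rewrite -ball_normE /=; apply: (@le_lt_trans _ _ (r / 2)); last lra.
  by apply/rV_normP; [exact: ltW|move=> i; rewrite !mxE distrC; exact: Ly].
have /eqGP[[_ n1] [_ n2]] := reps_eqG au av.
have [M M0 LM] := compact_sub_box cL.
near=> e => y xy.
have Ly : L y.
  by move=> i; apply: le_trans (ltW xy); have := rV_coord_le (x - y) i; rewrite !mxE distrC.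
have By : box n M y by exact: LM.
have /andP[e0 e2] : 0 < e <= 1 / 2 by near: e; apply: e_small; lra.
have Hv : cabs (v e y) <= e ^+ q.+1.
  by move: y Ly {xy By}; near: e; exact: (nul_supO nv cL LV q.+1).
have H1 : `|renet u e y - renet v e y| <= e ^+ q.+1.
  by move: y By {xy Ly Hv}; near: e; exact: n1.
have H2 : `|imnet u e y - imnet v e y| <= e ^+ q.+1.
  by move: y By {xy Ly Hv H1}; near: e; exact: n2.
have eq2 : e ^+ q.+1 + e ^+ q.+1 <= e ^+ q.
  by rewrite exprS -mulrDl -[leRHS]mul1r ler_wpM2r ?exprn_ge0 ?(ltW e0) //; move: e2; lra.
split; apply: le_trans eq2.
  rewrite -[renet u e y](subrK (renet v e y)); apply: le_trans (ler_normD _ _) _.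
  by apply: lerD => //; exact: le_trans (cabs_re _) Hv.
rewrite -[imnet u e y](subrK (imnet v e y)); apply: le_trans (ler_normD _ _) _.
by apply: lerD => //; exact: le_trans (cabs_im _) Hv.
Unshelve. all: by end_near. Qed.

Lemma coord_near (x : 'rV[R]_n) j (c : R) : `|x 0 j| < c -> \forall y \near x, `|(y : 'rV[R]_n) 0 j| < c.
Proof.
move=> xc; have r0 : 0 < c - `|x 0 j| by rewrite subr_gt0.
apply/nbhs_ballP; exists (c - `|x 0 j|) => //= y; rewrite -ball_normE /= => xy.
rewrite -[y 0 j](subrK (x 0 j)); apply: le_lt_trans (ler_normD _ _) _.
by rewrite -ltrBrDr; apply: le_lt_trans xy; have := rV_coord_le (x - y) j; rewrite !mxE distrC.
Qed.

Lemma ReCM (c : R) (z : R[i]) : complex.Re (c%:C * z) = c * complex.Re z.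
Proof. by case: z => a b /=; rewrite mul0r subr0. Qed.

Lemma ImCM (c : R) (z : R[i]) : complex.Im (c%:C * z) = c * complex.Im z.
Proof. by case: z => a b /=; rewrite mul0r addr0. Qed.

(* Multiply any representative by a cutoff equal to 1 near the support; that the
   difference is null off the support follows from local nullity by compactness. *)
Lemma compact_rep_exists (a : colombeau R n) : compactly_supported a -> exists w, compact_rep a w.
Proof.
move=> [K cK sK]; have [M M0 KM] := compact_sub_box cK.
pose u := a_rep a.
have mu : moderate u by exact: moderate_a_rep.
have au : a u by exact: a_rep_in.
have M1 : 0 <= M + 1 by rewrite addr_ge0.
pose chi := @cutoff R n (M + 1).
pose w : net R n := fun e x => (chi x)%:C * u e x.
have mchi := mode_fixed (@rsmooth_cutoff R n (M + 1)).
have [mr mi] := (moderateP u).1 mu.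
have Er : renet w = fun e x => chi x * renet u e x.
  by apply/funext => e; apply/funext => x; exact: ReCM.
have Ei : imnet w = fun e x => chi x * imnet u e x.
  by apply/funext => e; apply/funext => x; exact: ImCM.
have mw : moderate w by apply/moderateP; rewrite Er Ei; split; exact: modeM.
have loc L (q : nat) : \forall e \near 0^'+, forall x, box n L x ->
    `|(chi x - 1) * renet u e x| <= e ^+ q /\ `|(chi x - 1) * imnet u e x| <= e ^+ q.
  have [C C0 HC] := continuous_box_bounded (L + 1) (rsmooth_continuous (@rsmooth_cutoff R n (M + 1))).
  have C1 : 0 < (C + 1)^-1 by rewrite invr_gt0 ltr_wpDl.
  have /compact_near_coveringP cov := @box_compact R n L.
  apply: (cov _ _ (fun e x => `|(chi x - 1) * renet u e x| <= e ^+ q /\ `|(chi x - 1) * imnet u e x| <= e ^+ q)).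
  (* Either the cutoff equals 1 in a neighbourhood of x, or x is outside the box of size M, hence
     off the support, and [u] is null near x. *)
  move=> x Bx; have [Hx|Hx] := pselect (forall j, `|x 0 j| < M + 1).
    have near_x : \forall y \near x, forall j : 'I_n, `|(y : 'rV[R]_n) 0 j| < M + 1.
      apply: (@near_ord_forall n _ (nbhs x) _ (fun (j : 'I_n) (y : 'rV[R]_n) => `|y 0 j| < M + 1)) => j.
      exact: coord_near.
    near=> y e.
    have -> : chi y = 1.
      by apply: cutoff1 => // j; apply: ltW; move: j; near: y.
    have e0 : 0 <= e by apply: ltW; near: e; exact: nbhs_right_gt.
    by rewrite subrr !mul0r normr0 exprn_ge0.
  have sx : ~ supp a x.
    move=> /sK /KM Kx; apply: Hx => j; apply: le_lt_trans (Kx j) _; by rewrite ltrDl.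
  have [r r0 Hr] := local_null au sx.
  near=> y e.
  have xy : `|x - y| < r by near: y; apply/nbhs_ballP; exists r => // y; rewrite -ball_normE.
  have xy1 : `|x - y| < 1 by near: y; apply/nbhs_ballP; exists 1 => //= y; rewrite -ball_normE.
  have By : box n (L + 1) y.
    move=> j; rewrite -[y 0 j](subrK (x 0 j)) addrC; apply: le_trans (ler_normD _ _) _.
    apply: lerD; first exact: Bx.
    by apply: le_trans (ltW xy1); have := rV_coord_le (x - y) j; rewrite !mxE distrC.
  have /andP[e0 eC] : 0 < e <= (C + 1)^-1 by near: e; exact: e_small.
  have Hall : forall z, `|x - z| < r -> `|renet u e z| <= e ^+ q.+1 /\ `|imnet u e z| <= e ^+ q.+1.
    by near: e; exact: Hr.
  have [H1 H2] := Hall y xy.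
  have Hc : `|chi y - 1| <= C + 1.
    by apply: le_trans (ler_normB _ _) _; rewrite normr1 lerD2r; exact: HC.
  have key z : `|z| <= e ^+ q.+1 -> `|(chi y - 1) * z| <= e ^+ q.
    move=> Hz; rewrite normrM; apply: (@le_trans _ _ ((C + 1) * e ^+ q.+1)).
      by apply: ler_pM.
    rewrite exprS mulrA -[leRHS]mul1r ler_wpM2r ?exprn_ge0 ?(ltW e0) //.
    have Cp : 0 < C + 1 by rewrite ltr_wpDl.
    by rewrite -[leRHS](mulfV (lt0r_neq0 Cp)) ler_pM2l.
  by split; exact: key.
exists w; split.
  apply: (eqG_reps au); apply: eqG_moderate => //; rewrite ?Er ?Ei => L q.
    by apply: filterS (loc L q) => e H x /H[H1 _]; move: H1; rewrite mulrBl mul1r.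
  by apply: filterS (loc L q) => e H x /H[_ H1]; move: H1; rewrite mulrBl mul1r.
exists (box n (M + 1 + 1)); first exact: box_compact.
by move=> e _ x Bx; rewrite /w /chi cutoff0 // mul0r.
Unshelve. all: by end_near. Qed.

End CompactRep.

(** * Slow scale bounds on the flow *)

Section ScaleTools.
Variable R : realType.
Variable P : scale R.

Lemma nseq_rcons (T : Type) (x : T) m : nseq m.+1 x = rcons (nseq m x) x.
Proof. by elim: m => //= m <-. Qed.

(** All derivatives are eventually at most 1, so null nets fit every scale and may be added to slow
    scale estimates. *)
Lemma nul_Sb d al (u : real_net R d) : mode u -> nul u -> Sb P al u.
Proof.
move=> mu nu be _ M; exists (fun=> 1); first exact: bound_cst.
by have := nul_dnet be mu nu M 0%N; apply: filterS => e H x /H; rewrite expr0.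
Qed.

Lemma Sb_perm d (al be : seq 'I_d) (u : real_net R d) : snet u -> perm_eq al be ->
  Sb P al u -> Sb P be u.
Proof.
move=> su pab Sa s sb.
have /count_subseqP[s' s'a ss'] : forall x, (count_mem x s <= count_mem x al)%N.
  move=> x; have /permP -> := pab; exact: leq_count_subseq.
apply: Obd_ext (Sa s' s'a) => e e01.
by rewrite /dnet (dparts_perm (su e e01) ss').
Qed.

Lemma Sb_coord d al (k : 'I_d) : Sb P al (fun (_ : R) (z : 'rV[R]_d) => z 0 k).
Proof.
have O : Obd P (fun (_ : R) (z : 'rV[R]_d) => z 0 k).
  move=> M; exists (fun=> M); first exact: bound_cst.
  by apply: nearW => e x; exact.
elim/last_ind: al => [|al i ih]; first exact/Sb_nil.
apply/Sb_rcons; split=> //.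
rewrite (_ : dnet [:: i] _ = fun _ _ => (k == i)%:R); first exact: Sb_cst.
by apply/funext => e; apply/funext => x; rewrite /dnet /= dpart_coord.
Qed.

Lemma dparts_add d al (f h : 'rV[R]_d -> R) x : rsmooth f -> rsmooth h ->
  dparts al (fun x => f x + h x) x = dparts al f x + dparts al h x.
Proof.
elim/last_ind: al f h => [//|al i ih] f h sf sh; rewrite !dparts_rcons.
have -> : dpart i (fun x => f x + h x) = fun x => dpart i f x + dpart i h x.
  by apply/funext => z; rewrite dpartD.
by apply: ih; exact: rsmooth_dpart.
Qed.

Lemma dparts_sum d m al (f : 'I_m -> 'rV[R]_d -> R) x : (forall j, rsmooth (f j)) ->
  dparts al (fun x => \sum_(j < m) f j x) x = \sum_(j < m) dparts al (f j) x.
Proof.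
elim/last_ind: al f => [//|al i ih] f sf; rewrite !dparts_rcons.
under [RHS]eq_bigr do rewrite dparts_rcons.
have -> : dpart i (fun x => \sum_(j < m) f j x) = fun x => \sum_(j < m) dpart i (f j) x.
  by apply/funext => z; rewrite dpart_sum.
by apply: ih => j; exact: rsmooth_dpart.
Qed.

Lemma Obd_sum d m (u : 'I_m -> real_net R d) : (forall j, Obd P (u j)) ->
  Obd P (fun e x => \sum_(j < m) u j e x).
Proof.
elim: m u => [|m ih] u Ou.
  by apply: Obd_ext (Obd_cst P d 0) => e _; apply/funext => x; rewrite big_ord0.
apply: Obd_ext (ObdD (ih _ (fun j => Ou (widen_ord (leqnSn m) j))) (Ou ord_max)) => e _.
by apply/funext => x; rewrite big_ord_recr.
Qed.

Lemma Obd_all d m (u : 'I_m -> real_net R d) : (forall j, Obd P (u j)) ->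
  forall M, exists2 r, P r & \forall e \near 0^'+, 0 <= r e /\
    forall j x, box d M x -> `|u j e x| <= r e.
Proof.
move=> Ou M.
have /choice[r Hr] : forall j, exists r, P r /\ \forall e \near 0^'+, forall x, box d M x -> `|u j e x| <= r e.
  by move=> j; have [r Pr Hr] := Ou j M; exists r.
exists (fun e => \sum_j `|r j e|); first by apply: bound_sum => j; apply: bound_norm; exact: (Hr j).1.
have K : \forall e \near 0^'+, forall j x, box d M x -> `|u j e x| <= r j e.
  by apply: near_ord_forall => j; exact: (Hr j).2.
apply: filterS K => e H; split; first by apply: sumr_ge0.
move=> j x /H; move=> /(_ j) Hj; apply: (le_trans Hj); apply: (le_trans (ler_norm _)).
by rewrite (bigD1 j) //= lerDl sumr_ge0.
Qed.

(** Removing the term in which all derivatives fall on v leaves only derivatives of v of strictly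
    lower order, as an induction on the order requires. *)
Lemma leibniz_remainder d al (u v : real_net R d) : snet u -> snet v -> Sb P al u ->
  (forall be, subseq be al -> (size be < size al)%N -> Obd P (dnet be v)) ->
  Obd P (fun e x => dnet al (fun e x => u e x * v e x) e x - u e x * dnet al v e x).
Proof.
elim/last_ind: al v => [|al i ih] v su sv Su Hv.
  apply: (Obd_ext (v := fun _ _ => 0)); last exact: Obd_cst.
  by move=> e _; apply/funext => x; rewrite /dnet /= subrr.
have /Sb_rcons[Su1 Su2] := Su.
have sdu : snet (dnet [:: i] u) by exact: snet_dnet.
have sdv : snet (dnet [:: i] v) by exact: snet_dnet.
have Sv : Sb P al v.
  move=> be sb; apply: Hv; first exact: subseq_trans sb (subseq_rcons _ _).
  by rewrite size_rcons ltnS; exact: size_subseq.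
have H1 := SbM sdu sv Su2 Sv (subseq_refl al).
have H2 : Obd P (fun e x => dnet al (fun e x => u e x * dnet [:: i] v e x) e x - u e x * dnet al (dnet [:: i] v) e x).
  apply: ih => // be sb lt; rewrite (_ : dnet be _ = dnet (rcons be i) v).
    apply: Hv; last by rewrite !size_rcons ltnS.
    by rewrite -!cats1; apply: cat_subseq.
  by apply/funext => e; rewrite /dnet dparts_rcons.
apply: Obd_ext (ObdD H1 H2) => e e01; apply/funext => x.
have E : dnet (rcons al i) (fun e x => u e x * v e x) e =
    dnet al (fun e x => dnet [:: i] u e x * v e x + u e x * dnet [:: i] v e x) e.
  rewrite /dnet dparts_rcons; congr dparts; apply/funext => z.
  by rewrite (dpart_mul _ _ (su e e01) (sv e e01)).
have E2 : dnet (rcons al i) v e x = dnet al (dnet [:: i] v) e x by rewrite /dnet dparts_rcons.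
have sM1 : rsmooth (fun x => dnet [:: i] u e x * v e x) by apply: rsmoothM; [exact: sdu|exact: sv].
have sM2 : rsmooth (fun x => u e x * dnet [:: i] v e x) by apply: rsmoothM; [exact: su|exact: sdv].
rewrite E E2 addrA; congr (_ - _).
exact: (dparts_add al x sM1 sM2).
Qed.

End ScaleTools.

(** * Dependence of the phase on the flow *)

Section PhasePoint.
Variables (R : realType) (n : nat).

Definition phase_point (z : 'rV[R]_(1 + n + n)) : 'rV[R]_(n + (1 + 1)) := zero_s (lsubmx z).

Lemma phaseE (g : 'I_n -> real_net R (n + (1 + 1))) : phase g =
  fun e z => \sum_(h < n) (pull phase_point (g h) e z * z 0 (rshift (1 + n) h)).
Proof.
apply/funext => e; apply/funext => z; rewrite /phase; apply: eq_bigr => h _.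
by rewrite /pull /phase_point /zero_s mxE.
Qed.

Lemma phase_point_coord (P : scale R) al k : mode (fun (_ : R) z => phase_point z 0 k) /\
  Sb P al (fun (_ : R) z => phase_point z 0 k).
Proof.
move: k; apply: xts_ind => [j||].
- have -> : (fun (_ : R) z => phase_point z 0 (ix j)) = fun _ z => z 0 (lshift n (idx_x j)).
    by apply/funext => e; apply/funext => z; rewrite /phase_point zero_s_x mxE.
  by split; [exact: mode_coord|exact: Sb_coord].
- have -> : (fun (_ : R) z => phase_point z 0 (it n)) = fun _ z => z 0 (lshift n (idx_t n)).
    by apply/funext => e; apply/funext => z; rewrite /phase_point zero_s_t mxE.
  by split; [exact: mode_coord|exact: Sb_coord].
have -> : (fun (_ : R) z => phase_point z 0 (idx_s n)) = fun _ z => 0.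
  by apply/funext => e; apply/funext => z; rewrite /phase_point zero_s_s.
by split; [exact: mode_cst|exact: Sb_cst].
Qed.

Lemma box_phase_point (M : R) z : box _ M z -> box _ M (phase_point z).
Proof. by move=> Bz; apply: box_zero_s => j; rewrite mxE; exact: Bz. Qed.

Lemma phase_point_bounded (M : R) : exists M' : R, forall z, box _ M z -> box _ M' (phase_point z).
Proof. by exists M => z; exact: box_phase_point. Qed.

Lemma mode_phase (g : 'I_n -> real_net R (n + (1 + 1))) : (forall h, mode (g h)) -> mode (phase g).
Proof.
move=> mg; rewrite phaseE; apply: mode_sum => h; apply: modeM; last exact: mode_coord.
exact: (pull_mode (fun k => (phase_point_coord (modscale R) [::] k).1) phase_point_bounded).
Qed.

Lemma nul_phase (g g' : 'I_n -> real_net R (n + (1 + 1))) :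
  (forall h, nul (fun e z => g' h e z - g h e z)) -> nul (fun e z => phase g' e z - phase g e z).
Proof.
move=> ng; have N h : nul (fun e z => z 0 (rshift (1 + n) h) * pull phase_point (fun e z => g' h e z - g h e z) e z).
  by apply: nulM; [exact: (mode_coord R _).2 [::]|exact: (pull_nul phase_point_bounded)].
apply: nul_ext (nul_sum N) => e _ z; rewrite !phaseE -sumrB; apply: eq_bigr => h _.
by rewrite -mulrBl mulrC.
Qed.

End PhasePoint.

(** * Derivatives of the flow in x, then in t, then in s *)

Section SlowFlow.
Variables (R : realType) (n : nat) (P : scale R).
Local Notation iis := (idx_s n).
Local Notation iit := (it n).
Local Notation rnet := (real_net R).
Variables (A : 'I_n -> rnet (1 + n)) (g : 'I_n -> rnet (n + (1 + 1))).
Hypothesis ok : flow_ok A g.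
Let mA := flow_mA ok.
Let mg := flow_mg ok.
Let cg := flow_cg ok.
Hypothesis PA : forall j al, Obd P (dnet al (A j)).
Hypothesis LA : forall j k, logbound P (dnet [:: idx_x k] (A j)).

Let rho h : rnet (n + (1 + 1)) := fun e z => dnet [:: iis] (g h) e z + along g (A h) e z.
Let nrho h : nul (rho h). Proof. exact: flow_ode. Qed.
Let mal (f : rnet (1 + n)) : mode f -> mode (along g f). Proof. exact: along_mode. Qed.
Let mrho h : mode (rho h).
Proof. by apply: modeD; [exact: mode_dnet|exact: mal]. Qed.

Lemma Sb_flow_coord al k : (forall h, Sb P al (g h)) -> Sb P al (flow g k).
Proof.
move=> Sg; move: k; apply: tx_ind => [|h]; rewrite ?flow_t ?flow_x //.
exact: Sb_coord.
Qed.

Lemma Sb_along al (f : rnet (1 + n)) : mode f -> (forall be, Obd P (dnet be f)) ->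
  (forall h, Sb P al (g h)) -> Sb P al (along g f).
Proof.
move=> mf Pf Sg.
have := Sb_comp (cbd_flow cg) mf.1 (fun k => (mode_flow mg k).1) Pf (fun k => Sb_flow_coord k Sg).
by apply: Sb_ext => e _; apply/funext => z; rewrite alongE.
Qed.

Let PdA j k al : Obd P (dnet al (dnet [:: k] (A j))).
Proof.
by rewrite (_ : dnet al _ = dnet (rcons al k) (A j)) //; apply/funext => e; rewrite /dnet dparts_rcons.
Qed.

Let diag_shift j (y : 'rV[R]_(1 + n)) (h : R) :
  diag (h *: delta_mx 0 (idx_x j) + y) = h *: delta_mx 0 (ix j) + diag y.
Proof.
apply/rowP; apply: xts_ind => [k||];
  rewrite [RHS]mxE [X in _ = X + _]mxE [X in _ = _ * X + _]mxE ?diag_x ?diag_t ?diag_s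
   [LHS]mxE [X in X + _ = _]mxE [X in _ * X + _ = _]mxE eqxx /= ?eq_idx //.
Qed.

Let diag_dnet js h e y : 0 < e <= 1 ->
  dnet (map (@ix n) js) (g h) e (diag y) = dnet (map (@idx_x n) js) (pull (@diag R n) (g h)) e y.
Proof.
move=> e01; rewrite /dnet (_ : pull (@diag R n) (g h) e = g h e \o @diag R n) //.
rewrite (dparts_precomp (si := @si n)) //; last 2 first.
- exact: (mg h).1.
- by move=> i /mapP[j _ ->] x s; rewrite si_x.
rewrite -map_comp; congr (dparts _ _ _); apply: eq_map => j; by rewrite /= si_x.
Qed.

Let Bdiag (M : R) : exists M' : R, forall x, box _ M x -> box _ M' (@diag R n x).
Proof. by exists M => x; exact: box_diag. Qed.

(** Initial values for the equation of the x derivatives: at s = t gamma_h is the coordinate x_h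
    plus a null net. *)
Let init_Obd js h : Obd P (dnet (map (@idx_x n) js) (pull (@diag R n) (g h))).
Proof.
have mp : mode (pull (@diag R n) (g h)) by exact: (pull_mode (@mode_diag R n) Bdiag).
have mc := mode_coord R (@idx_x n h).
have S1 := nul_Sb P (al := map (@idx_x n) js) (modeB mp mc) (flow_init ok h).
have S2 := SbD (modeB mp mc).1 mc.1 S1 (Sb_coord P (al := map (@idx_x n) js) (@idx_x n h)).
apply: Obd_ext (S2 _ (subseq_refl _)) => e _; rewrite /dnet; congr dparts.
by apply/funext => y; rewrite subrK.
Qed.

(** The characteristic equation differentiated in x. The innermost derivative is taken by the chain
    rule, which exposes d_x a_1 along the flow as the linear coefficient. *)
Let step_eq be i h e z : 0 < e <= 1 ->
  dnet [:: iis] (dnet (rcons be (ix i)) (g h)) e z =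
  dnet (rcons be (ix i)) (rho h) e z
  - \sum_k dnet be (fun e z => along g (dnet [:: idx_x k] (A h)) e z * dnet [:: ix i] (g k) e z) e z.
Proof.
move=> e01.
have sg k := (mg k).1 e e01.
have -> : dnet [:: iis] (dnet (rcons be (ix i)) (g h)) e z = dnet (rcons be (ix i)) (dnet [:: iis] (g h)) e z.
  rewrite /dnet; have := dparts_perm (sg h) (_ : perm_eq (iis :: rcons be (ix i)) (rcons (rcons be (ix i)) iis)).
  by rewrite perm_sym perm_rcons perm_refl dparts_rcons => /(_ isT) <-.
have sal : rsmooth (along g (A h) e) by exact: (mal (mA h)).1.
have sds : rsmooth (dnet [:: iis] (g h) e) := rsmooth_dpart iis (sg h).
have -> : dnet (rcons be (ix i)) (rho h) e z = dnet (rcons be (ix i)) (dnet [:: iis] (g h)) e z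
    + dnet (rcons be (ix i)) (along g (A h)) e z.
  exact: dparts_add.
rewrite -[LHS]addr0 -addrA; congr (_ + _); apply/esym/eqP; rewrite subr_eq0; apply/eqP.
rewrite /dnet dparts_rcons.
have -> : dpart (ix i) (along g (A h) e) = fun z => \sum_k along g (dnet [:: idx_x k] (A h)) e z * dnet [:: ix i] (g k) e z.
  apply/funext => y; have := dpart_along mg (ix i) y e01 (mA h).1.
  rewrite eq_iis_ix mul0r add0r /dnet /= => ->.
  by apply: eq_bigr => k _; rewrite mulrC.
apply: dparts_sum => k.
exact: (rsmoothM ((mal (mode_dnet _ (mA h))).1 e e01) (rsmooth_dpart (ix i) ((mg k).1 e e01))).
Qed.

(* Induction on the order: a derivative of the flow in x satisfies the linearised
   characteristic equation, with a remainder involving lower orders only. *)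
Lemma Sb_flow_x js h : Sb P (map (@ix n) js) (g h).
Proof.
have [m] := ubnP (size js); elim: m js h => [//|m ih] js h; rewrite ltnS => sm be sb.
have {sb} [js' sjs -> {be}] : exists2 js', (size js' <= m)%N & be = map (@ix n) js'.
  have /subseqP[msk _ ->] := sb; exists (mask msk js); last by rewrite map_mask.
  by apply: leq_trans sm; exact: size_subseq (mask_subseq _ _).
elim/last_ind: js' sjs {js sm} => [_|js i _].
  move=> M; have [M' HM'] := cg M; exists (fun=> M'); first exact: bound_cst.
  by apply: filterS HM' => e H x Bx; exact: H.
rewrite size_rcons => sm; rewrite map_rcons.
set be := map (@ix n) js.
pose Y k : rnet (n + (1 + 1)) := dnet (rcons be (ix i)) (g k).
have Sbe k : Sb P be (g k) by exact: ih.
have SU k h' : Sb P be (along g (dnet [:: idx_x k] (A h'))).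
  by apply: Sb_along => //; exact: mode_dnet.
have sU k h' : snet (along g (dnet [:: idx_x k] (A h'))) by exact: (mal (mode_dnet _ (mA h'))).1.
have sV k : snet (dnet [:: ix i] (g k)) by exact: snet_dnet (mg k).1.
(* The part of the differentiated equation that involves only lower orders of gamma; it becomes the
   inhomogeneity in Gronwall. *)
pose Rm k h' : rnet (n + (1 + 1)) := fun e z =>
   dnet be (fun e z => along g (dnet [:: idx_x k] (A h')) e z * dnet [:: ix i] (g k) e z) e z
   - along g (dnet [:: idx_x k] (A h')) e z * dnet be (dnet [:: ix i] (g k)) e z.
have OR k h' : Obd P (Rm k h').
  apply: leibniz_remainder => // ce sce lce.
  have -> : dnet ce (dnet [:: ix i] (g k)) = dnet (rcons ce (ix i)) (g k).
    by apply/funext => e; rewrite /dnet dparts_rcons.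
  have /subseqP[msk _ Ece] := sce; rewrite -map_mask in Ece.
  rewrite Ece -map_rcons; apply: (ih (rcons (mask msk js) i)); last exact: subseq_refl.
  rewrite size_rcons; apply: leq_ltn_trans sm.
  by move: lce; rewrite Ece !size_map.
have HYs h' e z : 0 < e <= 1 -> dnet [:: iis] (Y h') e z =
    dnet (rcons be (ix i)) (rho h') e z - \sum_k Rm k h' e z
    - \sum_k along g (dnet [:: idx_x k] (A h')) e z * Y k e z.
  move=> e01; rewrite step_eq // -addrA -opprD -big_split; congr (_ - _).
  apply: eq_bigr => k _; rewrite /Rm /Y.
  have -> : dnet (rcons be (ix i)) (g k) e z = dnet be (dnet [:: ix i] (g k)) e z.
    by rewrite /dnet dparts_rcons.
  exact: (esym (subrK _ _)).
apply: (@gronwall_Obd R n n Y (fun z => z 0 iit)).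
- by move=> k; exact: snet_dnet (mg k).1.
- by move=> M z; exact.
- move=> M.
  have H h' : exists l, logb P l /\ \forall e \near 0^'+, forall k y, box _ M y ->
      `|along g (dnet [:: idx_x k] (A h')) e y| <= l e.
    have [l Pl Hl] := logbound_all (fun k => along_logbound cg (LA h' k)) M.
    by exists l.
  have /choice[l Hl] := H.
  have Or h' : Obd P (fun e z => dnet (rcons be (ix i)) (rho h') e z - \sum_k Rm k h' e z).
    apply: ObdD; first exact: nul_Sb (subseq_refl _).
    by apply: ObdN; apply: Obd_sum.
  have [r Pr Hr] := Obd_all Or M.
  exists (fun e => \sum_h l h e), r; split => //; first by apply: logb_sum => h'; exact: (Hl h').1.
  have K : \forall e \near 0^'+, forall h' k y, box _ M y ->
      `|along g (dnet [:: idx_x k] (A h')) e y| <= l h' e.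
    by apply: near_ord_forall => h'; exact: (Hl h').2.
  near=> e.
  have e01 : 0 < e <= 1 by near: e; exact: near01.
  have [r0 re] : 0 <= r e /\ forall j x, box _ M x ->
     `|dnet (rcons be (ix i)) (rho j) e x - \sum_k Rm k j e x| <= r e by near: e.
  split=> // z Bz h'; rewrite HYs //; apply: (le_trans (ler_normB _ _)); rewrite addrC.
  apply: lerD; last exact: re.
  apply: (le_trans (ler_norm_sum _ _ _)); rewrite mulr_sumr; apply: ler_sum => k _.
  rewrite normrM; apply: ler_wpM2r => //.
  apply: (@le_trans _ _ (l h' e)); first by move: h' k z Bz; near: e.
  by rewrite (bigD1 h') //= lerDl sumr_ge0 // => j _; exact: (Hl j).1.1.
- move=> M; have [D PD HD] := Obd_all (fun h' => init_Obd (rcons js i) h') M.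
  exists D => //; near=> e => k z Bz.
  have e01 : 0 < e <= 1 by near: e; exact: near01.
  have [_ De] : 0 <= D e /\ forall j x, box _ M x ->
     `|dnet (map (@idx_x n) (rcons js i)) (pull (@diag R n) (g j)) e x| <= D e by near: e.
  rewrite sets_t /Y -map_rcons diag_dnet //; apply: De; exact: box_proj_tx.
Unshelve. all: by end_near. Qed.

Let mpA j : mode (pull (@proj_tx R n) (A j)).
Proof.
apply: (pull_mode (@mode_proj_tx R n)) => // M; exists M => x; exact: box_proj_tx.
Qed.

Let cbd_proj : cbd (fun k (_ : R) (z : 'rV[R]_(n + (1 + 1))) => proj_tx z 0 k).
Proof. by move=> M; exists M; apply: nearW => e x Bx k; exact: box_proj_tx. Qed.

Let Sb_proj al j : Sb P al (pull (@proj_tx R n) (A j)).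
Proof.
have Sc k : Sb P al (fun (_ : R) (z : 'rV[R]_(n + (1 + 1))) => proj_tx z 0 k).
  move: k; apply: tx_ind => [|k].
    by apply: Sb_ext (Sb_coord P (al := al) iit) => e _; apply/funext => z; rewrite proj_tx_t.
  by apply: Sb_ext (Sb_coord P (al := al) (ix k)) => e _; apply/funext => z; rewrite proj_tx_x.
have := Sb_comp cbd_proj (mA j).1 (fun k => (mode_proj_tx R k).1) (PA j) Sc.
apply: Sb_ext => e _; apply/funext => z; rewrite /pull; congr (A j e _).
by apply/rowP => k; rewrite mxE.
Qed.

(* Each t-derivative is traded for x-derivatives by the transport equation, and below
   each s-derivative is removed by the characteristic equation. *)
Lemma Sb_flow_xt m js h : Sb P (map (@ix n) js ++ nseq m iit) (g h).
Proof.
elim: m js h => [|m ih] js h; first by rewrite cats0; exact: Sb_flow_x.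
rewrite nseq_rcons -rcons_cat; set al := _ ++ nseq m _.
apply/Sb_rcons; split; first exact: ih.
have nZ := nul_Z mA mg cg (flow_ode ok) (flow_init ok) (flow_log ok) h.
have mZ : mode (Xs A (g h)) by apply: Xs_mode.
pose S : rnet (n + (1 + 1)) := fun e z => \sum_j pull (@proj_tx R n) (A j) e z * dnet [:: ix j] (g h) e z.
have mT j : mode (fun e z => pull (@proj_tx R n) (A j) e z * dnet [:: ix j] (g h) e z).
  by apply: modeM => //; exact: mode_dnet.
have SS : Sb P al S.
  apply: Sb_sum => j; first exact: (mT j).1.
  apply: SbM; [exact: (mpA j).1|exact: snet_dnet (mg h).1|exact: Sb_proj|].
  (* One t derivative fewer, one x derivative more: for this the list of x derivatives is arbitrary
     in the induction. *)
  have H := ih (j :: js) h.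
  have : Sb P (rcons al (ix j)) (g h).
    by apply: (Sb_perm (mg h).1 _ H); rewrite perm_sym perm_rcons.
  by case/Sb_rcons.
have mS : mode S by exact: mode_sum.
have := SbD mZ.1 mS.1 (nul_Sb P (al := al) mZ nZ) SS.
by apply: Sb_ext => e _; apply/funext => z; rewrite /Xs /S subrK.
Qed.

Lemma Sb_flow_xts l js m h : Sb P ((map (@ix n) js ++ nseq m iit) ++ nseq l iis) (g h).
Proof.
elim: l h => [|l ih] h; first by rewrite cats0; exact: Sb_flow_xt.
rewrite nseq_rcons -rcons_cat; set al := _ ++ nseq l _.
apply/Sb_rcons; split; first exact: ih.
have Sa : Sb P al (along g (A h)) by apply: Sb_along => //; exact: mA.
have := SbD (mrho h).1 (modeN (mal (mA h))).1 (nul_Sb P (al := al) (mrho h) (@nrho h)) (SbN (mal (mA h)).1 Sa).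
by apply: Sb_ext => e _; apply/funext => z; rewrite /rho addrK.
Qed.

(** Partial derivatives commute, so each list can be sorted into x, t and s directions. *)
Lemma Sb_flow al h : Sb P al (g h).
Proof.
have [js [m [l pal]]] : exists js m l, perm_eq ((map (@ix n) js ++ nseq m iit) ++ nseq l iis) al.
  elim: al => [|i al [js [m [l ih]]]]; first by exists [::], 0%N, 0%N.
  have {}ih j : perm_eq (j :: (map (@ix n) js ++ nseq m iit) ++ nseq l iis) (j :: al) by rewrite perm_cons.
  move: i; apply: xts_ind => [j||].
  - by exists (j :: js), m, l; exact: ih.
  - exists js, m.+1, l; apply: perm_trans _ (ih iit).
    have aux (x y z w : nat) : (x + (y + z) + w = y + (x + z + w))%N by rewrite (addnCA x) -addnA.
    by apply/permP => a; rewrite /= !count_cat /=; exact: aux.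
  - exists js, m, l.+1; apply: perm_trans _ (ih iis).
    by apply/permP => a; rewrite /= !count_cat /=; exact: addnCA.
exact: (Sb_perm (mg h).1 pal (@Sb_flow_xts l js m h)).
Qed.

Let mode_iy (k : 'I_(1 + n)) : mode (fun (_ : R) (w : 'rV[R]_(1 + n + 1)) => w 0 (iy k)).
Proof. exact: mode_coord. Qed.

Lemma Sb_prim al (f : rnet (1 + n)) : mode f -> (forall be, Obd P (dnet be f)) ->
  Sb P al (prim (along g f)).
Proof.
move=> mf Pf.
have Sa be : Obd P (dnet be (along g f)).
  exact: (Sb_along mf Pf (fun h => @Sb_flow be h) (subseq_refl be)).
have Sh be k : Sb P be (fun (_ : R) (w : 'rV[R]_(1 + n + 1)) => homot w 0 k).
  move: k; apply: xts_ind => [j||].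
  - by apply: Sb_ext (Sb_coord P (al := be) (iy (idx_x j))) => e _; apply/funext => w; exact: homot_x.
  - by apply: Sb_ext (Sb_coord P (al := be) (iy (idx_t n))) => e _; apply/funext => w; exact: homot_t.
  have := SbM (mode_iy (idx_t n)).1 (mode_coord R (@ith n)).1 (Sb_coord P (al := be) (iy (idx_t n))) (Sb_coord P (al := be) (@ith n)).
  by apply: Sb_ext => e _; apply/funext => w; exact: homot_s.
have cH : cbd (fun k (_ : R) (w : 'rV[R]_(1 + n + 1)) => homot w 0 k).
  by move=> M; have [M' HM'] := @Bhomot R n M; exists M'; apply: nearW => e x Bx k; exact: HM'.
have sp : snet (pull (@homot R n) (along g f)) by exact: (pull_snet (@mode_homot R n) (mal mf).1).
apply: SbM.
- exact: (mode_coord R (idx_t n)).1.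
- exact: snet_pintn.
- exact: Sb_coord.
apply: Sb_pintn => //.
have := Sb_comp cH (mal mf).1 (fun k => (@mode_homot R n k).1) Sa (Sh (map (lshift 1) al)).
apply: Sb_ext => e _; apply/funext => w; rewrite /pull; congr (along g f e _).
by apply/rowP => k; rewrite mxE.
Qed.

Lemma Sb_amplitude al (p q : rnet (1 + n)) : mode p -> mode q -> logbound P q ->
  (forall be, Obd P (dnet be p)) -> (forall be, Obd P (dnet be q)) ->
  Sb P al (amp1 g p q) /\ Sb P al (amp2 g p q).
Proof.
move=> mp mq lq Pp Pq.
exact: (Sb_amp ok mp mq lq (@Sb_prim al p mp Pp) (@Sb_prim al q mq Pq)).
Qed.

Lemma Sb_phase al : Sb P al (phase g).
Proof.
have cio : cbd (fun k (_ : R) (z : 'rV[R]_(1 + n + n)) => phase_point z 0 k).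
  by move=> M; exists M; apply: nearW => e z Bz k; exact: box_phase_point.
have mio k := phase_point_coord P al k.
have Sg h : Sb P al (pull (@phase_point R n) (g h)).
  have -> : pull (@phase_point R n) (g h) = fun e z => g h e (\row_k phase_point z 0 k).
    by apply/funext => e; apply/funext => z; rewrite /pull; congr (g h e _); apply/rowP => k; rewrite mxE.
  apply: (Sb_comp cio (mg h).1 (fun k => (mio k).1.1)) => [be|k]; last exact: (mio k).2.
  exact: (@Sb_flow be h _ (subseq_refl _)).
have mpull h : mode (pull (@phase_point R n) (g h)).
  exact: (pull_mode (fun k => (mio k).1) (@phase_point_bounded R n) (mg h)).
rewrite phaseE; apply: Sb_sum => h; first exact: (modeM (mpull h) (mode_coord R _)).1.
exact: (SbM (mpull h).1 (mode_coord R _).1 (Sg h) (Sb_coord P (al := al) _)).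
Qed.

End SlowFlow.

(** * The Cauchy problem on representatives *)

Section NetAlgebra.
Variables (R : realType) (d : nat).
Implicit Types u v : net R d.

Definition cnet (f h : real_net R d) : net R d := fun e x => f e x +i* h e x.

Lemma cnet_eta u : cnet (renet u) (imnet u) = u.
Proof. by apply/funext => e; apply/funext => x; rewrite /cnet /renet /imnet /re_fun /im_fun; case: (u e x). Qed.

Lemma renet_mul u v : renet (fun e x => u e x * v e x) =
  fun e x => renet u e x * renet v e x - imnet u e x * imnet v e x.
Proof. by apply/funext => e; apply/funext => x; exact: complex_ReM. Qed.

Lemma imnet_mul u v : imnet (fun e x => u e x * v e x) =
  fun e x => renet u e x * imnet v e x + imnet u e x * renet v e x.
Proof. by apply/funext => e; apply/funext => x; exact: complex_ImM. Qed.

Lemma renet_add u v : renet (fun e x => u e x + v e x) = fun e x => renet u e x + renet v e x.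
Proof.
by apply/funext => e; apply/funext => x; rewrite /renet /re_fun; case: (u e x); case: (v e x).
Qed.

Lemma imnet_add u v : imnet (fun e x => u e x + v e x) = fun e x => imnet u e x + imnet v e x.
Proof.
by apply/funext => e; apply/funext => x; rewrite /imnet /im_fun; case: (u e x); case: (v e x).
Qed.

Lemma renet_Dnet i u : renet (Dnet i u) = dnet [:: i] (imnet u).
Proof.
apply/funext => e; apply/funext => x; rewrite /renet /re_fun /Dnet complex_ReM /=.
by rewrite oppr0 mul0r sub0r mulN1r opprK.
Qed.

Lemma imnet_Dnet i u : imnet (Dnet i u) = fun e x => - dnet [:: i] (renet u) e x.
Proof.
apply/funext => e; apply/funext => x; rewrite /imnet /im_fun /Dnet complex_ImM /=.
by rewrite oppr0 mul0r add0r mulN1r.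
Qed.

Lemma moderate_mul u v : moderate u -> moderate v -> moderate (fun e x => u e x * v e x).
Proof.
move=> /moderateP[mr mi] /moderateP[nr ni]; apply/moderateP; rewrite renet_mul imnet_mul.
by split; [apply: modeB|apply: modeD]; apply: modeM.
Qed.

Lemma moderate_add u v : moderate u -> moderate v -> moderate (fun e x => u e x + v e x).
Proof.
move=> /moderateP[mr mi] /moderateP[nr ni]; apply/moderateP; rewrite renet_add imnet_add.
by split; apply: modeD.
Qed.

Lemma moderate_Dnet i u : moderate u -> moderate (Dnet i u).
Proof.
move=> /moderateP[mr mi]; apply/moderateP; rewrite renet_Dnet imnet_Dnet.
by split; [exact: mode_dnet|apply: modeN; exact: mode_dnet].
Qed.

Lemma nul_mulB (a b a' b' : real_net R d) : mode b -> mode a' ->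
  nul (fun e x => a e x - a' e x) -> nul (fun e x => b e x - b' e x) ->
  nul (fun e x => a e x * b e x - a' e x * b' e x).
Proof.
move=> mb ma na nb.
apply: nul_ext (nulD (nulM (mb.2 [::]) na) (nulM (ma.2 [::]) nb)) => e _ x.
by rewrite /dnet /=; ring.
Qed.

Lemma eqG_mul u u' v v' : moderate u' -> moderate v -> moderate u -> moderate v' ->
  eqG u u' -> eqG v v' ->
  eqG (fun e x => u e x * v e x) (fun e x => u' e x * v' e x).
Proof.
move=> mu' mv mu mv' /eqGP[[_ n1] [_ n2]] /eqGP[[_ n3] [_ n4]].
have [r1 i1] := (moderateP _).1 mu'; have [r2 i2] := (moderateP _).1 mv.
apply: eqG_moderate; try exact: moderate_mul; rewrite ?renet_mul ?imnet_mul.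
  apply: nul_ext (nulB (nul_mulB r2 r1 n1 n3) (nul_mulB i2 i1 n2 n4)) => e _ x; ring.
apply: nul_ext (nulD (nul_mulB i2 r1 n1 n4) (nul_mulB r2 i1 n2 n3)) => e _ x; ring.
Qed.

Lemma eqG_add u u' v v' : eqG u u' -> eqG v v' ->
  eqG (fun e x => u e x + v e x) (fun e x => u' e x + v' e x).
Proof.
move=> /eqGP[[m1 n1] [m2 n2]] /eqGP[[m3 n3] [m4 n4]].
apply/eqGP; rewrite !renet_add !imnet_add; split; split.
- apply: mode_ext (modeD m1 m3) => e _; apply/funext => x; ring.
- apply: nul_ext (nulD n1 n3) => e _ x; ring.
- apply: mode_ext (modeD m2 m4) => e _; apply/funext => x; ring.
- apply: nul_ext (nulD n2 n4) => e _ x; ring.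
Qed.

Lemma eqG_sum m (u v : 'I_m -> net R d) : (forall j, eqG (u j) (v j)) ->
  eqG (fun e x => \sum_(j < m) u j e x) (fun e x => \sum_(j < m) v j e x).
Proof.
elim: m u v => [|m ih] u v uv.
  have -> : (fun (e : R) (x : 'rV[R]_d) => \sum_(j < 0) v j e x) = fun _ _ => 0.
    by apply/funext => e; apply/funext => x; rewrite big_ord0.
  have -> : (fun (e : R) (x : 'rV[R]_d) => \sum_(j < 0) u j e x) = fun _ _ => 0.
    by apply/funext => e; apply/funext => x; rewrite big_ord0.
  by apply: eqG_refl; exact: moderate_cst.
have E (w : 'I_m.+1 -> net R d) : (fun (e : R) (x : 'rV[R]_d) => \sum_(j < m.+1) w j e x) =
   fun e x => \sum_(j < m) w (widen_ord (leqnSn m) j) e x + w ord_max e x.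
  by apply/funext => e; apply/funext => x; rewrite big_ord_recr.
by rewrite !E; apply: eqG_add => //; apply: ih.
Qed.

Lemma moderate_sum m (u : 'I_m -> net R d) : (forall j, moderate (u j)) ->
  moderate (fun e x => \sum_(j < m) u j e x).
Proof.
elim: m u => [|m ih] u mu.
  have -> : (fun (e : R) (x : 'rV[R]_d) => \sum_(j < 0) u j e x) = fun _ _ => 0.
    by apply/funext => e; apply/funext => x; rewrite big_ord0.
  exact: moderate_cst.
have -> : (fun (e : R) (x : 'rV[R]_d) => \sum_(j < m.+1) u j e x) =
   fun e x => \sum_(j < m) u (widen_ord (leqnSn m) j) e x + u ord_max e x.
  by apply/funext => e; apply/funext => x; rewrite big_ord_recr.
by apply: moderate_add => //; apply: ih.
Qed.

Lemma eqG_Dnet i u v : moderate u -> moderate v -> eqG u v -> eqG (Dnet i u) (Dnet i v).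
Proof.
move=> mu mv /eqGP[[m1 n1] [m2 n2]].
have [r1 i1] := (moderateP _).1 mu; have [r2 i2] := (moderateP _).1 mv.
apply: eqG_moderate; try exact: moderate_Dnet; rewrite ?renet_Dnet ?imnet_Dnet.
  apply: nul_ext (nul_dpart i m2 n2) => e e01 x; rewrite /dnet /=.
  by rewrite (dpartB i x (i1.1 e e01) (i2.1 e e01)).
apply: nul_ext (nulN (nul_dpart i m1 n1)) => e e01 x; rewrite /dnet /=.
by rewrite (dpartB i x (r1.1 e e01) (r2.1 e e01)) opprB opprK addrC.
Qed.

End NetAlgebra.

(** * The Cauchy problem as a real system for one choice of representatives *)

Section CauchyReal.
Variables (R : realType) (n : nat).
Implicit Types (A : 'I_n -> real_net R (1 + n)) (p q : real_net R (1 + n)).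

Lemma mode_tx0 k : mode (fun (_ : R) (x : 'rV[R]_n) => tx 0 x 0 k).
Proof.
move: k; apply: tx_ind => [|h].
  by apply: mode_ext (mode_cst n (0 : R)) => e _; apply/funext => x; rewrite tx_t.
by apply: mode_ext (mode_coord R h) => e _; apply/funext => x; rewrite tx_x.
Qed.

Lemma box_tx0 (M : R) : exists M' : R, forall x, box n M x -> box (1 + n) M' (tx 0 x).
Proof.
exists (Num.max M 0) => x Bx; apply: tx_ind => [|h]; rewrite ?tx_t ?tx_x le_max.
  by rewrite normr0 lexx orbT.
by rewrite Bx.
Qed.

Definition trace0 (v : net R (1 + n)) : net R n := fun e x => v e (tx 0 x).

Lemma moderate_trace0 v : moderate v -> moderate (trace0 v).
Proof.
move=> /moderateP[mr mi]; apply/moderateP.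
by split; [exact: (pull_mode mode_tx0 box_tx0 mr)|exact: (pull_mode mode_tx0 box_tx0 mi)].
Qed.

Lemma eqG_trace0 u v : moderate u -> moderate v -> eqG u v -> eqG (trace0 u) (trace0 v).
Proof.
move=> mu mv /eqGP[[m1 n1] [m2 n2]]; apply: eqG_moderate; try exact: moderate_trace0.
  exact: (pull_nul box_tx0 n1).
exact: (pull_nul box_tx0 n2).
Qed.

(** The equation for v1 + i v2 with real A and a_0 = p + i q. As D_t = -i d_t, the first line is its
    imaginary part up to sign and the second its real part. *)
Definition system A p q (v1 v2 : real_net R (1 + n)) :=
  nul (fun e y => Xop A v1 e y + q e y * v1 e y + p e y * v2 e y) /\
  nul (fun e y => Xop A v2 e y - p e y * v1 e y + q e y * v2 e y).

Definition rhs (al : 'I_n -> net R (1 + n)) (al0 v : net R (1 + n)) : net R (1 + n) :=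
  fun e y => \sum_(j < n) al j e y * Dnet (idx_x j) v e y + al0 e y * v e y.

Lemma moderate_rhs al al0 v : (forall j, moderate (al j)) -> moderate al0 -> moderate v ->
  moderate (rhs al al0 v).
Proof.
move=> mal mal0 mv; apply: moderate_add; last exact: moderate_mul.
by apply: moderate_sum => j; apply: moderate_mul => //; exact: moderate_Dnet.
Qed.

Lemma eqG_rhs al al' al0 al0' v v' : (forall j, moderate (al j)) -> (forall j, moderate (al' j)) ->
  moderate al0 -> moderate al0' -> moderate v -> moderate v' ->
  (forall j, eqG (al j) (al' j)) -> eqG al0 al0' -> eqG v v' ->
  eqG (rhs al al0 v) (rhs al' al0' v').
Proof.
move=> ml ml' m0 m0' mv mv' el e0 ev; apply: eqG_add; last exact: (eqG_mul m0' mv m0 mv' e0 ev).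
apply: eqG_sum => j.
exact: (eqG_mul (ml' j) (moderate_Dnet _ mv) (ml j) (moderate_Dnet _ mv') (el j) (eqG_Dnet _ mv mv' ev)).
Qed.

Definition rcnet d (f : real_net R d) : net R d := fun e x => (f e x)%:C.

Lemma re_rcnet d (f : real_net R d) : renet (rcnet f) = f. Proof. by []. Qed.
Lemma im_rcnet d (f : real_net R d) : imnet (rcnet f) = fun _ _ => 0. Proof. by []. Qed.

Lemma system_eqG A p q v : (forall j, mode (A j)) -> mode p -> mode q -> moderate v ->
  eqG (Dnet (idx_t n) v) (rhs (fun j => rcnet (A j)) (cnet p q) v) <->
  system A p q (renet v) (imnet v).
Proof.
move=> mA mp mq mv.
have mr : moderate (rhs (fun j => rcnet (A j)) (cnet p q) v).
  apply: moderate_rhs => // [j|]; apply/moderateP; last by split.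
  by split; [exact: mA|exact: mode_cst].
have mD := moderate_Dnet (idx_t n) mv.
have Er e y : renet (Dnet (idx_t n) v) e y - renet (rhs (fun j => rcnet (A j)) (cnet p q) v) e y =
    Xop A (imnet v) e y - p e y * renet v e y + q e y * imnet v e y.
  rewrite renet_Dnet /rhs renet_add renet_mul /=.
  have -> : renet (fun e y => \sum_(j < n) rcnet (A j) e y * Dnet (idx_x j) v e y) e y =
      \sum_(j < n) A j e y * dnet [:: idx_x j] (imnet v) e y.
    rewrite /renet /re_fun (raddf_sum (@complex.Re R)); apply: eq_bigr => j _.
    transitivity (A j e y * renet (Dnet (idx_x j) v) e y); first exact: ReCM.
    by rewrite renet_Dnet.
  rewrite /Xop; set S := \sum_(_ < _) _; rewrite /renet /imnet /re_fun /im_fun /=; ring.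
have Ei e y : imnet (Dnet (idx_t n) v) e y - imnet (rhs (fun j => rcnet (A j)) (cnet p q) v) e y =
    - (Xop A (renet v) e y + q e y * renet v e y + p e y * imnet v e y).
  rewrite imnet_Dnet /rhs imnet_add imnet_mul /=.
  have -> : imnet (fun e y => \sum_(j < n) rcnet (A j) e y * Dnet (idx_x j) v e y) e y =
      - \sum_(j < n) A j e y * dnet [:: idx_x j] (renet v) e y.
    rewrite /imnet /im_fun (raddf_sum (@complex.Im R)) -sumrN; apply: eq_bigr => j _.
    transitivity (A j e y * imnet (Dnet (idx_x j) v) e y); first exact: ImCM.
    by rewrite imnet_Dnet mulrN.
  rewrite /Xop; set S := \sum_(_ < _) _; rewrite /renet /imnet /re_fun /im_fun /=; ring.
split.
  move=> /eqGP[[_ n1] [_ n2]]; split.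
    apply: nul_ext (nulN n2) => e _ y; by rewrite Ei opprK.
  by apply: nul_ext n1 => e _ y; rewrite Er.
move=> [s1 s2]; apply: eqG_moderate => //.
  by apply: nul_ext s2 => e _ y; rewrite Er.
by apply: nul_ext (nulN s1) => e _ y; rewrite Ei.
Qed.

(** The problem quantifies over all representatives; since both sides of the equation respect
    negligible differences, one choice suffices. *)
Lemma cauchy_systemP (a1 : 'I_n -> colombeau R (1 + n)) (a0 u : colombeau R (1 + n)) (g0 : colombeau R n)
    A p q v w : (forall j, a1 j (rcnet (A j))) -> a0 (cnet p q) -> u v -> g0 w ->
  cauchy_problem a1 a0 g0 u <-> system A p q (renet v) (imnet v) /\ eqG (trace0 v) w.
Proof.
move=> rA r0 uv gw.
have mA j : mode (A j) by have /moderateP[] := reps_moderate (rA j).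
have [mp mq] : mode p /\ mode q by have /moderateP[] := reps_moderate r0.
have mv := reps_moderate uv.
split=> [/(_ _ _ _ _ rA r0 uv gw)[H1 H2]|[H1 H2] al al0 v' w' ral ral0 uv' gw'].
  by split=> //; apply/(system_eqG mA mp mq mv).
have mal j := reps_moderate (ral j).
have mrA j := reps_moderate (rA j).
have mal0 := reps_moderate ral0; have m0 := reps_moderate r0.
have mv' := reps_moderate uv'.
split.
  apply: (eqG_trans (v := Dnet (idx_t n) v)).
    by apply: eqG_Dnet => //; exact: reps_eqG uv' uv.
  apply: (eqG_trans (v := rhs (fun j => rcnet (A j)) (cnet p q) v)).
    exact/(system_eqG mA mp mq mv).
  apply: eqG_rhs => //; [|exact: reps_eqG r0 ral0|exact: reps_eqG uv uv'].
  by move=> j; exact: reps_eqG (rA j) (ral j).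
apply: (eqG_trans (v := trace0 v)).
  by apply: eqG_trace0 => //; exact: reps_eqG uv' uv.
exact: eqG_trans H2 (reps_eqG gw gw').
Qed.

End CauchyReal.

(** * The main theorem *)

Section Scales.
Variable R : realType.

Lemma bound_exp (P : scale R) (m : R -> R) N : P m -> P (fun e => m e ^+ N).
Proof.
move=> Pm; elim: N => [|N ih].
  by apply: bound_le (bound_cst P 1) _; apply: nearW => e; rewrite expr0.
by apply: bound_le (boundM Pm ih) _; apply: nearW => e; rewrite exprS.
Qed.

(** The exponential of c times this function is a power of 1 + |m|, dominated by an integer power,
    which the scale contains. The summand 1 keeps the logarithm nonnegative. *)
Lemma logb_ln (P : scale R) (m : R -> R) C : P m -> 0 <= C -> logb P (fun e => C * ln (1 + `|m e|)).
Proof.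
move=> Pm C0.
have l0 e : 0 <= ln (1 + `|m e|) by rewrite ln_ge0 // lerDl.
split=> [e|c c0]; first exact: mulr_ge0.
have [N HN] : exists N : nat, c * C <= N%:R.
  by exists (Num.bound (c * C)); apply: ltW; apply: archi_boundP; exact: mulr_ge0.
have := bound_exp N (boundD (bound_cst P 1) (bound_norm Pm)); move=> H; apply: (bound_le H).
apply: nearW => e; have p0 : 0 < 1 + `|m e| by rewrite ltr_pwDl.
rewrite ger0_norm ?expR_ge0 // [leRHS]ger0_norm ?exprn_ge0 ?(ltW p0) //.
rewrite -[X in _ <= X ^+ _](@lnK R) ?posrE // -expRM_natl ler_expR mulrA.
by apply: ler_wpM2r.
Qed.

Lemma ln_le_1D (x : R) : 0 <= x -> ln x <= ln (1 + x).
Proof.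
rewrite le_eqVlt => /predU1P[<-|x0]; first by rewrite ln0 // addr0 ln1.
by rewrite ler_ln ?posrE ?ltr_pwDl // ?lerDr // ltW.
Qed.

Lemma logbound_ln (P : scale R) d (f : real_net R d) :
  (forall M, exists2 m : R -> R, P m & exists2 C : R, 0 <= C &
     \forall e \near 0^'+, forall y, box d M y -> `|f e y| <= C * ln `|m e|) -> logbound P f.
Proof.
move=> Hf M; have [m Pm [C C0 HC]] := Hf M.
exists (fun e => C * ln (1 + `|m e|)); first exact: logb_ln.
apply: filterS HC => e H y By; apply: le_trans (H y By) _.
by apply: ler_wpM2l => //; exact: ln_le_1D.
Qed.

Lemma logbound_nul (P : scale R) d (f h : real_net R d) : logbound P f ->
  nul (fun e x => h e x - f e x) -> logbound P h.
Proof.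
move=> Lf nf M; have [l [l0 Pl] Hl] := Lf M.
exists (fun e => l e + 1).
  split=> [e|c c0]; first by rewrite addr_ge0.
  apply: bound_le (boundM (Pl c c0) (bound_cst P (expR c))) _; apply: nearW => e.
  by rewrite mulrDr mulr1 expRD.
near=> e => y By; rewrite -[h e y](subrK (f e y)) addrC; apply: le_trans (ler_normD _ _) _.
apply: lerD; first by move: y By; near: e; exact: Hl.
by rewrite -[leRHS](expr0 e); move: y By; near: e; exact: nf.
Unshelve. all: by end_near. Qed.

Lemma modb_inv : modb (fun e : R => e^-1).
Proof. exact: modb_expV 1. Qed.

(* [slow_scale] with natural exponents only, which is equivalent. *)
Definition slowb (g : R -> R) := forall k : nat, exists2 C : R, 0 < C &
  \forall e \near 0^'+, `|g e| ^+ k <= C * e^-1.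

Lemma slowb_cst (c : R) : slowb (fun=> c).
Proof.
move=> k; exists (`|c| ^+ k + 1); first by rewrite ltr_wpDl // exprn_ge0.
apply: filterS (near01 R) => e /andP[e0 e1].
apply: (@le_trans _ _ (`|c| ^+ k + 1)); first by rewrite lerDl.
by rewrite ler_peMr ?invf_ge1 // addr_ge0 // exprn_ge0.
Qed.

Lemma slowb_le (g h : R -> R) : slowb g -> (\forall e \near 0^'+, `|h e| <= `|g e|) -> slowb h.
Proof.
move=> Sg hg k; have [C C0 HC] := Sg k; exists C => //; near=> e.
apply: (@le_trans _ _ (`|g e| ^+ k)); last by near: e.
by apply: lerXn2r; rewrite ?nnegrE //; near: e.
Unshelve. all: by end_near. Qed.

Lemma max_exp (a b : R) k : 0 <= a -> 0 <= b -> Num.max a b ^+ k <= a ^+ k + b ^+ k.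
Proof.
move=> a0' b0; have ak : 0 <= a ^+ k by exact: exprn_ge0.
have bk : 0 <= b ^+ k by exact: exprn_ge0.
by have [ab|/ltW ab] := leP a b; rewrite ?(max_r ab) ?(max_l ab) ?lerDl ?lerDr.
Qed.

Lemma slowb_D (g h : R -> R) : slowb g -> slowb h -> slowb (fun e => g e + h e).
Proof.
move=> Sg Sh k; have [C C0 HC] := Sg k; have [D D0 HD] := Sh k.
exists (2 ^+ k * (C + D)); first by rewrite mulr_gt0 ?exprn_gt0 ?addr_gt0.
near=> e.
have Hg : `|g e| ^+ k <= C * e^-1 by near: e.
have Hh : `|h e| ^+ k <= D * e^-1 by near: e.
apply: (@le_trans _ _ ((2 * Num.max `|g e| `|h e|) ^+ k)).
  apply: lerXn2r; rewrite ?nnegrE // ?mulr_ge0 // ?le_max ?normr_ge0 //.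
  apply: le_trans (ler_normD _ _) _; rewrite mulr_natl mulr2n.
  by apply: lerD; rewrite le_max lexx ?orbT.
rewrite exprMn -mulrA; apply: ler_wpM2l; first exact: exprn_ge0.
apply: le_trans (max_exp _ _ _) _ => //; rewrite mulrDl; exact: lerD.
Unshelve. all: by end_near. Qed.

(** Since all exponents are allowed, the k-th power of the product is handled by the exponent 2k of
    the larger factor. *)
Lemma slowb_M (g h : R -> R) : slowb g -> slowb h -> slowb (fun e => g e * h e).
Proof.
move=> Sg Sh k; have [C C0 HC] := Sg (2 * k)%N; have [D D0 HD] := Sh (2 * k)%N.
exists (C + D); first exact: addr_gt0.
near=> e.
have Hg : `|g e| ^+ (2 * k) <= C * e^-1 by near: e.
have Hh : `|h e| ^+ (2 * k) <= D * e^-1 by near: e.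
have m0 : 0 <= Num.max `|g e| `|h e| by rewrite le_max normr_ge0.
apply: (@le_trans _ _ (Num.max `|g e| `|h e| ^+ (2 * k))).
  rewrite exprM; apply: lerXn2r; rewrite ?nnegrE // ?exprn_ge0 //.
  by rewrite normrM expr2; apply: ler_pM; rewrite // le_max lexx ?orbT.
apply: le_trans (max_exp _ _ _) _ => //; rewrite mulrDl; exact: lerD.
Unshelve. all: by end_near. Qed.

Definition slowscale : scale R := Scale slowb_cst slowb_le slowb_D slowb_M.

Lemma slow_slowb (mu : R -> R[i]) : slow_scale mu -> slowb (fun e => cabs (mu e)).
Proof.
move=> Smu k; have [C C0 HC] := Smu k%:R (ler0n _ _); exists C => //.
apply: filterS HC => e; rewrite powR_mulrn ?cabs_ge0 // ger0_norm //; exact: cabs_ge0.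
Qed.

(** A real exponent is rounded up to an integer when |g| exceeds 1; otherwise the power is at most
    1. *)
Lemma slowb_slow (g : R -> R) : slowb g -> slow_scale (fun e => (g e)%:C).
Proof.
move=> Sg q q0; pose k := Num.bound q.
have qk : q <= k%:R by apply: ltW; exact: archi_boundP.
have [C C0 HC] := Sg k; exists (1 + C); first exact: addr_gt0.
near=> e; rewrite cabsC mulrDl mul1r.
have /andP[e0 e1] : 0 < e <= 1 by near: e; exact: near01.
have H : `|g e| ^+ k <= C * e^-1 by near: e.
have [g1|g1] := leP `|g e| 1.
  apply: (@le_trans _ _ 1); last by rewrite ler_wpDr ?invf_ge1 // mulr_ge0 ?invr_ge0 ?(ltW e0) ?(ltW C0).
  apply: le_trans (_ : `|g e| `^ q <= 1 `^ q) _; last by rewrite powR1.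
  by apply: ge0_ler_powR; rewrite ?nnegrE.
apply: (@le_trans _ _ (`|g e| ^+ k)).
  by rewrite -powR_mulrn //; apply: ler_powR => //; exact: ltW.
by apply: ler_wpDl => //; rewrite invr_ge0 ltW.
Unshelve. all: by end_near. Qed.

Lemma slow_regular_Obd d (v : net R d) :
  (forall K, compact K -> forall al, exists2 mu, slow_scale mu &
     supO K (pders_net al v) (fun e => cabs (mu e))) <->
  forall al, Obd slowscale (dnet al (renet v)) /\ Obd slowscale (dnet al (imnet v)).
Proof.
split=> [H al|H K cK al].
  rewrite -renet_pders -imnet_pders; apply/Obd_supO => K cK.
  have [mu Smu Hmu] := H K cK al; exists (fun e => cabs (mu e)) => //.
  exact: slow_slowb.
have : Obd slowscale (renet (pders_net al v)) /\ Obd slowscale (imnet (pders_net al v)).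
  by rewrite renet_pders imnet_pders; exact: H.
move=> /Obd_supO /(_ K cK)[g Sg Hg]; exists (fun e => (g e)%:C); first exact: slowb_slow.
by apply: supO_le Hg _; apply: nearW => e; rewrite cabsC; exact: ler_norm.
Qed.

Lemma supO_logbound (P : scale R) d (v : net R d) :
  (forall M, exists2 m : R -> R, P m & supO (box d M) v (fun e => ln `|m e|)) ->
  logbound P (renet v) /\ logbound P (imnet v).
Proof.
move=> H; split; apply: logbound_ln => M; have [m Pm [C C0 HC]] := H M; exists m => //;
  exists C; try exact: ltW; apply: filterS HC => e He y By; apply: le_trans (He y By).
  exact: cabs_re.
exact: cabs_im.
Qed.

Lemma log_type_logbound d (a : colombeau R d) u : log_type a -> a u ->
  logbound (modscale R) (renet u) /\ logbound (modscale R) (imnet u).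
Proof.
move=> [v av Hv] au.
have [L1 L2] : logbound (modscale R) (renet v) /\ logbound (modscale R) (imnet v).
  apply: supO_logbound => M; exists (fun e => e^-1); first exact: modb_inv.
  apply: supO_le (Hv _ (@box_compact R d M)) _.
  by apply: filterS (near01 R) => e /andP[e0 _]; rewrite ger0_norm // invr_ge0 ltW.
have /eqGP[[_ n1] [_ n2]] := reps_eqG au av.
by split; [exact: logbound_nul L1 n1|exact: logbound_nul L2 n2].
Qed.

Lemma slow_log_type_logbound d (a : colombeau R d) u : slow_scale_log_type a -> a u ->
  logbound slowscale (renet u) /\ logbound slowscale (imnet u).
Proof.
move=> [v av Hv] au.
have [L1 L2] : logbound slowscale (renet v) /\ logbound slowscale (imnet v).
  apply: supO_logbound => M; have [mu Smu Hmu] := Hv _ (@box_compact R d M).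
  exists (fun e => cabs (mu e)); first exact: slow_slowb.
  by apply: supO_le Hmu _; apply: nearW => e; rewrite ger0_norm ?cabs_ge0.
have /eqGP[[_ n1] [_ n2]] := reps_eqG au av.
by split; [exact: logbound_nul L1 n1|exact: logbound_nul L2 n2].
Qed.

Lemma slowb_modb g : slowb g -> modb g.
Proof.
move=> /(_ 1%N)[C C0 HC]; exists 2%N.
have H := cst_le_expV C.
near=> e.
have /andP[e0 e1] : 0 < e <= 1 by near: e; exact: near01.
have H1 : `|g e| ^+ 1 <= C * e^-1 by near: e.
have H2 : C <= e ^- 1 by near: e.
rewrite expr1 in H1; apply: le_trans H1 _; rewrite expr2 invfM.
by apply: ler_wpM2r; [rewrite invr_ge0 ltW|rewrite expr1 in H2].
Unshelve. all: by end_near. Qed.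

Lemma logbound_slow_mod d (f : real_net R d) : logbound slowscale f -> logbound (modscale R) f.
Proof.
move=> Lf M; have [l [l0 Pl] Hl] := Lf M; exists l => //.
by split=> // c c0; apply: slowb_modb; exact: Pl.
Qed.

(** [pderG] is built from a chosen representative; this makes it usable with any other, in
    particular with one having slow scale bounds. *)
Lemma pderG_rep d (i : 'I_d) (a : colombeau R d) u : a u -> pderG i a (pder_net i u).
Proof.
move=> au.
have ar := a_rep_in a.
have /eqGP[[m1 n1] [m2 n2]] := reps_eqG au ar.
have mu := reps_moderate au; have mr := reps_moderate ar.
have [r1 i1] := (moderateP _).1 mu; have [r2 i2] := (moderateP _).1 mr.
apply: eqG_moderate; try exact: moderate_pder.
  apply: nul_ext (nul_dpart i m1 n1) => e e01 x; rewrite /dnet /=.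
  by rewrite (dpartB i x (r1.1 e e01) (r2.1 e e01)).
apply: nul_ext (nul_dpart i m2 n2) => e e01 x; rewrite /dnet /=.
by rewrite (dpartB i x (i1.1 e e01) (i2.1 e e01)).
Qed.

End Scales.

(** * Existence, uniqueness and the integral formula in the algebra *)

Section Main.
Variables (R : realType) (n : nat).
Variables (a1 : 'I_n -> colombeau R (1 + n)) (a0 : colombeau R (1 + n)).
Variable ga : 'I_n -> colombeau R (n + (1 + 1)).
Variables (A : 'I_n -> real_net R (1 + n)) (p q : real_net R (1 + n)).
Hypothesis char : characteristic_curve a1 ga.
Hypothesis rA : forall j, a1 j (rcnet (A j)).
Hypothesis r0 : a0 (cnet p q).
Hypothesis LA : forall j k, logbound (modscale R) (dnet [:: idx_x k] (A j)).
Hypothesis (lp : logbound (modscale R) p) (lq : logbound (modscale R) q).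

Let mA j : mode (A j). Proof. by have /moderateP[] := reps_moderate (rA j). Qed.
Let mp : mode p. Proof. by have /moderateP[] := reps_moderate r0. Qed.
Let mq : mode q. Proof. by have /moderateP[] := reps_moderate r0. Qed.

Lemma real_rep_mode d (a : colombeau R d) f : real_rep a f -> mode f.
Proof. by move=> /reps_moderate /moderateP[]. Qed.

Lemma real_rep_nul d (a : colombeau R d) f h : real_rep a f -> real_rep a h ->
  nul (fun e x => f e x - h e x).
Proof. by move=> rf rh; have /eqGP[[_ ?] _] := reps_eqG rf rh. Qed.

(** c-boundedness is given for one real representative only; any other differs from it by at most 1
    on a box for small eps, hence the bound enlarged by 1. *)
Lemma real_reps_flow g : (forall h, real_rep (ga h) (g h)) -> flow_ok A g.
Proof.
move=> rg; have [[g1 rg1 cg1] ode] := char.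
have mg h := real_rep_mode (rg h).
have cg : cbd g.
  move=> M; have [L cL HL] := cg1 _ (@box_compact R _ M).
  have [M' M'0 LM'] := compact_sub_box cL; exists (M' + 1).
  have N : \forall e \near 0^'+, forall h x, box _ M x -> `|g h e x - g1 h e x| <= 1.
    apply: near_ord_forall => h; have := real_rep_nul (rg h) (rg1 h) M 0%N.
    by apply: filterS => e H x /H; rewrite expr0.
  near=> e => x Bx h; rewrite -[g h e x](subrK (g1 h e x)) addrC.
  apply: le_trans (ler_normD _ _) _; apply: lerD; last by move: h x Bx; near: e.
  have Lx : L (\row_h g1 h e x) by move: x Bx; near: e.
  by have := LM' _ Lx h; rewrite mxE.
split=> //.
  move=> h; have [/eqGP[[_ N] _] _] := ode g (fun j => rcnet (A j)) rg rA h.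
  by apply: nul_ext N => e _ z; rewrite /along /renet /re_fun /= opprK.
move=> h; have [_ /eqGP[[_ N] _]] := ode g (fun j => rcnet (A j)) rg rA h.
by apply: nul_ext N => e _ y.
Unshelve. all: by end_near. Qed.

Lemma nul_eq0 d (u : real_net R d) : (forall e x, u e x = 0) -> nul u.
Proof. by move=> u0; apply: (nul_ext _ (@nul0 R d)) => e _ x. Qed.

Lemma cauchy_unique g0 u u' : (exists g, forall h, real_rep (ga h) (g h)) ->
  cauchy_problem a1 a0 g0 u -> cauchy_problem a1 a0 g0 u' -> u' = u.
Proof.
move=> [g rg] Cu Cu'; have ok := real_reps_flow rg.
have rep d (a : colombeau R d) : exists2 v, a v & moderate v.
  by have [v mv ->] := repsP a; exists v => //; exact: eqG_refl.
have [v uv mv] := rep _ u; have [v' uv' mv'] := rep _ u'; have [w gw _] := rep _ g0.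
have [[s1 s2] tr] := (cauchy_systemP rA r0 uv gw).1 Cu.
have [[s1' s2'] tr'] := (cauchy_systemP rA r0 uv' gw).1 Cu'.
have [m1 m2] := (moderateP _).1 mv; have [m1' m2'] := (moderateP _).1 mv'.
have /eqGP[[_ i1] [_ i2]] := eqG_trans tr' (eqG_sym tr).
have [] := @system_unique R n A g ok p q lp lq
  (fun e y => renet v' e y - renet v e y) (fun e y => imnet v' e y - imnet v e y)
  (modeB m1' m1) (modeB m2' m2) _ _ i1 i2.
- apply: nul_ext (nulB s1' s1) => e e01 y; rewrite (XB A y e01 m1'.1 m1.1); ring.
- apply: nul_ext (nulB s2' s2) => e e01 y; rewrite (XB A y e01 m2'.1 m2.1); ring.
move=> N1 N2; apply: (colombeau_eq uv').
apply: eqG_reps uv _; exact: eqG_moderate.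
Qed.

Definition amplitude g : net R (1 + n) := cnet (amp1 g p q) (amp2 g p q).

Lemma moderate_amplitude g : (forall h, real_rep (ga h) (g h)) -> moderate (amplitude g).
Proof. by move=> rg; apply/moderateP; exact: (mode_amp (real_reps_flow rg) mp mq lq). Qed.

Lemma cauchy_amplitude g (b : colombeau R (1 + n)) : (forall h, real_rep (ga h) (g h)) -> b (amplitude g) ->
  cauchy_problem a1 a0 (cstG 1) b.
Proof.
move=> rg bg; have ok := real_reps_flow rg.
have r1 : (cstG 1 : colombeau R n) (fun _ _ => 1) by apply: eqG_refl; exact: moderate_cst.
apply/(cauchy_systemP rA r0 bg r1); split; first exact: (amp_eq ok mp mq lq).
apply: eqG_moderate; [exact: moderate_trace0 (reps_moderate bg)|exact: moderate_cst| |].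
  by apply: nul_eq0 => e x; have [E _] := amp_init g p q e x; rewrite /renet /re_fun /= E subrr.
by apply: nul_eq0 => e x; have [_ E] := amp_init g p q e x; rewrite /imnet /im_fun /= E subrr.
Qed.

Definition solution g (w : net R n) : net R (1 + n) :=
  fun e y => amplitude g e y * w e (\row_h g h e (zero_s y)).

Lemma cauchy_solution g (u0 : colombeau R n) w (u : colombeau R (1 + n)) : (forall h, real_rep (ga h) (g h)) -> u0 w ->
  u (solution g w) -> cauchy_problem a1 a0 u0 u.
Proof.
move=> rg u0w uS; have ok := real_reps_flow rg.
have [mw1 mw2] := (moderateP _).1 (reps_moderate u0w).
have E1 : renet (solution g w) = sol1 g p q (renet w) (imnet w).
  by apply/funext => e; apply/funext => y; exact: complex_ReM.
have E2 : imnet (solution g w) = sol2 g p q (renet w) (imnet w).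
  by apply/funext => e; apply/funext => y; exact: complex_ImM.
apply/(cauchy_systemP rA r0 uS u0w); rewrite E1 E2; split; first exact: (sol_eq ok mp mq lq mw1 mw2).
have [I1 I2] := sol_init ok p q mw1 mw2.
apply: eqG_moderate; [exact: moderate_trace0 (reps_moderate uS)|exact: reps_moderate u0w| |].
  by apply: nul_ext I1 => e _ x; rewrite -E1.
by apply: nul_ext I2 => e _ x; rewrite -E2.
Qed.

Lemma moderate_solution g w : (forall h, real_rep (ga h) (g h)) -> moderate w ->
  moderate (solution g w).
Proof.
move=> rg /moderateP[mw1 mw2]; have ok := real_reps_flow rg.
have [m1 m2] := mode_sol ok mp mq lq mw1 mw2.
apply/moderateP; split.
  apply: mode_ext m1 => e _; apply/funext => y; exact: complex_ReM.
by apply: mode_ext m2 => e _; apply/funext => y; exact: complex_ImM.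
Qed.

Lemma phase_dot g e (y : 'rV[R]_(1 + n)) (eta : 'rV[R]_n) :
  phase g e (row_mx y eta) = dot (\row_h g h e (zero_s y)) eta.
Proof.
by rewrite /phase /dot; apply: eq_bigr => h _; rewrite row_mxKl row_mxEl row_mxEr mxE.
Qed.

(** By uniqueness u and b are the classes of [solution] and [amplitude]. For arbitrary
    representatives, Fourier inversion evaluates the operator to [be] times the transported [w],
    which differs negligibly from [solution]. *)
Lemma fio_solution (u0 : colombeau R n) b u : compactly_supported u0 ->
  cauchy_problem a1 a0 (cstG 1) b -> cauchy_problem a1 a0 u0 u -> is_fio ga b u0 u.
Proof.
move=> cu0 Cb Cu; split; first exact: compact_rep_exists.
move=> g be w rg bbe [u0w [K cK Kw]].
have mw := reps_moderate u0w; have mS := moderate_solution rg mw.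
have ex : exists g, forall h, real_rep (ga h) (g h) by exists g.
have SE : colombeau_of mS = u.
  apply: (cauchy_unique ex Cu); apply: (cauchy_solution rg u0w); exact: eqG_refl.
have bE : colombeau_of (moderate_amplitude rg) = b.
  apply: (cauchy_unique ex Cb); apply: (cauchy_amplitude rg).
  by apply: eqG_refl; exact: moderate_amplitude.
have beA : eqG be (amplitude g) by move: bbe; rewrite -bE.
have uS : u (solution g w) by rewrite -SE; exact: eqG_refl.
pose W : net R (1 + n) := fun e y => w e (\row_h g h e (zero_s y)).
have mW : moderate W.
  have [m1 m2] := (moderateP _).1 mw; have ok := real_reps_flow rg.
  by apply/moderateP; split; [exact: (mode_transported ok m1)|exact: (mode_transported ok m2)].
have E1 : eqG (fun e y => be e y * W e y) (solution g w).
  by apply: eqG_mul => //; [exact: moderate_amplitude|exact: reps_moderate bbe|exact: eqG_refl].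
have [M M0 KM] := compact_sub_box cK.
have val e y : 0 < e <= 1 -> fio (phase g) be w e y = be e y * W e y.
  move=> e01; have sw : csmooth (w e) by apply/smoothP; exact: mw.1.
  have uw : csupported M (w e) by move=> z Bz; apply: Kw => // /KM.
  exact: (@fio_value R n (phase g) be w _ e y M M0 sw uw (phase_dot g e y)).
apply: (eqG_reps uS); apply: eqG_trans E1.
have mbW : moderate (fun e y => be e y * W e y) by apply: moderate_mul => //; exact: reps_moderate bbe.
have [b1 b2] := (moderateP _).1 mbW.
have F1 e : 0 < e <= 1 -> renet (fio (phase g) be w) e = renet (fun e y => be e y * W e y) e.
  by move=> e01; apply/funext => y; rewrite /renet /re_fun val.
have F2 e : 0 < e <= 1 -> imnet (fio (phase g) be w) e = imnet (fun e y => be e y * W e y) e.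
  by move=> e01; apply/funext => y; rewrite /imnet /im_fun val.
apply: eqG_moderate => //; first by apply/moderateP; split; [exact: mode_ext b1|exact: mode_ext b2].
  by apply: (nul_ext _ (@nul0 R (1 + n))) => e e01 y; rewrite F1 // subrr.
by apply: (nul_ext _ (@nul0 R (1 + n))) => e e01 y; rewrite F2 // subrr.
Qed.

Lemma phase_representative g g' : (forall h, real_rep (ga h) (g h)) -> (forall h, real_rep (ga h) (g' h)) ->
  eqG (rcnet (phase g')) (rcnet (phase g)).
Proof.
move=> rg rg'.
have mph f : (forall h, real_rep (ga h) (f h)) -> mode (phase f).
  by move=> rf; apply: mode_phase => h; exact: real_rep_mode (rf h).
apply: eqG_moderate.
- by apply/moderateP; split; [exact: mph|exact: mode_cst].
- by apply/moderateP; split; [exact: mph|exact: mode_cst].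
- by apply: nul_phase => h; exact: real_rep_nul (rg' h) (rg h).
by apply: nul_eq0 => e x; rewrite subrr.
Qed.

End Main.

Section Reps.
Variable R : realType.

(** A representative with good bounds need not be the real valued one; its imaginary part is null by
    comparison, so its real part represents the same element and keeps the bounds. *)
Lemma real_valued_rep d (a : colombeau R d) v : real_valued a -> a v -> a (rcnet (renet v)).
Proof.
move=> [v0 av0 im0] av; have /eqGP[_ [m N]] := reps_eqG av av0.
have [mr mi] := (moderateP _).1 (reps_moderate av).
apply: (eqG_reps av); apply: eqG_moderate; rewrite ?re_rcnet ?im_rcnet.
- by apply/moderateP; split => //; exact: mode_cst.
- exact: reps_moderate av.
- by apply: nul_eq0 => e x; rewrite subrr.
apply: nul_ext (nulN N) => e e01 x; rewrite sub0r; congr (- _).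
by have -> : imnet v0 e x = 0; [exact: im0|rewrite subr0].
Qed.

End Reps.

Theorem proposition2p6 (R : realType) (n : nat) (hn : (1 <= n)%N)
    (a1 : 'I_n -> colombeau R (1 + n)) (a0 : colombeau R (1 + n))
    (u0 : colombeau R n) (hu0 : compactly_supported u0) :
  ((forall j, [/\ real_valued (a1 j), compactly_supported_x (a1 j) &
                  forall k, log_type (pderG (idx_x k) (a1 j))]) ->
   compactly_supported_x a0 -> log_type a0 ->
   forall ga : 'I_n -> colombeau R (n + (1 + 1)),
   characteristic_curve a1 ga ->
   exists b : colombeau R (1 + n),
     [/\ cauchy_problem a1 a0 (cstG 1) b,
         forall b', cauchy_problem a1 a0 (cstG 1) b' -> b' = b &
         forall u, cauchy_problem a1 a0 u0 u -> is_fio ga b u0 u])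
  /\
  ((forall j, [/\ real_valued (a1 j), slow_scale_regular (a1 j),
                  compactly_supported_x (a1 j) &
                  forall k, slow_scale_log_type (pderG (idx_x k) (a1 j))]) ->
   slow_scale_regular a0 -> compactly_supported_x a0 ->
   slow_scale_log_type a0 ->
   forall ga : 'I_n -> colombeau R (n + (1 + 1)),
   characteristic_curve a1 ga ->
   exists (phi : colombeau R (1 + n + n)) (b : colombeau R (1 + n)),
     [/\ cauchy_problem a1 a0 (cstG 1) b,
         forall b', cauchy_problem a1 a0 (cstG 1) b' -> b' = b,
         forall u, cauchy_problem a1 a0 u0 u -> is_fio ga b u0 u,
         is_phase ga phi /\ slow_scale_regular phi &
         slow_scale_regular b]).
Proof.
split=> [H1 _ L0|H1 S0 _ L0] ga char; have [[g rg _] _] := char.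
- pose A j := renet (a_rep (a1 j)).
  have rA j : a1 j (rcnet (A j)).
    by have [rv _ _] := H1 j; exact: real_valued_rep rv (a_rep_in _).
  have r0 : a0 (cnet (renet (a_rep a0)) (imnet (a_rep a0))) by rewrite cnet_eta; exact: a_rep_in.
  have [lp lq] := log_type_logbound L0 (a_rep_in a0).
  have LA j k : logbound (modscale R) (dnet [:: idx_x k] (A j)).
    have [_ _ lk] := H1 j.
    by have [] := log_type_logbound (lk k) (pderG_rep (idx_x k) (a_rep_in (a1 j))).
  have ma := moderate_amplitude char rA r0 LA lq rg.
  have ba : colombeau_of ma (amplitude (renet (a_rep a0)) (imnet (a_rep a0)) g) by exact: eqG_refl.
  have Cb := cauchy_amplitude char rA r0 LA lq rg ba.
  exists (colombeau_of ma); split => // [b' Cb'|u Cu].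
    by apply: (cauchy_unique char rA r0 LA lp lq _ Cb Cb'); exists g.
  exact: (fio_solution char rA r0 LA lp lq hu0 Cb Cu).
have reg d (a : colombeau R d) : slow_scale_regular a -> exists v, a v /\
    forall al, Obd (slowscale R) (dnet al (renet v)) /\ Obd (slowscale R) (dnet al (imnet v)).
  by move=> [v av /slow_regular_Obd Hv]; exists v.
have /choice[v Hv] : forall j, exists v, a1 j v /\
    forall al, Obd (slowscale R) (dnet al (renet v)) /\ Obd (slowscale R) (dnet al (imnet v)).
  (* The representatives are chosen for their slow scale bounds of all orders; realness and the
     logarithmic bounds are then transferred to them, both being insensitive to null differences. *)
  by move=> j; have [_ sr _ _] := H1 j; exact: reg.
have [v0 [av0 Hv0]] := reg _ a0 S0.
pose A j := renet (v j).
have rA j : a1 j (rcnet (A j)).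
  by have [rv _ _ _] := H1 j; exact: real_valued_rep rv (Hv j).1.
have r0 : a0 (cnet (renet v0) (imnet v0)) by rewrite cnet_eta.
have [slp slq] := slow_log_type_logbound L0 av0.
have [lp lq] := (logbound_slow_mod slp, logbound_slow_mod slq).
have sLA j k : logbound (slowscale R) (dnet [:: idx_x k] (A j)).
  have [_ _ _ lk] := H1 j.
  by have [] := slow_log_type_logbound (lk k) (pderG_rep (idx_x k) (Hv j).1).
have LA j k := logbound_slow_mod (sLA j k).
have ok := real_reps_flow char rA LA rg.
have PA j al : Obd (slowscale R) (dnet al (A j)) by have [] := (Hv j).2 al.
have ma := moderate_amplitude char rA r0 LA lq rg.
have ba : colombeau_of ma (amplitude (renet v0) (imnet v0) g) by exact: eqG_refl.
have Cb := cauchy_amplitude char rA r0 LA lq rg ba.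
have mph : moderate (rcnet (phase g)).
  apply/moderateP; split; last exact: mode_cst.
  by apply: mode_phase => h; exact: real_rep_mode (rg h).
exists (colombeau_of mph), (colombeau_of ma); split => // [b' Cb'|u Cu||].
- by apply: (cauchy_unique char rA r0 LA lp lq _ Cb Cb'); exists g.
- exact: (fio_solution char rA r0 LA lp lq hu0 Cb Cu).
- split; first by move=> g' rg'; exact: (phase_representative rg rg').
  exists (rcnet (phase g)); first exact: eqG_refl.
  apply/slow_regular_Obd => al; split.
    exact: (Sb_phase ok PA sLA (subseq_refl al)).
  rewrite im_rcnet; exact: (Sb_cst (slowscale R) 0 (subseq_refl al)).
exists (amplitude (renet v0) (imnet v0) g) => //.
have [mp mq] := (moderateP _).1 (reps_moderate av0).
apply/slow_regular_Obd => al.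
have [S1 S2] := Sb_amplitude ok PA sLA al mp mq slq (fun be => (Hv0 be).1) (fun be => (Hv0 be).2).
by split; [exact: S1 (subseq_refl al)|exact: S2 (subseq_refl al)].
Qed.
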